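(* Let $V$ be a vertex operator algebra which is $C_2$-cofinite and of positive energy. Then $V$ satisfies the following three conditions: (1) $V$ is $C_1$-cofinite. (2) There exists a positive integer $N$ such that $|\Re(n_1)-\Re(n_2)|\le N$ for the lowest weights $n_1$ and $n_2$ of any two irreducible $V$-modules and such that the associative algebra $A_N(V)$ is finite dimensional. (3) Every irreducible $V$-module is $\mathbb R$-graded (all its weights are real) and is $C_1$-cofinite as a $V$-module.
   Context: $V=\coprod_{n\in\mathbb Z}V_{(n)}$ is a vertex operator algebra over $\mathbb C$, $Y(u,x)=\sum_{n\in\mathbb Z}u_nx^{-n-1}$, $V_+=\coprod_{n>0}V_{(n)}$. $V$-modules are ordinary modules: $\mathbb C$-graded by $L(0)$-eigenvalues, with finite-dimensional weight spaces and weights with real part bounded below. The lowest weight of an irreducible $V$-module $W$ is the weight $n_0$ with $W_{(n_0)}\ne0$ and $W=\coprod_{k\in\mathbb N}W_{(n_0+k)}$. $V$ is of positive energy if $V_{(n)}=0$ for $n<0$ and $V_{(0)}=\mathbb C\mathbf 1$. For $n\ge1$ and a $V$-module $W$, $C_n(W)$ is the span of the elements $u_{-n}w$ for $u\in V_+$, $w\in W$; $W$ is $C_n$-cofinite if $\dim W/C_n(W)<\infty$. For $n\ge2$, $V$ is $C_n$-cofinite if it is so as a module over itself. For $n=1$ a different definition is used for the algebra: $V$ is $C_1$-cofinite (in the sense of Li) if $V/C_1^a(V)$ is finite dimensional, where $C^a_1(V)$ is spanned by $u_{-1}v$ for $u,v\in V_+$ and $L(-1)v$ for $v\in V$. For $n\in\mathbb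 N$, $A_n(V)=V/O_n(V)$ is the (Zhu, Dong–Li–Mason) associative algebra with product induced by $u*_nv=\sum_{m=0}^n(-1)^m\binom{m+n}{n}\mathrm{Res}_x\,x^{-n-m-1}Y((1+x)^{L(0)+n}u,x)v$, where $O_n(V)$ is spanned by $\mathrm{Res}_x\,x^{-2n-2}Y((1+x)^{L(0)+n}u,x)v$ for $u,v\in V$ and $(L(-1)+L(0))u$ for $u\in V$. *)

(* Defs.v *)
From HB Require Import structures.
From mathcomp Require Import all_boot all_order all_algebra.
From mathcomp Require Import generic_quotient ring_quotient.
From mathcomp Require Import boolp classical_sets functions cardinality fsbigop.
From mathcomp Require Import reals.
From mathcomp Require Import complex.

Set Implicit Arguments.
Unset Strict Implicit.
Unset Printing Implicit Defensive.

Import Order.TTheory GRing.Theory Num.Theory.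

Local Open Scope classical_set_scope.
Local Open Scope ring_scope.
Local Open Scope quotient_scope.

Section LinearAlgebra.
Context {F : fieldType} {V : lmodType F}.

Definition subspace (A : set V) : Prop :=
  A 0 /\ forall (a : F) (u v : V), A u -> A v -> A (a *: u + v).

Definition lspan (X : set V) : set V :=
  [set v | exists s : seq (F * V),
     (forall p, p \in s -> X p.2) /\ v = \sum_(p <- s) p.1 *: p.2].

Definition finite_dim_in (A : set V) : Prop :=
  exists s : seq V, A `<=` lspan [set` s].

Definition direct_sum (I : choiceType) (A : I -> set V) : Prop :=
  (forall i, subspace (A i)) /\
  (forall v : V, exists! f : I -> V,
     [/\ forall i, A i (f i), finite_set [set i | f i != 0]
       & v = \sum_(i \in [set: I]) f i]).

Lemma lspan_subspace (X : set V) : subspace (lspan X).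
Proof.
split; first by exists [::]; rewrite big_nil.
move=> a u v [s [sX ->]] [t [tX ->]].
exists ([seq (a * p.1, p.2) | p <- s] ++ t); split.
  by move=> p; rewrite mem_cat => /orP[/mapP[q /sX ? ->]|/tX].
rewrite big_cat big_map scaler_sumr /=; congr (_ + _).
by apply: eq_bigr => p _; rewrite scalerA.
Qed.

Lemma sub_lspan (X : set V) : X `<=` lspan X.
Proof.
move=> x Xx; exists [:: (1, x)]; split; last by rewrite big_seq1 scale1r.
by move=> p; rewrite inE => /eqP ->.
Qed.

Definition lspan_pred (X : set V) : {pred V} := fun v => `[< lspan X v >].

Lemma lspan_pred_submod_closed (X : set V) : submod_closed (lspan_pred X).
Proof.
have [X0 XZD] := lspan_subspace X.
split; first exact/asboolP.
by move=> a u v /asboolP Xu /asboolP Xv; apply/asboolP/XZD.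
Qed.

HB.instance Definition _ (X : set V) :=
  GRing.isSubmodClosed.Build F V (lspan_pred X) (lspan_pred_submod_closed X).

End LinearAlgebra.

Definition finite_dim (F : fieldType) (V : lmodType F) : Prop :=
  finite_dim_in [set: V].

Section QuotientSpace.
Context {F : fieldType} {V : lmodType F}.
Variable X : set V.

Definition quot_space : Type := Quotient.quot (lspan_pred X : zmodClosed V).

HB.instance Definition _ := ZmodQuotient.on quot_space.

Definition quot_class (v : V) : quot_space := \pi_quot_space v.
Definition quot_repr (q : quot_space) : V := repr q.
Definition quot_scale (a : F) (q : quot_space) : quot_space :=
  quot_class (a *: quot_repr q).

Lemma quot_reprK (q : quot_space) : quot_class (quot_repr q) = q.
Proof. exact: reprK. Qed.

Lemma quot_classP (u v : V) : quot_class u = quot_class v <-> lspan X (u - v).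
Proof.
split=> [/eqmodP/asboolP //|uv].
by apply/eqmodP/asboolP.
Qed.

Lemma quot_classD (u v : V) : quot_class (u + v) = quot_class u + quot_class v.
Proof. by rewrite /quot_class raddfD. Qed.

Lemma quot_scale_class (a : F) (v : V) :
  quot_scale a (quot_class v) = quot_class (a *: v).
Proof.
apply/quot_classP; rewrite -scalerBr -[_ *: _]addr0.
have [X0 XZD] := lspan_subspace X.
by apply: XZD => //; apply/quot_classP; rewrite quot_reprK.
Qed.

Lemma quot_scalerA a b (q : quot_space) :
  quot_scale a (quot_scale b q) = quot_scale (a * b) q.
Proof. by rewrite -[q]quot_reprK !quot_scale_class scalerA. Qed.

Lemma quot_scale1r : left_id 1 quot_scale.
Proof. by move=> q; rewrite -[q]quot_reprK quot_scale_class scale1r. Qed.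

Lemma quot_scalerDr : right_distributive quot_scale +%R.
Proof.
move=> a p q; rewrite -[p]quot_reprK -[q]quot_reprK.
by rewrite -quot_classD !quot_scale_class -quot_classD scalerDr.
Qed.

Lemma quot_scalerDl (q : quot_space) : {morph quot_scale^~ q : a b / a + b}.
Proof.
move=> a b; rewrite -[q]quot_reprK.
by rewrite !quot_scale_class -quot_classD scalerDl.
Qed.

HB.instance Definition _ := GRing.Zmodule_isLmodule.Build F quot_space
  quot_scalerA quot_scale1r quot_scalerDr quot_scalerDl.

End QuotientSpace.

Definition gbinom (F : fieldType) (x : F) (k : nat) : F :=
  (\prod_(j < k) (x - j%:R)) / k`!%:R.

Section VertexAxioms.
Context {R : realType} {V W : lmodType R[i]}.

(* A vertex operator map is given by its modes: [Y u n w] is [u_n w], where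
   Y(u, x) w = \sum_n (u_n w) x^(-n-1).                                       *)

Definition mode_bilinear (Y : V -> int -> W -> W) : Prop :=
  (forall u n, linear (Y u n)) /\ (forall n w, linear (fun u => Y u n w)).

Definition lower_truncated (Y : V -> int -> W -> W) : Prop :=
  forall u w, exists N : int, forall n : int, N <= n -> Y u n w = 0.

(* The Jacobi identity
     x0^-1 d((x1-x2)/x0) Y(u,x1) Y(v,x2) - x0^-1 d((x2-x1)/-x0) Y(v,x2) Y(u,x1)
       = x2^-1 d((x1-x0)/x2) Y(Y(u,x0)v, x2),
   d being the formal delta function: this is the equality of the coefficients
   of x0^(-l-1) x1^(-m-1) x2^(-n-1) on both sides.  Under lower truncation
   both sums have finite support.                                             *)
Definition jacobi (YV : V -> int -> V -> V) (YW : V -> int -> W -> W) : Prop :=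
  forall (u v : V) (w : W) (l m n : int),
    \sum_(i \in [set: nat])
      ((-1) ^+ i * gbinom l%:~R i) *:
        (YW u (m + l - i%:Z) (YW v (n + i%:Z) w)
         - (-1) ^ l *: YW v (n + l - i%:Z) (YW u (m + i%:Z) w))
    = \sum_(i \in [set: nat])
        gbinom m%:~R i *: YW (YV u (l + i%:Z) v) (m + n - i%:Z) w.

Definition virasoro (c : R[i]) (L : int -> W -> W) : Prop :=
  forall (m n : int) (w : W),
    L m (L n w) - L n (L m w) =
    (m - n)%:~R *: L (m + n) w
    + (if m + n == 0 then (m ^+ 3 - m)%:~R / 12%:R * c else 0) *: w.

End VertexAxioms.

Record voa (R : realType) := Voa {
  voa_space :> lmodType R[i];
  voa_gr : int -> set voa_space;
  voa_Y : voa_space -> int -> voa_space -> voa_space;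
  voa_one : voa_space;
  voa_omega : voa_space;
  voa_c : R[i];
  voa_gr_sum : direct_sum voa_gr;
  voa_gr_fin : forall n, finite_dim_in (voa_gr n);
  voa_gr_bound : exists N : int, forall n v, n < N -> voa_gr n v -> v = 0;
  voa_Y_bilinear : mode_bilinear voa_Y;
  voa_Y_trunc : lower_truncated voa_Y;
  voa_vacuum : forall n v, voa_Y voa_one n v = if n == -1 then v else 0;
  voa_creation : forall v,
    voa_Y v (-1) voa_one = v /\ forall n, 0 <= n -> voa_Y v n voa_one = 0;
  voa_jacobi : jacobi voa_Y voa_Y;
  voa_one_gr : voa_gr 0 voa_one;
  voa_omega_gr : voa_gr 2 voa_omega;
  voa_virasoro : virasoro voa_c (fun n => voa_Y voa_omega (n + 1));
  voa_L0 : forall n v, voa_gr n v -> voa_Y voa_omega 1 v = n%:~R *: v;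
  voa_Lm1 : forall u n v,
    voa_Y (voa_Y voa_omega 0 u) n v = - n%:~R *: voa_Y u (n - 1) v
}.

Definition voa_L (R : realType) (V : voa R) (n : int) (v : V) : V :=
  voa_Y (voa_omega V) (n + 1) v.

Record voa_module (R : realType) (V : voa R) := VoaModule {
  mod_space :> lmodType R[i];
  mod_gr : R[i] -> set mod_space;
  mod_Y : V -> int -> mod_space -> mod_space;
  mod_gr_sum : direct_sum mod_gr;
  mod_gr_fin : forall n, finite_dim_in (mod_gr n);
  mod_gr_bound : exists B : R, forall n w,
    complex.Re n < B -> mod_gr n w -> w = 0;
  mod_Y_bilinear : mode_bilinear mod_Y;
  mod_Y_trunc : lower_truncated mod_Y;
  mod_vacuum : forall n w, mod_Y (voa_one V) n w = if n == -1 then w else 0;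
  mod_jacobi : jacobi (@voa_Y R V) mod_Y;
  mod_virasoro : virasoro (voa_c V) (fun n => mod_Y (voa_omega V) (n + 1));
  mod_L0 : forall n w, mod_gr n w -> mod_Y (voa_omega V) 1 w = n *: w;
  mod_Lm1 : forall u n w,
    mod_Y (voa_L (-1) u) n w = - n%:~R *: mod_Y u (n - 1) w
}.

Section AdjointModule.
Context {R : realType} (V : voa R).

Definition adjoint_gr (c : R[i]) : set V :=
  [set v | v = 0 \/ exists n : int, c = n%:~R /\ voa_gr n v].

Lemma adjoint_gr_int (n : int) : adjoint_gr n%:~R = @voa_gr R V n.
Proof.
have [sub0 _] := (voa_gr_sum V).1 n.
rewrite predeqE => v; split; last by right; exists n.
by case=> [->//|[m [/intr_inj -> ?]]].
Qed.

Lemma adjoint_gr_nint (c : R[i]) :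
  (forall n : int, c != n%:~R) -> adjoint_gr c = [set 0].
Proof.
move=> cn; rewrite predeqE => v; split; last by left.
by case=> // -[n [cE _]]; move: (cn n); rewrite cE eqxx.
Qed.

Lemma adjoint_gr_case (c : R[i]) :
  (exists n : int, c = n%:~R) \/ (forall n : int, c != n%:~R).
Proof.
case: (pselect (exists n : int, c = n%:~R)) => [|h]; first by left.
by right=> n; apply/eqP => cE; apply: h; exists n.
Qed.

Lemma adjoint_gr_sum : direct_sum adjoint_gr.
Proof.
have [sub dec] := voa_gr_sum V; split.
  move=> c; case: (adjoint_gr_case c) => [[n ->]|cn].
    by rewrite adjoint_gr_int.
  rewrite adjoint_gr_nint //; split=> // a u v -> ->.
  by rewrite scaler0 addr0.
move=> v; have [f [[fgr ffin fsum] funiq]] := dec v.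
have sumE (h : R[i] -> V) : (forall c, adjoint_gr c (h c)) ->
    \sum_(c \in [set: R[i]]) h c = \sum_(n \in [set: int]) h n%:~R.
  move=> hgr.
  rewrite -(@fsbig_image _ _ _ _ _ [set: int] (fun n : int => n%:~R : R[i]) h).
    apply/esym/fsbig_widen => // c [_ /= cN]; move: (hgr c).
    rewrite adjoint_gr_nint //= => n; apply/eqP => cE; apply: cN.
    by exists n.
  by move=> m n _ _ /intr_inj.
pose g (c : R[i]) : V :=
  if pselect (exists n : int, c = n%:~R) is left e then f (projT1 (cid e)) else 0.
have gint (n : int) : g n%:~R = f n.
  rewrite /g; case: pselect => [e|]; last by case; exists n.
  by case: cid => m /= /intr_inj ->.
have gnint (c : R[i]) : (forall n : int, c != n%:~R) -> g c = 0.
  by move=> cn; rewrite /g; case: pselect => // e; case: {+}e => n cE; case/eqP: (cn n).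
have ggr c : adjoint_gr c (g c).
  case: (adjoint_gr_case c) => [[n ->]|cn]; last by left; apply: gnint.
  by rewrite adjoint_gr_int gint.
have gfin : finite_set [set c | g c != 0].
  apply: (@sub_finite_set _ _ ((fun n : int => n%:~R : R[i]) @` [set n | f n != 0])).
    move=> c /= gc; case: (adjoint_gr_case c) => [[n cE]|cn].
      by exists n; rewrite //= -gint -cE.
    by rewrite gnint ?eqxx in gc.
  exact: finite_image.
exists g; split.
  split=> //.
  by rewrite sumE // fsum; apply: eq_fsbigr => n _; rewrite gint.
move=> h [hgr hfin hsum]; apply/funext => c.
have fE : f = fun n : int => h n%:~R.
  apply: funiq; split.
  - by move=> n; rewrite -adjoint_gr_int.
  - apply: (@finite_preimage _ _ [set c | h c != 0] (fun n : int => n%:~R)) hfin.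
    by move=> m n _ _ /intr_inj.
  - by rewrite -sumE.
case: (adjoint_gr_case c) => [[n ->]|cn]; first by rewrite gint fE.
by rewrite gnint //; move: (hgr c); rewrite adjoint_gr_nint // => ->.
Qed.

Lemma adjoint_gr_fin c : finite_dim_in (adjoint_gr c).
Proof.
case: (adjoint_gr_case c) => [[n ->]|cn].
  by rewrite adjoint_gr_int; apply: voa_gr_fin.
rewrite adjoint_gr_nint //; exists [::] => v ->.
by exists [::]; rewrite big_nil.
Qed.

Lemma adjoint_gr_bound : exists B : R, forall n w,
  complex.Re n < B -> adjoint_gr n w -> w = 0.
Proof.
have [N hN] := voa_gr_bound V; exists N%:~R => c w cN.
case=> // -[n [cE nw]]; apply: (hN n) => //.
move: cN; rewrite cE.
have -> : complex.Re (n%:~R : R[i]) = n%:~R.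
  by rewrite (_ : n%:~R = (n%:~R)%:C%C) // rmorph_int.
by rewrite ltr_int.
Qed.

Lemma adjoint_L0 n w : adjoint_gr n w -> voa_Y (voa_omega V) 1 w = n *: w.
Proof.
case=> [->|[m [-> /voa_L0 //]]].
have [lin _] := voa_Y_bilinear V.
by have := lin (voa_omega V) 1 (-1) 0 0; rewrite !scaler0 addr0 scaleN1r addNr.
Qed.

Definition adjoint_module : voa_module V := {|
  mod_space := voa_space V;
  mod_gr := adjoint_gr;
  mod_Y := @voa_Y R V;
  mod_gr_sum := adjoint_gr_sum;
  mod_gr_fin := adjoint_gr_fin;
  mod_gr_bound := adjoint_gr_bound;
  mod_Y_bilinear := voa_Y_bilinear V;
  mod_Y_trunc := @voa_Y_trunc R V;
  mod_vacuum := @voa_vacuum R V;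
  mod_jacobi := @voa_jacobi R V;
  mod_virasoro := @voa_virasoro R V;
  mod_L0 := adjoint_L0;
  mod_Lm1 := @voa_Lm1 R V
|}.

End AdjointModule.

Section Modules.
Context {R : realType} {V : voa R}.

Definition is_submodule (W : voa_module V) (S : set W) : Prop :=
  subspace S /\ forall (u : V) (n : int) (w : W), S w -> S (mod_Y u n w).

Definition irreducible (W : voa_module V) : Prop :=
  (exists w : W, w <> 0) /\
  forall S : set W, is_submodule S -> S = [set 0] \/ S = [set: W].

Definition is_weight (W : voa_module V) (n : R[i]) : Prop :=
  exists w : W, mod_gr n w /\ w <> 0.

Definition is_lowest_weight (W : voa_module V) (n0 : R[i]) : Prop :=
  is_weight W n0 /\
  direct_sum (fun k : nat => @mod_gr R V W (n0 + k%:R)).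

Definition real_graded (W : voa_module V) : Prop :=
  forall n, is_weight W n -> n \is Num.real.

End Modules.

Definition positive_energy (R : realType) (V : voa R) : Prop :=
  (forall (n : int) (v : V), n < 0 -> voa_gr n v -> v = 0) /\
  voa_gr 0 = lspan [set voa_one V].

Definition Vplus (R : realType) (V : voa R) : set V :=
  lspan [set v | exists n : int, 0 < n /\ voa_gr n v].

Arguments Vplus {R} V.

(* [C_n(W)] is the span of [C_gen n W]. *)
Definition C_gen (R : realType) (V : voa R) (n : nat) (W : voa_module V) :
    set W :=
  [set x | exists u w, Vplus V u /\ x = mod_Y u (- n%:Z) w].

Arguments C_gen {R V} n W.

Definition C_cofinite_mod (R : realType) (V : voa R) (n : nat)
    (W : voa_module V) : Prop :=
  finite_dim (quot_space (C_gen n W)).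

(* For [n >= 2]; C_1-cofiniteness of the algebra is [C1a_cofinite] below, which
   is a different condition (Li).                                             *)
Definition C_cofinite (R : realType) (V : voa R) (n : nat) : Prop :=
  C_cofinite_mod n (adjoint_module V).

(* [C_1^a(V)] is the span of [C1a_gen V]. *)
Definition C1a_gen (R : realType) (V : voa R) : set V :=
  [set x | exists u v, [/\ Vplus V u, Vplus V v & x = voa_Y u (-1) v]] `|`
  [set x | exists v : V, x = voa_L (-1) v].

Arguments C1a_gen {R} V.

Definition C1a_cofinite (R : realType) (V : voa R) : Prop :=
  finite_dim (quot_space (C1a_gen V)).

Section ZhuAlgebra.
Context {R : realType} (V : voa R).

(* (L(0) + n) (L(0) + n - 1) ... (L(0) + n - k + 1) u *)
Fixpoint L0_falling (n k : nat) (u : V) : V :=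
  if k is j.+1 then
    voa_L 0 (L0_falling n j u) + (n%:R - j%:R) *: L0_falling n j u
  else u.

(* The coefficient of x^k in (1+x)^(L(0)+n) u. *)
Definition L0_binom (n k : nat) (u : V) : V := k`!%:R^-1 *: L0_falling n k u.

(* Res_x x^p Y((1+x)^(L(0)+n) u, x) v *)
Definition zhu_res (n : nat) (p : int) (u v : V) : V :=
  \sum_(k \in [set: nat]) voa_Y (L0_binom n k u) (p + k%:Z) v.

Definition zhu_mul (n : nat) (u v : V) : V :=
  \sum_(m < n.+1)
    ((-1) ^+ m * 'C(m + n, n)%:R) *: zhu_res n (- (n + m + 1)%N%:Z) u v.

(* [O_n(V)] is the span of [O_gen n]. *)
Definition O_gen (n : nat) : set V :=
  [set x | exists u v, x = zhu_res n (- (2 * n + 2)%N%:Z) u v] `|`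
  [set x | exists u, x = voa_L (-1) u + voa_L 0 u].

Definition zhu_algebra (n : nat) : lmodType R[i] := quot_space (O_gen n).

(* The product of A_n(V), computed on representatives: [O_n(V)] is a two-sided
   ideal for [zhu_mul n] (Zhu, Dong-Li-Mason).                                *)
Definition zhu_algebra_mul (n : nat) (a b : zhu_algebra n) : zhu_algebra n :=
  quot_class (O_gen n) (zhu_mul n (quot_repr a) (quot_repr b)).

End ZhuAlgebra.

(* Main.v *)
(* The C_1-, C_1^a- and Zhu-quotients are finite dimensional because C_2-cofiniteness
   bounds the homogeneous part of V outside C_2(V), and words in the modes of a
   finite set of generators, ordered with few repetitions, span V and its modules.

   For the weights, let W be graded by n0 + N and put c' = n0 - c / 24. Zhu's
   recursion for the graded traces S(v) = tr_W o(v) q^(L(0) - n0) expresses the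
   traces of all v through those of finitely many v_i, with isobaric coefficients
   in C[P, Q, R] evaluated at the Eisenstein series (P has weight 2, Q weight 4,
   R weight 6). Hence the S(v_i) satisfy a system
     (12 q d/dq + 12 c') S(v_i) = sum_j A_ij S(v_j)
   in which A_ij is isobaric of weight wt v_i + 2 - wt v_j, and A does not
   depend on W. At q = 0 it shows that 12 c' is an eigenvalue of a fixed matrix,
   so only finitely many n0 occur. Isobaricity makes the exponent rigid: two
   such systems sharing a nonzero entry, with exponents differing by l, yield two
   isobaric scalar equations for that entry in derivations differing by l. Their
   resultant, with l treated as a variable of weight 2, is a nonzero isobaric
   polynomial that vanishes at l, and since forms of different weights are
   linearly independent this forces l = 0. As the character S(1) has rational
   coefficients, complex conjugation turns the system into one for the same S(1)
   with the conjugate exponent. Thus n0 - c / 24 is real for every W, and W = V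
   gives that c itself is real. *)

Require Import Defs.
From HB Require Import structures.
From mathcomp Require Import all_boot all_order all_algebra.
From mathcomp Require Import boolp classical_sets functions cardinality fsbigop.
From mathcomp Require Import reals complex.
From mathcomp Require Import perm ring lra zify.

Set Implicit Arguments.
Unset Strict Implicit.
Unset Printing Implicit Defensive.

Import Order.TTheory GRing.Theory Num.Theory.

Local Open Scope ring_scope.

(** * Formal power series in q *)

(** No series is summed and no transformation law under SL2(Z) is available: everything happens
    among formal power series. The substitute for modularity is the triple [dP], [Weul], [Dram],
    which satisfies the relations of sl2. Applying [dP] to a relation makes a weight or a P-degree
    reappear as the constant in an equation theta(v/u) = constant, and a quotient of power series
    has no logarithm, so that constant is 0. With a separate descent showing that P is not a
    quotient of forms in Q and R, this gives the independence of q-expansions. Weights match only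
    for Zhu's second grading, by L[0] instead of L(0); hence the operators [br] and [brm] and the
    lifting of homogeneous vectors to L[0]-eigenvectors. The Eisenstein series come from one formal
    object, z times the logarithmic derivative of Jacobi's theta function: its heat equation follows
    from an identity on the solutions of a x + b y = N, and its z-coefficients yield Ramanujan's
    identities as well as the coefficients of the trace recursion. The factor 12 clears the
    denominators of Ramanujan's identities. *)

Record ser (A : Type) := Ser { scoef :> nat -> A }.

Lemma ser_ext (A : Type) (f g : ser A) : (forall n, f n = g n) -> f = g.
Proof. by case: f g => [f] [g] fg; congr Ser; apply/funext. Qed.

HB.instance Definition _ (A : Type) := gen_eqMixin (ser A).
HB.instance Definition _ (A : Type) := gen_choiceMixin (ser A).

Section SerZmod.
Context {A : zmodType}.
Implicit Types f g h : ser A.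

Definition ser_add f g := Ser (fun n => f n + g n).
Definition ser_opp f := Ser (fun n => - f n).
Definition ser_zero : ser A := Ser (fun=> 0).

Fact ser_addA : associative ser_add.
Proof. by move=> f g h; apply: ser_ext => n /=; rewrite addrA. Qed.
Fact ser_addC : commutative ser_add.
Proof. by move=> f g; apply: ser_ext => n /=; rewrite addrC. Qed.
Fact ser_add0 : left_id ser_zero ser_add.
Proof. by move=> f; apply: ser_ext => n /=; rewrite add0r. Qed.
Fact ser_addN : left_inverse ser_zero ser_opp ser_add.
Proof. by move=> f; apply: ser_ext => n /=; rewrite addNr. Qed.

HB.instance Definition _ :=
  GRing.isZmodule.Build (ser A) ser_addA ser_addC ser_add0 ser_addN.

Lemma serD f g n : (f + g) n = f n + g n. Proof. by []. Qed.
Lemma serN f n : (- f) n = - f n. Proof. by []. Qed.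
Lemma ser0 n : (0 : ser A) n = 0. Proof. by []. Qed.
Lemma serB f g n : (f - g) n = f n - g n. Proof. by []. Qed.

Lemma ser_sum (I : Type) (r : seq I) (P : pred I) (F : I -> ser A) n :
  (\sum_(i <- r | P i) F i) n = \sum_(i <- r | P i) F i n.
Proof. exact: (big_morph (fun f : ser A => f n) (id1 := 0) (op1 := +%R)). Qed.

Lemma serMn f k n : (f *+ k) n = f n *+ k.
Proof. by elim: k => [|k IH]; rewrite ?mulr0n // !mulrS serD IH. Qed.

End SerZmod.

Section SerRing.
Context {A : comNzRingType}.
Implicit Types f g h : ser A.

Definition ser_mul f g := Ser (fun n => \sum_(i < n.+1) f i * g (n - i)%N).
Definition sercst (a : A) : ser A := Ser (fun n => if n == 0%N then a else 0).

(** Coefficients up to [N] only see truncations, so commutativity and associativity are inherited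
    from polynomials. *)
Lemma ser_mul_poly f g n N : (n <= N)%N ->
  ser_mul f g n = ((\poly_(i < N.+1) f i) * (\poly_(i < N.+1) g i))`_n.
Proof.
move=> nN; rewrite coefM /=; apply: eq_bigr => i _.
by rewrite !coef_poly !ltnS (leq_trans (leq_subr _ _) nN)
  (leq_trans _ nN) // -ltnS.
Qed.

Fact ser_mulC : commutative ser_mul.
Proof.
by move=> f g; apply: ser_ext => n; rewrite !(ser_mul_poly _ _ (leqnn n)) mulrC.
Qed.

Fact ser_mulA : associative ser_mul.
Proof.
move=> f g h; apply: ser_ext => n.
transitivity (((\poly_(i < n.+1) f i) * ((\poly_(i < n.+1) g i)
   * (\poly_(i < n.+1) h i)))`_n).
  rewrite coefM /=; apply: eq_bigr => i _.
  rewrite coef_poly ltnS -ltnS ltn_ord; congr (_ * _).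
  by rewrite -ser_mul_poly // leq_subr.
rewrite mulrA coefM /=; apply: eq_bigr => i _.
rewrite [X in _ * X]coef_poly ltnS leq_subr; congr (_ * _).
by rewrite -ser_mul_poly // -ltnS.
Qed.

Fact ser_mul1 : left_id (sercst 1) ser_mul.
Proof.
move=> f; apply: ser_ext => n /=; rewrite big_ord_recl /= mul1r subn0.
by rewrite big1 ?addr0 // => i _; rewrite mul0r.
Qed.

Fact ser_mulDl : left_distributive ser_mul +%R.
Proof.
move=> f g h; apply: ser_ext => n /=; rewrite -big_split /=.
by apply: eq_bigr => i _; rewrite mulrDl.
Qed.

Fact ser_1neq0 : sercst 1 != 0.
Proof.
apply/eqP => /(congr1 (fun f : ser A => f 0%N)) /= /eqP.
by rewrite (negPf (oner_neq0 _)).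
Qed.

HB.instance Definition _ := GRing.Zmodule_isComNzRing.Build (ser A)
  ser_mulA ser_mulC ser_mul1 ser_mulDl ser_1neq0.

Lemma serM f g n : (f * g) n = \sum_(i < n.+1) f i * g (n - i)%N.
Proof. by []. Qed.

Lemma ser1 n : (1 : ser A) n = if n == 0%N then 1 else 0.
Proof. by []. Qed.

Lemma serM0 f g : (f * g) 0%N = f 0%N * g 0%N.
Proof. by rewrite serM big_ord_recl big_ord0 addr0. Qed.

Fact sercst_is_additive : zmod_morphism sercst.
Proof.
by move=> a b; apply: ser_ext => -[|n] //=; rewrite subrr.
Qed.
Fact sercst_is_monoid : monoid_morphism sercst.
Proof.
split=> // a b; apply: ser_ext => n; rewrite serM big_ord_recl /= subn0.
rewrite big1 ?addr0; last by move=> i _; rewrite mul0r.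
by case: n => //= n; rewrite mulr0.
Qed.
HB.instance Definition _ := GRing.isZmodMorphism.Build A (ser A) sercst
  sercst_is_additive.
HB.instance Definition _ := GRing.isMonoidMorphism.Build A (ser A) sercst
  sercst_is_monoid.

Lemma sercstM a f n : (sercst a * f) n = a * f n.
Proof.
rewrite serM big_ord_recl /= subn0 big1 ?addr0 // => i _.
by rewrite mul0r.
Qed.

Definition serX : ser A := Ser (fun n => if n == 1%N then 1 else 0).

Lemma serXM f n : (serX * f) n = if n is m.+1 then f m else 0.
Proof.
case: n => [|n]; first by rewrite serM0 mul0r.
rewrite serM 2!big_ord_recl /= mul0r add0r mul1r subSS subn0.
by rewrite big1 ?addr0 // => i _; rewrite mul0r.
Qed.

Lemma serX_inj f g : serX * f = serX * g -> f = g.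
Proof.
move=> fg; apply: ser_ext => n.
by have := congr1 (fun h : ser A => h n.+1) fg; rewrite !serXM.
Qed.

Lemma ser_eqXM f : f 0%N = 0 -> f = serX * Ser (fun n => f n.+1).
Proof. by move=> f0; apply: ser_ext => -[|n]; rewrite serXM. Qed.

Definition stheta f := Ser (fun n => f n *+ n).

Fact stheta_is_additive : zmod_morphism stheta.
Proof. by move=> f g; apply: ser_ext => n /=; rewrite mulrnBl. Qed.
HB.instance Definition _ := GRing.isZmodMorphism.Build (ser A) (ser A) stheta
  stheta_is_additive.

Lemma sthetaM f g : stheta (f * g) = stheta f * g + f * stheta g.
Proof.
apply: ser_ext => n; rewrite serD !serM /= -big_split -sumrMnl /=.
apply: eq_bigr => i _; rewrite mulrnAl mulrnAr -mulrnDr.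
by rewrite subnKC // -ltnS.
Qed.

Lemma stheta_cst a : stheta (sercst a) = 0.
Proof. by apply: ser_ext => -[|n] //=; rewrite mul0rn. Qed.

Lemma stheta0 f : stheta f 0%N = 0. Proof. by []. Qed.

Lemma stheta_coef f n : stheta f n = f n *+ n. Proof. by []. Qed.

Lemma sthetaX : stheta serX = serX.
Proof. by apply: ser_ext => -[|[|n]] //=; rewrite mul0rn. Qed.

(* The geometric series of [1 - f] inverts [f]. *)
Lemma ser_inv f : f 0%N = 1 -> {g : ser A | f * g = 1 & g 0%N = 1}.
Proof.
move=> f0; pose u := 1 - f.
have u0 k n : (n < k)%N -> (u ^+ k) n = 0.
  elim: k n => // k IH n nk; rewrite exprS.
  have {1}-> : u = serX * Ser (fun n => u n.+1).
    by apply: ser_eqXM; rewrite /u serB ser1 f0 subrr.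
  rewrite -mulrA serXM; case: n nk => // n nk.
  rewrite serM big1 // => i _.
  by rewrite IH ?mulr0 // (leq_ltn_trans (leq_subr _ _)).
pose g := Ser (fun n => (\sum_(k < n.+1) u ^+ k) n).
have gE n N : (n <= N)%N -> g n = (\sum_(k < N.+1) u ^+ k) n.
  move=> nN; rewrite -(subnKC nN) -addSn big_split_ord serD.
  by rewrite [X in _ + X]ser_sum [X in _ + X]big1 ?addr0 // => i _; rewrite u0 //= ltn_addr.
exists g; last first.
  by rewrite (gE 0%N 0%N) // big_ord_recl big_ord0 expr0 addr0 ser1.
apply: ser_ext => n.
transitivity ((f * (\sum_(k < n.+1) u ^+ k)) n).
  by rewrite !serM; apply: eq_bigr => i _; rewrite (gE _ n) // leq_subr.
have -> : f * (\sum_(k < n.+1) u ^+ k) = 1 - u ^+ n.+1.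
  have fu : f = - (u - 1) by rewrite /u opprB opprB addrC subrK.
  by rewrite {1}fu mulNr -subrX1 opprB.
by rewrite serB u0 // subr0.
Qed.

End SerRing.

Section SerDom.
Context {F : idomainType}.
Implicit Types f g : ser F.

Lemma ser_neq0P f : f <> 0 -> exists n, f n != 0 /\ forall m, (m < n)%N -> f m = 0.
Proof.
move=> f0.
have [n fn] : exists n, f n != 0.
  apply: contrapT => h; apply: f0; apply: ser_ext => n.
  by apply/eqP/negPn/negP => fn; apply: h; exists n.
case: (ex_minnP (ex_intro (fun n => f n != 0) n fn)) => m fm mmin.
exists m; split=> // k km; apply/eqP/negPn/negP => /mmin.
by rewrite leqNgt km.
Qed.

(** Lowest terms multiply without interference; over an integral domain this is why series have no
    zero divisors. *)
Lemma serM_low f g m n : (forall k, (k < m)%N -> f k = 0) ->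
  (forall k, (k < n)%N -> g k = 0) -> (f * g) (m + n)%N = f m * g n.
Proof.
move=> fm gn; rewrite serM.
have mlt : (m < (m + n).+1)%N by rewrite ltnS leq_addr.
rewrite (bigD1 (Ordinal mlt)) //= addKn big1 ?addr0 // => i.
rewrite -val_eqE /= neq_ltn => /orP[im|mi]; first by rewrite fm ?mul0r.
rewrite gn ?mulr0 //; have := ltn_ord i; lia.
Qed.

Lemma serM_low0 f g m n k : (forall k, (k < m)%N -> f k = 0) ->
  (forall k, (k < n)%N -> g k = 0) -> (k < m + n)%N -> (f * g) k = 0.
Proof.
move=> fm gn kmn; rewrite serM big1 // => i _.
have [im|mi] := ltnP i m; first by rewrite fm ?mul0r.
by rewrite gn ?mulr0 //; have := ltn_ord i; lia.
Qed.

Lemma ser_mulf_eq0 f g : f * g = 0 -> f = 0 \/ g = 0.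
Proof.
move=> fg; case: (pselect (f = 0)) => [|f0]; first by left.
case: (pselect (g = 0)) => [|g0]; first by right.
have [m [fm fl]] := ser_neq0P f0; have [n [gn gl]] := ser_neq0P g0.
have := serM_low fl gl; rewrite fg ser0 => /esym/eqP.
by rewrite mulf_eq0 (negPf fm) (negPf gn).
Qed.

Lemma ser_mulIf f g h : f <> 0 -> f * g = f * h -> g = h.
Proof.
move=> f0 /eqP; rewrite -subr_eq0 -mulrBr => /eqP /ser_mulf_eq0 [//|/eqP].
by rewrite subr_eq0 => /eqP.
Qed.

End SerDom.

(* No logarithms: the left-hand side is [u^2 theta(v/u)], and [theta] of a
   Laurent series has no constant term. *)
Lemma ser_no_log (F : numFieldType) (u v : ser F) (c : F) : u <> 0 ->
  u * stheta v - v * stheta u = sercst c * (u * u) -> c = 0.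
Proof.
move=> u0 E; have [a [ua ul]] := ser_neq0P u0.
case: (pselect (v = 0)) => [v0|v0].
  move/(congr1 (fun f : ser F => f (a + a)%N)): E.
  rewrite v0 raddf0 mulr0 mul0r subr0 ser0 sercstM (serM_low ul ul).
  by move=> /esym/eqP; rewrite !mulf_eq0 (negPf ua) !orbF => /eqP.
have [b [vb vl]] := ser_neq0P v0.
have tl (f : ser F) (n : nat) : (forall k, (k < n)%N -> f k = 0) ->
    forall k, (k < n)%N -> stheta f k = 0 :> F.
  by move=> fl k kn; rewrite stheta_coef fl // mul0rn.
have [ba|ab] := ltnP b a.
  move/(congr1 (fun f : ser F => f (a + b)%N)): E.
  rewrite serB (serM_low ul (tl _ _ vl)) [X in _ - _ X](addnC a b).
  rewrite (serM_low vl (tl _ _ ul)) sercstM (serM_low0 ul ul) ?mulr0 ?ltn_add2l //.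
  rewrite !stheta_coef -[v b *+ b]mulr_natr -[u a *+ a]mulr_natr !mulrA.
  rewrite [v b * u a]mulrC -mulrBr => /eqP.
  rewrite !mulf_eq0 (negPf ua) (negPf vb) /= subr_eq0 eqr_nat.
  by rewrite (ltn_eqF ba).
move/(congr1 (fun f : ser F => f (a + a)%N)): E.
rewrite sercstM (serM_low ul ul) serB.
have -> : (u * stheta v) (a + a)%N = (v * stheta u) (a + a)%N.
  have vl' k : (k < a)%N -> v k = 0 by move=> ka; rewrite vl // (leq_trans ka).
  by rewrite (serM_low ul (tl _ _ vl')) (serM_low vl' (tl _ _ ul)) !stheta_coef
    !mulrnAr mulrC.
by rewrite subrr => /esym/eqP; rewrite !mulf_eq0 (negPf ua) !orbF => /eqP.
Qed.

(** * Ramanujan's ring of quasimodular polynomials *)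

Section Derivations.

(** Derivations along a ring map, not just of a ring: evaluation after [Dram] and [th] after
    evaluation are then of the same kind, and such identities are checked on generators only. *)
Definition der (A : nzRingType) (S : nzRingType) (phi : A -> S) (d : A -> S) : Prop :=
  (forall x y, d (x + y) = d x + d y) /\
  (forall x y, d (x * y) = d x * phi y + phi x * d y).

Lemma der0 (A S : nzRingType) (phi d : A -> S) : der phi d -> d 0 = 0.
Proof. by move=> [dD _]; apply: (@addIr _ (d 0)); rewrite -dD !add0r. Qed.

Lemma derB (A S : nzRingType) (phi d1 d2 : A -> S) :
  der phi d1 -> der phi d2 -> der phi (fun x => d1 x - d2 x).
Proof.
move=> [D1 M1] [D2 M2]; split=> x y.
  by rewrite D1 D2 opprD addrACA.
by rewrite M1 M2 mulrBl mulrBr opprD addrACA.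
Qed.

Lemma derD (A S : nzRingType) (phi d1 d2 : A -> S) :
  der phi d1 -> der phi d2 -> der phi (fun x => d1 x + d2 x).
Proof.
move=> [D1 M1] [D2 M2]; split=> x y.
  by rewrite D1 D2 addrACA.
by rewrite M1 M2 mulrDl mulrDr addrACA.
Qed.

Lemma derZ (A S : comNzRingType) (phi d : A -> S) (c : S) :
  der phi d -> der phi (fun x => c * d x).
Proof.
move=> [D1 M1]; split=> x y; first by rewrite D1 mulrDr.
by rewrite M1 mulrDr !mulrA [c * phi x]mulrC.
Qed.

Lemma der_comm (A : comNzRingType) (d1 d2 : A -> A) :
  der id d1 -> der id d2 -> der id (fun x => d1 (d2 x) - d2 (d1 x)).
Proof.
move=> [D1 M1] [D2 M2]; split=> x y.
  by rewrite !(D1, D2) opprD addrACA.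
rewrite !(M1, M2, D1, D2) /=; ring.
Qed.

Lemma der_deriv (A : comNzRingType) : der id (@deriv A).
Proof. by split=> x y; rewrite ?derivD ?derivM. Qed.

Lemma der_map (A : comNzRingType) (d : A -> A) : der id d -> der id (map_poly d).
Proof.
move=> dd; have d0 := der0 dd; case: dd => dD dM; split=> x y; apply/polyP => i.
  by rewrite !(coef_map_id0 _ _ d0, coefD) dD.
rewrite coefD !coefM (coef_map_id0 _ _ d0) coefM.
rewrite (big_morph d dD d0) -big_split /=; apply: eq_bigr => j _.
by rewrite dM !(coef_map_id0 _ _ d0).
Qed.

Lemma der_comp (A B S : nzRingType) (phi : {rmorphism A -> B}) (psi d : B -> S) :
  der psi d -> der (psi \o phi) (d \o phi).
Proof.
by move=> [dD dM]; split=> x y /=; rewrite ?rmorphD ?rmorphM ?dD ?dM.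
Qed.

Lemma der_post (A B : nzRingType) (phi : {rmorphism A -> B}) (d : A -> A) :
  der id d -> der phi (phi \o d).
Proof.
by move=> [dD dM]; split=> x y /=; rewrite ?dD ?dM ?rmorphD ?rmorphM.
Qed.

Lemma der_poly_eq0 (A S : nzRingType) (phi d : {poly A} -> S) :
  der phi d -> d 'X = 0 -> (forall c, d c%:P = 0) -> forall p, d p = 0.
Proof.
move=> [dD dM] dX dC; elim/poly_ind => [|p c IH]; first exact: dC.
by rewrite dD dM IH dX dC mul0r mulr0 !addr0.
Qed.

Lemma der_polyC (A S : nzRingType) (phi d : {poly A} -> S) :
  der phi d -> der (phi \o polyC) (d \o polyC).
Proof. by move=> [dD dM]; split=> x y /=; rewrite ?polyCD ?polyCM ?dD ?dM. Qed.

Definition evx (A S : comNzRingType) (f : {rmorphism A -> S}) (u : S) :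
  {rmorphism {poly A} -> S} := horner_morph (fun x => mulrC u (f x)).

Lemma evxC (A S : comNzRingType) (f : {rmorphism A -> S}) u c :
  evx f u c%:P = f c.
Proof. by rewrite /evx /= horner_morphC. Qed.

Lemma evxX (A S : comNzRingType) (f : {rmorphism A -> S}) u : evx f u 'X = u.
Proof. by rewrite /evx /= horner_morphX. Qed.

End Derivations.

(* [{poly {poly F}}] models C[Q, R] (outer variable R) and [{poly {poly {poly F}}}]
   models C[P, Q, R] (outer variable P); [W2], [Weul] are the Euler fields of the
   weights 2, 4, 6 and [Dram] is 12 times Ramanujan's derivation.               *)
Section Quasimodular.
Context {F : numFieldType}.
Local Notation M2 := {poly {poly F}}.
Local Notation M := {poly M2}.

Definition Q2 : M2 := 'X%:P.
Definition R2 : M2 := 'X.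
Definition c2 (c : F) : M2 := c%:P%:P.
Definition mc (c : F) : M := c%:P%:P%:P.
Definition mP : M := 'X.
Definition mQ : M := Q2%:P.
Definition mR : M := R2%:P.

Definition dQ (g : M2) : M2 := map_poly (@deriv F) g.
Definition dR (g : M2) : M2 := deriv g.
Definition W2 (g : M2) : M2 := (4%:R * Q2) * dQ g + (6%:R * R2) * dR g.
(** The Serre derivation (times 12): what is left of Ramanujan's derivation on C[Q, R] once P times
    the Euler field is removed. *)
Definition serre2 (g : M2) : M2 := - (4%:R * R2) * dQ g - (6%:R * Q2 ^+ 2) * dR g.
Definition dP (f : M) : M := deriv f.
Definition Weul (f : M) : M := (2%:R * mP) * dP f + map_poly W2 f.
Definition Dram (f : M) : M :=
  map_poly serre2 f + mP * map_poly W2 f + (mP ^+ 2 - mQ) * dP f.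

Lemma der_dQ : der id dQ. Proof. exact/der_map/der_deriv. Qed.
Lemma der_dR : der id dR. Proof. exact: der_deriv. Qed.
Lemma der_W2 : der id W2.
Proof. by apply: derD; apply: derZ; [apply: der_dQ|apply: der_dR]. Qed.
Lemma der_serre2 : der id serre2.
Proof. by apply: derB; apply: derZ; [apply: der_dQ|apply: der_dR]. Qed.
Lemma der_dP : der id dP. Proof. exact: der_deriv. Qed.
Lemma der_W : der id Weul.
Proof.
by apply: derD; [apply: derZ; apply: der_dP|apply: der_map; apply: der_W2].
Qed.
Lemma der_D : der id Dram.
Proof.
apply: derD; last by apply: derZ; apply: der_dP.
apply: derD; first by apply: der_map; apply: der_serre2.
by apply: derZ; apply: der_map; apply: der_W2.
Qed.

Lemma mapC (d : M2 -> M2) c : d 0 = 0 -> map_poly d c%:P = (d c)%:P.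
Proof.
move=> d0; apply/polyP => i; rewrite (coef_map_id0 _ _ d0) !coefC.
by case: eqP => // _; rewrite d0.
Qed.

Lemma dQ_Q : dQ Q2 = 1.
Proof. by rewrite /dQ /Q2 map_polyC /= derivX. Qed.
Lemma dQ_R : dQ R2 = 0.
Proof.
by apply/polyP => i; rewrite coef_map_id0 ?linear0 // coefX; case: eqP;
  rewrite /= ?mulr1n ?mulr0n ?linear0 ?coef0 // => _; rewrite -[1]/(1%:P) derivC.
Qed.
Lemma dR_Q : dR Q2 = 0. Proof. by rewrite /dR /Q2 derivC. Qed.
Lemma dR_R : dR R2 = 1. Proof. by rewrite /dR /R2 derivX. Qed.
Lemma dQ_c c : dQ (c2 c) = 0.
Proof. by rewrite /dQ /c2 map_polyC /= derivC. Qed.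
Lemma dR_c c : dR (c2 c) = 0. Proof. by rewrite /dR /c2 derivC. Qed.

Definition dgen := (dQ_Q, dQ_R, dR_Q, dR_R, dQ_c, dR_c).

Lemma W2_Q : W2 Q2 = 4%:R * Q2. Proof. by rewrite /W2 !dgen; ring. Qed.
Lemma W2_R : W2 R2 = 6%:R * R2. Proof. by rewrite /W2 !dgen; ring. Qed.
Lemma W2_c c : W2 (c2 c) = 0. Proof. by rewrite /W2 !dgen; ring. Qed.
Lemma serre2_Q : serre2 Q2 = - (4%:R * R2).
Proof. by rewrite /serre2 !dgen; ring. Qed.
Lemma serre2_R : serre2 R2 = - (6%:R * Q2 ^+ 2).
Proof. by rewrite /serre2 !dgen; ring. Qed.
Lemma serre2_c c : serre2 (c2 c) = 0.
Proof. by rewrite /serre2 !dgen; ring. Qed.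

Lemma der_M2_eq0 (S : nzRingType) (phi d : M2 -> S) : der phi d ->
  d Q2 = 0 -> d R2 = 0 -> (forall c, d (c2 c) = 0) -> forall g, d g = 0.
Proof.
move=> dd dq dr dc; apply: (der_poly_eq0 dd) => // g.
exact: (der_poly_eq0 (der_polyC dd)).
Qed.

Lemma der_M_eq0 (S : nzRingType) (phi d : M -> S) : der phi d -> d mP = 0 ->
  d mQ = 0 -> d mR = 0 -> (forall c, d (mc c) = 0) -> forall f, d f = 0.
Proof.
move=> dd dp dq dr dc; apply: (der_poly_eq0 dd) => // g.
exact: (der_M2_eq0 (der_polyC dd)).
Qed.

Lemma map0 (d : M2 -> M2) : d 0 = 0 -> d 1 = 0 -> map_poly d 'X = 0.
Proof.
move=> d0 d1; apply/polyP => i; rewrite (coef_map_id0 _ _ d0) coefX coef0.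
by case: eqP.
Qed.

Lemma der1 (A : nzRingType) (d : A -> A) : der id d -> d 1 = 0.
Proof.
move=> [_ dM]; apply: (@addIr _ (d 1)); rewrite add0r.
by rewrite -{3}[1]mulr1 dM /= mulr1 mul1r.
Qed.

Lemma dP_C g : dP g%:P = 0. Proof. exact: derivC. Qed.
Lemma dP_P : dP mP = 1. Proof. exact: derivX. Qed.
Lemma W_C g : Weul g%:P = (W2 g)%:P.
Proof. by rewrite /Weul dP_C mulr0 add0r mapC // (der0 der_W2). Qed.
Lemma W_P : Weul mP = 2%:R * mP.
Proof.
by rewrite /Weul dP_P map0 ?(der0 der_W2) ?(der1 der_W2) // mulr1 addr0.
Qed.
Lemma D_C g : Dram g%:P = (serre2 g)%:P + mP * (W2 g)%:P.
Proof.
by rewrite /Dram dP_C mulr0 addr0 !mapC // ?(der0 der_W2) ?(der0 der_serre2).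
Qed.
Lemma D_P : Dram mP = mP ^+ 2 - mQ.
Proof.
rewrite /Dram dP_P !map0 ?(der0 der_W2) ?(der1 der_W2) ?(der0 der_serre2)
  ?(der1 der_serre2) //; ring.
Qed.
Lemma W_Q : Weul mQ = 4%:R * mQ.
Proof. by rewrite W_C W2_Q polyCM rmorph_nat. Qed.
Lemma W_R : Weul mR = 6%:R * mR.
Proof. by rewrite W_C W2_R polyCM rmorph_nat. Qed.
Lemma W_c c : Weul (mc c) = 0. Proof. by rewrite W_C W2_c. Qed.
Lemma D_Q : Dram mQ = 4%:R * (mP * mQ - mR).
Proof.
rewrite D_C W2_Q serre2_Q rmorphN !rmorphM !rmorph_nat /= -/mQ -/mR; ring.
Qed.
Lemma D_R : Dram mR = 6%:R * (mP * mR - mQ ^+ 2).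
Proof.
rewrite D_C W2_R serre2_R rmorphN !rmorphM !rmorph_nat /= -/mQ -/mR; ring.
Qed.
Lemma D_c c : Dram (mc c) = 0.
Proof. by rewrite D_C W2_c serre2_c mulr0 addr0. Qed.

Lemma der_nat (A : comNzRingType) (d : A -> A) n x : der id d ->
  d (n%:R * x) = n%:R * d x.
Proof.
move=> dd; case: (dd) => [dD dM]; elim: n => [|n IH].
  by rewrite !mul0r (der0 dd).
by rewrite -natr1 !mulrDl dD IH !mul1r.
Qed.
Lemma derN (A : comNzRingType) (d : A -> A) x : der id d -> d (- x) = - d x.
Proof.
move=> dd; case: (dd) => [dD dM].
by apply/eqP; rewrite -addr_eq0 -dD addNr (der0 dd).
Qed.
Lemma der_sub (A : comNzRingType) (d : A -> A) x y : der id d -> d (x - y) = d x - d y.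
Proof. by move=> dd; case: (dd) => [dD dM]; rewrite dD derN. Qed.
Lemma der_sq (A : comNzRingType) (d : A -> A) x : der id d ->
  d (x ^+ 2) = 2%:R * x * d x.
Proof. by move=> [dD dM]; rewrite expr2 dM /=; ring. Qed.

(** With the next two relations, [dP], [Weul] and [Dram] span a copy of sl2. The difference of the
    two sides is a derivation, so it suffices to compare them on P, Q, R and constants. *)
Lemma comm_dP_D f : dP (Dram f) = Dram (dP f) + Weul f.
Proof.
apply/eqP; rewrite addrC -subr_eq -subr_eq0; apply/eqP; move: f.
have := derB (der_comm der_dP der_D) der_W.
have [D1 M1] := der_dP; have [D2 M2] := der_D.
move=> /der_M_eq0; apply=> [||| c].
- rewrite D_P dP_P (der1 der_D) (der_sub _ _ der_dP) (der_sq _ der_dP) dP_P dP_C W_P; ring.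
- rewrite D_Q dP_C (der0 der_D) (der_nat _ _ der_dP) (der_sub _ _ der_dP) M1 /=.
  rewrite dP_P !dP_C W_Q; ring.
- rewrite D_R dP_C (der0 der_D) (der_nat _ _ der_dP) (der_sub _ _ der_dP) M1 /=.
  rewrite (der_sq _ der_dP) dP_P !dP_C W_R; ring.
- by rewrite D_c (der0 der_dP) dP_C (der0 der_D) W_c !subr0.
Qed.

Lemma comm_W_D f : Weul (Dram f) = Dram (Weul f) + 2%:R * Dram f.
Proof.
apply/eqP; rewrite addrC -subr_eq -subr_eq0; apply/eqP; move: f.
have := derB (der_comm der_W der_D) (derZ 2%:R der_D).
have [D1 M1] := der_W; have [D2 M2] := der_D.
move=> /der_M_eq0; apply=> [||| c].
- rewrite W_P D_P (der_nat _ _ der_D) D_P (der_sub _ _ der_W) (der_sq _ der_W) W_P W_Q; ring.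
- rewrite W_Q D_Q (der_nat _ _ der_D) D_Q (der_nat _ _ der_W) (der_sub _ _ der_W) M1 /=.
  rewrite W_P W_Q W_R; ring.
- rewrite W_R D_R (der_nat _ _ der_D) D_R (der_nat _ _ der_W) (der_sub _ _ der_W) M1 /=.
  rewrite (der_sq _ der_W) W_P W_Q W_R; ring.
- by rewrite D_c W_c (der0 der_W) (der0 der_D) mulr0 !subr0.
Qed.

Lemma comm_W_dP f : Weul (dP f) = dP (Weul f) - 2%:R * dP f.
Proof.
apply/eqP; rewrite -subr_eq0; apply/eqP.
have h := derD (der_comm der_W der_dP) (derZ 2%:R der_dP).
transitivity (Weul (dP f) - dP (Weul f) + 2%:R * dP f); first by ring.
move: f; apply: (der_M_eq0 h) => [||| c].
- rewrite W_P dP_P (der_nat _ _ der_dP) dP_P (der1 der_W); ring.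
- by rewrite W_Q dP_C (der_nat _ _ der_dP) dP_C (der0 der_W); ring.
- by rewrite W_R dP_C (der_nat _ _ der_dP) dP_C (der0 der_W); ring.
- by rewrite W_c (der0 der_dP) dP_C (der0 der_W); ring.
Qed.

Lemma comm_W2_serre2 g : W2 (serre2 g) = serre2 (W2 g) + 2%:R * serre2 g.
Proof.
apply/eqP; rewrite addrC -subr_eq -subr_eq0; apply/eqP; move: g.
have := derB (der_comm der_W2 der_serre2) (derZ 2%:R der_serre2).
move=> /der_M2_eq0; apply=> [|| c].
- rewrite W2_Q serre2_Q (der_nat _ _ der_serre2) serre2_Q (derN _ der_W2).
  rewrite (der_nat _ _ der_W2) W2_R; ring.
- rewrite W2_R serre2_R (der_nat _ _ der_serre2) serre2_R (derN _ der_W2).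
  rewrite (der_nat _ _ der_W2) (der_sq _ der_W2) W2_Q; ring.
- by rewrite W2_c serre2_c (der0 der_W2) (der0 der_serre2) mulr0 !subr0.
Qed.

End Quasimodular.

(** * Weights as eigenvalues of the Euler field *)

Section Isobaric.
Context {F : numFieldType}.
Local Notation M2 := {poly {poly F}}.
Local Notation M := {poly M2}.

(** A weight is an eigenvalue in [F] and not a degree: it need not be known in advance to be a
    natural number, 0 has every weight, and differences of weights need no truncated subtraction. *)
Definition isob2 (k : F) (g : M2) := W2 g = c2 k * g.
Definition isob (k : F) (f : M) := Weul f = mc k * f.

Lemma c2D (a b : F) : c2 (a + b) = c2 a + c2 b.
Proof. by rewrite /c2 !rmorphD. Qed.
Lemma c2B (a b : F) : c2 (a - b) = c2 a - c2 b.
Proof. by rewrite /c2 !rmorphB. Qed.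
Lemma c2N (a : F) : c2 (- a) = - c2 a.
Proof. by rewrite /c2 !rmorphN. Qed.
Lemma c2M (a b : F) : c2 (a * b) = c2 a * c2 b.
Proof. by rewrite /c2 !rmorphM. Qed.
Lemma c2_nat n : c2 (n%:R : F) = n%:R.
Proof. by rewrite /c2 !rmorph_nat. Qed.
Lemma c20 : c2 (0 : F) = 0. Proof. exact: (c2_nat 0). Qed.
Lemma c21 : c2 (1 : F) = 1. Proof. exact: (c2_nat 1). Qed.
Lemma mcD (a b : F) : mc (a + b) = mc a + mc b.
Proof. by rewrite /mc !rmorphD. Qed.
Lemma mcB (a b : F) : mc (a - b) = mc a - mc b.
Proof. by rewrite /mc !rmorphB. Qed.
Lemma mcN (a : F) : mc (- a) = - mc a.
Proof. by rewrite /mc !rmorphN. Qed.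
Lemma mcM (a b : F) : mc (a * b) = mc a * mc b.
Proof. by rewrite /mc !rmorphM. Qed.
Lemma mc_nat n : mc (n%:R : F) = n%:R.
Proof. by rewrite /mc !rmorph_nat. Qed.
Lemma mc1 : mc (1 : F) = 1. Proof. exact: (mc_nat 1). Qed.
Lemma mc0 : mc (0 : F) = 0. Proof. exact: (mc_nat 0). Qed.
Definition c2E := (c2D, c2B, c2N, c2M, c2_nat, c21).
Definition mcE := (mcD, mcB, mcN, mcM, mc_nat, mc1).

Lemma isob2M k l g h : isob2 k g -> isob2 l h -> isob2 (k + l) (g * h).
Proof.
by move=> Hg Hh; rewrite /isob2 (der_W2 (F := F)).2 /= Hg Hh !c2E; ring.
Qed.
Lemma isob2D k g h : isob2 k g -> isob2 k h -> isob2 k (g + h).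
Proof. by move=> Hg Hh; rewrite /isob2 (der_W2 (F := F)).1 Hg Hh mulrDr. Qed.
Lemma isob2N k g : isob2 k g -> isob2 k (- g).
Proof. by move=> Hg; rewrite /isob2 (derN _ der_W2) Hg mulrN. Qed.
Lemma isob2B k g h : isob2 k g -> isob2 k h -> isob2 k (g - h).
Proof. by move=> Hg Hh; apply: isob2D => //; apply: isob2N. Qed.
Lemma isob2_c c : isob2 0 (c2 c).
Proof. by rewrite /isob2 W2_c c20 mul0r. Qed.
Lemma isob2_Q : isob2 4%:R Q2. Proof. by rewrite /isob2 W2_Q c2_nat. Qed.
Lemma isob2_R : isob2 6%:R R2. Proof. by rewrite /isob2 W2_R c2_nat. Qed.
Lemma isob2_serre k g : isob2 k g -> isob2 (k + 2%:R) (serre2 g).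
Proof.
move=> Hg; rewrite /isob2 comm_W2_serre2 Hg (der_serre2 (F := F)).2 /= serre2_c !c2E; ring.
Qed.

Lemma isobM k l f h : isob k f -> isob l h -> isob (k + l) (f * h).
Proof.
by move=> Hf Hh; rewrite /isob (der_W (F := F)).2 /= Hf Hh !mcE; ring.
Qed.
Lemma isobD k f h : isob k f -> isob k h -> isob k (f + h).
Proof. by move=> Hf Hh; rewrite /isob (der_W (F := F)).1 Hf Hh mulrDr. Qed.
Lemma isobN k f : isob k f -> isob k (- f).
Proof. by move=> Hf; rewrite /isob mulrN -Hf; exact: (derN f der_W). Qed.
Lemma isobB k f h : isob k f -> isob k h -> isob k (f - h).
Proof. by move=> Hf Hh; apply: isobD => //; apply: isobN. Qed.
Lemma isob0 k : isob k 0.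
Proof. by rewrite /isob (der0 der_W) mulr0. Qed.
Lemma isob1 : isob 0 1.
Proof. by rewrite /isob (der1 der_W) mc0 mul0r. Qed.
Lemma isob_c c : isob 0 (mc c).
Proof. by rewrite /isob W_c mc0 mul0r. Qed.
Lemma isob_C k g : isob2 k g -> isob k g%:P.
Proof. by move=> Hg; rewrite /isob W_C Hg polyCM. Qed.
Lemma isob_P : isob 2%:R mP. Proof. by rewrite /isob W_P mc_nat. Qed.
Lemma isob_Dram k f : isob k f -> isob (k + 2%:R) (Dram f).
Proof.
move=> Hf; rewrite /isob comm_W_D Hf (der_D (F := F)).2 /= D_c !mcE; ring.
Qed.
Lemma isob_dP k f : isob k f -> isob (k - 2%:R) (dP f).
Proof.
move=> Hf; rewrite /isob comm_W_dP Hf (der_dP (F := F)).2 /= dP_C !mcE; ring.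
Qed.
Lemma isob_sum k (I : Type) (r : seq I) (P : pred I) (f : I -> M) :
  (forall i, P i -> isob k (f i)) -> isob k (\sum_(i <- r | P i) f i).
Proof. by move=> h; apply: big_ind => //; [apply: isob0|move=> x y; apply: isobD]. Qed.

Lemma isob2_coef k f i : isob k f -> isob2 (k - 2%:R * i%:R) f`_i.
Proof.
move/(congr1 (fun f : M => f`_i)); rewrite /Weul coefD /mP -mulrA mulr_natl.
rewrite coefMn coefXM (coef_map_id0 _ _ (der0 der_W2)) /mc coefCM /isob2 /dP.
rewrite -/(c2 k).
case: i => [|i] /= E; first by move: E; rewrite mul0rn add0r mulr0 subr0.
move: E; rewrite coef_deriv => E.
apply: (addrI (f`_i.+1 *+ i.+1 *+ 2)); rewrite E !c2E; ring.
Qed.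

End Isobaric.

(** * Values at the cusp and divisibility by the discriminant *)

Section Evaluation.
Context {F : numFieldType}.
Local Notation M2 := {poly {poly F}}.
Local Notation M := {poly M2}.

(** The parametrization (t^2, t^3) of the cuspidal cubic R^2 = Q^3. The point t = 1 is Q = R = 1,
    the constant terms of the two series. *)
Definition cusp : {rmorphism M2 -> {poly F}} :=
  locked (evx (evx (@polyC F) ('X^2)) 'X^3).

Lemma cusp_Q : cusp Q2 = 'X^2. Proof. by rewrite /cusp -lock evxC evxX. Qed.
Lemma cusp_R : cusp R2 = 'X^3. Proof. by rewrite /cusp -lock evxX. Qed.
Lemma cusp_c c : cusp (c2 c) = c%:P. Proof. by rewrite /cusp -lock !evxC. Qed.

Lemma cusp_euler g : (2%:R * 'X) * (cusp g)^`() = cusp (W2 g).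
Proof.
apply/eqP; rewrite -subr_eq0; apply/eqP; move: g.
have d1 : der cusp (fun g => (2%:R * 'X) * (cusp g)^`()).
  by split=> x y; rewrite ?rmorphD ?rmorphM /= ?derivD ?derivM; ring.
have d2 : der cusp (fun g => cusp (W2 g)).
  exact: (der_post cusp der_W2).
have := derB d1 d2 => /der_M2_eq0; apply=> [||c].
- rewrite W2_Q rmorphM rmorph_nat /= cusp_Q derivXn /=; ring.
- rewrite W2_R rmorphM rmorph_nat /= cusp_R derivXn /=; ring.
- by rewrite W2_c rmorph0 cusp_c derivC; ring.
Qed.

(** On the cubic the Euler field is 2 t d/dt, so an isobaric form becomes a single monomial in t and
    its value at t = 1 is its only coefficient. *)
Lemma cusp_eq0 k g : isob2 k g -> (cusp g).[1] = 0 -> cusp g = 0.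
Proof.
move=> Hg g1; have E := cusp_euler g; move: E; rewrite Hg rmorphM /= cusp_c => E.
have cE n : (cusp g)`_n * (2%:R * n%:R - k) = 0.
  have := congr1 (fun p : {poly F} => p`_n) E.
  rewrite coefCM -mulrA mulr_natl coefMn coefXM coef_deriv => H.
  rewrite mulrBr [_ * k]mulrC -H; case: n {H} => [|n] /=; first by ring.
  ring.
case: (pselect (exists n, (cusp g)`_n != 0)) => [[n gn]|h]; last first.
  by apply/polyP => n; rewrite coef0; apply/eqP/negPn/negP => gn; apply: h; exists n.
have kn : k = 2%:R * n%:R.
  have := cE n => /eqP; rewrite mulf_eq0 (negPf gn) /= subr_eq0 => /eqP //.
have oth m : m != n -> (cusp g)`_m = 0.
  move=> mn; have := cE m => /eqP; rewrite mulf_eq0 => /orP[/eqP //|].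
  rewrite kn -mulrBr mulf_eq0 pnatr_eq0 /= subr_eq0 eqr_nat (negPf mn) //.
have nsz : (n < size (cusp g))%N.
  by rewrite ltnNge; apply/negP => /leq_sizeP /(_ n (leqnn n)) /eqP; rewrite (negPf gn).
move: g1; rewrite horner_coef (bigD1 (Ordinal nsz)) //= expr1n mulr1 big1 ?addr0.
  by move=> g0; rewrite g0 eqxx in gn.
by move=> i; rewrite -val_eqE /= => ni; rewrite oth // mul0r.
Qed.

Definition disc : M2 := R2 ^+ 2 - Q2 ^+ 3.

Lemma isob2_disc : isob2 12%:R disc.
Proof.
rewrite /isob2 /disc (der_sub _ _ der_W2) !exprS expr0 !mulr1.
have WM := (der_W2 (F := F)).2.
by rewrite !WM /= W2_Q W2_R !c2E; ring.
Qed.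

Lemma disc_neq0 : disc != 0.
Proof.
apply/eqP => /(congr1 (fun g : M2 => g`_2)).
rewrite /disc /R2 /Q2 coefB coefXn /= -rmorphXn coefC subr0 coef0 => /eqP.
by rewrite oner_eq0.
Qed.

Lemma discE : disc = 'X^2 - ('X^3)%:P.
Proof. by rewrite /disc /R2 /Q2 rmorphXn. Qed.

Lemma size_disc : size disc = 3%N.
Proof.
rewrite discE size_polyDl ?size_polyXn // size_polyN.
by rewrite (leq_ltn_trans (size_polyC_leq1 _)).
Qed.

Lemma isob2_cancel k l d g : @isob2 F l d -> d != 0 -> isob2 k (d * g) -> isob2 (k - l) g.
Proof.
move=> Hd d0; rewrite /isob2 (der_W2 (F := F)).2 /= Hd => E.
apply: (mulfI d0); apply: (addrI (c2 l * d * g)); rewrite E !c2E; ring.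
Qed.

(** Any monomial Q^j R^i that occurs in [g] forces k = 4 j + 6 i. *)
Lemma isob2_wt k g : @isob2 F k g -> g != 0 -> exists m : nat, k = m%:R.
Proof.
move=> Hg /eqP g0.
have [i gi] : exists i, g`_i != 0.
  apply: contrapT => h; apply: g0; apply/polyP => i; rewrite coef0.
  by apply/eqP/negPn/negP => gi; apply: h; exists i.
have [j gij] : exists j, g`_i`_j != 0.
  apply: contrapT => h; move/eqP: gi; apply; apply/polyP => j; rewrite coef0.
  by apply/eqP/negPn/negP => gj; apply: h; exists j.
exists (4 * j + 6 * i)%N.
have := congr1 (fun h : M2 => h`_i`_j) Hg.
rewrite /W2 /Q2 /R2 -!mulrA !mulr_natl coefD !coefMn coefCM coefXM /c2 coefCM.
rewrite /dQ /dR coef_map_id0 ?linear0 // coefD !coefMn coefXM coefCM.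
case: i gi gij => [|i] gi gij /=; case: j gij => [|j] gij /=;
  rewrite ?coef_deriv ?coefMn ?coef0 ?mul0rn ?add0r ?addr0 => E;
  apply: (mulIf gij); rewrite -E; ring.
Qed.

(** A form that vanishes at t = 1 vanishes on the whole cubic. Division by the discriminant, monic
    of degree 2 in R, leaves a remainder r_0 + r_1 R, and the even and odd powers of t in r_0(t^2) +
    r_1(t^2) t^3 separate. *)
Lemma disc_dvd k g : isob2 k g -> (cusp g).[1] = 0 ->
  exists2 h, g = disc * h & isob2 (k - 12%:R) h.
Proof.
move=> Hg /(cusp_eq0 Hg) g0.
have dmon : disc \is monic.
  rewrite monicE discE lead_coefDl ?lead_coefXn ?size_polyXn // size_polyN.
  by rewrite (leq_ltn_trans (size_polyC_leq1 _)).
have gE := Pdiv.RingMonic.rdivp_eq dmon g.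
set h := Pdiv.Ring.rdivp g disc in gE; set r := Pdiv.Ring.rmodp g disc in gE.
have sr : (size r < 3)%N by rewrite -size_disc Pdiv.Ring.ltn_rmodp disc_neq0.
have rE : r = (r`_0)%:P + (r`_1)%:P * R2.
  apply/polyP => i; rewrite coefD coefC coefCM /R2 coefX.
  case: i => [|[|i]] /=; rewrite ?mulr0 ?mulr1 ?addr0 ?add0r //.
  by rewrite nth_default // -ltnS (leq_trans sr).
have cd : cusp disc = 0.
  by rewrite /disc rmorphB !rmorphXn /= cusp_Q cusp_R -!exprM subrr.
have cC (a : {poly F}) : cusp a%:P = a \Po 'X^2.
  rewrite /cusp -lock evxC; elim/poly_ind: a => [|p c IH]; first by rewrite rmorph0 comp_poly0.
  rewrite rmorphD rmorphM /= IH evxX evxC comp_polyD comp_polyM comp_polyX.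
  by rewrite comp_polyC.
have r0 : (r`_0 \Po 'X^2) + (r`_1 \Po 'X^2) * 'X^3 = 0.
  by rewrite -!cC -cusp_R -rmorphM -rmorphD -rE -g0 gE rmorphD rmorphM /= cd mulr0 add0r.
have r0c n : (r`_0 \Po 'X^2)`_n + (if (n < 3)%N then 0 else (r`_1 \Po 'X^2)`_(n - 3)) = 0.
  by rewrite -coefMXn -coefD r0 coef0.
have a0 : r`_0 = 0.
  apply/polyP => i; have := r0c (2 * i)%N; rewrite !coef_comp_poly_Xn // coef0.
  rewrite dvdn_mulr // mulKn //; case: ltnP => [_|i3]; first by rewrite addr0.
  by rewrite (_ : (2 %| 2 * i - 3)%N = false) ?addr0 //; apply/negP; lia.
have b0 : r`_1 = 0.
  apply/polyP => i; have := r0c (2 * i + 3)%N; rewrite !coef_comp_poly_Xn // coef0.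
  rewrite addnK dvdn_mulr // mulKn // ltnNge leq_addl /=.
  by rewrite (_ : (2 %| 2 * i + 3)%N = false) ?add0r //; apply/negP; lia.
exists h; first by rewrite gE rE a0 b0 polyC0 mul0r !addr0 mulrC.
apply: (isob2_cancel isob2_disc disc_neq0).
by rewrite [disc * h]mulrC (_ : h * disc = g) // gE rE a0 b0 polyC0 mul0r !addr0.
Qed.

End Evaluation.

(** * Independence of the q-expansions of P, Q, R *)

Section QExpansion.
Context {F : numFieldType}.
Local Notation M2 := {poly {poly F}}.
Local Notation M := {poly M2}.
Variables p q r : ser F.

Definition th (f : ser F) : ser F := stheta f *+ 12.

Lemma der_th : der id th.
Proof.
split=> f g; rewrite /th; first by rewrite raddfD mulrnDl.
by rewrite sthetaM mulrnDl mulrnAl mulrnAr.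
Qed.

Lemma th_cst c : th (sercst c) = 0.
Proof. by rewrite /th stheta_cst mul0rn. Qed.

Definition ev2 : {rmorphism M2 -> ser F} := locked (evx (evx (@sercst F) q) r).
Definition ev : {rmorphism M -> ser F} := locked (evx ev2 p).

Lemma ev2_Q : ev2 Q2 = q. Proof. by rewrite /ev2 -lock evxC evxX. Qed.
Lemma ev2_R : ev2 R2 = r. Proof. by rewrite /ev2 -lock evxX. Qed.
Lemma ev2_c c : ev2 (c2 c) = sercst c. Proof. by rewrite /ev2 -lock !evxC. Qed.
Lemma ev_C g : ev g%:P = ev2 g. Proof. by rewrite /ev -lock evxC. Qed.
Lemma ev_P : ev mP = p. Proof. by rewrite /ev -lock evxX. Qed.
Lemma ev_Q : ev mQ = q. Proof. by rewrite ev_C ev2_Q. Qed.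
Lemma ev_R : ev mR = r. Proof. by rewrite ev_C ev2_R. Qed.
Lemma ev_c c : ev (mc c) = sercst c. Proof. by rewrite ev_C ev2_c. Qed.

Hypothesis ramP : th p = p ^+ 2 - q.
Hypothesis ramQ : th q = 4%:R * (p * q - r).
Hypothesis ramR : th r = 6%:R * (p * r - q ^+ 2).
Hypotheses (p0 : p 0%N = 1) (q0 : q 0%N = 1) (r0 : r 0%N = 1).
Hypothesis disc0 : r ^+ 2 <> q ^+ 3.

Lemma ev_D f : ev (Dram f) = th (ev f).
Proof.
apply/eqP; rewrite -subr_eq0; apply/eqP; move: f.
have d1 : der ev (fun f => ev (Dram f)) by exact: (der_post ev (der_D (F := F))).
have d2 : der ev (fun f => th (ev f)) by exact: (der_comp ev der_th).
have := derB d1 d2 => /der_M_eq0; apply=> [|||c].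
- by rewrite D_P rmorphB rmorphXn /= ev_P ev_Q ramP subrr.
- by rewrite D_Q rmorphM rmorph_nat rmorphB rmorphM /= ev_P ev_Q ev_R ramQ subrr.
- by rewrite D_R rmorphM rmorph_nat rmorphB rmorphM rmorphXn /= ev_P ev_Q ev_R ramR subrr.
- by rewrite D_c ev_c th_cst subr0; apply: rmorph0.
Qed.

Lemma ev2_serre k g : isob2 k g ->
  th (ev2 g) = ev2 (serre2 g) + sercst k * p * ev2 g.
Proof.
move=> Hg; rewrite -ev_C -ev_D D_C rmorphD rmorphM /= ev_P !ev_C Hg rmorphM /= ev2_c.
by rewrite mulrCA mulrA.
Qed.

Lemma ev2_coef0 g : ev2 g 0%N = (cusp g).[1].
Proof.
have cst (h : {poly F}) : ev2 h%:P 0%N = (cusp h%:P).[1].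
  elim/poly_ind: h => [|h c IH]; first by rewrite polyC0 !rmorph0 horner0.
  rewrite polyCD polyCM !rmorphD !rmorphM serD hornerD serM0 hornerM IH.
  have -> : 'X%:P = Q2 by []. have -> : c%:P%:P = c2 c :> M2 by [].
  by rewrite ev2_Q cusp_Q ev2_c cusp_c hornerXn hornerC expr1n q0.
elim/poly_ind: g => [|g c IH]; first by rewrite !rmorph0 horner0.
rewrite !rmorphD !rmorphM serD hornerD serM0 hornerM IH cst.
have -> : 'X = R2 :> M2 by [].
by rewrite ev2_R cusp_R hornerXn expr1n r0.
Qed.

Lemma ev2_disc : ev2 disc <> 0.
Proof.
rewrite /disc rmorphB !rmorphXn /= ev2_R ev2_Q => /eqP; rewrite subr_eq0 => /eqP.
exact: disc0.
Qed.

(** The constant term is the value at the cusp, so a form with zero expansion is divisible by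
    [disc]. As [ev2 disc] is nonzero in a domain, the quotient has zero expansion too, and its
    degree in R is smaller. *)
Lemma ev2_inj k g : isob2 k g -> ev2 g = 0 -> g = 0.
Proof.
move: {-1}(size g) (leqnn (size g)) => n; elim: n k g => [|n IH] k g sg Hg g0.
  by apply/eqP; rewrite -size_poly_leq0.
have := congr1 (fun f : ser F => f 0%N) g0; rewrite ev2_coef0 => /(disc_dvd Hg) [h gE Hh].
have h0 : h = 0.
  case: (eqVneq h 0) => [//|hn0]; apply: (IH _ _ _ Hh); last first.
    by move: g0; rewrite gE rmorphM /= => /ser_mulf_eq0 [/ev2_disc|].
  move: sg; rewrite gE size_mul ?disc_neq0 //.
  rewrite size_disc.
  by rewrite !addSn /= ltnS => /(leq_trans (leqnSn _)).
by rewrite gE h0 mulr0.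
Qed.

(* Descent on the weight [m] of the denominator of a presentation [P = A / B]. *)
Lemma P_not_modular k B A : isob2 k B -> isob2 (k + 2%:R) A ->
  ev2 A = p * ev2 B -> B = 0.
Proof.
move=> HB HA AB; apply/eqP; case: (eqVneq B 0) => // Bn0.
have [m km] := isob2_wt HB Bn0; rewrite {}km in HB HA.
exfalso; elim/ltn_ind: m B A HB HA AB Bn0 => m IH B A HB HA AB Bn0.
have evB0 : ev2 B <> 0 by move/(ev2_inj HB)/eqP; apply/negP.
pose e1 (g : M2) := (cusp g).[1].
have e1A : e1 A = e1 B by rewrite /e1 -!ev2_coef0 AB serM0 p0 mul1r.
(* A denominator with zero constant term forces the same on its numerator, and both can be divided
   by [disc]; a weight below [m + 12] then falls below [m], which the induction hypothesis
   excludes. *)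
have div12 (B' A' : M2) (l : nat) : isob2 l%:R B' -> isob2 (l%:R + 2%:R) A' ->
    ev2 A' = p * ev2 B' -> (l < m + 12)%N -> e1 B' = 0 -> B' = 0.
  move=> HB' HA' AB' lm b0.
  have a0 : e1 A' = 0 by rewrite /e1 -ev2_coef0 AB' serM0 p0 mul1r ev2_coef0.
  have [B1 BE HB1] := disc_dvd HB' b0; have [A1 AE HA1] := disc_dvd HA' a0.
  case: (eqVneq B1 0) => [->|B10] in BE *; first by rewrite BE mulr0.
  exfalso; have [j jE] := isob2_wt HB1 B10.
  apply: (IH j _ B1 A1) => //.
  - have : l%:R = (j + 12)%:R :> F by rewrite natrD -jE subrK.
    by move/eqP; rewrite eqr_nat => /eqP le; move: lm; rewrite le ltn_add2r.
  - by rewrite -jE.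
  - by rewrite -jE addrAC.
  - apply: (ser_mulIf ev2_disc); rewrite -rmorphM /= -AE AB' BE rmorphM /=; ring.
have lt12 : (m < m + 12)%N by rewrite -{1}[m]addn0 ltn_add2l.
have b1 : e1 B != 0 by apply/eqP => /(div12 _ _ _ HB HA AB lt12)/eqP; apply/negP.
have HsA := isob2_serre HA; have HsB := isob2_serre HB.
(* Differentiating A = P B and substituting th P = P^2 - Q gives a relation from which P can be
   eliminated; it involves Q and R alone, so it holds between the polynomials themselves. *)
have star : B * serre2 A - A * serre2 B + A ^+ 2 + Q2 * B ^+ 2 = 0.
  apply: (@ev2_inj (m%:R + m%:R + 4%:R)).
    apply: isob2D; last first.
      have -> : m%:R + m%:R + 4%:R = 4%:R + (m%:R + m%:R) :> F by ring.
      by apply: isob2M; [apply: isob2_Q|apply: isob2M].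
    apply: isob2D; last first.
      have -> : m%:R + m%:R + 4%:R = (m%:R + 2%:R) + (m%:R + 2%:R) :> F by ring.
      exact: isob2M.
    apply: isob2B.
      have -> : m%:R + m%:R + 4%:R = m%:R + (m%:R + 2%:R + 2%:R) :> F by ring.
      exact: isob2M.
    have -> : m%:R + m%:R + 4%:R = (m%:R + 2%:R) + (m%:R + 2%:R) :> F by ring.
    exact: isob2M.
  have := ev2_serre HA; have := ev2_serre HB.
  move: (serre2 A) (serre2 B) => S1 S2 thB thA.
  move: thA; rewrite AB (der_th).2 /= ramP thB => thA.
  rewrite !(rmorphD, rmorphN, rmorphM, rmorphXn) /= ev2_Q AB.
  have sA : ev2 S1 = (p ^+ 2 - q) * ev2 B + p * (ev2 S2
      + sercst m%:R * p * ev2 B) - sercst (m%:R + 2%:R) * p * (p * ev2 B).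
    by rewrite thA addrK.
  rewrite sA rmorphD !rmorph_nat /=; ring.
(* Read as A C = B E, the relation presents P a second time, as E / C, with a denominator of weight
   [m + 2]. *)
pose C := A - serre2 B; pose E := - (serre2 A + Q2 * B).
have HC : isob2 (m%:R + 2%:R) C by apply: isob2B.
have HE : isob2 (m%:R + 2%:R + 2%:R) E.
  apply/isob2N/isob2D => //.
  have -> : m%:R + 2%:R + 2%:R = 4%:R + m%:R :> F by ring.
  by apply: isob2M => //; apply: isob2_Q.
have CE : A * C = B * E.
  apply/eqP; rewrite -subr_eq0 -[X in _ == X]star /C /E; apply/eqP; ring.
have EC : ev2 E = p * ev2 C.
  apply: (ser_mulIf evB0); rewrite -rmorphM /= -CE rmorphM /= AB; ring.
(* At Q = R = 1 the Serre derivation is minus the Euler field. *)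
have e1s : e1 (serre2 B) = - (m%:R * e1 B).
  have -> : m%:R * e1 B = e1 (W2 B).
    by rewrite /e1 HB rmorphM /= cusp_c hornerM hornerC.
  have k1 (a b X Y : M2) : cusp (- (a * R2) * X - (b * Q2 ^+ 2) * Y) =
      - (cusp a * 'X^3) * cusp X - (cusp b * 'X^4) * cusp Y.
    by rewrite rmorphB rmorphM rmorphN !rmorphM /= cusp_Q cusp_R -!exprD.
  have k2 (a b X Y : M2) : cusp (a * Q2 * X + b * R2 * Y) =
      (cusp a * 'X^2) * cusp X + (cusp b * 'X^3) * cusp Y.
    by rewrite rmorphD !rmorphM /= cusp_Q cusp_R.
  rewrite /e1 /serre2 /W2 k1 k2 !rmorph_nat; move: (cusp (dQ B)) (cusp (dR B)) => X Y.
  rewrite -(polyC_natr _ 4) -(polyC_natr _ 6) !(hornerXn, hornerC, hornerD, hornerN, hornerM) ?expr1n; ring.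
(* If C = 0 then A is the Serre derivative of B, and comparing constant terms gives 1 = - m. *)
case: (eqVneq C 0) => C0.
  move/eqP: C0; rewrite subr_eq0 => /eqP AsB.
  move: e1A; rewrite {1}AsB e1s => /eqP; rewrite -subr_eq0 => /eqP h.
  have : (m.+1)%:R * e1 B = 0 by rewrite -natr1 -[RHS]oppr0 -h; ring.
  by move/eqP; rewrite mulf_eq0 pnatr_eq0 (negPf b1).
clearbody C E.
(* The combination of both presentations whose denominator has constant term 0. Its weight [m + 6]
   is in the range of [div12], so it vanishes. *)
pose B2 := c2 (e1 B) * (Q2 * C) - c2 (e1 C) * (R2 * B).
pose A2 := c2 (e1 B) * (Q2 * E) - c2 (e1 C) * (R2 * A).
have HB2 : isob2 (m + 6)%:R B2.
  apply: isob2B.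
    have -> : (m + 6)%:R = 0 + (4%:R + (m%:R + 2%:R)) :> F by ring.
    by apply: isob2M; [apply: isob2_c|apply: isob2M => //; apply: isob2_Q].
  have -> : (m + 6)%:R = 0 + (6%:R + m%:R) :> F by ring.
  by apply: isob2M; [apply: isob2_c|apply: isob2M => //; apply: isob2_R].
have HA2 : isob2 ((m + 6)%:R + 2%:R) A2.
  apply: isob2B.
    have -> : (m + 6)%:R + 2%:R = 0 + (4%:R + (m%:R + 2%:R + 2%:R)) :> F by ring.
    by apply: isob2M; [apply: isob2_c|apply: isob2M => //; apply: isob2_Q].
  have -> : (m + 6)%:R + 2%:R = 0 + (6%:R + (m%:R + 2%:R)) :> F by ring.
  by apply: isob2M; [apply: isob2_c|apply: isob2M => //; apply: isob2_R].
have AB2 : ev2 A2 = p * ev2 B2.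
  by rewrite /A2 /B2 !(rmorphB, rmorphM) /= EC AB; ring.
have B20 : B2 = 0.
  apply: (div12 B2 A2 (m + 6)%N) => //; first by rewrite ltn_add2l.
  rewrite /e1 /B2 !(rmorphB, rmorphM) /= cusp_Q cusp_R !cusp_c.
  by rewrite !(hornerXn, hornerC, hornerD, hornerN, hornerM) ?expr1n /e1; ring.
have A20 : A2 = 0 by apply: (ev2_inj HA2); rewrite AB2 B20 rmorph0 mulr0.
have c1 : e1 C != 0.
  apply/eqP => c10; move/eqP: B20; rewrite /B2 c10 c20 mul0r subr0.
  rewrite !mulf_eq0 (negPf C0) orbF => /orP[|/eqP /(congr1 (@ev2))].
    by rewrite /c2 !polyC_eq0 (negPf b1).
  by rewrite ev2_Q rmorph0 => /(congr1 (fun f : ser F => f 0%N))/eqP; rewrite q0 oner_eq0.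
(* Since Q and R are coprime, the relation e1(B) Q C = e1(C) R B makes Q divide B, and likewise A;
   dividing by Q lowers the weight by 4. *)
have divQ (X Y : M2) : c2 (e1 B) * (Q2 * Y) = c2 (e1 C) * (R2 * X) ->
    exists X1, X = Q2 * X1.
  move=> XY; have Y0 : Y`_0 = 0.
    have := congr1 (fun g : M2 => g`_0) XY.
    rewrite /c2 /Q2 /R2 !coefCM coefXM /= mulr0 => /eqP.
    by rewrite !mulf_eq0 polyC_eq0 (negPf b1) polyX_eq0 /= => /eqP.
  exists (c2 (e1 B / e1 C) * \poly_(i < size Y) Y`_i.+1).
  apply/polyP => i; have := congr1 (fun g : M2 => g`_i.+1) XY.
  rewrite /c2 /Q2 /R2 !coefCM coefXM /= coef_poly.
  case: ltnP => [_ h|iY].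
    rewrite mulrCA rmorphM /= [X in _ = X](_ : _ = ((e1 C)^-1)%:P * ((e1 B)%:P * ('X * Y`_i.+1))); last by ring.
    by rewrite h mulrA -polyCM mulVf // mul1r.
  rewrite (nth_default _ (leq_trans iY (leqnSn _))) !mulr0 => /esym/eqP.
  by rewrite mulf_eq0 polyC_eq0 (negPf c1) => /eqP.
have [B1 BE] := divQ B C (subr0_eq B20); have [A1 AE] := divQ A E (subr0_eq A20).
have Q20 : Q2 != 0 :> M2 by rewrite /Q2 polyC_eq0 polyX_eq0.
have HB1 : isob2 (m%:R - 4%:R) B1.
  by apply: (isob2_cancel (@isob2_Q F) Q20); rewrite -BE.
have HA1 : isob2 (m%:R + 2%:R - 4%:R) A1.
  by apply: (isob2_cancel (@isob2_Q F) Q20); rewrite -AE.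
have B10 : B1 != 0 by apply: contraNneq Bn0 => B10; rewrite BE B10 mulr0.
have [j jE] := isob2_wt HB1 B10.
apply: (IH j _ B1 A1) => //.
- have : m%:R = (j + 4)%:R :> F by rewrite natrD -jE subrK.
  by move/eqP; rewrite eqr_nat => /eqP ->; rewrite -{1}[j]addn0 ltn_add2l.
- by rewrite -jE.
- by rewrite -jE addrAC.
- have qn0 : q <> 0.
    by move=> /(congr1 (fun f : ser F => f 0%N))/eqP; rewrite q0 oner_eq0.
  by apply: (ser_mulIf qn0); rewrite -{1}ev2_Q -rmorphM /= -AE AB BE rmorphM /= ev2_Q; ring.
Qed.

Lemma dP_CM (g : M2) (f : M) : dP (g%:P * f) = g%:P * dP f.
Proof. by rewrite (der_dP (F := F)).2 /= dP_C mul0r add0r. Qed.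

Lemma th_no_log (u v : ser F) c : u <> 0 ->
  u * th v - v * th u = sercst c * (u * u) -> c = 0.
Proof.
move=> u0; rewrite /th !mulrnAr -mulrnBl => E.
have : u * stheta v - v * stheta u = sercst (c / 12%:R) * (u * u).
  apply: ser_ext => n; have := congr1 (fun f : ser F => f n) E.
  rewrite serMn !sercstM -[_ *+ 12]mulr_natr => H.
  have n12 : (12%:R : F) != 0 by rewrite pnatr_eq0.
  by apply: (mulIf n12); rewrite H; field.
move/(ser_no_log u0)/eqP; rewrite mulf_eq0 invr_eq0 pnatr_eq0 orbF.
by move/eqP.
Qed.

(* Among the isobaric relations take one of minimal degree [n] in [P]; pseudo-division
   of [D f] by [f] and [th_no_log] force [n = 1].                              *)
Lemma ev_inj k f : isob k f -> ev f = 0 -> f = 0.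
Proof.
move: {-1}(size f) (leqnn (size f)) => n; elim: n k f => [|n IH] k f sf Hf f0.
  by apply/eqP; rewrite -size_poly_leq0.
have [sfn|nsf] := leqP (size f) n; first exact: (IH k).
have {}sf : size f = n.+1 by apply/eqP; rewrite eqn_leq sf.
have Cf i := isob2_coef i Hf.
case: n => [|n] in IH nsf sf *.
  have fE : f = (f`_0)%:P by rewrite -size1_polyC ?sf.
  move: f0; rewrite fE ev_C => /ev2_inj h; have := Cf 0%N; rewrite mulr0 subr0 => /h ->.
  by rewrite polyC0.
pose a := f`_n.+1; pose b := f`_n.
have a0 : a != 0.
  by rewrite /a -[n.+1]/(n.+2.-1) -sf -lead_coefE lead_coef_eq0 -size_poly_eq0 sf.
pose g := Dram f; have Hg : isob (k + 2%:R) g by apply: isob_Dram.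
have Cg i := isob2_coef i Hg.
have sg i : (n.+2 < i)%N -> g`_i = 0.
  move=> ni; have fi j : (n.+1 < j)%N -> f`_j = 0 by move=> nj; rewrite nth_default // sf.
  rewrite /g /Dram /mP /mQ !coefD (coef_map_id0 _ _ (der0 der_serre2)).
  rewrite coefXM mulrBl coefB coefXnM coefCM /dP !coef_deriv.
  case: i ni => [|[|i]] // ni; rewrite /= (coef_map_id0 _ _ (der0 der_W2)).
  rewrite subn2 /= !fi //; try by move: ni; lia.
  by rewrite (der0 der_serre2) (der0 der_W2) !mul0rn mulr0 subr0 !addr0.
have gtop : g`_n.+2 = c2 (k - n.+1%:R) * a.
  have fi j : (n.+1 < j)%N -> f`_j = 0 by move=> nj; rewrite nth_default // sf.
  rewrite /g /Dram /mP /mQ !coefD (coef_map_id0 _ _ (der0 der_serre2)) fi //.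
  rewrite (der0 der_serre2) add0r coefXM /= (coef_map_id0 _ _ (der0 der_W2)).
  rewrite mulrBl coefB coefXnM coefCM /dP !coef_deriv subn2 /= (fi n.+3) // mul0rn mulr0 subr0.
  by rewrite -/a (Cf n.+1) -/a -[a *+ _]mulr_natl !c2E; ring.
(* [L] is the pseudo-quotient of [g] by [f], of degree at most 1 since [Dram] raises the P-degree by
   at most one. The remainder [e] is isobaric, has smaller P-degree than [f] and zero expansion, so
   it is 0 by minimality. *)
pose l1 := a * g`_n.+2; pose l0 := a * g`_n.+1 - b * g`_n.+2.
pose L : M := l1%:P * mP + l0%:P; pose e : M := (a ^+ 2)%:P * g - L * f.
have Ha : isob2 (k - 2%:R * n.+1%:R) a by apply: Cf.
have Hb : isob2 (k - 2%:R * n%:R) b by apply: Cf.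
have He : isob ((k - 2%:R * n.+1%:R) + (k - 2%:R * n.+1%:R) + (k + 2%:R)) e.
  apply: isobB; first by apply: isobM => //; apply: isob_C; rewrite expr2; apply: isob2M.
  have -> : (k - 2%:R * n.+1%:R) + (k - 2%:R * n.+1%:R) + (k + 2%:R) =
     ((k - 2%:R * n.+1%:R) + (k + 2%:R - 2%:R * n.+2%:R) + 2%:R) + k by ring.
  apply: isobM => //; apply: isobD.
    by apply: isobM; [apply/isob_C/isob2M => //; apply: Cg|apply: isob_P].
  apply/isob_C/isob2B.
    have -> : (k - 2%:R * n.+1%:R) + (k + 2%:R - 2%:R * n.+2%:R) + 2%:R =
       (k - 2%:R * n.+1%:R) + (k + 2%:R - 2%:R * n.+1%:R) by ring.
    by apply: isob2M => //; apply: Cg.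
  have -> : (k - 2%:R * n.+1%:R) + (k + 2%:R - 2%:R * n.+2%:R) + 2%:R =
       (k - 2%:R * n%:R) + (k + 2%:R - 2%:R * n.+2%:R) by ring.
  by apply: isob2M => //; apply: Cg.
have se : (size e <= n.+1)%N.
  apply/leq_sizeP => i ni; rewrite /e /L mulrDl coefB coefD -mulrA !coefCM /mP coefXM.
  have fi j : (n.+1 < j)%N -> f`_j = 0 by move=> nj; rewrite nth_default // sf.
  have [|] := ltnP n.+2 i.
    move=> ni2; rewrite sg // (fi i); last exact: ltnW.
    by case: i {ni} ni2 => // i ni2; rewrite /= fi // !mulr0 addr0 subr0.
  rewrite leq_eqVlt => /orP[/eqP ->|] /=.
    by rewrite (fi n.+2) // -/a /l1; ring.
  rewrite ltnS leq_eqVlt => /orP[/eqP ->|] /=.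
    by rewrite -/a -/b /l1 /l0; ring.
  by rewrite ltnNge ni.
have e0 : e = 0.
  apply: (IH _ _ se He).
  by rewrite /e rmorphB !rmorphM /= ev_D f0 (der0 der_th) !mulr0 subr0.
have rel0 : (a ^+ 2)%:P * g = L * f by apply/eqP; rewrite -subr_eq0 -/e e0.
have [dD dM] := der_dP (F := F).
have dL : dP L = l1%:P by rewrite /L dD dM /= !dP_C dP_P; ring.
(* The relation is differentiated twice in P; moving [dP] past [Dram] brings in the weights [k] and
   [k - 2]. After evaluation the terms containing [f] itself disappear. *)
have rel1 : (a ^+ 2)%:P * (Dram (dP f) + mc k * f) = l1%:P * f + L * dP f.
  have := congr1 dP rel0; rewrite dP_CM [dP (L * f)]dM dL => <-.
  by rewrite -Hf -comm_dP_D.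
have rel2 : (a ^+ 2)%:P * (Dram (dP (dP f)) + mc (k - 2%:R) * dP f + mc k * dP f) =
    l1%:P * dP f + (l1%:P * dP f + L * dP (dP f)).
  have := congr1 dP rel1; rewrite dP_CM [dP (l1%:P * f + _)]dD dP_CM.
  rewrite [dP (L * _)]dM dL => <-; rewrite [dP (Dram _ + _)]dD [dP (mc k * _)]dP_CM.
  by rewrite comm_dP_D (isob_dP Hf).
have l1E : l1%:P = (a ^+ 2)%:P * mc (k - n.+1%:R).
  by rewrite /l1 gtop /mc -polyCM; congr polyC; ring.
have sd : (size (dP f) <= n.+1)%N by apply/leq_sizeP => i ni; rewrite /dP coef_deriv nth_default ?mul0rn // sf.
have d0 : dP f != 0.
  apply/eqP => /(congr1 (fun h : M => h`_n)); rewrite coef_deriv -/a coef0 => /eqP.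
  by rewrite -mulr_natr mulf_eq0 (negPf a0) -(c2_nat n.+1) /c2 !polyC_eq0 pnatr_eq0.
pose u := ev (dP f); pose v := ev (dP (dP f)); pose al := ev2 a.
have u0 : u <> 0.
  by move=> u0; move/eqP: d0; apply; apply: (IH _ _ sd (isob_dP Hf) u0).
have al0 : al <> 0 by move/(ev2_inj Ha)/eqP; apply/negP.
have r1 : al ^+ 2 * th u = ev L * u.
  have E (x y z w t s l : M) : x * (y + z * w) = t * w + l * s -> ev w = 0 ->
      ev x * ev y = ev l * ev s.
    move=> /(congr1 ev); rewrite !(rmorphM, rmorphD) /= => + w0.
    by rewrite w0 !mulr0 addr0 add0r.
  by have := E _ _ _ _ _ _ _ rel1 f0; rewrite ev_D ev_C -/u expr2 rmorphM -expr2.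
have r2 : al ^+ 2 * (th v + sercst (k - 2%:R) * u + sercst k * u) =
    al ^+ 2 * sercst (k - n.+1%:R) * u *+ 2 + ev L * v.
  have E (x y z1 z2 w c s l : M) :
      x * (y + z1 * w + z2 * w) = x * c * w + (x * c * w + l * s) ->
      ev x * (ev y + ev z1 * ev w + ev z2 * ev w) =
      ev x * ev c * ev w *+ 2 + ev l * ev s.
    by move=> /(congr1 ev); rewrite !(rmorphM, rmorphD) /= addrA -mulr2n.
  move: rel2; rewrite l1E => /E; rewrite ev_D !ev_c ev_C -/u -/v.
  by rewrite expr2 rmorphM -expr2.
(* The terms in [ev L] cancel, and the remaining constant is 2 (k - n - 1) - (2 k - 2) = - 2 n. *)
have key : u * th v - v * th u = sercst (- 2%:R * n%:R) * (u * u).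
  have al20 : al ^+ 2 <> 0.
    by rewrite expr2 => /ser_mulf_eq0 [].
  apply: (ser_mulIf al20).
  have -> : al ^+ 2 * (u * th v - v * th u) =
    u * (al ^+ 2 * (th v + sercst (k - 2%:R) * u + sercst k * u))
    - v * (al ^+ 2 * th u) - al ^+ 2 * (sercst (k - 2%:R) + sercst k) * u * u by ring.
  rewrite r1 r2 !rmorphB !rmorphM rmorphN !rmorph_nat /=; ring.
have := th_no_log u0 key => /eqP.
rewrite mulf_eq0 oppr_eq0 !pnatr_eq0 /= => /eqP n0; subst n.
have fE : f = a%:P * mP + b%:P.
  apply/polyP => i; rewrite coefD /mP coefCM coefX coefC.
  case: i => [|[|i]] /=; rewrite ?mulr0 ?mulr1 ?add0r ?addr0 //.
  by rewrite nth_default // sf.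
exfalso; move/eqP: a0; apply; apply: (P_not_modular Ha (A := - b)).
  have -> : k - 2%:R * 1%:R + 2%:R = k - 2%:R * 0%:R by ring.
  exact: isob2N.
move: f0; rewrite fE rmorphD rmorphM /= !ev_C ev_P rmorphN => h.
by apply/eqP; rewrite eq_sym -addr_eq0 mulrC h.
Qed.

(** Against a fixed nonzero f0 the Wronskians f0 D f - f D f0 satisfy a relation with one term
    fewer, so they vanish and D kills f / f0. By [comm_dP_D], the logarithmic P-derivative v / u of
    f / f0 then has the constant D-derivative [k0 - k]; without logarithms this forces equal
    weights, so f must be 0. *)
Lemma isob_indep (s : seq (F * M)) : uniq (map fst s) ->
  (forall x, x \in s -> isob x.1 x.2) -> \sum_(x <- s) ev x.2 = 0 ->
  forall x, x \in s -> x.2 = 0.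
Proof.
move: {-1}(size s) (leqnn (size s)) => n; elim: n s => [|n IH] s.
  by rewrite leqn0 size_eq0 => /eqP ->.
case: s => [|[k0 f0] s] //= ss /andP[k0s us] Hs; rewrite big_cons /= => sum0.
have Hf0 : isob k0 f0 by apply: (Hs (k0, f0)); rewrite inE eqxx.
have Hs' x : x \in s -> isob x.1 x.2 by move=> xs; apply: Hs; rewrite inE xs orbT.
case: (eqVneq f0 0) => [f00|fn0].
  move=> x; rewrite inE => /orP[/eqP -> //|]; apply: IH => //.
  by move: sum0; rewrite f00 rmorph0 add0r.
pose t := [seq (k0 + x.1 + 2%:R, f0 * Dram x.2 - x.2 * Dram f0) | x <- s].
have tP x : x \in t -> x.2 = 0.
  apply: IH.
  - by rewrite size_map.
  - rewrite -map_comp (eq_map (g := fun x => (k0 + 2%:R) + x.1)); last first.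
      by move=> y /=; ring.
    by rewrite map_comp map_inj_uniq // => y z /addrI.
  - move=> y /mapP[z zs ->] /=; apply: isobB.
      have -> : k0 + z.1 + 2%:R = k0 + (z.1 + 2%:R) by ring.
      by apply: isobM => //; apply/isob_Dram/Hs'.
    have -> : k0 + z.1 + 2%:R = z.1 + (k0 + 2%:R) by ring.
    by apply: isobM; [apply: Hs'|apply: isob_Dram].
  rewrite big_map /=.
  have E : \sum_(x <- s) ev x.2 = - ev f0 by apply/eqP; rewrite -addr_eq0 addrC sum0.
  under eq_bigr => z _ do rewrite rmorphB !rmorphM /= !ev_D.
  rewrite big_split /= -mulr_sumr sumrN -mulr_suml E.
  rewrite -(big_morph th (der_th).1 (der0 der_th)) E (derN _ der_th); ring.
have [dD dM] := der_dP (F := F).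
have sz x : x \in s -> x.2 = 0.
  move=> xs; have Hf := Hs' x xs; pose f := x.2; rewrite -/f in Hf *.
  have Phi : f0 * Dram f - f * Dram f0 = 0.
    by apply: (tP (_, _)); apply/mapP; exists x.
  case: (eqVneq f 0) => [//|fn0']; exfalso.
  pose u := f0 * f; pose v := dP f * f0 - dP f0 * f.
  have dPhi : dP f0 * Dram f + f0 * (Dram (dP f) + mc x.1 * f)
      - (dP f * Dram f0 + f * (Dram (dP f0) + mc k0 * f0)) = 0.
    rewrite -Hf -Hf0 -!comm_dP_D -[dP f0 * _ + _]dM -[dP f * _ + _]dM.
    have := der_sub (f0 * Dram f) (f * Dram f0) (der_dP (F := F)).
    by rewrite Phi (der0 (der_dP (F := F))) => <-.
  have [DD DM] := der_D (F := F).
  have main : u * Dram v - v * Dram u = mc (k0 - x.1) * (u * u).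
    have DB a b := der_sub a b (der_D (F := F)).
    rewrite /u /v [Dram (dP f * f0 - _)]DB [Dram (f0 * f)]DM [Dram (dP f * _)]DM
      [Dram (dP f0 * _)]DM mcB /=.
    have z1 : f * Dram f0 - f0 * Dram f = 0 by rewrite -opprB Phi oppr0.
    apply/eqP; rewrite -subr_eq0; apply/eqP.
    transitivity (f0 * f * (dP f0 * Dram f + f0 * (Dram (dP f) + mc x.1 * f)
      - (dP f * Dram f0 + f * (Dram (dP f0) + mc k0 * f0)))
      + (dP f * f0 + dP f0 * f) * (f * Dram f0 - f0 * Dram f)); first by ring.
    by rewrite dPhi z1 !mulr0 addr0.
  have un0 : ev u <> 0.
    rewrite rmorphM /= => /ser_mulf_eq0 [/(ev_inj Hf0)|/(ev_inj Hf)] /eqP.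
      by rewrite (negPf fn0).
    by rewrite (negPf fn0').
  have E : ev u * th (ev v) - ev v * th (ev u) = sercst (k0 - x.1) * (ev u * ev u).
    by rewrite -!ev_D -ev_c -!rmorphM -rmorphB main.
  have /eqP := th_no_log un0 E.
  rewrite subr_eq0 => /eqP kk; move/negP: k0s; apply; apply/mapP; exists x => //.
move=> y; rewrite inE => /orP[/eqP ->|/sz //] /=.
apply: (ev_inj Hf0); move: sum0; rewrite big_seq big1 ?addr0 // => z zs.
by rewrite sz // rmorph0.
Qed.

End QExpansion.

(** * Isobaric differential systems and their exponents *)

Lemma der_mapX (A : comNzRingType) (d : A -> A) : der id d -> map_poly d 'X = 0.
Proof.
move=> dd; apply/polyP => i; rewrite (coef_map_id0 _ _ (der0 dd)) coefX coef0.
by case: eqP => _; rewrite ?(der1 dd) ?(der0 dd).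
Qed.

Lemma der_mapC (A : comNzRingType) (d : A -> A) c : der id d ->
  map_poly d c%:P = (d c)%:P.
Proof.
move=> dd; apply/polyP => i; rewrite (coef_map_id0 _ _ (der0 dd)) !coefC.
by case: eqP => // _; rewrite (der0 dd).
Qed.

Section GradedPoly.
Context {F : numFieldType}.

Record graded (A : comNzRingType) (G : F -> A -> Prop) : Prop := {
  graded0 : forall k, G k 0;
  graded1 : G 0 1;
  gradedN : forall k x, G k x -> G k (- x);
  gradedD : forall k x y, G k x -> G k y -> G k (x + y);
  gradedM : forall k l x y, G k x -> G l y -> G (k + l) (x * y) }.

(** The variable has weight 2, the weight by which the derivation raises. Used twice: the outer
    variable will be a differential operator, the inner one the unknown difference of two
    exponents. *)
Definition gpoly (A : comNzRingType) (G : F -> A -> Prop) (k : F) (g : {poly A}) :=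
  forall i, G (k - 2%:R * i%:R) g`_i.

Section Theory.
Context {A : comNzRingType} {G : F -> A -> Prop} (gG : graded G).

Lemma graded_sum k (I : Type) (r : seq I) (P : pred I) (f : I -> A) :
  (forall i, P i -> G k (f i)) -> G k (\sum_(i <- r | P i) f i).
Proof.
by move=> h; apply: big_ind => //; [apply: (graded0 gG)|apply: (gradedD gG)].
Qed.

Lemma graded_prod (I : Type) (r : seq I) (k : I -> F) (f : I -> A) :
  (forall i, G (k i) (f i)) -> G (\sum_(i <- r) k i) (\prod_(i <- r) f i).
Proof.
move=> h; elim: r => [|i r IH]; first by rewrite !big_nil; apply: (graded1 gG).
by rewrite !big_cons; apply: (gradedM gG).
Qed.

Lemma graded_gpoly : graded (gpoly G).
Proof.
split=> [k i||k x Hx i|k x y Hx Hy i|k l x y Hx Hy i].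
- by rewrite coef0; apply: graded0.
- move=> [|i]; rewrite coef1 /=; last by apply: (graded0 gG).
  by rewrite mulr0 subr0; apply: (graded1 gG).
- by rewrite coefN; apply: gradedN.
- by rewrite coefD; apply: gradedD.
rewrite coefM; apply: graded_sum => j _.
have -> : k + l - 2%:R * i%:R = (k - 2%:R * j%:R) + (l - 2%:R * (i - j)%N%:R).
  by rewrite natrB -1?ltnS //; ring.
exact: gradedM.
Qed.

Lemma gpolyC k c : G k c -> gpoly G k c%:P.
Proof.
move=> Hc [|i]; rewrite coefC /=; last by apply: (graded0 gG).
by rewrite mulr0 subr0.
Qed.

Lemma gpolyX : gpoly G 2%:R 'X.
Proof.
move=> i; rewrite coefX; case: eqP => [->|_]; last by apply: (graded0 gG).
by rewrite mulr1 subrr; apply: (graded1 gG).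
Qed.

Lemma gpoly_map k (d : A -> A) g : d 0 = 0 ->
  (forall l x, G l x -> G (l + 2%:R) (d x)) ->
  gpoly G k g -> gpoly G (k + 2%:R) (map_poly d g).
Proof.
by move=> d0 Gd Hg i; rewrite coef_map_id0 // addrAC; apply: Gd.
Qed.

Lemma graded_det n (B : 'M[A]_n) (u v : 'I_n -> F) :
  (forall i j, G (u i - v j) (B i j)) ->
  G (\sum_i u i - \sum_j v j) (\det B).
Proof.
move=> HB; rewrite /determinant; apply: graded_sum => s _.
rewrite -[_ - _]add0r; apply: (gradedM gG).
  by case: (odd_perm s); rewrite ?expr1 ?expr0; [apply: (gradedN gG)|]; apply: (graded1 gG).
rewrite [X in _ - X](reindex_inj (@perm_inj _ s)) -sumrB /=.
exact: graded_prod.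
Qed.

End Theory.

Lemma graded_isob : graded (isob (F := F)).
Proof.
split; [exact: isob0|exact: isob1|exact: isobN|exact: isobD|exact: isobM].
Qed.

End GradedPoly.

Lemma coef_prod_top (A : comNzRingType) (I : Type) (r : seq I) (f : I -> {poly A})
    (d : I -> nat) : (forall i, (size (f i) <= (d i).+1)%N) ->
  (size (\prod_(i <- r) f i)%R <= (\sum_(i <- r) d i).+1)%N /\
  (\prod_(i <- r) f i)`_(\sum_(i <- r) d i)%N = \prod_(i <- r) (f i)`_(d i).
Proof.
move=> h; elim: r => [|i r [IH1 IH2]]; first by rewrite !big_nil size_poly1 coef1.
rewrite !big_cons; split.
  apply: (leq_trans (size_polyMleq _ _)).
  by have := leq_add (h i) IH1; rewrite addSn addnS; case: (_ + _)%N => // m; rewrite /= ltnS.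
have dlt : (d i < (d i + \sum_(j <- r) d j).+1)%N by rewrite ltnS leq_addr.
rewrite coefM (bigD1 (Ordinal dlt)) //= addKn IH2 [X in _ + X]big1 ?addr0 // => j.
rewrite -val_eqE /= neq_ltn => /orP[jd|dj].
  rewrite [X in _ * X](_ : _ = 0) ?mulr0 // nth_default // (leq_trans IH1) //.
  by move: jd; have := ltn_ord j; lia.
by rewrite nth_default ?mul0r // (leq_trans (h i)).
Qed.

(** Each term of the expansion takes one entry from every row, so its top degree is the sum of the
    row degrees. *)
Lemma coef_det_top (A : comNzRingType) n (B : 'M[{poly A}]_n) (d : 'I_n -> nat) :
  (forall i j, (size (B i j) <= (d i).+1)%N) ->
  (\det B)`_(\sum_i d i)%N = \det (\matrix_(i, j) (B i j)`_(d i)).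
Proof.
move=> h; rewrite /determinant coef_sum; apply: eq_bigr => s _.
have [_ E] := coef_prod_top (index_enum 'I_n) (f := fun i => B i (s i)) (fun i => h i (s i)).
rewrite -[in LHS](rmorph_sign (@polyC A)) coefCM E; congr (_ * _).
by apply: eq_bigr => i _; rewrite mxE.
Qed.

(** A polynomial stands for a differential operator with its coefficients to the left of the powers
    of X, where X is T + b; [twist d] is composition with X on the left. *)
Definition twist (A : comNzRingType) (d : A -> A) (g : {poly A}) := map_poly d g + 'X * g.

Lemma twist_coef (A : comNzRingType) (d : A -> A) (g : {poly A}) j : d 0 = 0 ->
  (twist d g)`_j = d g`_j + (if j is i.+1 then g`_i else 0).
Proof. by move=> d0; rewrite /twist coefD coefXM coef_map_id0 //; case: j. Qed.

Lemma iter_twist_top (A : comNzRingType) (d : A -> A) (g : {poly A}) n k : d 0 = 0 ->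
  (forall j, (n < j)%N -> g`_j = 0) ->
  (forall j, (k + n < j)%N -> (iter k (twist d) g)`_j = 0) /\
  (iter k (twist d) g)`_(k + n) = g`_n.
Proof.
move=> d0 gn; elim: k => [|k [IH1 IH2]]; first by [].
split=> [j kj|]; rewrite [iter _ _ _]/= twist_coef //.
  rewrite IH1 ?d0 ?add0r; last by move: kj; lia.
  by case: j kj => // j kj; apply: IH1; move: kj; lia.
by rewrite addSn IH1 // d0 add0r IH2.
Qed.

(** * Polynomials acting as differential operators *)

Section Act.
Context {F : fieldType} {A : comNzRingType}.
Variables (d : A -> A) (T : ser F -> ser F) (Ev : {rmorphism A -> ser F}).
Hypotheses (der_d : der id d) (der_T : der id T).
Hypothesis Ev_d : forall x, Ev (d x) = T (Ev x).
Variables (x0 : A) (l b : F) (f : ser F).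
Hypotheses (d_x0 : d x0 = 0) (Ev_x0 : Ev x0 = sercst l).

Definition shiftT (c : F) (f : ser F) := T f + sercst c * f.

Let d0 : d 0 = 0. Proof. exact: der0 der_d. Qed.

Definition act (g : {poly A}) := \sum_(j < size g) Ev g`_j * iter j (shiftT b) f.

Lemma actE (g : {poly A}) N : (size g <= N)%N ->
  act g = \sum_(j < N) Ev g`_j * iter j (shiftT b) f.
Proof.
move=> gN; rewrite /act -(subnKC gN) big_split_ord /= [X in _ = _ + X]big1 ?addr0 //.
by move=> i _; rewrite nth_default ?leq_addr // rmorph0 mul0r.
Qed.

Lemma actD (g h : {poly A}) : act (g + h) = act g + act h.
Proof.
set N := maxn (size (g + h)) (maxn (size g) (size h)).
rewrite !(@actE _ N) ?leq_maxl // /N ?leq_max ?leqnn ?orbT //.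
by rewrite -big_split /=; apply: eq_bigr => j _; rewrite coefD rmorphD mulrDl.
Qed.

Lemma act0 : act 0 = 0. Proof. by rewrite /act size_poly0 big_ord0. Qed.

Lemma actC c (g : {poly A}) : act (c%:P * g) = Ev c * act g.
Proof.
rewrite (@actE _ (size g)); last first.
  by apply/leq_sizeP => j gj; rewrite coefCM nth_default // mulr0.
by rewrite mulr_sumr; apply: eq_bigr => j _; rewrite coefCM rmorphM mulrA.
Qed.

Lemma act_twist (g : {poly A}) : act (twist d g) = shiftT b (act g).
Proof.
have [TD TM] := der_T.
rewrite (@actE _ (size g).+1); last first.
  apply/leq_sizeP => j gj; rewrite twist_coef // nth_default ?(ltnW gj) // d0 add0r.
  by case: j gj => // j gj; rewrite nth_default.
transitivity (\sum_(j < size g) Ev (d g`_j) * iter j (shiftT b) f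
    + \sum_(j < size g) Ev g`_j * iter j.+1 (shiftT b) f).
  transitivity (\sum_(j < (size g).+1) (Ev (d g`_j) * iter j (shiftT b) f
      + Ev (if j : nat is i.+1 then g`_i else 0) * iter j (shiftT b) f)).
    by apply: eq_bigr => j _; rewrite twist_coef // rmorphD mulrDl.
  rewrite big_split; congr (_ + _).
    by rewrite big_ord_recr nth_default //= d0 rmorph0 mul0r addr0.
  by rewrite big_ord_recl /= rmorph0 mul0r add0r.
rewrite -[RHS]/(T (act g) + sercst b * act g) /act (big_morph T TD (der0 der_T)) mulr_sumr -!big_split /=.
by apply: eq_bigr => j _; rewrite Ev_d /= [in LHS]/shiftT TM /= -/(shiftT b); ring.
Qed.

Lemma act_iter_twist g k : act g = 0 -> act (iter k (twist d) g) = 0.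
Proof.
move=> g0; elim: k => //= k IH; rewrite act_twist IH /shiftT (der0 der_T) mulr0 addr0 //.
Qed.

(** T + b + l is X + x0, and X commutes with x0 because [d x0 = 0]; powers of the shifted operator
    are therefore ordinary powers of a binomial. *)
Lemma act_shift i : act (('X + x0%:P) ^+ i) = iter i (shiftT (b + l)) f.
Proof.
have dD := der_map der_d; have dX : map_poly d ('X + x0%:P) = 0.
  rewrite (dD).1 (der_mapX der_d) (der_mapC _ der_d).
  by rewrite d_x0 polyC0 addr0.
have dpow n : map_poly d (('X + x0%:P) ^+ n) = 0.
  elim: n => [|n IH]; first by rewrite expr0; apply: der1 dD.
  by rewrite exprS dD.2 /= dX IH mul0r mulr0 addr0.
elim: i => [|i IH].
  by rewrite expr0 /act size_poly1 big_ord1 coef1 rmorph1 mul1r.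
rewrite exprS mulrDl actD actC Ev_x0.
have -> : 'X * ('X + x0%:P) ^+ i = twist d (('X + x0%:P) ^+ i).
  by rewrite /twist dpow add0r.
rewrite act_twist IH /= /shiftT rmorphD /=; ring.
Qed.

Lemma act_shifted r (p : nat -> A) :
  \sum_(i < r.+1) Ev (p i) * iter i (shiftT (b + l)) f = 0 ->
  act (\sum_(i < r.+1) (p i)%:P * ('X + x0%:P) ^+ i) = 0.
Proof.
move=> <-; rewrite (big_morph act actD act0); apply: eq_bigr => i _.
by rewrite actC act_shift.
Qed.

Lemma act_unshifted r (p : nat -> A) :
  \sum_(i < r.+1) Ev (p i) * iter i (shiftT b) f = 0 ->
  act (\poly_(i < r.+1) p i) = 0.
Proof.
move=> <-; rewrite (@actE _ r.+1) ?size_poly //; apply: eq_bigr => i _.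
by rewrite coef_poly ltn_ord.
Qed.

End Act.

(** * Annihilating operators and their resultant *)

Section NoShift.
Context {F : numFieldType} {A : idomainType}.
Variables (G : F -> A -> Prop) (d : A -> A) (E : {rmorphism A -> ser F}) (T : ser F -> ser F).
Hypotheses (gG : graded G) (der_d : der id d) (der_T : der id T).
Hypothesis T_c : forall c, T (sercst c) = 0.
Hypothesis E_d : forall x, E (d x) = T (E x).
Hypothesis G_d : forall k x, G k x -> G (k + 2%:R) (d x).

Definition annihilates (c : F) (r : nat) (p : nat -> A) (f : ser F) :=
  [/\ exists w, forall i, G (w - 2%:R * i%:R) (p i), p r <> 0
    & \sum_(i < r.+1) E (p i) * iter i (shiftT T c) f = 0].

(** Specializes the formal difference of exponents to the scalar [l]. *)
Definition evscal (l : F) : {rmorphism {poly A} -> ser F} := locked (evx E (sercst l)).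

Lemma evscalC l c : evscal l c%:P = E c. Proof. by rewrite /evscal -lock evxC. Qed.
Lemma evscalX l : evscal l 'X = sercst l. Proof. by rewrite /evscal -lock evxX. Qed.

Lemma evscal_d l h : evscal l (map_poly d h) = T (evscal l h).
Proof.
apply/eqP; rewrite -subr_eq0; apply/eqP; move: h.
have := derB (der_post (evscal l) (der_map der_d)) (der_comp (evscal l) der_T).
move=> /der_poly_eq0; apply=> [|c] /=.
  by rewrite (der_mapX der_d) rmorph0 evscalX T_c subrr.
by rewrite (der_mapC _ der_d) !evscalC E_d subrr.
Qed.

Lemma gpoly_twist k (g : {poly {poly A}}) : gpoly (gpoly G) k g ->
  gpoly (gpoly G) (k + 2%:R) (twist (map_poly d) g).
Proof.
have d0 := der0 der_d; have gg := graded_gpoly gG.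
move=> Hg; apply: (gradedD (graded_gpoly gg)).
  apply: gpoly_map => //; first exact: (der0 (der_map der_d)).
  by move=> l x; apply: gpoly_map.
rewrite addrC; apply: (gradedM (graded_gpoly gg)) => //; exact: gpolyX.
Qed.

Section System.
Variables (n : nat) (k : 'I_n -> F) (B : 'M[A]_n) (y : 'I_n -> ser F) (c : F) (j0 : 'I_n).
Hypothesis gB : forall i j, G (k i + 2%:R - k j) (B i j).
Hypothesis k_j0 : k j0 = 0.
Hypothesis ode : forall i, shiftT T c (y i) = \sum_j E (B i j) * y j.

Let a : nat -> 'I_n -> A := fix a m := if m is m'.+1 then
  (fun i => d (a m' i) + \sum_l a m' l * B l i) else (fun i => (i == j0)%:R).

Let a_graded m i : G (2%:R * m%:R - k i) (a m i).
Proof.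
elim: m i => [|m IH] i /=.
  rewrite mulr0; case: eqP => [->|_]; last exact: (graded0 gG).
  by rewrite k_j0 subr0; apply: (graded1 gG).
apply: (gradedD gG).
  have -> : 2%:R * m.+1%:R - k i = (2%:R * m%:R - k i) + 2%:R by ring.
  exact: G_d.
apply: (graded_sum gG) => l _.
have -> : 2%:R * m.+1%:R - k i = (2%:R * m%:R - k l) + (k l + 2%:R - k i) by ring.
exact: (gradedM gG).
Qed.

Let a_iter m : iter m (shiftT T c) (y j0) = \sum_i E (a m i) * y i.
Proof.
have [TD TM] := der_T; elim: m => [|m IH].
  rewrite (bigD1 j0) //= eqxx rmorph1 mul1r big1 ?addr0 // => i ij.
  by rewrite (negPf ij) rmorph0 mul0r.
rewrite [LHS]/= IH /shiftT (big_morph T TD (der0 der_T)) mulr_sumr -big_split /=.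
transitivity (\sum_i (E (d (a m i)) * y i + E (a m i) * shiftT T c (y i))).
  by apply: eq_bigr => i _; rewrite TM E_d /shiftT /=; ring.
transitivity (\sum_i (E (d (a m i)) * y i + \sum_j E (a m i) * (E (B i j) * y j))).
  by apply: eq_bigr => i _; rewrite -mulr_sumr -ode.
rewrite big_split /= exchange_big /= -big_split /=; apply: eq_bigr => i _.
rewrite rmorphD rmorph_sum mulrDl; congr (_ + _); rewrite mulr_suml.
by apply: eq_bigr => l _; rewrite rmorphM mulrA.
Qed.

(** The iterates (T + c)^m y_j0 have the coordinates [a m] in the finite family [y]. Take r maximal
    such that the rows 0, ..., r - 1 have a nonzero minor of size r: all bordered minors vanish, and
    the cofactors of the added column form an operator whose leading coefficient is the chosen
    minor. Minors of an isobaric matrix are isobaric. *)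
Lemma system_annihilator : exists r p, annihilates c r p (y j0).
Proof.
pose P r := exists g : 'I_r -> 'I_n, \det (\matrix_(i < r, j < r) a i (g j)) != 0.
have P0 : P 0%N by exists (fun=> j0); rewrite det_mx00 oner_neq0.
(* With [n.+1] columns chosen among [n] indices, two columns coincide. *)
have Pn : ~ P n.+1.
  move=> [g /eqP]; apply.
  have [i [j [ij gij]]] : exists i j, i != j /\ g i = g j.
    apply: contrapT => h; have /leq_card : injective g.
      by move=> i j gij; apply/eqP/negPn/negP => ij; apply: h; exists i, j.
    by rewrite !card_ord ltnn.
  rewrite -det_tr; apply: (determinant_alternate ij) => l.
  by rewrite !mxE gij.
have [r [[g gr] Pr]] : exists r, P r /\ ~ P r.+1.
  apply: contrapT => h; apply: Pn; elim: n.+1 => // m IH.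
  by apply: contrapT => h'; apply: h; exists m.
pose Bc (e : nat -> A) : 'M[A]_r.+1 := \matrix_(i, j)
  if unlift ord_max j is Some j' then a i (g j') else e i.
pose p (i : nat) : A := cofactor (Bc (fun=> 0)) (inord i) ord_max.
(* The cofactors are extended by 0 because the weight condition in [annihilates] bears on every
   index, even beyond the order. *)
pose q (i : nat) : A := if (i < r.+1)%N then p i else 0.
have col_eq e : col' ord_max (Bc e) = \matrix_(i < r.+1, j < r) a i (g j).
  by apply/matrixP => i j; rewrite !mxE liftK.
have cofE e i : cofactor (Bc e) i ord_max = p i.
  by rewrite /p inord_val /cofactor !col_eq.
have rel x : \sum_(i < r.+1) a i x * p i = 0.
  have := expand_det_col (Bc (fun i => a i x)) ord_max.
  have -> : \det (Bc (fun i => a i x)) = 0.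
    apply/eqP/negPn/negP => D; apply: Pr.
    exists (fun j => if unlift ord_max j is Some j' then g j' else x).
    rewrite (_ : (\matrix_(i, j) _) = Bc (fun i => a i x)) //.
    by apply/matrixP => i j; rewrite !mxE; case: unliftP.
  move=> E0; rewrite [RHS]E0; apply: eq_bigr => i _.
  by rewrite cofE !mxE unlift_none.
exists r, q; split.
- exists (2%:R * \sum_(l < r.+1) (val l)%:R - \sum_(j < r) k (g j)) => i.
  rewrite /q; case: ltnP => ir; last exact: (graded0 gG).
  pose i' := Ordinal ir; have -> : p i = p i' by [].
  rewrite /p inord_val /cofactor -[X in G X _]add0r; apply: (gradedM gG).
    by rewrite -signr_odd; case: odd; rewrite ?expr1 ?expr0;
      [apply: (gradedN gG)|]; apply: (graded1 gG).
  have -> : 2%:R * \sum_(l < r.+1) (val l)%:R - \sum_(j < r) k (g j) - 2%:R * i%:R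
     = \sum_(l < r) 2%:R * (val (lift i' l))%:R - \sum_(j < r) k (g j).
    by rewrite (bigD1_ord i') //= -mulr_sumr; ring.
  by apply: (graded_det gG) => l j; rewrite col_eq !mxE; apply: a_graded.
- rewrite /q ltnSn /p /cofactor col_eq => /eqP.
  rewrite mulf_eq0 signr_eq0 /= => /eqP D; move/eqP: gr; apply; rewrite -[RHS]D.
  congr (\det _); apply/matrixP => i j; rewrite !mxE; congr (a _ _).
  have -> : inord r = ord_max :> 'I_r.+1 by apply: val_inj; rewrite /= inordK.
  by rewrite lift_max.
rewrite (eq_bigr (fun i : 'I_r.+1 => \sum_x (E (a i x * p i) * y x))); last first.
  move=> i _; rewrite /q ltn_ord a_iter mulr_sumr; apply: eq_bigr => x _.
  by rewrite rmorphM; ring.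
rewrite exchange_big big1 // => x _.
by rewrite -mulr_suml -rmorph_sum rel rmorph0 mul0r.
Qed.

End System.

Section Resultant.
Variables (r1 r2 : nat) (p1 p2 : nat -> A) (w1 w2 : F).
Hypothesis Hp1 : forall i, G (w1 - 2%:R * i%:R) (p1 i).
Hypothesis Hp2 : forall i, G (w2 - 2%:R * i%:R) (p2 i).

(** With X = T + b outside and the formal difference x inside, the first operator is written in
    powers of X + x and the second, [P2], in powers of X. *)
Let P1 : {poly {poly A}} :=
  \sum_(i < r1.+1) (p1 i)%:P%:P * ('X + ('X)%:P) ^+ i.
Let P2 : {poly {poly A}} := \poly_(i < r2.+1) (p2 i)%:P.

(** The rows of a Sylvester matrix, X^k P1 for k < r2 and X^k P2 for k < r1, where the products are
    compositions of differential operators. *)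
Let row_ (k : nat) : {poly {poly A}} :=
  if (k < r2)%N then iter k (twist (map_poly d)) P1
  else iter (k - r2) (twist (map_poly d)) P2.

Let rowdeg (k : nat) : nat := if (k < r2)%N then r1 else 0%N.

Let S := \matrix_(k < r2 + r1, j < r2 + r1) (row_ k)`_j.

Let md0 : map_poly d 0 = 0. Proof. exact: (der0 (der_map der_d)). Qed.
Let d0 : d 0 = 0. Proof. exact: der0 der_d. Qed.

Let XxE j i t : (('X + ('X)%:P) ^+ j : {poly {poly A}})`_i`_t =
  if (i + t == j)%N then 'C(j, i)%:R else 0.
Proof.
elim: j i t => [|j IH] i t.
  rewrite expr0 coef1; case: i => [|i]; rewrite ?coef1 ?coef0 //=.
  by case: t.
rewrite exprS mulrDl coefD coefXM coefCM coefD coefXM.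
case: i => [|i]; case: t => [|t] /=; rewrite ?coef0 ?add0r ?addr0 ?IH //.
- by rewrite !add0n eqSS !bin0.
- by rewrite !addn0 eqSS; case: eqP => // ->; rewrite !binn.
rewrite !addnS !addSn eqSS; case: eqP => // _; rewrite ?addr0 //.
by rewrite binS natrD addrC.
Qed.

Let P1coef i t : P1`_i`_t =
  \sum_(j < r1.+1) p1 j * (if (i + t == j)%N then 'C(j, i)%:R else 0).
Proof.
by rewrite /P1 !coef_sum; apply: eq_bigr => j _; rewrite !coefCM XxE.
Qed.

Let P1xdeg j t : (r1 < t)%N -> P1`_j`_t = 0.
Proof.
move=> rt; rewrite P1coef big1 // => i _; case: eqP => [ij|_]; last by rewrite mulr0.
by have := ltn_ord i; move: rt; lia.
Qed.

Let P1deg j : (r1 < j)%N -> P1`_j = 0.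
Proof.
move=> rj; apply/polyP => t; rewrite P1coef coef0 big1 // => i _.
by case: eqP => [ij|_]; rewrite ?mulr0 //; have := ltn_ord i; move: rj; lia.
Qed.

Let P2deg j : (r2 < j)%N -> P2`_j = 0.
Proof. by move=> rj; rewrite coef_poly ltnS leqNgt rj. Qed.

Let P1top j : P1`_j`_r1 = (p1 r1)%:P`_j.
Proof.
rewrite P1coef coefC; case: j => [|j] /=; last first.
  by rewrite big1 // => i _; case: eqP => [ij|_]; rewrite ?mulr0 //; have := ltn_ord i; lia.
rewrite big_ord_recr /= eqxx bin0 mulr1 big1 ?add0r // => i _.
by rewrite gtn_eqF ?mulr0.
Qed.

Let tw_x n (g : {poly {poly A}}) : (forall j t, (n < t)%N -> g`_j`_t = 0) ->
  forall k j t, (n < t)%N -> (iter k (twist (map_poly d)) g)`_j`_t = 0.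
Proof.
move=> Hg; elim=> [|k IH] j t nt; first exact: Hg.
rewrite [iter _ _ _]/= twist_coef // coefD coef_map_id0 // IH // d0 add0r.
by case: j => [|j]; rewrite ?coef0 ?IH.
Qed.

Let tw_top n (g : {poly {poly A}}) (h : {poly A}) : (forall j, g`_j`_n = h`_j) ->
  forall k j, (iter k (twist (map_poly d)) g)`_j`_n = (iter k (twist d) h)`_j.
Proof.
move=> Hg; elim=> [|k IH] j; first exact: Hg.
rewrite ![iter k.+1 _ _]/= !twist_coef // coefD coef_map_id0 // IH.
by case: j => [|j]; rewrite ?coef0 ?IH.
Qed.

Let row_deg k j : (k < r2 + r1)%N -> (r2 + r1 <= j)%N -> (row_ k)`_j = 0.
Proof.
move=> kr rj; rewrite /row_; case: ltnP => kr2.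
  by apply: (iter_twist_top k md0 P1deg).1; move: kr2 rj; lia.
by apply: (iter_twist_top (k - r2) md0 P2deg).1; move: kr kr2 rj; lia.
Qed.

Let S_size (k j : 'I_(r2 + r1)) : (size (S k j) <= (rowdeg k).+1)%N.
Proof.
apply/leq_sizeP => t; rewrite mxE /row_ /rowdeg; case: (ltnP k r2) => _ nt.
  exact: (tw_x P1xdeg).
apply: (@tw_x 0%N) => // i u; rewrite coef_poly; case: ifP => _ u0; last by rewrite coef0.
by rewrite coefC; case: u u0.
Qed.

(** In P1 the power x^r1 leaves no room for X, so only the constant [p1 r1] survives there. The
    matrix of top x-coefficients is triangular, with [p1 r1] in the first r2 diagonal places and
    [p2 r2] in the others. Hence the resultant is a nonzero polynomial in x. *)
Let det_top : (\det S)`_(r2 * r1) = p1 r1 ^+ r2 * p2 r2 ^+ r1.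
Proof.
have -> : (r2 * r1 = \sum_(k < r2 + r1) rowdeg k)%N.
  rewrite big_split_ord /= [X in (_ + X)%N]big1 ?addn0; last first.
    by move=> i _; rewrite /rowdeg /= ltnNge leq_addr.
  rewrite (eq_bigr (fun=> r1)) ?sum_nat_const ?card_ord // => i _.
  by rewrite /rowdeg /= ltn_ord.
rewrite coef_det_top //.
have P2top j : P2`_j`_0 = (\poly_(i < r2.+1) p2 i)`_j.
  by rewrite !coef_poly; case: ifP; rewrite ?coefC ?coef0.
have c0 j : (0 < j)%N -> ((p1 r1)%:P)`_j = 0 by rewrite coefC; case: j.
have p0 j : (r2 < j)%N -> (\poly_(i < r2.+1) p2 i)`_j = 0.
  by move=> rj; rewrite coef_poly ltnS leqNgt rj.
rewrite det_trig.
  rewrite big_split_ord /=; congr (_ * _).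
    rewrite (eq_bigr (fun=> p1 r1)) ?prodr_const ?card_ord // => i _.
    rewrite !mxE /row_ /rowdeg /= ltn_ord (tw_top P1top).
    by have := (iter_twist_top i d0 c0).2; rewrite addn0 coefC.
  rewrite (eq_bigr (fun=> p2 r2)) ?prodr_const ?card_ord // => i _.
  rewrite !mxE /row_ /rowdeg /= ltnNge leq_addr /= addKn (tw_top P2top) addnC.
  by rewrite (iter_twist_top i d0 p0).2 coef_poly ltnSn.
apply/forallP => k; apply/forallP => j; apply/implyP => kj; rewrite !mxE.
rewrite /row_ /rowdeg; case: (ltnP k r2) => kr.
  by rewrite (tw_top P1top) (iter_twist_top k d0 c0).1 ?addn0.
by rewrite (tw_top P2top) (iter_twist_top (k - r2) d0 p0).1 // subnK.
Qed.

Let det_graded : exists w, gpoly G w (\det S).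
Proof.
have gg := graded_gpoly gG; have ggg := graded_gpoly gg.
have Xx : gpoly (gpoly G) 2%:R ('X + ('X)%:P).
  apply: (gradedD ggg); first exact: (gpolyX gg).
  by apply: (gpolyC gg); apply: gpolyX.
have Xxn n : gpoly (gpoly G) (2%:R * n%:R) (('X + ('X)%:P) ^+ n).
  elim: n => [|n IH]; first by rewrite mulr0 expr0; apply: (graded1 ggg).
  have -> : 2%:R * n.+1%:R = 2%:R + 2%:R * n%:R :> F by ring.
  by rewrite exprS; apply: (gradedM ggg).
have gP1 : gpoly (gpoly G) w1 P1.
  apply: (graded_sum ggg) => i _.
  have -> : w1 = (w1 - 2%:R * i%:R) + 2%:R * i%:R by ring.
  by apply: (gradedM ggg) => //; apply: (gpolyC gg); apply: gpolyC.
have gP2 : gpoly (gpoly G) w2 P2.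
  move=> i; rewrite coef_poly; case: ifP => _; last by apply: (graded0 gg).
  exact: gpolyC.
have git k w g : gpoly (gpoly G) w g ->
    gpoly (gpoly G) (w + 2%:R * k%:R) (iter k (twist (map_poly d)) g).
  move=> Hg; elim: k => [|k IH]; first by rewrite mulr0 addr0.
  have -> : w + 2%:R * k.+1%:R = (w + 2%:R * k%:R) + 2%:R by ring.
  exact: gpoly_twist.
pose u (k : 'I_(r2 + r1)) : F :=
  if (k < r2)%N then w1 + 2%:R * k%:R else w2 + 2%:R * (k - r2)%N%:R.
exists (\sum_k u k - \sum_(j < r2 + r1) 2%:R * (val j)%:R).
apply: (graded_det gg) => k j; rewrite mxE /row_ /u.
by case: ltnP => _; apply: git.
Qed.

(** Both operators kill [f], so the specialized Sylvester matrix kills the vector of its iterates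
    and, by the adjugate, its determinant is 0. For nonzero [l] the injectivity assumed in a fixed
    weight would make the formal resultant 0, against [det_top]. *)
Lemma no_shift (l b : F) (f : ser F) :
  (forall w g, gpoly G w g -> l <> 0 -> evscal l g = 0 -> g = 0) ->
  p1 r1 <> 0 -> p2 r2 <> 0 ->
  \sum_(i < r1.+1) E (p1 i) * iter i (shiftT T (b + l)) f = 0 ->
  \sum_(i < r2.+1) E (p2 i) * iter i (shiftT T b) f = 0 ->
  f <> 0 -> l = 0.
Proof.
move=> inj p1n p2n a1 a2 f0; apply: contrapT => l0.
have top0 : p1 r1 ^+ r2 * p2 r2 ^+ r1 != 0.
  by rewrite mulf_neq0 ?expf_neq0 //; apply/eqP.
(* Two operators of order 0 give an empty matrix, with no entry from which to read [f]; there the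
   coefficient [p2 0] kills [f] directly. *)
case: (eqVneq (r2 + r1)%N 0%N) => [r0|rn0].
  move: r0 a2 p2n => /eqP; rewrite addn_eq0 => /andP[/eqP -> _].
  rewrite big_ord1 /= => /ser_mulf_eq0 [|//] E0; apply.
  have : evscal l (p2 0%N)%:P = 0 by rewrite evscalC.
  move/(inj _ _ (gpolyC gG (Hp2 0%N)) l0)/eqP.
  by rewrite polyC_eq0 => /eqP.
have N0 : (0 < r2 + r1)%N by rewrite lt0n.
suff : evscal l (\det S) = 0.
  have [w gw] := det_graded; move/(inj _ _ gw l0) => D0.
  by move/eqP: top0; rewrite -det_top D0 coef0.
have Ev_d := evscal_d l.
have Px0 : map_poly d 'X = 0 := der_mapX der_d.
have rowact k : act T (evscal l) b f (row_ k) = 0.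
  rewrite /row_; case: ifP => _.
    apply: (act_iter_twist (der_map der_d) der_T Ev_d).
    apply: (act_shifted (der_map der_d) der_T Ev_d Px0 (evscalX l) (p := fun i => (p1 i)%:P)).
    by rewrite -[RHS]a1; apply: eq_bigr => i _; rewrite evscalC.
  apply: (act_iter_twist (der_map der_d) der_T Ev_d).
  apply: (act_unshifted (p := fun i => (p2 i)%:P)).
  by rewrite -[RHS]a2; apply: eq_bigr => i _; rewrite evscalC.
pose v := \matrix_(j < r2 + r1, c < 1) iter j (shiftT T b) f.
have Sv : map_mx (evscal l) S *m v = 0.
  apply/matrixP => k c; rewrite !mxE.
  have szr : (size (row_ k) <= r2 + r1)%N by apply/leq_sizeP => j; apply: row_deg.
  rewrite -[RHS](rowact k) (actE _ _ _ _ szr).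
  by apply: eq_bigr => j _; rewrite !mxE.
have : \adj (map_mx (evscal l) S) *m (map_mx (evscal l) S *m v) = 0 by rewrite Sv mulmx0.
rewrite mulmxA mul_adj_mx det_map_mx mul_scalar_mx => /matrixP /(_ (Ordinal N0) ord0).
by rewrite !mxE /= => /ser_mulf_eq0 [|/f0].
Qed.

End Resultant.
End NoShift.

Section ShiftUnique.
Context {F : numFieldType}.
Local Notation M := {poly {poly {poly F}}}.
Variables p q r : ser F.
Hypothesis ramP : th p = p ^+ 2 - q.
Hypothesis ramQ : th q = 4%:R * (p * q - r).
Hypothesis ramR : th r = 6%:R * (p * r - q ^+ 2).
Hypotheses (p0 : p 0%N = 1) (q0 : q 0%N = 1) (r0 : r 0%N = 1).
Hypothesis disc0 : r ^+ 2 <> q ^+ 3.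
Variables (n : nat) (k : 'I_n -> F) (j0 : 'I_n).
Hypothesis k_j0 : k j0 = 0.

(** The injectivity required by [no_shift] holds because putting x = c - e turns the t-th
    coefficient, of weight w - 2 t, into one term of a sum of forms of distinct weights;
    [isob_indep] kills each term, and (c - e)^t is invertible. *)
Lemma shift_unique (A B : 'M[M]_n) (y z : 'I_n -> ser F) (c e : F) :
  (forall i j, isob (k i + 2%:R - k j) (A i j)) ->
  (forall i j, isob (k i + 2%:R - k j) (B i j)) ->
  (forall i, shiftT th c (y i) = \sum_j ev p q r (A i j) * y j) ->
  (forall i, shiftT th e (z i) = \sum_j ev p q r (B i j) * z j) ->
  y j0 = z j0 -> y j0 <> 0 -> c = e.
Proof.
move=> gA gB odeA odeB yz y0.
have gi := graded_isob (F := F).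
have EcD := ev_D ramP ramQ ramR.
have [r1 [p1 [[w1 g1] n1 a1]]] := system_annihilator gi (der_th (F := F))
  EcD (isob_Dram (F := F)) gA k_j0 odeA.
have [r2 [p2 [[w2 g2] n2 a2]]] := system_annihilator gi (der_th (F := F))
  EcD (isob_Dram (F := F)) gB k_j0 odeB.
rewrite -yz in a2.
have inj w (g : {poly M}) : gpoly isob w g -> c - e <> 0 ->
    evscal (ev p q r) (c - e) g = 0 -> g = 0.
  move=> Hg ce g0.
  pose s := [seq (w - 2%:R * (t : nat)%:R, mc ((c - e) ^+ t) * g`_t) | t <- iota 0 (size g)].
  have sP := @isob_indep F p q r ramP ramQ ramR p0 q0 r0 disc0 s.
  apply/polyP => t; rewrite coef0; case: (ltnP t (size g)) => tg; last by rewrite nth_default.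
  have /sP : uniq (map fst s).
    rewrite -map_comp map_inj_uniq ?iota_uniq // => t1 t2 /= /addrI/oppr_inj.
    have n20 : (2%:R : F) != 0 by rewrite pnatr_eq0.
    by move/(mulfI n20)/eqP; rewrite eqr_nat => /eqP.
  move=> /(_ _ _ (w - 2%:R * t%:R, mc ((c - e) ^+ t) * g`_t)) /= H.
  have /eqP : mc ((c - e) ^+ t) * g`_t = 0.
    apply: H.
    - move=> x /mapP[t' _ ->] /=; rewrite -[w - _]add0r; apply: isobM; first exact: isob_c.
      exact: Hg.
    - rewrite big_map /=; rewrite -[RHS]g0 -[g in RHS]coefK poly_def rmorph_sum /=.
      rewrite -[in RHS](big_mkord xpredT (fun t => evscal (ev p q r) (c - e) (g`_t *: 'X^t))).
      rewrite /index_iota subn0; apply: eq_bigr => i _.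
      by rewrite -mul_polyC !rmorphM rmorphXn /= evscalC evscalX ev_c rmorphXn mulrC.
    by apply/mapP; exists t => //; rewrite mem_iota.
  rewrite mulf_eq0 /mc !polyC_eq0 expf_eq0 => /orP[/andP[_ /eqP //]|/eqP //].
apply/eqP; rewrite -subr_eq0; apply/eqP.
apply: (no_shift gi (der_D (F := F)) (der_th (F := F)) (th_cst (F := F)) EcD (isob_Dram (F := F)) g1 g2 inj n1 n2 _ a2 y0).
by rewrite addrC subrK.
Qed.

End ShiftUnique.

(** * Eisenstein series and Ramanujan's identities *)

Section Divisors.

Definition divpairs (N : nat) : seq (nat * nat) :=
  locked [seq u <- [seq (n, x) | n <- iota 0 N.+1, x <- iota 0 N.+1] |
    [&& 0 < u.1, 0 < u.2 & u.1 * u.2 == N]%N].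

Definition quads (N : nat) : seq ((nat * nat) * (nat * nat)) :=
  locked [seq u <- [seq (v, w) | v <- [seq (a, b) | a <- iota 0 N.+1, b <- iota 0 N.+1],
                          w <- [seq (x, y) | x <- iota 0 N.+1, y <- iota 0 N.+1]] |
    [&& 0 < u.1.1, 0 < u.1.2, 0 < u.2.1, 0 < u.2.2 &
        u.1.1 * u.2.1 + u.1.2 * u.2.2 == N]%N].

Lemma mem_divpairs N u :
  (u \in divpairs N) = [&& 0 < u.1, 0 < u.2 & u.1 * u.2 == N]%N.
Proof.
case: u => n x; rewrite /divpairs -lock mem_filter; apply: andb_idr => h; apply/allpairsP.
by exists (n, x); rewrite !mem_iota; move: h => /=; split=> //; nia.
Qed.

Lemma mem_quads N u : (u \in quads N) =
  [&& 0 < u.1.1, 0 < u.1.2, 0 < u.2.1, 0 < u.2.2 &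
        u.1.1 * u.2.1 + u.1.2 * u.2.2 == N]%N.
Proof.
case: u => -[a b] [x y]; rewrite /quads -lock mem_filter; apply: andb_idr => h; apply/allpairsP.
exists ((a, b), (x, y)); split=> //; apply/allpairsP.
  by exists (a, b); rewrite !mem_iota; move: h => /=; split=> //; nia.
by exists (x, y); rewrite !mem_iota; move: h => /=; split=> //; nia.
Qed.

Lemma uniq_divpairs N : uniq (divpairs N).
Proof.
by rewrite /divpairs -lock; apply/filter_uniq/allpairs_uniq; rewrite ?iota_uniq // => -[? ?] [? ?] _ _ [-> ->].
Qed.

Lemma uniq_quads N : uniq (quads N).
Proof.
rewrite /quads -lock; apply/filter_uniq/allpairs_uniq.
- by apply: allpairs_uniq; rewrite ?iota_uniq // => -[? ?] [? ?] _ _ [-> ->].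
- by apply: allpairs_uniq; rewrite ?iota_uniq // => -[? ?] [? ?] _ _ [-> ->].
by move=> [? ?] [? ?] _ _ [-> ->].
Qed.

Section Sums.
Context {A : zmodType}.
Implicit Type f : (nat * nat) * (nat * nat) -> A.

Lemma quads_reindex N (P1 P2 : pred ((nat * nat) * (nat * nat)))
    (h : (nat * nat) * (nat * nat) -> (nat * nat) * (nat * nat)) f :
  (forall u v, u \in quads N -> P2 u -> v \in quads N -> P2 v -> h u = h v -> u = v) ->
  (forall u, u \in quads N -> P2 u -> (h u \in quads N) && P1 (h u)) ->
  (forall u, u \in quads N -> P1 u -> exists v, [/\ v \in quads N, P2 v & h v = u]) ->
  \sum_(u <- quads N | P1 u) f u = \sum_(u <- quads N | P2 u) f (h u).
Proof.
move=> hinj h12 h21; rewrite -big_filter -[RHS]big_filter -(big_map h xpredT f).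
apply: perm_big; apply: uniq_perm.
- exact/filter_uniq/uniq_quads.
- rewrite map_inj_in_uniq; first exact/filter_uniq/uniq_quads.
  move=> u v; rewrite !mem_filter => /andP[Pu uq] /andP[Pv vq].
  exact: hinj.
move=> u; rewrite mem_filter; apply/andP/mapP.
  move=> [Pu /h21] /(_ Pu) [v [vq Pv vu]]; exists v => //.
  by rewrite mem_filter Pv vq.
by move=> [v]; rewrite mem_filter => /andP[Pv vq] ->; case/andP: (h12 v vq Pv).
Qed.

(* Skoruppa's elementary identity: reduce the larger of [x], [y] by the smaller one. *)
Lemma skoruppa N (w : nat -> nat -> A) :
  \sum_(u <- quads N) (w u.1.1 u.1.2 -
     (if (u.1.1 < u.1.2)%N then w u.1.1 (u.1.2 - u.1.1)%N else
      if (u.1.2 < u.1.1)%N then w (u.1.1 - u.1.2)%N u.1.2 else 0)) =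
  \sum_(u <- quads N | u.2.1 == u.2.2) w u.1.1 u.1.2.
Proof.
rewrite sumrB; apply/eqP; rewrite subr_eq; apply/eqP.
rewrite (bigID (fun u => u.2.1 == u.2.2)) /=; congr (_ + _).
rewrite (bigID (fun u => (u.2.2 < u.2.1)%N)) /=.
rewrite [RHS](bigID (fun u => (u.1.1 < u.1.2)%N)) /=; congr (_ + _).
  rewrite (@quads_reindex N _ (fun u => (u.1.1 < u.1.2)%N)
     (fun u => ((u.1.1, u.1.2 - u.1.1), (u.2.1 + u.2.2, u.2.2)))%N).
  - by apply: eq_bigr => u ->.
  - move=> [[a b] [x y]] [[a' b'] [x' y']]; rewrite !mem_quads /=.
    by move=> h1 h2 h3 h4 [ea eb ex ey]; repeat (congr pair); move: h1 h2 h3 h4 ea eb ex ey; lia.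
  - by move=> [[a b] [x y]]; rewrite !mem_quads /=; nia.
  - move=> [[a b] [x y]]; rewrite !mem_quads /= => h1 h2.
    exists ((a, a + b), (x - y, y))%N; rewrite !mem_quads /=; split; [nia|lia|].
    by repeat (congr pair); lia.
rewrite [RHS](bigID (fun u => (u.1.2 < u.1.1)%N)) /= [X in _ = _ + X]big1 ?addr0; last first.
  by move=> u /andP[h1 h2]; rewrite (negPf h1) (negPf h2).
rewrite (@quads_reindex N _ (fun u => (u.1.2 < u.1.1)%N)
     (fun u => ((u.1.1 - u.1.2, u.1.2), (u.2.1, u.2.2 + u.2.1)))%N).
- rewrite [in RHS](eq_bigl (fun u => (u.1.2 < u.1.1)%N)); last first.
    by move=> u; case: ltngtP.
  by apply: eq_bigr => u h; rewrite h ltnNge (ltnW h).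
- move=> [[a b] [x y]] [[a' b'] [x' y']]; rewrite !mem_quads /=.
  by move=> h1 h2 h3 h4 [ea eb ex ey]; repeat (congr pair); move: h1 h2 h3 h4 ea eb ex ey; lia.
- by move=> [[a b] [x y]]; rewrite !mem_quads /=; nia.
move=> [[a b] [x y]]; rewrite !mem_quads /= => h1 h2.
exists ((a + b, b), (x, y - x))%N; rewrite !mem_quads /=; split; [nia|lia|].
by repeat (congr pair); lia.
Qed.

(** On x = y the equation reads (a + b) x = N, so [v] stands for the pair (a + b, x). *)
Lemma quads_diag N f : \sum_(u <- quads N | u.2.1 == u.2.2) f u =
  \sum_(v <- divpairs N) \sum_(a <- iota 1 v.1.-1) f ((a, v.1 - a)%N, (v.2, v.2)).
Proof.
rewrite -big_filter.
transitivity (\sum_(p <- [seq (v, a) | v <- divpairs N, a <- iota 1 v.1.-1])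
    f ((p.2, p.1.1 - p.2)%N, (p.1.2, p.1.2))).
  rewrite -(big_map (fun p => ((p.2, p.1.1 - p.2)%N, (p.1.2, p.1.2))) xpredT f).
  apply: perm_big; apply: uniq_perm; first exact/filter_uniq/uniq_quads.
    rewrite map_inj_in_uniq.
      apply: allpairs_uniq_dep; first exact: uniq_divpairs.
        by move=> v _; apply: iota_uniq.
      by move=> [v a] [v' a'] _ _ [-> ->].
    move=> [[n x] a] [[n' x'] a'] /allpairsPdep [[m z] [b [vd bi [-> -> ->]]]].
    move=> /allpairsPdep [[m' z'] [b' [vd' bi' [-> -> ->]]]] /= [bb E -> _]; subst b.
    congr ((_, _), _); move: bi bi' E; rewrite !mem_iota /=; lia.
  move=> [[a b] [x y]]; rewrite mem_filter mem_quads /=; apply/andP/mapP.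
    move=> [/eqP -> /and5P[a0 b0 x0 y0 /eqP E]]; exists (((a + b)%N, y), a) => /=.
      apply/allpairsPdep; exists ((a + b)%N, y), a; rewrite mem_divpairs mem_iota /=.
      by split=> //; lia.
    by rewrite addKn.
  move=> [[[n z] c]] /allpairsPdep [[n' z'] [d [vd di [-> -> ->]]]] /= [-> -> -> ->].
  move: vd di; rewrite mem_divpairs mem_iota /=.
  by move=> h1 h2; split=> //; nia.
rewrite big_allpairs_dep /=; apply: eq_bigr => v _; by [].
Qed.

Lemma quads_swap N f P : \sum_(u <- quads N | P u) f u =
  \sum_(u <- quads N | P (u.2, u.1)) f (u.2, u.1).
Proof.
apply: quads_reindex => [[v w] [v' w'] _ _ _ _ /= [-> ->] //|[[a b] [x y]]|[[a b] [x y]]].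
  by rewrite !mem_quads /= => + ->; rewrite andbT; nia.
rewrite !mem_quads /= => h P0; exists ((x, y), (a, b)); rewrite mem_quads /=; split=> //.
by move: h; nia.
Qed.

Lemma quads_diag' N f : \sum_(u <- quads N | u.1.1 == u.1.2) f u =
  \sum_(v <- divpairs N) \sum_(c <- iota 1 v.2.-1) f ((v.1, v.1), (c, v.2 - c)%N).
Proof.
rewrite quads_swap quads_diag /=.
rewrite (perm_big [seq (v.2, v.1) | v <- divpairs N]) ?big_map //=.
apply: uniq_perm; first exact: uniq_divpairs.
  by rewrite map_inj_uniq ?uniq_divpairs // => -[? ?] [? ?] [-> ->].
move=> [n x]; apply/idP/mapP => [|[[a b] + [-> ->]]]; last first.
  by rewrite !mem_divpairs /=; lia.
by rewrite mem_divpairs /= => h; exists (x, n) => //; rewrite mem_divpairs /=; lia.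
Qed.

End Sums.

Definition dser (A : zmodType) (f : nat -> nat -> A) : ser A :=
  Ser (fun N => \sum_(v <- divpairs N) f v.1 v.2).

End Divisors.

Section DivisorSeries.
Context {A : comNzRingType}.

Lemma dserM (f g : nat -> nat -> A) N : (dser f * dser g) N =
  \sum_(u <- quads N) f u.1.1 u.2.1 * g u.1.2 u.2.2.
Proof.
rewrite serM.
transitivity (\sum_(p <- [seq (i, w) | i <- iota 0 N.+1,
     w <- [seq (v, v') | v <- divpairs i, v' <- divpairs (N - i)]])
   f p.2.1.1 p.2.1.2 * g p.2.2.1 p.2.2.2).
  rewrite big_allpairs_dep -[iota 0 N.+1]/(index_iota 0 N.+1) big_mkord.
  apply: eq_bigr => i _; rewrite big_allpairs_dep /= mulr_suml.
  by apply: eq_bigr => v _; rewrite mulr_sumr.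
rewrite -(big_map (fun p : nat * ((nat * nat) * (nat * nat)) =>
   ((p.2.1.1, p.2.2.1), (p.2.1.2, p.2.2.2))) xpredT
   (fun u => f u.1.1 u.2.1 * g u.1.2 u.2.2)).
apply: perm_big; apply: uniq_perm; last 1 first.
- move=> [[a b] [x y]]; apply/mapP/idP.
    move=> [p /allpairsPdep [i [w [+ + ->]]]].
    rewrite mem_iota => iN /allpairsPdep [v [v' [+ + ->]]] /= [-> -> -> ->].
    by rewrite !mem_divpairs mem_quads /=; nia.
  rewrite mem_quads => h; exists ((a * x)%N, ((a, x), (b, y))); [|by []].
  apply/allpairsPdep; exists (a * x)%N, ((a, x), (b, y)); rewrite mem_iota; split=> //.
    by move: h => /=; nia.
  apply/allpairsPdep; exists (a, x), (b, y); rewrite !mem_divpairs; move: h => /=.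
  by split=> //; nia.
- rewrite map_inj_in_uniq.
    apply: allpairs_uniq_dep; first exact: iota_uniq.
      move=> i _; apply: allpairs_uniq_dep; first exact: uniq_divpairs.
        by move=> ? _; apply: uniq_divpairs.
      by move=> [? ?] [? ?] _ _ [-> ->].
    by move=> [? ?] [? ?] _ _ [-> ->].
  move=> [i [[a x] [b y]]] [i' [[a' x'] [b' y']]].
  move=> /allpairsPdep [i1 [w [+ + [-> ->]]]].
  rewrite mem_iota => iN /allpairsPdep [v [v' [+ + ->]]].
  move=> + + /allpairsPdep [i1' [w' [+ + [-> ->]]]].
  rewrite mem_iota => + + iN' /allpairsPdep [v1 [v1' [+ + ->]]].
  case: v => ? ?; case: v' => ? ?; case: v1 => ? ?; case: v1' => ? ?.
  rewrite !mem_divpairs /= => h1 h2 h3 h4 [ea eb ex ey]; subst.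
  by congr (_, _); nia.
- exact: uniq_quads.
Qed.

End DivisorSeries.

(** * The identity E8 = E4^2 by divisor sums *)

Section EisensteinE8.
Context {F : numFieldType}.

Definition sig (k : nat) : ser F := dser (fun n _ => n%:R ^+ k).

(** The diagonal side of [skoruppa] for the weight chosen in [sig3_sq]. Inside the proof n - a is
    relaxed to c - a with c free, so that the induction is on the number of terms alone. *)
Lemma sum_pow4 (n : nat) : \sum_(a <- iota 1 n.-1) (a%:R * (n - a)%N%:R * n%:R) ^+ 2 * 30%:R
  = n%:R ^+ 7 - n%:R ^+ 3 :> F.
Proof.
case: n => [|n]; first by rewrite big_nil; ring.
have P m c : \sum_(a <- iota 1 m) (a%:R * (c - a%:R) * c) ^+ 2 * 30%:R =
    c ^+ 2 * (m%:R * m.+1%:R * (2%:R * m%:R + 1) * 5%:R * c ^+ 2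
     - m%:R ^+ 2 * m.+1%:R ^+ 2 * 15%:R * c
     + m%:R * m.+1%:R * (2%:R * m%:R + 1) * (3%:R * m%:R ^+ 2 + 3%:R * m%:R - 1)) :> F.
  elim: m => [|m IH]; first by rewrite big_nil; ring.
  rewrite -[m.+1]addn1 iotaD big_cat IH /= big_seq1 add1n; ring.
rewrite -[n.+1.-1]/n big_seq.
rewrite (eq_bigr (fun a => (a%:R * (n.+1%:R - a%:R) * n.+1%:R) ^+ 2 * 30%:R)); last first.
  by move=> a; rewrite mem_iota => h; rewrite natrB //; move: h; lia.
rewrite -big_seq P; ring.
Qed.

(** For w(a, b) = 30 (a b (a + b))^2 one has w(a, b) - w(a, b - a) = 120 a^3 b^3, so [skoruppa]
    evaluates the square of [sig 3]. *)
Lemma sig3_sq : sig 3 * sig 3 = (sig 7 - sig 3) * sercst (120%:R^-1).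
Proof.
rewrite [RHS]mulrC; apply: ser_ext => N; rewrite sercstM serB dserM.
have n120 : (120%:R : F) != 0 by rewrite pnatr_eq0.
apply: (mulfI n120); rewrite mulVKf //.
have := skoruppa N (fun a b => (a%:R * b%:R * (a + b)%N%:R) ^+ 2 * 30%:R : F).
rewrite quads_diag /=.
rewrite (eq_bigr (fun u => 120%:R * (u.1.1%:R ^+ 3 * u.1.2%:R ^+ 3))); last first.
  move=> [[a b] [x y]] _ /=; case: (ltngtP a b) => [ab|ba|->].
  - by rewrite !natrD !natrB ?(ltnW ab) //; ring.
  - by rewrite !natrD !natrB ?(ltnW ba) //; ring.
  by rewrite subr0 natrD; ring.
rewrite -mulr_sumr => ->; rewrite /sig /= -sumrB; apply: eq_bigr => -[n x] _ /=.
rewrite -sum_pow4 big_seq [RHS]big_seq; apply: eq_bigr => a; rewrite mem_iota => h.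
by rewrite subnKC //; move: h; lia.
Qed.

End EisensteinE8.

(** * Hyperbolic series in z and the logarithmic derivative of theta *)

Section Eisenstein.
Context {F : numFieldType}.
Local Notation B := (ser F).

(** The exponential e^(s z); [EE s] and [OO s] are 2 cosh(s z) and 2 sinh(s z). *)
Definition ez (s : F) : B := Ser (fun j => s ^+ j / j`!%:R).

Lemma factn0 j : (j`!%:R : F) != 0. Proof. by rewrite pnatr_eq0 -lt0n fact_gt0. Qed.

Lemma ezD s t : ez (s + t) = ez s * ez t.
Proof.
apply: ser_ext => n; rewrite serM /= addrC exprDn mulr_suml; apply: eq_bigr => i _.
have iN : (i <= n)%N by rewrite -ltnS.
rewrite -(bin_fact iN) !natrM -mulr_natr.
have := factn0 i; have := factn0 (n - i)%N => h1 h2.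
have h3 : ('C(n, i)%:R : F) != 0 by rewrite pnatr_eq0 -lt0n bin_gt0.
by field; rewrite h1 h2 h3.
Qed.

Lemma ez0 : ez 0 = 1.
Proof. by apply: ser_ext => -[|j]; rewrite /= ?expr0 ?fact0 ?divr1 // expr0n mul0r. Qed.

Lemma stheta_ez s : stheta (ez s) = serX * sercst s * ez s.
Proof.
apply: ser_ext => -[|j]; rewrite stheta_coef -mulrA serXM ?mulr0n // sercstM /=.
rewrite factS natrM exprS -[_ *+ j.+1]mulr_natr.
have := factn0 j => h1; have h2 : (j.+1%:R : F) != 0 by rewrite pnatr_eq0.
by move: (j.+1%:R) h2 => x h2; field; rewrite h1 h2.
Qed.

Definition EE s := ez s + ez (- s).
Definition OO s := ez s - ez (- s).

Lemma EEN s : EE (- s) = EE s. Proof. by rewrite /EE opprK addrC. Qed.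

Lemma OOM s t : OO s * OO t = EE (s + t) - EE (s - t).
Proof. by rewrite /EE /OO !opprD !opprK !ezD; ring. Qed.

Lemma stheta_OO s : stheta (OO s) = serX * sercst s * EE s.
Proof. by rewrite /OO /EE raddfB /= !stheta_ez rmorphN /=; ring. Qed.

Lemma stheta_EE s : stheta (EE s) = serX * sercst s * OO s.
Proof. by rewrite /OO /EE raddfD /= !stheta_ez rmorphN /=; ring. Qed.

Lemma kap_exists : {kap : B | 2%:R * kap * (ez 1 - 1) = serX * (ez 1 + 1)}.
Proof.
pose v : B := Ser (fun j => (j.+1)`!%:R^-1).
have vE : ez 1 - 1 = serX * v.
  rewrite [LHS]ser_eqXM.
    by congr (_ * _); apply: ser_ext => j; rewrite /= expr1n mul1r subr0.
  by rewrite serB /= expr0 fact0 divr1 subrr.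
have v0 : v 0%N = 1 by rewrite /= invr1.
have [u vu _] := ser_inv v0.
exists (sercst (2%:R^-1) * (ez 1 + 1) * u).
rewrite vE; have h2 : 2%:R * sercst (2%:R^-1) = 1 :> B.
  by rewrite -[2%:R](rmorph_nat (@sercst F)) -rmorphM divff ?rmorph1 // pnatr_eq0.
transitivity ((2%:R * sercst (2%:R^-1)) * serX * (ez 1 + 1) * (v * u)); first by ring.
by rewrite h2 vu mul1r mulr1.
Qed.

Definition kap : B := sval kap_exists.
Lemma kapE : 2%:R * kap * (ez 1 - 1) = serX * (ez 1 + 1).
Proof. exact: (svalP kap_exists). Qed.

Lemma ez1_neq1 : ez 1 - 1 <> 0.
Proof.
move/(congr1 (fun f : B => f 1%N)); rewrite serB ser1 /= expr1 (_ : 1`! = 1)%N // divr1 subr0 => /eqP.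
by rewrite oner_eq0.
Qed.

(** The Riccati equation of coth, obtained by differentiating [kapE] and cancelling (e^z - 1)^2. *)
Lemma kap_ode : 4%:R * (kap ^+ 2 + stheta kap - kap) = serX ^+ 2.
Proof.
have K := kapE.
have st1 : stheta (1 : B) = 0 by rewrite -(rmorph1 (@sercst F)) stheta_cst.
have st2 (x : B) : stheta (2%:R * x) = 2%:R * stheta x by rewrite !mulr_natl raddfMn.
have := congr1 stheta K; rewrite (sthetaM (2%:R * kap)) st2 (sthetaM serX) raddfB raddfD /= st1 sthetaX stheta_ez.
rewrite rmorph1 mulr1 subr0 addr0 => DK.
apply: (ser_mulIf ez1_neq1); apply: (ser_mulIf ez1_neq1).
set E := ez 1 in K DK *.
transitivity ((2%:R * kap * (E - 1)) ^+ 2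
   + 2%:R * (2%:R * stheta kap * (E - 1) + 2%:R * kap * (serX * E)) * (E - 1)
   - 2%:R * (serX * E) * (2%:R * kap * (E - 1)) - 2%:R * (2%:R * kap * (E - 1)) * (E - 1)).
  ring.
rewrite DK K; ring.
Qed.

(** Multiplying [kapE] by e^(s z) gives the unit steps, which are symmetrized in s and telescoped
    from 0 to n. *)
Lemma kap_OO n : (0 < n)%N -> 2%:R * kap * OO n%:R =
  serX * (EE n%:R + 2%:R + 2%:R * \sum_(l <- iota 1 n.-1) EE l%:R).
Proof.
have K s : 2%:R * kap * (ez (s + 1) - ez s) = serX * (ez (s + 1) + ez s).
  rewrite ezD; transitivity (ez s * (2%:R * kap * (ez 1 - 1))); first by ring.
  rewrite kapE; ring.
have K1 s : 2%:R * kap * (OO (s + 1) - OO s) = serX * (EE (s + 1) + EE s).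
  have Ka := K s; have Kb := K (- s - 1); rewrite subrK in Kb.
  rewrite /OO /EE [- (s + 1)]opprD.
  transitivity (2%:R * kap * (ez (s + 1) - ez s) + 2%:R * kap * (ez (- s) - ez (- s - 1))); first by ring.
  rewrite Ka Kb; ring.
case: n => // n _; elim: n => [|n IH].
  rewrite big_nil; have := K1 0; rewrite add0r /OO /EE oppr0 subrr subr0 ez0 => ->; ring.
have := K1 n.+1%:R; rewrite natr1 => H.
transitivity (2%:R * kap * OO n.+1%:R + 2%:R * kap * (OO n.+2%:R - OO n.+1%:R)); first by ring.
have -> : iota 1 n.+2.-1 = iota 1 n ++ [:: n.+1] by rewrite -[n.+2.-1]addn1 iotaD add1n.
rewrite H IH big_cat /= big_seq1; ring.
Qed.

(* The expansion of [z Z], where [Z] is the logarithmic derivative of Jacobi's theta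
   function: [kap = (z/2) coth (z/2)]; the outer variable is q, the inner one z.   *)
Definition AA : ser B := dser (fun n _ => OO n%:R).
Definition UU : ser B := sercst kap - sercst serX * AA.
Definition dz (f : ser B) : ser B := Ser (fun N => stheta (f N)).
(** For U = z Z this is z^2 (Z^2 + Z'); as Z is the logarithmic z-derivative of theta, Z^2 + Z' is
    the second derivative of theta divided by theta. *)
Definition VV : ser B := UU ^+ 2 + dz UU - UU.

(** A product of two sinh is a difference of cosh, EE (a + b) - EE (a - b). With w(a, b) = EE a + EE
    b + EE (a + b) the left side of [skoruppa] produces exactly this off the diagonal; on a = b the
    excess is 2 EE a + 2. *)
Lemma AA_sq N : (AA * AA) N = \sum_(v <- divpairs N)
  ((v.1.-1)%:R * EE v.1%:R + 2%:R * \sum_(a <- iota 1 v.1.-1) EE a%:R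
   - (v.2.-1)%:R * (2%:R * EE v.1%:R + 2%:R)).
Proof.
rewrite dserM.
have := skoruppa N (fun a b => EE a%:R + EE b%:R + EE (a + b)%N%:R).
rewrite quads_diag /= => H.
have H2 := quads_diag' N (fun u => 2%:R * EE u.1.1%:R + 2%:R).
rewrite (eq_bigr (fun u => (EE u.1.1%:R + EE u.1.2%:R + EE (u.1.1 + u.1.2)%N%:R
    - (if (u.1.1 < u.1.2)%N then EE u.1.1%:R + EE (u.1.2 - u.1.1)%N%:R + EE (u.1.1 + (u.1.2 - u.1.1))%N%:R
       else if (u.1.2 < u.1.1)%N then EE (u.1.1 - u.1.2)%N%:R + EE u.1.2%:R
              + EE (u.1.1 - u.1.2 + u.1.2)%N%:R else 0))
    - (if u.1.1 == u.1.2 then 2%:R * EE u.1.1%:R + 2%:R else 0))); last first.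
  move=> [[a b] [x y]] _ /=; rewrite OOM natrD; case: (ltngtP a b) => [ab|ba|->].
  - by rewrite natrB ?(ltnW ab) // subnKC ?(ltnW ab) // -(EEN (a%:R - b%:R)) opprB; ring.
  - by rewrite natrB ?(ltnW ba) // subnK ?(ltnW ba) //; ring.
  by rewrite subrr {2}/EE oppr0 ez0; ring.
rewrite sumrB H -big_mkcond H2 /= -sumrB; apply: eq_bigr => -[n x] _ /=; congr (_ - _).
  clear; move: (EE) => EE; case: n => [|n]; first by rewrite /= !big_nil; ring.
  rewrite -[n.+1.-1]/n big_seq (eq_bigr (fun a => EE a%:R + EE (n.+1 - a)%N%:R + EE n.+1%:R)).
    rewrite -big_seq !big_split /= big_const_seq count_predT size_iota iter_addr_0.
    have -> : \sum_(a <- iota 1 n) EE (n.+1 - a)%N%:R = \sum_(a <- iota 1 n) EE a%:R.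
      have -> : iota 1 n = index_iota 1 n.+1 by rewrite /index_iota subn1.
      rewrite [RHS]big_nat_rev /=.
      by apply: eq_bigr => i _; rewrite add1n.
    rewrite -mulr_natl; ring.
  by move=> a; rewrite mem_iota => h; rewrite subnKC //; move: h; lia.
clear; move: (_ + _) => c.
by rewrite big_const_seq count_predT size_iota iter_addr_0 mulr_natl.
Qed.

End Eisenstein.

(** * The heat equation of theta and the recursion it gives *)

Section Heat.
Context {F : numFieldType}.
Local Notation B := (ser F).
Local Notation EE := (@EE F).
Local Notation OO := (@OO F).
Local Notation UU := (@UU F).
Local Notation VV := (@VV F).
Local Notation AA := (@AA F).
Local Notation kap := (@kap F).
Local Notation gX := (@serX F : B).

Lemma divpairs0 : divpairs 0 = [::].
Proof.
case E : (divpairs 0) => [//|u s].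
have : u \in divpairs 0 by rewrite E inE eqxx.
by rewrite mem_divpairs; case: u {E} => a b /=; nia.
Qed.

Lemma AA_coef N : AA N = \sum_(v <- divpairs N) OO v.1%:R. Proof. by []. Qed.
Lemma UU_0 : UU 0%N = kap.
Proof.
by rewrite /UU serB sercstM AA_coef divpairs0 big_nil mulr0 subr0.
Qed.

Lemma UU_S N : (0 < N)%N -> UU N = - (gX * AA N).
Proof. by move=> N0; rewrite /UU serB sercstM /=; case: N N0 => // N _; rewrite sub0r. Qed.

Definition YY N : B := - (\sum_(v <- divpairs N) v.2%:R * (2%:R * EE v.1%:R + 2%:R)).

Lemma VV_coef N : VV N = (UU ^+ 2) N + stheta (UU N) - UU N.
Proof. by []. Qed.

Lemma VV_S N : (0 < N)%N -> VV N = gX ^+ 2 * YY N.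
Proof.
move=> N0; rewrite VV_coef.
have -> : (UU ^+ 2) N = - (gX * (2%:R * kap * AA N)) + gX ^+ 2 * (AA * AA) N.
  have -> : UU ^+ 2 = sercst (kap ^+ 2) - sercst (gX * (2%:R * kap)) * AA
              + sercst (gX ^+ 2) * (AA * AA).
    have cM := rmorphM (@sercst B); have c2 := rmorph_nat (@sercst B) 2.
    rewrite !expr2 !cM c2 /UU.
    have G (C : comNzRingType) (u v w : C) : (u - v * w) * (u - v * w) =
      u * u - v * (2%:R * u) * w + v * v * (w * w) by ring.
    exact: (G (ser B)).
  rewrite serD serB !sercstM -[gX * _ * _]mulrA; congr (_ + _).
  have -> : sercst (kap ^+ 2) N = 0 by case: N N0.
  by rewrite sub0r.
rewrite AA_sq (UU_S N0).
have -> : stheta (- (gX * AA N)) = - (gX * AA N + gX * stheta (AA N)).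
  transitivity (- stheta (gX * AA N)); first exact: raddfN.
  by rewrite sthetaM sthetaX.
have -> : 2%:R * kap * AA N = gX * \sum_(v <- divpairs N)
    (EE v.1%:R + 2%:R + 2%:R * \sum_(l <- iota 1 v.1.-1) EE l%:R).
  rewrite AA_coef mulr_sumr [RHS]mulr_sumr big_seq [RHS]big_seq; apply: eq_bigr => -[n x].
  by rewrite mem_divpairs /= => h; apply: kap_OO; move: h; lia.
have -> : stheta (AA N) = gX * \sum_(v <- divpairs N) v.1%:R * EE v.1%:R.
  rewrite AA_coef raddf_sum mulr_sumr; apply: eq_bigr => v _ /=.
  by rewrite stheta_OO rmorph_nat; ring.
set s1 := (\sum_(v <- _) _); set s2 := (\sum_(v <- _) _); set s3 := (\sum_(v <- _) _).
transitivity (gX ^+ 2 * (s2 - s1 - s3)); first by rewrite /s2; ring.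
congr (_ * _); rewrite /s1 /s2 /s3 /YY -!sumrB -sumrN big_seq [RHS]big_seq.
apply: eq_bigr => -[n x]; rewrite mem_divpairs /= => h.
move: (\sum_(l <- _) _) (EE n%:R) => s e.
case: n h => [|n] //; case: x => [|x] // _.
have G (C : comNzRingType) (t u : C) :
  n%:R * u + 2%:R * t - x%:R * (2%:R * u + 2%:R) - (u + 2%:R + 2%:R * t) - n.+1%:R * u
  = - (x.+1%:R * (2%:R * u + 2%:R)) by ring.
exact: (G B).
Qed.

Lemma stheta_sumnat (I : Type) (r : seq I) (f : I -> nat) (g : I -> B) :
  stheta (\sum_(i <- r) (f i)%:R * g i) = \sum_(i <- r) (f i)%:R * stheta (g i).
Proof.
by rewrite raddf_sum; apply: eq_bigr => i _; rewrite !mulr_natl raddfMn.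
Qed.

Lemma stheta_nat n : stheta (n%:R : B) = 0.
Proof. by rewrite -(rmorph_nat (@sercst F)) stheta_cst. Qed.

(** The heat equation 2 theta_q Z = (Z^2 + Z')', multiplied by z^3 and read off at q^N. For N = 0 it
    follows from the Riccati equation of [kap]; for N > 0 both sides are divisor sums, and N = n x
    turns the factor x of [YY] into N after a z-derivative. *)
Lemma heat N : 2%:R * gX ^+ 2 * UU N *+ N = stheta (VV N) - 2%:R * VV N.
Proof.
case: N => [|N].
  rewrite mulr0n VV_coef UU_0 expr2 serM0 -expr2 UU_0.
  have H := kap_ode (F := F); set W := _ + _ - _ in H *.
  have : 4%:R * (stheta W - 2%:R * W) = 0.
    transitivity (stheta (4%:R * W) - 2%:R * (4%:R * W)).
      have -> : stheta (4%:R * W) = 4%:R * stheta W by rewrite [in LHS]mulr_natl [RHS]mulr_natl raddfMn.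
      by rewrite mulrBr (mulrCA 4%:R).
    by rewrite H expr2 sthetaM sthetaX; ring.
  rewrite mulr_natl => /(congr1 (fun f : B => f)) H4.
  apply: ser_ext => k; have := congr1 (fun f : B => f k) H4; rewrite serMn !ser0.
  by move/eqP; rewrite mulrn_eq0 => /eqP ->.
have N0 : (0 < N.+1)%N by [].
rewrite (VV_S N0) (UU_S N0) sthetaM expr2 sthetaM sthetaX.
transitivity (gX ^+ 2 * stheta (YY N.+1)); last by ring.
rewrite AA_coef /YY raddfN /= stheta_sumnat -mulr_natl.
transitivity (- (gX ^+ 2 * (\sum_(v <- divpairs N.+1) N.+1%:R * 2%:R * gX * OO v.1%:R))).
  by rewrite -mulr_sumr; ring.
rewrite mulrN; congr (- (_ * _)); rewrite big_seq [RHS]big_seq; apply: eq_bigr => -[n x].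
rewrite mem_divpairs => /and3P[_ _ /eqP /= <-].
have stz2 : stheta (2%:R * EE n%:R + 2%:R) = 2%:R * stheta (EE n%:R).
  by rewrite raddfD /= stheta_nat addr0 !(mulr_natl, raddfMn).
by rewrite stz2 stheta_EE rmorph_nat natrM; ring.
Qed.

(** The z-expansion of U: its even coefficients are Eisenstein series up to rational factors, with
    the Taylor coefficients of (z/2) coth (z/2) as constant terms. *)
Definition gam (k : nat) : ser F := Ser (fun N => (UU N) k).

Lemma serX2M (f : B) k : (gX ^+ 2 * f) k.+2 = f k.
Proof. by rewrite expr2 -mulrA !serXM. Qed.
Lemma serX2M2 (f : B) k : (2%:R * gX ^+ 2 * f) k.+2 = f k *+ 2.
Proof.
have -> : 2%:R * gX ^+ 2 * f = gX ^+ 2 * f *+ 2 by rewrite -[2%:R * _ * f]mulrA mulr_natl.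
by rewrite serMn serX2M.
Qed.

Lemma gam_rec k : stheta (gam k) *+ 2 =
  (\sum_(j < k.+3) gam j * gam (k.+2 - j)%N + gam k.+2 *+ k.+1) *+ k.
Proof.
apply: ser_ext => N; have := congr1 (fun f : B => f k.+2) (heat N).
have -> : (stheta (VV N) - 2%:R * VV N) k.+2 = VV N k.+2 *+ k.+2 - VV N k.+2 *+ 2.
  by rewrite (mulr_natl (VV N)).
rewrite (serMn (2%:R * gX ^+ 2 * UU N)) serX2M2.
rewrite -mulrnBr // subSS subn1 -[k.+1.-1]/k => H.
rewrite serMn stheta_coef -mulrnA mulnC mulrnA H.
have -> : VV N k.+2 = \sum_(j < k.+3) (gam j * gam (k.+2 - j)%N) N + (UU N) k.+2 *+ k.+1.
  rewrite VV_coef serB serD stheta_coef expr2 serM ser_sum mulrSr.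
  rewrite (eq_bigr (fun i : 'I_N.+1 => \sum_(j < k.+3) UU i j * UU (N - i)%N (k.+2 - j)%N)).
    by rewrite exchange_big /= addrA addrK; congr (_ + _); apply: eq_bigr => j _; rewrite serM.
  by move=> i _; rewrite serM.
rewrite -ser_sum; symmetry; etransitivity; first exact: serMn.
by congr (_ *+ k); congr (_ + _); apply: (serMn (gam k.+2)).
Qed.

Lemma kap_coef k : \sum_(j < k.+1) kap j * kap (k - j)%N + kap k *+ k - kap k
  = (if k == 2%N then 4%:R^-1 else 0).
Proof.
have := congr1 (fun f : B => f k) (kap_ode (F := F)).
rewrite mulr_natl serMn serB serD stheta_coef expr2 serM => H.
have n4 : (4%:R : F) != 0 by rewrite pnatr_eq0.
apply: (mulIf n4); rewrite mulr_natr H expr2.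
by case: k {H} => [|[|[|k]]]; rewrite !serXM ?mul0r //= mulVf.
Qed.

End Heat.

Section EisensteinIsobaric.
Context {F : numFieldType}.
Local Notation B := (ser F).
Local Notation OO := (@OO F).
Local Notation UU := (@UU F).
Local Notation kap := (@kap F).
Local Notation gam := (@gam F).

Lemma gam_0 k : gam k 0%N = kap k.
Proof. by rewrite -[gam k 0%N]/(UU 0%N k) UU_0. Qed.

Lemma OO_coef (s : F) j : OO s j = (s ^+ j - (- s) ^+ j) / j`!%:R.
Proof. by rewrite /OO serB /= mulrBl. Qed.

Lemma gam_S0 N : (0 < N)%N -> gam 0%N N = 0.
Proof. by move=> N0; rewrite -[gam 0%N N]/(UU N 0%N) (UU_S (F := F) N0) serN serXM oppr0. Qed.

Lemma gam_S k N : (0 < N)%N -> gam k.+1 N =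
  - (\sum_(v <- divpairs N) (v.1%:R ^+ k - (- v.1%:R) ^+ k)) / k`!%:R.
Proof.
move=> N0; rewrite -[gam k.+1 N]/(UU N k.+1) (UU_S (F := F) N0) serN serXM AA_coef ser_sum mulNr mulr_suml.
by congr (- _); apply: eq_bigr => v _; rewrite OO_coef.
Qed.

Lemma kap0 : kap 0%N = 1.
Proof.
have E0 : (@ez F 1 - 1) 0%N = 0 by rewrite serB ser1 /= expr0 fact0 divr1 subrr.
have E1 : (@ez F 1 - 1) 1%N = 1 by rewrite serB ser1 /= expr1 -[1`!]/1%N divr1 subr0.
have E2 : (@ez F 1 + 1) 0%N = 2%:R by rewrite serD ser1 /= expr0 fact0 divr1.
have n2 : (2%:R : F) != 0 by rewrite pnatr_eq0.
have := congr1 (fun f : B => f 1%N) (kapE (F := F)).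
rewrite serXM E2 serM big_ord_recl big_ord1 -[(1 - _)%N]/1%N E1 -[(1 - _)%N]/0%N E0 mulr0 addr0.
by rewrite mulr1 mulr_natl (serMn kap) => H; apply: (mulIf n2); rewrite mulr_natr H mul1r.
Qed.

Lemma kap1 : kap 1%N = 0.
Proof.
have := kap_coef (F := F) 1; rewrite big_ord_recl big_ord1 /= kap0 => H.
have n2 : (2%:R : F) != 0 by rewrite pnatr_eq0.
apply: (mulIf n2); rewrite mul0r -[RHS]H /bump add1n subn0; ring.
Qed.

Lemma kap2 : kap 2%N = 12%:R^-1.
Proof.
have := kap_coef (F := F) 2; rewrite !big_ord_recl big_ord0 /= /bump !add1n !subn0 -[(2 - 1)%N]/1%N -[(2 - 2)%N]/0%N kap0 kap1 => H.
have n3 : (3%:R : F) != 0 by rewrite pnatr_eq0.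
have n4 : (4%:R : F) != 0 by rewrite pnatr_eq0.
apply: (mulIf n3); transitivity ((4%:R^-1 : F)); last by field; rewrite ?n4 ?pnatr_eq0.
rewrite -[RHS]H; ring.
Qed.

Lemma gam0 : gam 0%N = 1.
Proof.
apply: ser_ext => -[|N]; first by rewrite gam_0 kap0.
by rewrite gam_S0.
Qed.

Lemma gam1 : gam 1%N = 0.
Proof.
apply: ser_ext => -[|N]; first by rewrite gam_0 kap1.
rewrite gam_S // ser0 big1 ?oppr0 ?mul0r // => v _.
by rewrite !expr0 subrr.
Qed.

(** The two extreme terms of the sum in [gam_rec] contain [gam 0 = 1] and raise the factor of
    [gam k.+2] from k + 1 to k + 3; dividing by k requires k > 0. *)
Lemma gam_step k : (0 < k)%N -> gam k.+2 *+ k.+3 = sercst (2%:R / k%:R) * stheta (gam k)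
   - \sum_(j < k.+1) gam j.+1 * gam (k.+1 - j)%N.
Proof.
move=> k0; have := gam_rec (F := F) k.
rewrite big_ord_recl big_ord_recr /= subn0 gam0 mul1r.
rewrite (_ : (k.+2 - bump 0 k.+1)%N = 0%N); last by rewrite /bump; lia.
rewrite (_ : bump 0 k.+1 = k.+2) // gam0 mulr1.
rewrite (eq_bigr (fun j : 'I_k.+1 => gam j.+1 * gam (k.+1 - j)%N)); last first.
  by move=> j _; rewrite /bump /= add1n subSS.
move: (\sum_(j < k.+1) _) => s H.
have kn : (k%:R : F) != 0 by rewrite pnatr_eq0 -lt0n.
have -> : sercst (2%:R / k%:R) * stheta (gam k) = gam k.+2 *+ k.+3 + s.
  transitivity (sercst (k%:R^-1) * (stheta (gam k) *+ 2)).
    by rewrite rmorphM rmorph_nat -[stheta _ *+ 2]mulr_natl mulrA [2%:R * _]mulrC.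
  have KK (x : B) : sercst (k%:R^-1) * (x *+ k) = x.
    by apply: ser_ext => n; rewrite sercstM serMn -[x n *+ k]mulr_natl mulrA mulVf // mul1r.
  rewrite H KK (mulrS _ k.+2) (mulrS _ k.+1) -!addrA.
  by congr (_ + _); rewrite addrC !addrA.
by rewrite addrK.
Qed.

End EisensteinIsobaric.

Section EisensteinSystem.
Context {F : numFieldType}.
Local Notation B := (ser F).
Local Notation kap := (@kap F).
Local Notation gam := (@gam F).

Lemma natF_neq0 n : (n.+1%:R : F) != 0. Proof. by rewrite pnatr_eq0. Qed.

Lemma ser_mulrnI (f : B) n : f *+ n.+1 = 0 -> f = 0.
Proof.
move=> h; apply: ser_ext => k; have := congr1 (fun f : B => f k) h.
by rewrite serMn ser0 => /eqP; rewrite mulrn_eq0 => /eqP.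
Qed.

Lemma gam3 : gam 3 = 0.
Proof.
apply: (@ser_mulrnI _ 3); rewrite (gam_step (k := 1)) //.
by rewrite !big_ord_recl big_ord0 gam1 raddf0 !(mulr0, mul0r, addr0, subr0).
Qed.

Lemma gam5 : gam 5 = 0.
Proof.
apply: (@ser_mulrnI _ 5); rewrite (gam_step (k := 3)) //.
have -> : \sum_(j < 4) gam j.+1 * gam (4 - j)%N = gam 1 * gam 4 + (gam 2 * gam 3 + (gam 3 * gam 2 + (gam 4 * gam 1 + 0))) by rewrite !big_ord_recl big_ord0.
by rewrite gam1 gam3 raddf0 !(mulr0, mul0r, addr0, subr0).
Qed.

Lemma gam4E : gam 4 *+ 5 = stheta (gam 2) - gam 2 ^+ 2.
Proof.
rewrite (gam_step (k := 2)) // divff ?natF_neq0 // rmorph1 mul1r.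
have -> : \sum_(j < 3) gam j.+1 * gam (3 - j)%N = gam 1 * gam 3 + (gam 2 * gam 2 + (gam 3 * gam 1 + 0)) by rewrite !big_ord_recl big_ord0.
by rewrite gam1 gam3 !(mulr0, mul0r, addr0, add0r, subr0).
Qed.

Lemma gam6E : gam 6 *+ 14 = stheta (gam 4) - gam 2 * gam 4 *+ 4.
Proof.
have -> : gam 6 *+ 14 = gam 6 *+ 7 *+ 2 by rewrite -mulrnA.
rewrite (gam_step (k := 4)) // mulrnBl; congr (_ - _).
  by rewrite -mulrnAl -rmorphMn /= -mulr_natr mulrAC -natrM divff ?natF_neq0 // rmorph1 mul1r.
have -> : \sum_(j < 5) gam j.+1 * gam (5 - j)%N = gam 1 * gam 5 + (gam 2 * gam 4 + (gam 3 * gam 3 + (gam 4 * gam 2 + (gam 5 * gam 1 + 0)))) by rewrite !big_ord_recl big_ord0.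
rewrite gam1 gam3 gam5 !(mulr0, mul0r, addr0, add0r, subr0).
by rewrite [gam 4 * _]mulrC -mulr2n -mulrnA.
Qed.

Lemma gam8E : gam 8 *+ 27 = stheta (gam 6) - gam 2 * gam 6 *+ 6 - gam 4 ^+ 2 *+ 3.
Proof.
have -> : gam 8 *+ 27 = gam 8 *+ 9 *+ 3 by rewrite -mulrnA.
have E6 : sercst (2%:R / 6%:R) * stheta (gam 6) *+ 3 = stheta (gam 6).
  by rewrite -mulrnAl -rmorphMn /= -mulr_natr mulrAC -natrM divff ?natF_neq0 // rmorph1 mul1r.
rewrite (gam_step (k := 6)) // mulrnBl E6 -addrA; congr (stheta (gam 6) + _).
have -> : \sum_(j < 7) gam j.+1 * gam (7 - j)%N = gam 1 * gam 7 + (gam 2 * gam 6 + (gam 3 * gam 5 + (gam 4 * gam 4 + (gam 5 * gam 3 + (gam 6 * gam 2 + (gam 7 * gam 1 + 0)))))) by rewrite !big_ord_recl big_ord0.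
rewrite gam1 gam3 gam5 !(mulr0, mul0r, addr0, add0r, subr0).
rewrite [gam 6 * _]mulrC -opprD; congr (- _); move: (gam 2 * _) => u.
by rewrite -expr2 addrC -addrA -mulr2n mulrnDl -mulrnA [LHS]addrC.
Qed.

Lemma kap_vals : [/\ kap 4%N = - 720%:R^-1, kap 6%N = (42%:R * 720%:R)^-1 & kap 8%N = - (1680%:R * 720%:R)^-1].
Proof.
have H4 := congr1 (fun f : B => f 0%N) gam4E.
have H6 := congr1 (fun f : B => f 0%N) gam6E.
have H8 := congr1 (fun f : B => f 0%N) gam8E.
move: H4 H6 H8; rewrite !serB !serMn !stheta0 !expr2 !serM0 !gam_0 kap2 !sub0r => H4 H6 H8.
have n5 := natF_neq0 4; have n14 := natF_neq0 13; have n27 := natF_neq0 26.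
have E4 : kap 4%N = - 720%:R^-1.
  by apply: (mulIf n5); rewrite [LHS]mulr_natr H4; field; rewrite ?pnatr_eq0.
have E6 : kap 6%N = (42%:R * 720%:R)^-1.
  by apply: (mulIf n14); rewrite [LHS]mulr_natr H6 E4; field; rewrite ?pnatr_eq0.
split=> //.
by apply: (mulIf n27); rewrite [LHS]mulr_natr H8 E6 E4; field; rewrite ?pnatr_eq0.
Qed.

Lemma gam_even k (c : F) : c = 2%:R / (k.*2.+1)`!%:R ->
  gam k.*2.+2 = sercst (kap k.*2.+2) - sercst c * sig k.*2.+1.
Proof.
move=> ->; apply: ser_ext => -[|N]; rewrite serB sercstM.
  by rewrite gam_0 /sig /dser /= divpairs0 big_nil mulr0 subr0.
rewrite gam_S // sub0r mulNr; congr (- _); rewrite mulr_suml [RHS]mulr_sumr.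
by apply: eq_bigr => v _; rewrite exprNn -signr_odd /= odd_double expr1; ring.
Qed.

(** E8 = E4^2 in this normalization. The recursion expresses the derivative of [gam 6] through
    [gam 8]; this relation closes the system and gives Ramanujan's third identity. *)
Lemma gam8_sq : gam 8 = - sercst (3%:R / 7%:R) * gam 4 ^+ 2.
Proof.
have [k4 k6 k8] := kap_vals.
rewrite (@gam_even 3 (2520%:R^-1)); last by rewrite (_ : (7`! = 2520 * 2)%N) // natrM; field; rewrite ?pnatr_eq0.
rewrite (@gam_even 1 (3%:R^-1)); last by rewrite (_ : (3`! = 3 * 2)%N) // natrM; field; rewrite ?pnatr_eq0.
have S : sig 7 = sig 3 + sercst 120%:R * (sig 3 * sig 3) :> B.
  rewrite sig3_sq mulrCA -rmorphM divff ?natF_neq0 // rmorph1 mulr1 addrC subrK //.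
rewrite -[3.*2.+2]/8%N -[1.*2.+2]/4%N -[3.*2.+1]/7%N -[1.*2.+1]/3%N k4 k8 S.
move: (sig 3) => s; apply: ser_ext => n.
have -> : - sercst (3 / 7) * (sercst (- 720^-1) - sercst 3^-1 * s) ^+ 2 =
  - (sercst (3%:R / 7%:R * (720%:R^-1) ^+ 2)) - sercst (3%:R / 7%:R * 2%:R * 720%:R^-1 * 3%:R^-1) * s
   - sercst (3%:R / 7%:R * 3%:R^-1 * 3%:R^-1) * (s * s) :> B.
  have cM := rmorphM (@sercst F); have c2 := rmorph_nat (@sercst F) 2.
  rewrite !expr2 !cM c2 rmorphN /=; move: (sercst _) (sercst _) (sercst _) => u v w; ring.
have -> : sercst (- (1680%:R * 720%:R)^-1) - sercst (2520%:R^-1) * (s + sercst 120%:R * (s * s)) =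
   - sercst ((1680%:R * 720%:R)^-1) - sercst (2520%:R^-1) * s - sercst (2520%:R^-1 * 120%:R) * (s * s) :> B.
  have cM := rmorphM (@sercst F); rewrite cM rmorphN /=; ring.
congr (scoef (- sercst _ - sercst _ * _ - sercst _ * _) _); by field; rewrite ?pnatr_eq0.
Qed.

End EisensteinSystem.

(** * Ramanujan's identities for P, Q, R *)

Section EisensteinRing.
Context {F : numFieldType}.
Local Notation B := (ser F).
Local Notation M := {poly {poly {poly F}}}.
Local Notation kap := (@kap F).
Local Notation gam := (@gam F).

(** The factors 12, - 720 and 42 * 720 are the inverses of [kap 2], [kap 4], [kap 6], so that all
    three series start with 1. *)
Definition eisP : B := 12%:R * gam 2.
Definition eisQ : B := - (720%:R * gam 4).
Definition eisR : B := 42%:R * 720%:R * gam 6.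

Lemma sthetaMn (f : B) n : stheta (n%:R * f) = n%:R * stheta f.
Proof. by rewrite !mulr_natl raddfMn. Qed.

Lemma thE (f : B) : th f = 12%:R * stheta f.
Proof. by rewrite /th mulr_natl. Qed.

Lemma eis_ramP : th eisP = eisP ^+ 2 - eisQ.
Proof.
rewrite thE /eisP sthetaMn /eisQ.
have -> : stheta (gam 2) = 5%:R * gam 4 + gam 2 ^+ 2 by rewrite mulr_natl gam4E subrK.
by move: (gam 2) (gam 4) => g2 g4; ring.
Qed.

Lemma eis_ramQ : th eisQ = 4%:R * (eisP * eisQ - eisR).
Proof.
rewrite thE /eisP /eisQ /eisR -mulNr -[- 720%:R]mulN1r -mulrA.
have -> : stheta (-1 * (720%:R * gam 4)) = - (720%:R * stheta (gam 4)).
  by rewrite mulN1r raddfN /= sthetaMn.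
have -> : stheta (gam 4) = 14%:R * gam 6 + 4%:R * (gam 2 * gam 4).
  by rewrite !mulr_natl gam6E subrK.
by move: (gam 2) (gam 4) (gam 6) => g2 g4 g6; ring.
Qed.

Lemma eis_ramR : th eisR = 6%:R * (eisP * eisR - eisQ ^+ 2).
Proof.
rewrite thE /eisP /eisQ /eisR -mulrA !sthetaMn.
have H8 := gam8E (F := F); rewrite gam8_sq in H8.
have E7 : 7%:R * gam 8 = - (3%:R * gam 4 ^+ 2).
  rewrite gam8_sq mulNr mulrN mulrA; congr (- (_ * _)).
  by rewrite -[7%:R](rmorph_nat (@sercst F)) -rmorphM /= mulrCA divff ?natF_neq0 // mulr1 rmorph_nat.
have E : 7%:R * stheta (gam 6) = 42%:R * (gam 2 * gam 6) - 60%:R * gam 4 ^+ 2.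
  have -> : stheta (gam 6) = 27%:R * gam 8 + 6%:R * (gam 2 * gam 6) + 3%:R * gam 4 ^+ 2.
    by rewrite !mulr_natl gam8E addrAC subrK subrK.
  transitivity (27%:R * (7%:R * gam 8) + 42%:R * (gam 2 * gam 6) + 21%:R * gam 4 ^+ 2).
    by move: (gam 8) (gam 2 * gam 6) (gam 4) => g8 g26 g4; ring.
  by rewrite E7; move: (gam 2 * gam 6) (gam 4) => g26 g4; ring.
transitivity (12%:R * (6%:R * (720%:R * (7%:R * stheta (gam 6))))).
  by move: (stheta _) => t; ring.
by rewrite E; move: (gam 2) (gam 4) (gam 6) => g2 g4 g6; ring.
Qed.

Lemma serMn0 (f : B) n k : (n%:R * f) k = n%:R * f k.
Proof. by rewrite -(rmorph_nat (@sercst F)) sercstM. Qed.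

Lemma eisP0 : eisP 0%N = 1.
Proof. by rewrite /eisP serMn0 gam_0 kap2 divff ?natF_neq0. Qed.
Lemma eisQ0 : eisQ 0%N = 1.
Proof.
have [k4 _ _] := kap_vals (F := F).
by rewrite /eisQ serN serMn0 gam_0 k4 mulrN opprK divff ?natF_neq0.
Qed.
Lemma eisR0 : eisR 0%N = 1.
Proof.
have [_ k6 _] := kap_vals (F := F).
by rewrite /eisR -mulrA !serMn0 gam_0 k6 mulrA divff // mulf_neq0 ?natF_neq0.
Qed.

Lemma sig_1 k : sig k 1%N = 1 :> F.
Proof.
have -> : sig k 1%N = \sum_(v <- divpairs 1) (v.1%:R ^+ k) :> F by [].
rewrite (perm_big [:: (1%N, 1%N)]) ?big_seq1 ?expr1n //.
apply: uniq_perm => //; first exact: uniq_divpairs.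
move=> -[a b]; rewrite mem_divpairs inE xpair_eqE /=.
by apply/idP/idP; nia.
Qed.

Lemma eisQ1 : eisQ 1%N = 240%:R.
Proof.
rewrite /eisQ serN serMn0 (@gam_even _ 1 (3%:R^-1)); last by rewrite (_ : (3`! = 3 * 2)%N) // natrM; field.
rewrite serB sercstM sig_1 mulr1 sub0r; by field.
Qed.
Lemma eisR1 : eisR 1%N = - 504%:R.
Proof.
rewrite /eisR -mulrA !serMn0 (@gam_even _ 2 (60%:R^-1)); last by rewrite (_ : (5`! = 60 * 2)%N) // natrM; field.
by rewrite serB sercstM sig_1 mulr1 sub0r; by field.
Qed.

(** The coefficients of q already differ: 2 (- 504) - 3 (240) = - 1728. *)
Lemma eis_disc : eisR ^+ 2 <> eisQ ^+ 3.
Proof.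
move: eisQ eisR eisQ0 eisR0 eisQ1 eisR1 => Q R Q0 R0 Q1 R1.
move=> /(congr1 (fun f : B => f 1%N)).
have M1 (f g : B) : (f * g) 1%N = f 0%N * g 1%N + f 1%N * g 0%N.
  by rewrite serM big_ord_recl big_ord1.
rewrite (exprS Q) !expr2 !M1 !serM0 Q0 R0 Q1 R1 => /eqP.
rewrite -subr_eq0 (_ : _ - _ = - 1728%:R); last by ring.
by rewrite oppr_eq0 pnatr_eq0.
Qed.

Local Notation ev := (ev eisP eisQ eisR).

(** The [gam k] are the coefficients of the trace recursion. [gam_step] builds them from smaller
    ones by products and by the derivation, and both respect weights. *)
Lemma gam_isob k : exists2 g : M, isob k%:R g & gam k = ev g.
Proof.
elim/ltn_ind: k => -[|[|[|k]]] IH.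
- by exists 1; [exact: isob1 | rewrite gam0 rmorph1].
- by exists 0; [exact: isob0 | rewrite gam1 rmorph0].
- exists (mc (12%:R^-1) * mP); first by rewrite -[2%:R]add0r; apply: isobM; [exact: isob_c | exact: isob_P].
  rewrite rmorphM /= ev_c ev_P /eisP -(rmorph_nat (@sercst F)) mulrA -rmorphM /=.
  by rewrite mulVf ?natF_neq0 // rmorph1 mul1r.
have {}IH j : (j < k.+3)%N -> {g : M | isob j%:R g & gam j = ev g}.
  by move=> jk; apply/cid2/IH.
pose g (j : nat) : M := if pselect (j < k.+3)%N is left h then s2val (IH j h) else 0.
have gP j : (j < k.+3)%N -> isob j%:R (g j) /\ gam j = ev (g j).
  by move=> jk; rewrite /g; case: pselect => // h; split; [exact: (s2valP (IH j h)) | exact: (s2valP' (IH j h))].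
exists (mc (k.+4%:R^-1) * (mc (2%:R / k.+1%:R / 12%:R) * Dram (g k.+1)
   - \sum_(j < k.+2) g j.+1 * g (k.+2 - j)%N)).
  rewrite -[k.+3%:R]add0r; apply: isobM; first exact: isob_c.
  apply: isobB.
    rewrite -[k.+3%:R]add0r; apply: isobM; first exact: isob_c.
    by rewrite -[k.+3]addn2 natrD; apply: isob_Dram; apply: (gP _ _).1.
  apply: isob_sum => j _; rewrite (_ : k.+3 = j.+1 + (k.+2 - j))%N; last by case: j => /=; lia.
  by rewrite natrD; apply: isobM; apply: (gP _ _).1; case: j => /=; lia.
rewrite rmorphM rmorphB /= ev_c rmorphM /= ev_c (ev_D eis_ramP eis_ramQ eis_ramR) rmorph_sum.
rewrite (eq_bigr (fun j : 'I_k.+2 => gam j.+1 * gam (k.+2 - j)%N)); last first.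
  by move=> j _; rewrite rmorphM /=; congr (_ * _); symmetry; apply: (gP _ _).2; case: j => /=; lia.
rewrite -(gP k.+1 _).2 // thE -(rmorph_nat (@sercst F)) (mulrA (sercst _) (sercst _)) -rmorphM /=.
rewrite divfK ?natF_neq0 // -gam_step // -(mulr_natl (gam _)) -(rmorph_nat (@sercst F)) mulrA -rmorphM /=.
by rewrite mulVf ?natF_neq0 // rmorph1 mul1r.
Qed.

End EisensteinRing.

(** * Conjugation of the coefficients *)

Section Conjugation.
Context {F : numFieldType}.
Variable s : {rmorphism F -> F}.
Local Notation M := {poly {poly {poly F}}}.

Definition sermap (f : ser F) : ser F := Ser (fun n => s (f n)).

Lemma sermapD f g : sermap (f + g) = sermap f + sermap g.
Proof. by apply: ser_ext => n; rewrite serD -[LHS]/(s ((f + g) n)) serD rmorphD. Qed.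
Lemma sermapM f g : sermap (f * g) = sermap f * sermap g.
Proof.
apply: ser_ext => n; rewrite -[LHS]/(s ((f * g) n)) !serM rmorph_sum.
by apply: eq_bigr => i _; rewrite rmorphM.
Qed.
Lemma sermap_cst c : sermap (sercst c) = sercst (s c).
Proof. by apply: ser_ext => -[|n] //=; rewrite rmorph0. Qed.
Lemma sermap0 : sermap 0 = 0.
Proof. by apply: ser_ext => n /=; rewrite rmorph0. Qed.
Lemma sermap_sum (I : Type) (r : seq I) (f : I -> ser F) :
  sermap (\sum_(i <- r) f i) = \sum_(i <- r) sermap (f i).
Proof. exact: (big_morph sermap sermapD sermap0). Qed.
Lemma sermap_th f : sermap (th f) = th (sermap f).
Proof.
by apply: ser_ext => n; rewrite /th serMn stheta_coef -[LHS]/(s ((stheta f *+ 12) n)) serMn stheta_coef !rmorphMn.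
Qed.

Definition mconj : {rmorphism M -> M} := map_poly (map_poly (map_poly s)).

Lemma mpoly_ind (P : M -> Prop) :
  (forall c, P (mc c)) -> P mP -> P mQ -> P mR ->
  (forall f g, P f -> P g -> P (f + g)) -> (forall f g, P f -> P g -> P (f * g)) ->
  forall f, P f.
Proof.
move=> Pc PP PQ PR PD PM.
have H1 (c : {poly F}) : P c%:P%:P.
  elim/poly_ind: c => [|c a IH]; first exact: (Pc 0).
  have -> : (c * 'X + a%:P)%:P%:P = c%:P%:P * mQ + mc a by rewrite /mQ /Q2 /mc !(polyCD, polyCM).
  by apply: (PD) => //; apply: PM.
have H2 (g : {poly {poly F}}) : P g%:P.
  elim/poly_ind: g => [|g c IH]; first exact: (Pc 0).
  have -> : (g * 'X + c%:P)%:P = g%:P * mR + c%:P%:P by rewrite /mR /R2 !(polyCD, polyCM).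
  by apply: (PD) => //; apply: PM.
elim/poly_ind => [|f g IH]; first exact: (Pc 0).
by apply: (PD) => //; apply: PM.
Qed.

Lemma mconj_c c : mconj (mc c) = mc (s c).
Proof. by rewrite /mconj /mc /= map_polyC /= map_polyC /= map_polyC. Qed.
Lemma mconj_P : mconj mP = mP.
Proof. by rewrite /mconj /mP /= map_polyX. Qed.
Lemma mconj_R : mconj mR = mR.
Proof. by rewrite /mconj /mR /R2 /= map_polyC /= map_polyX. Qed.
Lemma mconj_Q : mconj mQ = mQ.
Proof. by rewrite /mconj /mQ /Q2 /= map_polyC /= map_polyC /= map_polyX. Qed.
Lemma mconjD f g : mconj (f + g) = mconj f + mconj g.
Proof. exact: rmorphD. Qed.
Lemma mconjM f g : mconj (f * g) = mconj f * mconj g.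
Proof. exact: rmorphM. Qed.

Lemma ev_mconj p q r f : sermap p = p -> sermap q = q -> sermap r = r ->
  sermap (ev p q r f) = ev p q r (mconj f).
Proof.
move=> hp hq hr; elim/mpoly_ind: f => [c||||f g IHf IHg|f g IHf IHg].
- by rewrite mconj_c !ev_c sermap_cst.
- by rewrite mconj_P ev_P hp.
- by rewrite mconj_Q ev_Q hq.
- by rewrite mconj_R ev_R hr.
- by rewrite mconjD [in LHS]rmorphD [in RHS]rmorphD sermapD IHf IHg.
- by rewrite mconjM [in LHS]rmorphM [in RHS]rmorphM sermapM IHf IHg.
Qed.

Lemma isob_mconj k f : s k = k -> isob k f -> isob k (mconj f).
Proof.
move=> sk fk.
have Wc g : Weul (mconj g) = mconj (Weul g).
  have [WD WM] := der_W (F := F).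
  have n i : mconj i%:R = i%:R by exact: rmorph_nat.
  elim/mpoly_ind: g => [c||||f1 g IHf IHg|f1 g IHf IHg].
  - by rewrite mconj_c !W_c rmorph0.
  - by rewrite mconj_P W_P mconjM n mconj_P.
  - by rewrite mconj_Q W_Q mconjM n mconj_Q.
  - by rewrite mconj_R W_R mconjM n mconj_R.
  - by rewrite mconjD !WD mconjD IHf IHg.
  - by rewrite mconjM !WM mconjD !mconjM IHf IHg.
by rewrite /isob Wc fk mconjM mconj_c sk.
Qed.

Lemma sermap_gam k : (1 < k)%N -> s (kap k) = kap k -> sermap (gam k) = gam k.
Proof.
case: k => // k _ hk; apply: ser_ext => -[|N]; rewrite -[LHS]/(s (gam _ _)).
  by rewrite gam_0.
rewrite gam_S // fmorph_div rmorph_nat rmorphN rmorph_sum; congr (- _ / _).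
by apply: eq_bigr => v _; rewrite rmorphB !rmorphXn rmorphN rmorph_nat.
Qed.

Lemma sermap_eis : [/\ sermap eisP = eisP, sermap eisQ = eisQ & sermap eisR = eisR].
Proof.
have [k4 k6 _] := kap_vals (F := F).
have n c (f : ser F) : sermap (c%:R * f) = c%:R * sermap f.
  by rewrite -(rmorph_nat (@sercst F)) sermapM sermap_cst [s _]rmorph_nat.
have N (f : ser F) : sermap (- f) = - sermap f.
  by apply: ser_ext => i; rewrite serN -[LHS]/(s ((- f) i)) serN rmorphN.
split.
- by rewrite /eisP n sermap_gam // kap2 fmorphV rmorph_nat.
- by rewrite /eisQ N n sermap_gam // k4 rmorphN fmorphV rmorph_nat.
- by rewrite /eisR -mulrA !n sermap_gam // k6 fmorphV rmorphM !rmorph_nat.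
Qed.

End Conjugation.

(** * Graded spaces and subspaces *)

Local Open Scope classical_set_scope.

Section FiniteSupport.
Context {T : nmodType} {I : choiceType}.

Lemma fsum_seq (s : seq I) (f : I -> T) : uniq s -> (forall i, i \notin s -> f i = 0) ->
  \sum_(i \in [set: I]) f i = \sum_(i <- s) f i.
Proof.
move=> us f0; rewrite (fsbigE s) //; last by move=> i _; apply: f0.
by apply: eq_bigl => i; apply: in_setT.
Qed.

End FiniteSupport.

Lemma fsum_nat (T : nmodType) (N : nat) (f : nat -> T) :
  (forall i, (N <= i)%N -> f i = 0) -> \sum_(i \in [set: nat]) f i = \sum_(i < N) f i.
Proof.
move=> f0; rewrite (fsum_seq (iota_uniq 0 N)); last first.
  by move=> i; rewrite mem_iota /= add0n -leqNgt => /f0.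
have -> : iota 0 N = index_iota 0 N by rewrite /index_iota subn0.
by rewrite big_mkord.
Qed.

Section LinearLemmas.
Context {F : fieldType} {U V : lmodType F}.

Section LinearMap.
Variable f : U -> V.
Hypothesis lf : linear f.
Lemma lin0 : f 0 = 0.
Proof. by have := lf (-1) 0 0; rewrite !scaleN1r !addNr. Qed.
Lemma linD u v : f (u + v) = f u + f v.
Proof. by have := lf 1 u v; rewrite !scale1r. Qed.
Lemma linZ a u : f (a *: u) = a *: f u.
Proof. by have := lf a u 0; rewrite lin0 !addr0. Qed.
Lemma linN u : f (- u) = - f u.
Proof. by rewrite -!scaleN1r linZ. Qed.
Lemma linB u v : f (u - v) = f u - f v.
Proof. by rewrite linD linN. Qed.
Lemma lin_sum (I : Type) (r : seq I) (P : pred I) (g : I -> U) :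
  f (\sum_(i <- r | P i) g i) = \sum_(i <- r | P i) f (g i).
Proof. by apply: (big_morph f linD lin0). Qed.
End LinearMap.

Lemma linear_id : linear (@id U). Proof. by []. Qed.
Lemma linear_sumf (I : Type) (r : seq I) (P : pred I) (g : I -> U -> V) :
  (forall i, linear (g i)) -> linear (fun u => \sum_(i <- r | P i) g i u).
Proof.
move=> lg a u v; rewrite scaler_sumr -big_split; apply: eq_bigr => i _; exact: lg.
Qed.
Lemma linear_scale c (g : U -> V) : linear g -> linear (fun u => c *: g u).
Proof. by move=> lg a u v; rewrite lg scalerDr !scalerA mulrC. Qed.
Lemma linear_add (g h : U -> V) : linear g -> linear h -> linear (fun u => g u + h u).
Proof. by move=> lg lh a u v; rewrite lg lh scalerDr addrACA. Qed.
Lemma linear_comp (W : lmodType F) (g : V -> W) (h : U -> V) :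
  linear g -> linear h -> linear (fun u => g (h u)).
Proof. by move=> lg lh a u v; rewrite lh lg. Qed.

Lemma sub_addP (A : set V) : subspace A -> forall u v, A u -> A v -> A (u + v).
Proof. by case=> _ h u v Au Av; rewrite -[u]scale1r; apply: h. Qed.
Lemma sub_scaleP (A : set V) : subspace A -> forall a u, A u -> A (a *: u).
Proof. by case=> h0 h a u Au; rewrite -[_ *: _]addr0; apply: h. Qed.
Lemma sub_subP (A : set V) : subspace A -> forall u v, A u -> A v -> A (u - v).
Proof. by move=> sA u v Au Av; apply: sub_addP => //; rewrite -scaleN1r; apply: sub_scaleP. Qed.
Lemma sub_sumP (A : set V) : subspace A -> forall (I : Type) (r : seq I) (P : pred I) (g : I -> V),
  (forall i, P i -> A (g i)) -> A (\sum_(i <- r | P i) g i).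
Proof.
move=> sA I r P g Ag; apply: big_ind => //; first by case: sA.
exact: sub_addP.
Qed.
Lemma sub_sum_seqP (A : set V) : subspace A -> forall (I : eqType) (r : seq I) (g : I -> V),
  (forall i, i \in r -> A (g i)) -> A (\sum_(i <- r) g i).
Proof. by move=> sA I r g Ag; rewrite big_seq; apply: sub_sumP. Qed.

Lemma lspan_min (X A : set V) : subspace A -> X `<=` A -> lspan X `<=` A.
Proof.
move=> sA XA v [s [sX ->]]; apply: sub_sum_seqP => // p ps.
by apply: sub_scaleP => //; apply/XA/sX.
Qed.

Lemma subspace_preim (A : set V) (f : U -> V) : linear f -> subspace A ->
  subspace [set u | A (f u)].
Proof.
move=> lf [A0 AD]; split=> [|a u v /= Au Av]; first by rewrite /= lin0.
by rewrite lf; apply: AD.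
Qed.

Lemma lspan_mono (X Y : set V) : X `<=` Y -> lspan X `<=` lspan Y.
Proof.
by move=> XY; apply: lspan_min; [exact: lspan_subspace | move=> x /XY; exact: sub_lspan].
Qed.

End LinearLemmas.

(** * Bases and homogeneous components *)

Section Bases.
Context {F : fieldType} {V : lmodType F}.

Definition indep (b : seq V) := forall g : nat -> F,
  \sum_(i < size b) g i *: b`_i = 0 -> forall i, (i < size b)%N -> g i = 0.

Lemma lspan_cons x (s : seq V) v : lspan [set` x :: s] v ->
  exists a u, lspan [set` s] u /\ v = a *: x + u.
Proof.
have [sp0 spD] := lspan_subspace [set` s].
apply: (@lspan_min _ _ _ [set w | exists a u, lspan [set` s] u /\ w = a *: x + u]).
  split; first by exists 0, 0; rewrite scale0r addr0.
  move=> c _ _ [a [u [su ->]]] [a' [u' [su' ->]]].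
  exists (c * a + a'), (c *: u + u'); split; first exact: spD.
  by rewrite scalerDr scalerDl scalerA addrACA.
move=> w /=; rewrite inE => /orP[/eqP ->|ws].
  by exists 1, 0; rewrite scale1r addr0.
by exists 0, w; split; [exact: sub_lspan | rewrite scale0r add0r].
Qed.

Lemma lspan_nil (v : V) : lspan [set` ([::] : seq V)] v -> v = 0.
Proof.
by apply: (@lspan_min _ _ _ [set 0]) => //; split=> // a _ _ -> ->; rewrite scaler0 addr0.
Qed.

Lemma basis_exists (A : set V) : subspace A -> finite_dim_in A ->
  exists b : seq V, [/\ forall x, x \in b -> A x, indep b &
    forall v, A v -> exists g : nat -> F, v = \sum_(i < size b) g i *: b`_i].
Proof.
move=> sA [s]; elim: s A sA => [|x s IH] A sA As.
  exists [::]; split=> // v /As /lspan_nil ->.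
  by exists (fun=> 0); rewrite big_ord0.
have [A0 AD] := sA; have [sp0 spD] := lspan_subspace [set` s].
pose A' := [set v | A v /\ lspan [set` s] v].
have sA' : subspace A'.
  by split=> // a u v [Au su] [Av sv]; split; [apply: AD | apply: spD].
have [b [bA' bi bs]] := IH A' sA' (fun v => @proj2 _ _).
case: (pselect (A `<=` A')) => AA'.
  by exists b; split=> // [y /bA' []|v /AA'/bs].
have [a [Aa A'a]] : exists a, A a /\ ~ A' a.
  by apply: contra_notP AA' => h v Av; apply: contra_notP h => h; exists v.
exists (a :: b); split.
- by move=> y; rewrite inE => /orP[/eqP -> //|/bA' []].
- move=> g; rewrite /= big_ord_recl /= => g0.
  have Ab : A' (\sum_(i < size b) g i.+1 *: b`_i).
    by apply: sub_sumP => // i _; apply: sub_scaleP => //; apply/bA'/mem_nth.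
  have ga : g 0%N = 0.
    apply: contra_notP A'a => /eqP gn.
    have -> : a = (- (g 0%N)^-1) *: \sum_(i < size b) g i.+1 *: b`_i.
      apply/eqP; rewrite -subr_eq0 scaleNr opprK; apply/eqP.
      by rewrite -[a in LHS]scale1r -(mulVf gn) -scalerA -scalerDr g0 scaler0.
    exact: sub_scaleP.
  move=> [//|i] /=; rewrite ltnS; apply: (bi (fun i => g i.+1)).
  by move: g0; rewrite ga scale0r add0r.
- move=> v Av.
  have [al [u [su aE]]] := lspan_cons (As _ Aa).
  have [be [w [sw vE]]] := lspan_cons (As _ Av).
  have aln : al != 0.
    by apply: contra_notN A'a => /eqP al0; split=> //; rewrite aE al0 scale0r add0r.
  have A'v : A' (v - (be / al) *: a).
    split; first by apply: sub_subP => //; apply: sub_scaleP.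
    have -> : v - (be / al) *: a = - (be / al) *: u + w.
      rewrite vE aE scalerDr scalerA divfK // scaleNr opprD addrACA subrr add0r addrC //.
    exact: spD.
  have [g gE] := bs _ A'v.
  exists (fun i => if i is j.+1 then g j else be / al).
  by rewrite /= big_ord_recl /= -gE addrC subrK.
Qed.

End Bases.

Section Graded.
Context {F : fieldType} {V : lmodType F} {I : choiceType} {A : I -> set V}.
Hypothesis dA : direct_sum A.

Lemma pr_key v : {f : I -> V | [/\ forall i, A i (f i), finite_set [set i | f i != 0]
  & v = \sum_(i \in [set: I]) f i]}.
Proof. by apply: cid; have [f [h _]] := dA.2 v; exists f. Qed.

Definition pr i v := sval (pr_key v) i.

Lemma pr_in i v : A i (pr i v).
Proof. by rewrite /pr; case: (svalP (pr_key v)). Qed.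

Lemma pr_supp v : exists2 s : seq I, uniq s & forall i, i \notin s -> pr i v = 0.
Proof.
case: (svalP (pr_key v)) => _ /finite_seqP [s sE] _.
exists (undup s); first exact: undup_uniq.
move=> i; rewrite mem_undup => h; apply/eqP; apply: contraNT h => h.
by have := congr1 (fun B : set I => B i) sE => /= <-.
Qed.

Lemma pr_sum v (s : seq I) : uniq s -> (forall i, i \notin s -> pr i v = 0) ->
  v = \sum_(i <- s) pr i v.
Proof.
move=> us h; case: (svalP (pr_key v)) => _ _ {1}->.
by rewrite (fsum_seq us).
Qed.

Lemma pr_uniq v (s : seq I) (f : I -> V) : uniq s -> (forall i, A i (f i)) ->
  (forall i, i \notin s -> f i = 0) -> v = \sum_(i <- s) f i -> forall i, pr i v = f i.
Proof.
move=> us fA f0 vE; have [g [_ gu]] := dA.2 v.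
have -> : f = g.
  symmetry; apply: gu; split=> //; last by rewrite (fsum_seq us).
  apply: (@sub_finite_set _ _ [set` s]); last exact: finite_seq.
  by move=> i /=; apply: contraNT => /f0 ->.
have E : g = sval (pr_key v) by apply: gu; apply: (svalP (pr_key v)).
by move=> i; rewrite E.
Qed.

Lemma pr_common (vs : seq V) : exists2 s : seq I, uniq s &
  forall v, v \in vs -> forall i, i \notin s -> pr i v = 0.
Proof.
elim: vs => [|v vs [s us sP]]; first by exists [::].
have [t ut tP] := pr_supp v.
exists (undup (t ++ s)); first exact: undup_uniq.
move=> w; rewrite inE => /orP[/eqP -> | wvs] i; rewrite mem_undup mem_cat negb_or => /andP[it is_].
  exact: tP.
exact: sP.
Qed.

Lemma pr_linear i : linear (pr i).
Proof.
move=> a u v; have [s us sP] := pr_common [:: u; v].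
have uP := sP u (mem_head _ _); have vP := sP v; rewrite !inE eqxx orbT in vP.
have {}vP := vP isT.
apply: (pr_uniq us (f := fun i => a *: pr i u + pr i v)).
- by move=> j; apply: (dA.1 j).2; apply: pr_in.
- by move=> j js; rewrite uP // vP // scaler0 addr0.
- by rewrite big_split -scaler_sumr -!pr_sum.
Qed.

Lemma pr_case i j v : A i v -> pr j v = if j == i then v else 0.
Proof.
move=> Av; apply: (@pr_uniq v [:: i] (fun j => if j == i then v else 0)) => //.
- by move=> k; case: eqP => [->|_] //; case: (dA.1 k).
- by move=> k; rewrite inE => /negbTE ->.
- by rewrite big_seq1 eqxx.
Qed.

Lemma pr_id i v : A i v -> pr i v = v.
Proof. by move=> /(pr_case i) ->; rewrite eqxx. Qed.

Lemma graded_ind (P : set V) : subspace P -> (forall i v, A i v -> P v) -> forall v, P v.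
Proof.
move=> sP h v; have [s us sv] := pr_supp v; rewrite (pr_sum us sv).
by apply: sub_sumP => // i _; apply: (h i); apply: pr_in.
Qed.

Lemma graded_lin_ext (W : lmodType F) (f g : V -> W) : linear f -> linear g ->
  (forall i v, A i v -> f v = g v) -> f =1 g.
Proof.
move=> lf lg fg; apply: graded_ind => //.
split; first by rewrite /= (lin0 lf) (lin0 lg).
by move=> a u v /= h1 h2; rewrite lf lg h1 h2.
Qed.

(** Operations such as a[n] and o(a) have formulas involving the weight of a; they are given on
    homogeneous vectors and extended linearly. *)
Definition glin (W : lmodType F) (G : I -> V -> W) (v : V) : W :=
  \sum_(i <- s2val (cid2 (pr_supp v))) G i (pr i v).

Lemma glinE (W : lmodType F) (G : I -> V -> W) v s : (forall i, linear (G i)) -> uniq s ->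
  (forall i, i \notin s -> pr i v = 0) -> glin G v = \sum_(i <- s) G i (pr i v).
Proof.
rewrite /glin; case: cid2 => t ut tP lG us sP /=.
rewrite -(fsum_seq ut) ?(fsum_seq us) // => i h; first by rewrite sP // (lin0 (lG i)).
by rewrite tP // (lin0 (lG i)).
Qed.

Lemma glin_linear (W : lmodType F) (G : I -> V -> W) : (forall i, linear (G i)) -> linear (glin G).
Proof.
move=> lG a u v; have [s us sP] := pr_common [:: u; v; a *: u + v].
rewrite !(@glinE _ G _ s) //; try by apply: sP; rewrite !inE eqxx ?orbT.
rewrite scaler_sumr -big_split; apply: eq_bigr => i _.
by rewrite (pr_linear i) lG.
Qed.

Lemma glin_hom (W : lmodType F) (G : I -> V -> W) i v : (forall i, linear (G i)) -> A i v ->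
  glin G v = G i v.
Proof.
move=> lG Av; rewrite (@glinE _ G v [:: i]) // ?big_seq1 ?(pr_id Av) // => j.
by rewrite inE (pr_case _ Av) => /negbTE ->.
Qed.

Hypothesis finA : forall i, finite_dim_in (A i).

Lemma basis_coord i : exists (b : seq V) (c : nat -> V -> F),
  [/\ forall x, x \in b -> A i x, forall j a u v, c j (a *: u + v) = a * c j u + c j v,
    forall v, A i v -> v = \sum_(j < size b) c j v *: b`_j &
    forall j k, (j < size b)%N -> (k < size b)%N -> c j b`_k = (j == k)%:R].
Proof.
have [b [bA bi bs]] := basis_exists (dA.1 i) (finA i).
have /cid2 [g _ gP] : exists2 g : V -> nat -> F, True & forall v, pr i v = \sum_(j < size b) g v j *: b`_j.
  by have [g gP] := choice (fun v => bs _ (pr_in i v)); exists g.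
pose c j v := if (j < size b)%N then g v j else 0.
have cP v : pr i v = \sum_(j < size b) c j v *: b`_j.
  by rewrite gP; apply: eq_bigr => j _; rewrite /c ltn_ord.
have uni (h1 h2 : nat -> F) : \sum_(j < size b) h1 j *: b`_j = \sum_(j < size b) h2 j *: b`_j ->
    forall j, (j < size b)%N -> h1 j = h2 j.
  move=> /eqP; rewrite -subr_eq0 -sumrB => /eqP h j jb.
  apply/eqP; rewrite -subr_eq0; apply/eqP; apply: (bi (fun j => h1 j - h2 j)) => //.
  by rewrite -[RHS]h; apply: eq_bigr => k _; rewrite scalerBl.
exists b, c; split=> //.
- move=> j a u v; case: (ltnP j (size b)) => jb; last by rewrite /c ltnNge jb mulr0 addr0.
  apply: (uni (c^~ (a *: u + v)) (fun j => a * c j u + c j v)) => //.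
  rewrite -cP (pr_linear i) !cP scaler_sumr -big_split.
  by apply: eq_bigr => k _; rewrite scalerDl scalerA.
- by move=> v Av; rewrite -cP pr_id.
- move=> j k jb kb; apply: (uni (c^~ b`_k) (fun j => (j == k)%:R)) => //.
  rewrite -cP (pr_id (bA _ (mem_nth 0 kb))).
  rewrite (bigD1 (Ordinal kb)) //= eqxx scale1r big1 ?addr0 // => l.
  by rewrite -val_eqE /= => /negbTE ->; rewrite scale0r.
Qed.

End Graded.

Lemma direct_sum_reindex (F : fieldType) (V : lmodType F) (I : choiceType) (A : I -> set V)
  (phi : nat -> I) : direct_sum A -> injective phi ->
  (forall i v, (forall k, i != phi k) -> A i v -> v = 0) -> direct_sum (fun k => A (phi k)).
Proof.
move=> dA iphi A0; split=> [k|v]; first exact: (dA.1 _).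
have [s us sP] := pr_supp dA v.
have /finite_seqP [t tE] : finite_set [set k | phi k \in s].
  apply: (@finite_preimage _ _ [set` s] phi); last exact: finite_seq.
  by move=> x y _ _ /iphi.
have t0 k : k \notin undup t -> pr dA (phi k) v = 0.
  rewrite mem_undup => kt; apply: sP; apply: contraNN kt => h.
  by have := congr1 (fun B : set nat => B k) tE => /= <-.
exists (fun k => pr dA (phi k) v); split.
  split=> [k||]; first exact: pr_in.
    apply: (@sub_finite_set _ _ [set` undup t]); last exact: finite_seq.
    by move=> k /=; apply: contraNT => /t0 ->.
  rewrite (fsum_seq (undup_uniq t) t0).
  rewrite -(big_map phi xpredT (fun i => pr dA i v)); apply: pr_sum.
    by rewrite map_inj_uniq ?undup_uniq.
  move=> i im; case: (pselect (exists k, i = phi k)) => [[k iE]|ni].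
    by rewrite iE; apply: t0; apply: contraNN im => kt; rewrite iE; apply: map_f.
  by apply: (A0 i); [move=> k; apply/eqP => e; apply: ni; exists k | apply: pr_in].
move=> f [fA /finite_seqP [r rE] vE]; apply/funext => k.
have r0 j : j \notin undup r -> f j = 0.
  rewrite mem_undup => jr; apply/eqP; apply: contraNT jr => h.
  by have := congr1 (fun B : set nat => B j) rE => /= <-.
rewrite vE (fsum_seq (undup_uniq r) r0) (lin_sum (pr_linear dA _)).
rewrite -(fsum_seq (undup_uniq r)); last by move=> j /r0 ->; rewrite (lin0 (pr_linear dA _)).
rewrite (@fsum_seq _ _ [:: k]) // ?big_seq1; first exact: pr_id.
move=> j; rewrite inE => jk; rewrite (pr_case _ _ (fA j)).
by rewrite ifN //; apply: contraNN jk => /eqP/iphi ->.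
Qed.

Section Binomials.
Context {K : numFieldType}.

Lemma gbinom0 (x : K) : gbinom x 0 = 1.
Proof. by rewrite /gbinom big_ord0 fact0 divr1. Qed.

Lemma gbinomS (x : K) i : i.+1%:R * gbinom x i.+1 = (x - i%:R) * gbinom x i.
Proof.
rewrite /gbinom big_ord_recr factS natrM invfM /=.
have n1 : (i.+1%:R : K) != 0 by rewrite pnatr_eq0.
move: (\prod_(_ < _) _) ((i`!)%:R^-1) => P f.
by move: n1; move: (i.+1%:R) => c n1; field.
Qed.

Lemma gbinom_zero (x : K) i : gbinom x i = 0 -> gbinom x i.+1 = 0.
Proof.
move=> h; have /eqP := gbinomS x i; rewrite h mulr0 mulf_eq0 pnatr_eq0 /=.
by move=> /eqP.
Qed.

Lemma gbinom0S i : gbinom (0 : K) i.+1 = 0.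
Proof.
elim: i => [|i]; last exact: gbinom_zero.
by have := gbinomS (0 : K) 0; rewrite mul1r subr0 mul0r.
Qed.

Lemma gbinom1 : gbinom (1 : K) 1 = 1.
Proof. by have := gbinomS (1 : K) 0; rewrite mul1r subr0 mul1r gbinom0. Qed.

Lemma gbinom1SS i : gbinom (1 : K) i.+2 = 0.
Proof.
elim: i => [|i]; last exact: gbinom_zero.
have /eqP := gbinomS (1 : K) 1; rewrite subrr mul0r mulf_eq0 pnatr_eq0 /=.
by move=> /eqP.
Qed.

Lemma gbinomN1 i : gbinom (- 1 : K) i = (-1) ^+ i.
Proof.
elim: i => [|i IH]; first by rewrite gbinom0.
have n1 : (i.+1%:R : K) != 0 by rewrite pnatr_eq0.
by apply: (mulfI n1); rewrite gbinomS IH exprS mulrA mulrN1 -opprD nat1r mulNr.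
Qed.

End Binomials.

(** * Modes on a module, from the Jacobi identity *)

Section ModuleBasics.
Context {R : realType} {V : voa R} (W : voa_module V).
Local Notation K := R[i].
Local Notation Y := (@mod_Y R V W).
Local Notation YV := (@voa_Y R V).

Lemma Yl u n : linear (Y u n). Proof. exact: (mod_Y_bilinear W).1. Qed.
Lemma Yr n w : linear (fun u => Y u n w). Proof. exact: (mod_Y_bilinear W).2. Qed.

Lemma trunc_nat u w (m : int) : exists N : nat, forall i : nat, (N <= i)%N -> Y u (m + i%:Z) w = 0.
Proof.
have [N hN] := mod_Y_trunc u w; exists `|N - m|%N => i iN; apply: hN; lia.
Qed.

(** The case l = 0 of the Jacobi identity: only i = 0 survives on its left side. *)
Lemma mode_comm u v (m n : int) w N : (forall i : nat, (N <= i)%N -> YV u i%:Z v = 0) ->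
  Y u m (Y v n w) - Y v n (Y u m w) =
  \sum_(i < N) gbinom (m%:~R : K) i *: Y (YV u i%:Z v) (m + n - i%:Z) w.
Proof.
move=> uv; have := mod_jacobi (v := W) u v w 0 m n.
rewrite (@fsum_nat _ 1); last first.
  by case=> // i _; rewrite gbinom0S mulr0 scale0r.
rewrite big_ord1 gbinom0 mulr1 expr0 scale1r /= !addr0 ?subr0 expr0z scale1r => ->.
rewrite (@fsum_nat _ N); last by move=> i /uv; rewrite add0r => ->; rewrite (lin0 (Yr _ _)) scaler0.
by apply: eq_bigr => i _; rewrite add0r.
Qed.

(** The case l = -1, m = 0: the binomial of -1 is (-1)^i, which cancels the sign, and the right side
    is reduced to i = 0. *)
Lemma mode_iter u v (n : int) w N : (forall i : nat, (N <= i)%N -> Y v (n + i%:Z) w = 0) ->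
  (forall i : nat, (N <= i)%N -> Y u i%:Z w = 0) ->
  Y (YV u (-1) v) n w = \sum_(i < N) (Y u (-1 - i%:Z) (Y v (n + i%:Z) w) + Y v (n - 1 - i%:Z) (Y u i%:Z w)).
Proof.
move=> hv hu; have := mod_jacobi (v := W) u v w (-1) 0 n.
rewrite (@fsum_nat _ N); last first.
  by move=> i iN; rewrite !add0r hv // hu // !(lin0 (Yl _ _)) scaler0 subr0 scaler0.
rewrite (@fsum_nat _ 1); last first.
  by case=> // i _; rewrite gbinom0S scale0r.
rewrite big_ord1 gbinom0 scale1r (_ : -1 + _ = -1) // (_ : 0 + n - _ = n) => [<-|]; last by rewrite add0r subr0.
apply: eq_bigr => i _; rewrite [(-1)%:~R]mulrNz mulr1z gbinomN1 -expr2 sqrr_sign scale1r.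
by rewrite !add0r exprN1 invrN1 scaleN1r opprK.
Qed.

Lemma mode_L0 u (n : int) w :
  Y (voa_omega V) 1 (Y u n w) - Y u n (Y (voa_omega V) 1 w) =
  Y (YV (voa_omega V) 1 u) n w - (n + 1)%:~R *: Y u n w.
Proof.
have [N hN] := voa_Y_trunc (voa_omega V) u.
rewrite (@mode_comm _ _ _ _ _ `|N|%N.+2); last by move=> i iN; apply: hN; lia.
rewrite !big_ord_recl big1 ?addr0; last by move=> i _; rewrite /bump /= gbinom1SS scale0r.
rewrite gbinom0 -[(lift ord0 ord0)%:Z]/(1 : int) (_ : 1 + n - 1 = n); last by rewrite addrC addKr.
rewrite gbinom1 !scale1r addrC; congr (_ + _).
have := @mod_Lm1 _ _ W u (1 + n) w; rewrite /voa_L addNr => ->.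
by rewrite [1 + n]addrC addrK scaleNr.
Qed.

(** L(0) separates the components, having a different eigenvalue on each; this is how the effect of
    a mode on the grading is found. *)
Lemma L0_gr (mu : K) w : Y (voa_omega V) 1 w = mu *: w -> mod_gr mu w.
Proof.
move=> wmu; have dW := mod_gr_sum W.
have E lam v : pr dW lam (Y (voa_omega V) 1 v) = lam *: pr dW lam v.
  apply: (graded_lin_ext dW (f := fun v => pr dW lam (Y (voa_omega V) 1 v)) (g := fun v => lam *: pr dW lam v)).
  - by apply: linear_comp; [exact: pr_linear | exact: Yl].
  - exact: linear_scale (pr_linear dW lam).
  move=> i x xi; rewrite (mod_L0 xi) (linZ (pr_linear dW lam)) (pr_case dW _ xi).
  by case: eqP => [->//|]; rewrite !scaler0.
have [s us sP] := pr_supp dW w.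
suff h lam : lam != mu -> pr dW lam w = 0.
  rewrite (@pr_sum _ _ _ _ dW w [:: mu]) // ?big_seq1; first exact: pr_in.
  by move=> i; rewrite inE; apply: h.
move=> lm; have := E lam w; rewrite wmu (linZ (pr_linear dW lam)) => /eqP.
by rewrite -subr_eq0 -scalerBl scaler_eq0 subr_eq0 eq_sym (negbTE lm) /= => /eqP.
Qed.

Lemma mode_gr (h : int) u (n : int) (lam : K) w : voa_gr h u -> mod_gr lam w ->
  mod_gr (lam + (h - n - 1)%:~R) (Y u n w).
Proof.
move=> uh wl; apply: L0_gr; have := mode_L0 u n w.
rewrite (mod_L0 wl) (voa_L0 uh) (linZ (Yl _ _)) (linZ (Yr _ _)) => /eqP.
rewrite subr_eq => /eqP ->; rewrite -scalerBl -scalerDl; congr (_ *: _).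
by rewrite !rmorphB rmorphD /=; ring.
Qed.

Section LowestWeight.
Variable n0 : K.
Hypothesis dW : direct_sum (fun k : nat => @mod_gr R V W (n0 + k%:R)).
Local Notation Wg k := (@mod_gr R V W (n0 + k%:R)).

Lemma gr_out (lam : K) w : (forall k : nat, lam != n0 + k%:R) -> @mod_gr R V W lam w -> w = 0.
Proof.
move=> hl wl; have dG := mod_gr_sum W.
suff h x : pr dG lam x = 0 by rewrite -(pr_id dG wl) h.
apply: (graded_ind dW (P := [set x | pr dG lam x = 0])).
  split; first exact: lin0 (pr_linear dG lam).
  by move=> a u v /= u0 v0; rewrite (pr_linear dG lam) u0 v0 scaler0 addr0.
by move=> k v vk; rewrite /= (pr_case dG _ vk) (negbTE (hl k)).
Qed.

Lemma mode_ngr (h k j : nat) u (n : int) w : @voa_gr R V h%:Z u -> Wg k w ->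
  (j%:Z = k%:Z + h%:Z - n - 1) -> Wg j (Y u n w).
Proof.
move=> uh wk jE; have := mode_gr n uh wk; rewrite -addrA (_ : k%:R + _ = j%:R) //.
by rewrite -[k%:R]/((k%:Z)%:~R) -rmorphD /= -[j%:R]/((j%:Z)%:~R) jE; congr (_%:~R); ring.
Qed.

Lemma mode_ngr0 (h k : nat) u (n : int) w : @voa_gr R V h%:Z u -> Wg k w ->
  (k%:Z + h%:Z - n - 1 < 0) -> Y u n w = 0.
Proof.
move=> uh wk neg; apply: (gr_out _ (mode_gr n uh wk)) => j.
rewrite -addrA (inj_eq (addrI n0)) -[k%:R]/((k%:Z)%:~R) -rmorphD /= -[j%:R]/((j%:Z)%:~R).
by rewrite eqr_int; apply/eqP; lia.
Qed.

End LowestWeight.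
End ModuleBasics.

Section PositiveEnergy.
Context {R : realType} (V : voa R).
Hypothesis posV : positive_energy V.
Local Notation K := R[i].
Definition Vg (k : nat) : set V := voa_gr k%:Z.

Lemma Vg_sum : direct_sum Vg.
Proof.
apply: (direct_sum_reindex (voa_gr_sum V)) => [i j [->] //|i v hi vi].
apply: (posV.1 i) => //; case: i hi vi => // i hi _.
by have := hi i; rewrite eqxx.
Qed.

(** V is treated as a module with n0 = 0, so that statements on graded modules specialize to it. *)
Lemma adjoint_Vg (k : nat) : @mod_gr R V (adjoint_module V) (0 + k%:R) = Vg k.
Proof. by rewrite add0r; exact: (adjoint_gr_int V k%:Z). Qed.

Lemma adjoint_sum : direct_sum (fun k : nat => @mod_gr R V (adjoint_module V) (0 + k%:R)).
Proof.
by rewrite (_ : (fun k : nat => _) = Vg) ?[X in direct_sum X]/Vg; [exact: Vg_sum | apply/funext => k; exact: adjoint_Vg].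
Qed.

Lemma mode_Vg (h k j : nat) (u v : V) (n : int) : Vg h u -> Vg k v ->
  (j%:Z = k%:Z + h%:Z - n - 1) -> Vg j (voa_Y u n v).
Proof.
rewrite -![Vg]/(Vg) -(adjoint_Vg k) -(adjoint_Vg j); exact: mode_ngr.
Qed.

Lemma mode_Vg0 (h k : nat) (u v : V) (n : int) : Vg h u -> Vg k v ->
  (k%:Z + h%:Z - n - 1 < 0) -> voa_Y u n v = 0.
Proof. by rewrite -(adjoint_Vg k); apply: (mode_ngr0 adjoint_sum). Qed.

End PositiveEnergy.

(** * Spanning sets of C_2-cofinite modules *)

Section Words.
Context {R : realType} {V : voa R}.
Hypothesis posV : positive_energy V.
Local Notation K := R[i].
Local Notation Vg := (@Vg R V).

(** The homogeneous form of C_2-cofiniteness: in high degree nothing lies outside C_2(V), and both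
    factors may be taken homogeneous, of total weight k - 1. *)
Definition C2hom (N0 : nat) := forall k, (N0 < k)%N -> Vg k `<=`
  lspan [set y | exists h j u x, [/\ (0 < h)%N, Vg h u, Vg j x, (j + h).+1 = k & y = voa_Y u (-2) x]].

Lemma Lm1_Vg h (u : V) : Vg h u -> Vg h.+1 (voa_L (-1) u).
Proof.
move=> uh; have o2 : Vg 2 (voa_omega V) by exact: voa_omega_gr.
by apply: (mode_Vg o2 uh); lia.
Qed.

Lemma Vg0_vac (u : V) : Vg 0 u -> exists c, u = c *: voa_one V.
Proof.
rewrite /Vg -[0%N%:Z]/(0 : int) posV.2.
apply: (@lspan_min _ _ _ [set u | exists c, u = c *: voa_one V]).
  split; first by exists 0; rewrite scale0r.
  by move=> a _ _ [c ->] [d ->]; exists (a * c + d); rewrite scalerA scalerDl.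
by move=> _ ->; exists 1; rewrite scale1r.
Qed.

Variables (W : voa_module V) (n0 : K).
Hypothesis dW : direct_sum (fun k : nat => @mod_gr R V W (n0 + k%:R)).
Local Notation Wg k := (@mod_gr R V W (n0 + k%:R)).
Local Notation Y := (@mod_Y R V W).
Variable w0 : W.
Hypothesis w0_gr : Wg 0 w0.
Hypothesis w0_gen : forall S : set W, is_submodule S -> S w0 -> forall w, S w.

Local Notation letter := (V * nat * int)%type.

Definition wact (s : seq letter) (w : W) := foldr (fun (l : letter) w => Y l.1.1 l.2 w) w s.
Definition wd (s : seq letter) := wact s w0.
Definition valid (s : seq letter) := forall l, l \in s -> Vg l.1.2 l.1.1.
(** Three measures drive the reduction of words: [deg], the total weight of the letters, drops in
    commutators; [exc] is the degree above n0 that the word reaches; [pot], the sum of the squared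
    mode indices, grows when equal letters are spread apart. *)
Fixpoint deg (s : seq letter) : nat := if s is l :: s' then (l.1.2 + deg s')%N else 0%N.
Fixpoint exc (s : seq letter) : int :=
  if s is l :: s' then (l.1.2%:Z - l.2 - 1) + exc s' else 0.
Fixpoint pot (s : seq letter) : nat := if s is l :: s' then (`|l.2| ^ 2 + pot s')%N else 0%N.

Lemma act_cat s t w : wact (s ++ t) w = wact s (wact t w).
Proof. by rewrite /wact foldr_cat. Qed.
Lemma act_linear s : linear (wact s).
Proof. by elim: s => [|l s IH] a u v //=; rewrite IH (Yl _ _). Qed.
Lemma wd_cat s t : wd (s ++ t) = wact s (wd t). Proof. exact: act_cat. Qed.
Lemma deg_cat s t : deg (s ++ t) = (deg s + deg t)%N.
Proof. by elim: s => //= l s ->; rewrite addnA. Qed.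
Lemma exc_cat s t : exc (s ++ t) = exc s + exc t.
Proof. by elim: s => [|l s IH] /=; rewrite ?add0r // IH addrA. Qed.
Lemma pot_cat s t : pot (s ++ t) = (pot s + pot t)%N.
Proof. by elim: s => //= l s ->; rewrite addnA. Qed.
Lemma valid_cat s t : valid (s ++ t) <-> valid s /\ valid t.
Proof.
split=> [h|[h1 h2] l]; last by rewrite mem_cat => /orP[/h1|/h2].
by split=> l ls; apply: h; rewrite mem_cat ls ?orbT.
Qed.
Lemma valid_cons l s : valid (l :: s) <-> Vg l.1.2 l.1.1 /\ valid s.
Proof.
split=> [h|[h1 h2] l']; last by rewrite inE => /orP[/eqP -> //|/h2].
by split=> [|l' ls]; apply: h; rewrite inE ?eqxx ?ls ?orbT.
Qed.

Lemma wd_gr s : valid s -> (forall k : nat, exc s = k%:Z -> Wg k (wd s)) /\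
  (exc s < 0 -> wd s = 0).
Proof.
elim: s => [_|[[a h] n] s IH /valid_cons [/= va vs]].
  by split=> // k /= [<-].
have [IH1 IH2] := IH vs.
case: (ltrP (exc s) 0) => es.
  rewrite /= IH2 // (lin0 (Yl _ _)); split=> // k _; exact: (dW.1 k).1.
have [j jE] : exists j : nat, exc s = j%:Z by exists `|exc s|%N; lia.
split=> [k kE|e0].
  by apply: (mode_ngr va (IH1 j jE)); move: kE; rewrite jE /=; lia.
by apply: (mode_ngr0 dW va (IH1 j jE)); move: e0; rewrite jE /=; lia.
Qed.

Section Target.
Variable m : nat.
Hypothesis m2 : (2 <= m)%N.

Definition Cgen (k : nat) : set W :=
  [set y | exists h j u x, [/\ (0 < h)%N, Vg h u, Wg j x, (j + h + m)%N = k.+1 & y = Y u (- m%:Z) x]].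
Definition Tm (k : nat) := lspan (Cgen k).

Lemma Tm_sub k : subspace (Tm k). Proof. exact: lspan_subspace. Qed.

(** Modes below - m reduce to - m, since u_(-m-i-1) is a multiple of (L(-1) u)_(-m-i); a letter of
    weight 0 is a multiple of the vacuum and acts by 0 there. *)
Lemma Cm_letter i h u j w k : Vg h u -> Wg j w -> (j + h + m + i)%N = k.+1 ->
  Tm k (Y u (- (m + i)%N%:Z) w).
Proof.
elim: i h u => [|i IH] h u uh wj jk.
  rewrite addn0; case: h uh jk => [|h] uh jk; last first.
    by apply: sub_lspan; exists h.+1, j, u, w; split=> //; lia.
  have [c ->] := Vg0_vac uh; rewrite (linZ (Yr _ _)) mod_vacuum ifN; last by lia.
  by rewrite scaler0; case: (Tm_sub k).
have := @mod_Lm1 _ _ W u (- (m + i)%N%:Z) w.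
rewrite (_ : - (m + i)%N%:Z - 1 = - (m + i.+1)%N%:Z); last by lia.
rewrite mulrNz opprK => E.
have n1 : ((m + i)%N%:Z%:~R : K) != 0 by rewrite intr_eq0; lia.
have -> : Y u (- (m + i.+1)%N%:Z) w = ((m + i)%N%:Z%:~R)^-1 *: Y (voa_L (-1) u) (- (m + i)%N%:Z) w.
  by rewrite E scalerA mulVf // scale1r.
apply: (sub_scaleP (Tm_sub k)); apply: (IH h.+1) => //; last by lia.
exact: Lm1_Vg.
Qed.

Variable N0 : nat.
Hypothesis hC2 : C2hom N0.
Variable xs : seq (V * nat).
Hypothesis xs_le : forall x, x \in xs -> (x.2 <= N0)%N /\ Vg x.2 x.1.
Hypothesis xs_span : forall h, (h <= N0)%N -> Vg h `<=` lspan [set y | (y, h) \in xs].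

(** There are at most |xs| (N0 + m) distinct letters with mode index between - m and the weight, and
    each raises the degree by at most N0 + m. *)
Definition bnd := (size xs * (N0 + m) * (N0 + m))%N.
Definition good s := forall k : nat, exc s = k%:Z -> (bnd < k)%N -> Tm k (wd s).

Section Step.
Variables (p k : nat).
Hypothesis bk : (bnd < k)%N.
Hypothesis IHp : forall s, valid s -> (deg s < p)%N -> good s.

(** The commutator of a and b is a sum of single letters a_i b of weight h + l - i - 1 < h + l, so
    letters commute modulo words of smaller [deg]. *)
Lemma swap s1 x y s2 : valid (s1 ++ x :: y :: s2) -> (deg (s1 ++ x :: y :: s2) <= p)%N ->
  exc (s1 ++ x :: y :: s2) = k%:Z ->
  Tm k (wd (s1 ++ x :: y :: s2) - wd (s1 ++ y :: x :: s2)).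
Proof.
case: x => [[a h] n]; case: y => [[b l] n'].
move=> /valid_cat [v1 /valid_cons [/= va /valid_cons [/= vb v2]]].
rewrite deg_cat exc_cat /= => dp ek; rewrite !wd_cat -(linB (act_linear s1)) /=.
rewrite (@mode_comm _ _ _ _ _ _ _ _ (h + l)%N); last first.
  by move=> i hi; apply: (mode_Vg0 posV va vb); lia.
rewrite (lin_sum (act_linear s1)); apply: (sub_sumP (Tm_sub k)) => i _.
rewrite (linZ (act_linear s1)); apply: (sub_scaleP (Tm_sub k)).
have -> : wact s1 (Y (voa_Y a i%:Z b) (n + n' - i%:Z) (wact s2 w0)) =
   wd (s1 ++ ((voa_Y a i%:Z b, (h + l - i).-1)%N, n + n' - i%:Z) :: s2) by rewrite wd_cat.
have il := ltn_ord i; apply: IHp => //.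
- apply/valid_cat; split=> //; apply/valid_cons; split=> //=.
  by apply: (mode_Vg va vb); lia.
- by rewrite deg_cat /=; lia.
- by rewrite exc_cat /= -ek; lia.
Qed.

Lemma move_letter s0 s1 x s2 : valid (s0 ++ s1 ++ x :: s2) ->
  (deg (s0 ++ s1 ++ x :: s2) <= p)%N -> exc (s0 ++ s1 ++ x :: s2) = k%:Z ->
  Tm k (wd (s0 ++ s1 ++ x :: s2) - wd (s0 ++ x :: s1 ++ s2)).
Proof.
elim: s1 s0 => [|y s1 IH] s0 v d e; first by rewrite subrr; case: (Tm_sub k).
have E : s0 ++ (y :: s1) ++ x :: s2 = rcons s0 y ++ s1 ++ x :: s2 by rewrite cat_rcons.
have H1 := IH (rcons s0 y); rewrite -E in H1; have {}H1 := H1 v d e; rewrite cat_rcons in H1.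
have {v}[v0 /valid_cat [/valid_cons [vy v1] /valid_cons [vx v2]]] := (valid_cat _ _).1 v.
have H2 : Tm k (wd (s0 ++ y :: x :: s1 ++ s2) - wd (s0 ++ x :: y :: s1 ++ s2)).
  apply: swap.
  - by apply/valid_cat; split=> //; do 2 (apply/valid_cons; split=> //); apply/valid_cat.
  - by move: d; rewrite !deg_cat /= ?deg_cat /=; lia.
  - by rewrite -e !exc_cat /= ?exc_cat /=; lia.
have := sub_addP (Tm_sub k) H1 H2; rewrite addrA subrK; exact.
Qed.

Lemma move_back s0 x s1 : valid (s0 ++ x :: s1) -> (deg (s0 ++ x :: s1) <= p)%N ->
  exc (s0 ++ x :: s1) = k%:Z -> Tm k (wd (s0 ++ s1 ++ [:: x])) -> Tm k (wd (s0 ++ x :: s1)).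
Proof.
move=> v d e h.
have H := @move_letter s0 s1 x [::]; rewrite cats0 in H.
have {v}[v0 /valid_cons [vx v1]] := (valid_cat _ _).1 v.
have {}H : Tm k (wd (s0 ++ s1 ++ [:: x]) - wd (s0 ++ x :: s1)).
  apply: H.
  - by apply/valid_cat; split=> //; apply/valid_cat; split=> //; apply/valid_cons.
  - by move: d; rewrite !deg_cat /=; lia.
  - by rewrite -e !exc_cat /=; lia.
have := sub_subP (Tm_sub k) h H; by rewrite opprB addrC subrK.
Qed.

(** Moved to the end, such a letter would send the lowest vector [w0] below degree 0. *)
Lemma kill_letter s0 x s1 : valid (s0 ++ x :: s1) -> (deg (s0 ++ x :: s1) <= p)%N ->
  exc (s0 ++ x :: s1) = k%:Z -> x.1.2%:Z <= x.2 -> Tm k (wd (s0 ++ x :: s1)).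
Proof.
move=> v d e xn; apply: move_back => //.
have {v}[v0 /valid_cons [vx v1]] := (valid_cat _ _).1 v.
rewrite catA wd_cat (_ : wd [:: x] = 0) ?(lin0 (act_linear _)); first by case: (Tm_sub k).
by apply: (mode_ngr0 dW vx w0_gr); lia.
Qed.

Lemma front_letter s0 x s1 : valid (s0 ++ x :: s1) -> (deg (s0 ++ x :: s1) <= p)%N ->
  exc (s0 ++ x :: s1) = k%:Z -> x.2 <= - m%:Z -> Tm k (wd (s0 ++ x :: s1)).
Proof.
move=> v d e xn; have := @move_letter [::] s0 x s1 v d e.
have {v}[v0 /valid_cons [vx v1]] := (valid_cat _ _).1 v.
have v01 : valid (s0 ++ s1) by apply/valid_cat.
have [g1 g2] := wd_gr v01.
rewrite /= => H; rewrite -[wd _](subrK (wd (x :: s0 ++ s1))).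
apply: (sub_addP (Tm_sub k)); first exact: H.
case: x vx {H} xn d e => [[a h] n] /= vx xn d e.
case: (ltrP (exc (s0 ++ s1)) 0) => es.
  by rewrite g2 // (lin0 (Yl _ _)); case: (Tm_sub k).
have [j jE] : exists j : nat, exc (s0 ++ s1) = j%:Z by exists `|exc (s0 ++ s1)|%N; lia.
have [i iE] : exists i : nat, n = - (m + i)%N%:Z by exists (absz (n + m%:Z)); lia.
rewrite iE; apply: (Cm_letter vx (g1 j jE)).
by move: e jE; rewrite !exc_cat /=; lia.
Qed.

(** A letter of weight above [N0] is a combination of u_(-2) x = (L(-1) u)_(-1) x, which the iterate
    formula splits into pairs of letters from u and x; their total weight is h - 1, so [deg]
    drops. *)
Lemma C2_letter s0 a h n s1 : valid (s0 ++ (a, h, n) :: s1) ->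
  (deg (s0 ++ (a, h, n) :: s1) <= p)%N ->
  exc (s0 ++ (a, h, n) :: s1) = k%:Z -> (N0 < h)%N -> Tm k (wd (s0 ++ (a, h, n) :: s1)).
Proof.
move=> /valid_cat [v0 /valid_cons [/= va v1]]; rewrite deg_cat exc_cat /= => d e hN.
have := hC2 hN va; move: a {va} => a.
rewrite wd_cat /= -/(wd s1).
apply: (@lspan_min _ _ _ [set a | Tm k (wact s0 (Y a n (wd s1)))]).
  apply: (subspace_preim (f := fun a => wact s0 (Y a n (wd s1)))); last exact: Tm_sub.
  exact: linear_comp (act_linear s0) (Yr _ _).
move=> _ [h1 [j [u [x [h0 uh xj hE ->]]]]] /=.
have uE w n' : Y (voa_L (-1) u) n' w = - n'%:~R *: Y u (n' - 1) w by exact: mod_Lm1.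
have -> : voa_Y u (-2) x = voa_Y (voa_L (-1) u) (-1) x.
  by rewrite /voa_L addNr voa_Lm1 mulrNz mulr1z opprK scale1r.
have [N1 hN1] := trunc_nat x (wd s1) n.
have [N2 hN2] := trunc_nat (voa_L (-1) u) (wd s1) 0.
rewrite (@mode_iter _ _ _ _ _ _ _ (N1 + N2)%N); first last.
- by move=> i ii; have := hN2 i; rewrite add0r; apply; lia.
- by move=> i ii; apply: hN1; lia.
rewrite (lin_sum (act_linear s0)); apply: (sub_sumP (Tm_sub k)) => i _.
rewrite (linD (act_linear s0)) !uE !(linZ (Yl _ _)) !(linZ (act_linear s0)).
have key l1 l2 : valid [:: l1; l2] -> (l1.1.2 + l2.1.2 < h)%N ->
    exc [:: l1; l2] = h%:Z - n - 1 -> Tm k (wact s0 (Y l1.1.1 l1.2 (Y l2.1.1 l2.2 (wd s1)))).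
  move=> v12 d12 e12.
  rewrite -[X in Tm k X]/(wact s0 (wd (l1 :: l2 :: s1))) -wd_cat.
  have {v12} /valid_cons [vl1 /valid_cons [vl2 _]] := v12.
  apply: IHp => //.
  - by apply/valid_cat; split=> //; do 2 (apply/valid_cons; split=> //).
  - by rewrite deg_cat /=; lia.
  - by rewrite -e exc_cat /=; move: e12; rewrite /=; lia.
apply: (sub_addP (Tm_sub k)); apply: (sub_scaleP (Tm_sub k)).
- apply: (key (u, h1, -1 - i%:Z - 1) (x, j, n + i%:Z)) => /=; try lia.
  by do 2 (apply/valid_cons; split=> //).
- apply: (key (x, j, n - 1 - i%:Z) (u, h1, i%:Z - 1)) => /=; try lia.
  by do 2 (apply/valid_cons; split=> //).
Qed.

Definition in_xs (s : seq letter) := all (fun l => l.1 \in xs) s.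

Lemma in_xs_valid s : in_xs s -> valid s.
Proof. by move=> /allP h l /h /xs_le []. Qed.

Lemma reduce_letters r : (forall s, in_xs s -> size s = r -> deg s = p -> exc s = k%:Z -> Tm k (wd s)) ->
  forall s, valid s -> size s = r -> deg s = p -> exc s = k%:Z -> Tm k (wd s).
Proof.
move=> H s; rewrite -[s]cat0s; have : in_xs [::] by [].
move: [::] => s1; elim: s s1 => [|[[a h] n] s2 IH] s1 i1.
  by rewrite cats0 => _; apply: H.
move=> v sz d e; case: (ltnP N0 h) => hN; first by apply: C2_letter => //; rewrite d.
have {v}[v1 /valid_cons [/= va v2]] := (valid_cat _ _).1 v.
move: sz d e; rewrite size_cat deg_cat exc_cat /= => sz d e.
have := xs_span hN va; rewrite wd_cat /= -/(wd s2); move: a {va} => a.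
apply: (@lspan_min _ _ _ [set a | Tm k (wact s1 (Y a n (wd s2)))]).
  apply: (subspace_preim (f := fun a => wact s1 (Y a n (wd s2)))); last exact: Tm_sub.
  exact: linear_comp (act_linear s1) (Yr _ _).
move=> x /= xxs.
rewrite -[X in Tm k X]/(wact s1 (wd ((x, h, n) :: s2))) -wd_cat -cat_rcons.
have ix : in_xs (rcons s1 (x, h, n)) by rewrite /in_xs all_rcons /= xxs.
apply: IH => //.
- by apply/valid_cat; split=> //; apply: in_xs_valid.
- by rewrite size_cat size_rcons -sz addnS addSn.
- by rewrite cat_rcons deg_cat /=; lia.
- by rewrite cat_rcons exc_cat /=; lia.
Qed.

End Step.

Lemma pot_le B (s : seq letter) : (forall l : letter, l \in s -> `|l.2| <= B)%N -> (pot s <= size s * B ^ 2)%N.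
Proof.
elim: s => [//|l s IH] h /=; rewrite mulSn leq_add //.
  by rewrite leq_exp2r // h ?mem_head.
by apply: IH => l' ls; apply: h; rewrite inE ls orbT.
Qed.

Lemma exc_ge0 (s : seq letter) : (forall l : letter, l \in s -> l.2 < l.1.2%:Z) -> 0 <= exc s.
Proof.
elim: s => [//|l s IH] h /=.
have h1 : l.2 < l.1.2%:Z by apply: h; apply: mem_head.
have h2 : 0 <= exc s by apply: IH => l' ls; apply: h; rewrite inE ls orbT.
by lia.
Qed.

Lemma exc_ge (s : seq letter) (l : letter) :
  (forall l : letter, l \in s -> l.2 < l.1.2%:Z) -> l \in s ->
  l.1.2%:Z - l.2 - 1 <= exc s.
Proof.
elim: s => [//|l' s IH] h /=.
have hs (l2 : letter) : l2 \in s -> l2.2 < l2.1.2%:Z by move=> ls; apply: h; rewrite inE ls orbT.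
have h1 : l'.2 < l'.1.2%:Z by apply: h; apply: mem_head.
have h2 := exc_ge0 hs.
rewrite inE => /orP[/eqP -> |ls]; first by lia.
by have := IH hs ls; lia.
Qed.

Lemma exc_le B (s : seq letter) : (forall l : letter, l \in s -> l.1.2%:Z - l.2 - 1 <= B%:Z) ->
  exc s <= (size s * B)%N%:Z.
Proof.
elim: s => [//|l s IH] h /=; rewrite mulSn.
have := h l (mem_head _ _).
have : exc s <= (size s * B)%N%:Z by apply: IH => l' ls; apply: h; rewrite inE ls orbT.
by lia.
Qed.

Lemma split_notuniq (T : eqType) (s : seq T) : ~~ uniq s ->
  exists x s0 s1 s2, s = s0 ++ x :: s1 ++ x :: s2.
Proof.
elim: s => [//|x s IH] /=; rewrite negb_and negbK => /orP[xs'|/IH [y [s0 [s1 [s2 ->]]]]].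
  by case/splitPr: xs' => s1 s2; exists x, [::], s1, s2.
by exists y, (x :: s0), s1, s2.
Qed.

(** Once the letters that kill [w0] and those that can be moved to the front are excluded, a word
    without repetition is too short to reach a degree above [bnd]. *)
Lemma good_uniq p k s : (bnd < k)%N -> (forall s, valid s -> (deg s < p)%N -> good s) ->
  in_xs s -> deg s = p -> exc s = k%:Z -> uniq s -> Tm k (wd s).
Proof.
move=> bk IHp ix d e us; have v := in_xs_valid ix.
case: (pselect (exists2 l : letter, l \in s & l.1.2%:Z <= l.2)) => [[l /splitPr ls ll]|hlow].
  by case: ls v d e => s0 s1 v d e; apply: (kill_letter bk IHp) => //; rewrite d.
case: (pselect (exists2 l : letter, l \in s & l.2 <= - m%:Z)) => [[l /splitPr ls ll]|hfr].
  by case: ls v d e => s0 s1 v d e; apply: (front_letter bk IHp) => //; rewrite d.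
exfalso; pose L := [seq (x, j) | x <- xs, j <- [seq i%:Z - m%:Z + 1 | i <- iota 0 (N0 + m)]].
have bl (l : letter) : l \in s -> [/\ l.1 \in xs, - m%:Z < l.2, l.2 < l.1.2%:Z & (l.1.2 <= N0)%N].
  move=> ls; have lx := allP ix l ls; split=> //; last by case: (xs_le lx).
    by rewrite ltNge; apply/negP => h; apply: hfr; exists l.
  by rewrite ltNge; apply/negP => h; apply: hlow; exists l.
have sL : (size s <= size L)%N.
  apply: uniq_leq_size => // l /bl [lx l1 l2 l3].
  rewrite [l]surjective_pairing; apply: allpairs_f => //.
  case: l {lx} l1 l2 l3 => [[a h] n] /= l1 l2 l3.
  apply/mapP; exists (absz (n + m%:Z - 1)%R); last by lia.
  by rewrite mem_iota; lia.
have H : exc s <= (size s * (N0 + m))%N%:Z by apply: exc_le => l /bl [lx l1 l2 l3]; lia.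
rewrite e in H; move: bk sL; rewrite /bnd size_allpairs size_map size_iota => bk sL.
have := leq_mul sL (leqnn (N0 + m)); lia.
Qed.

(** Two equal letters a_n a_n form the middle term of (a_(-1) a)_(2n+1), which gives a shorter word
    of the same [deg]; every other term a_j a_(2n-j) has a larger [pot]. As [pot] is bounded when no
    letter kills [w0], pushing it upward ends. *)
Lemma good_step p k r : (bnd < k)%N -> (forall s, valid s -> (deg s < p)%N -> good s) ->
  (forall s, valid s -> (size s < r)%N -> deg s = p -> exc s = k%:Z -> Tm k (wd s)) ->
  forall s, valid s -> size s = r -> deg s = p -> exc s = k%:Z -> Tm k (wd s).
Proof.
move=> bk IHp IHr; apply: reduce_letters => // s ix sz d e.
(* If every mode index n is below its weight h, no letter lowers the degree, so h - n - 1 <= k for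
   each, whence |n| <= N0 + k + 1. *)
pose B := (r * (N0 + k + 1) ^ 2)%N.
have [t] : exists t, (B < pot s + t)%N by exists B.+1; lia.
elim: t s ix sz d e => [|t IHt] s ix sz d e Bs; have v := in_xs_valid ix.
  case: (pselect (exists2 l : letter, l \in s & l.1.2%:Z <= l.2)) => [[l /splitPr ls ll]|hlow].
    by case: ls v d e => s0 s1 v d e; apply: (kill_letter bk IHp) => //; rewrite d.
  exfalso; have hl (l : letter) : l \in s -> l.2 < l.1.2%:Z.
    by move=> ls; rewrite ltNge; apply/negP => h; apply: hlow; exists l.
  suff : (pot s <= B)%N by lia.
  rewrite /B -sz; apply: pot_le => l ls; have := exc_ge hl ls; have := hl l ls; rewrite e.
  have [+ _] := xs_le (allP ix l ls).
  by case: (l) => [[a h] n] /=; lia.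
case: (boolP (uniq s)) => us; first exact: (good_uniq bk IHp ix d e us).
have [x [s0 [s1 [s2 sE]]]] := split_notuniq us.
rewrite sE in v d e.
have mv : Tm k (wd (s0 ++ x :: s1 ++ x :: s2) - wd (s0 ++ x :: x :: s1 ++ s2)).
  have := move_letter bk IHp (s0 := rcons s0 x) (s1 := s1) (x := x) (s2 := s2); rewrite !cat_rcons; apply=> //.
  by rewrite d.
rewrite sE -[wd _](subrK (wd (s0 ++ x :: x :: s1 ++ s2))); apply: (sub_addP (Tm_sub k)) => //.
have {}v : valid (s0 ++ x :: x :: s1 ++ s2) by move=> l ls; apply: v; move: ls; rewrite !(mem_cat, inE); case: (l == x) => //=; rewrite ?orbT.
have {}sz : size (s0 ++ x :: x :: s1 ++ s2) = r by rewrite -sz sE !size_cat /= !size_cat /=; lia.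
have {}ix : in_xs (s0 ++ x :: x :: s1 ++ s2).
  by move: ix; rewrite sE /in_xs !all_cat /= !all_cat /=; case: (x.1 \in xs); rewrite ?andbF //= ?andbT.
have {}Bs : (B < pot (s0 ++ x :: x :: s1 ++ s2) + t.+1)%N.
  by move: Bs; rewrite sE !pot_cat /= !pot_cat /=; lia.
have {}d : deg (s0 ++ x :: x :: s1 ++ s2) = p by rewrite -d !deg_cat /= !deg_cat /=; lia.
have {}e : exc (s0 ++ x :: x :: s1 ++ s2) = k%:Z by rewrite -e !exc_cat /= !exc_cat /=; lia.
move: (s1 ++ s2) v sz ix Bs d e => {mv sE us}s1' v sz ix Bs d e.
have [v0 /valid_cons [vx /valid_cons [_ v1]]] := (valid_cat _ _).1 v.
case: x vx v sz ix Bs d e => [[a h] n] /= va v sz ix Bs d e.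
have [N1 hN1] := trunc_nat a (wd s1') (2%:Z * n + 1).
have [N2 hN2] := trunc_nat a (wd s1') 0.
set M := (N1 + N2 + (absz n).+1)%N; pose ws := wd s1'.
have hv (i : nat) : (M <= i)%N -> Y a (2%:Z * n + 1 + i%:Z) ws = 0.
  by move=> ii; apply: hN1; rewrite /M in ii; lia.
have hu (i : nat) : (M <= i)%N -> Y a i%:Z ws = 0.
  by move=> ii; have := hN2 i; rewrite add0r; apply; rewrite /M in ii; lia.
pose pair (j : int) := wact s0 (Y a j (Y a (2%:Z * n - j) ws)).
have pn : pair n = wd (s0 ++ [:: (a, h, n), (a, h, n) & s1']).
  by rewrite wd_cat /pair (_ : 2%:Z * n - n = n) //; lia.
have tot : wact s0 (Y (voa_Y a (-1) a) (2%:Z * n + 1) ws) =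
    \sum_(i < M) (pair (-1 - i%:Z) + pair (2%:Z * n - i%:Z)).
  rewrite (mode_iter hv hu) (lin_sum (act_linear s0)); apply: eq_bigr => i _.
  rewrite (linD (act_linear s0)) /pair; congr (wact s0 (Y a _ (Y a _ ws)) + wact s0 (Y a _ (Y a _ ws))); lia.
have Hj (j : int) : Tm k (pair j - (j == n)%:R *: pair n).
  case: eqP => [->|jn]; first by rewrite scale1r subrr; case: (Tm_sub k).
  rewrite scale0r subr0.
  have -> : pair j = wd (s0 ++ [:: (a, h, j), (a, h, 2%:Z * n - j) & s1']) by rewrite wd_cat.
  apply: IHt.
  - by move: ix; rewrite /in_xs !all_cat.
  - by rewrite -sz !size_cat.
  - by rewrite -d !deg_cat.
  - by rewrite -e !exc_cat /=; lia.
  - move: Bs; rewrite !pot_cat /= => Bs; apply: leq_trans Bs _.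
    have : (absz n ^ 2 + absz n ^ 2 < absz j ^ 2 + absz (2%:Z * n - j)%R ^ 2)%N.
      have S (z : int) : (absz z ^ 2)%N%:Z = z * z by rewrite -mulnn PoszM; lia.
      by rewrite -ltz_nat !PoszD !S; nia.
    by move: (absz n ^ 2)%N (absz j ^ 2)%N (absz (2%:Z * n - j)%R ^ 2)%N => x y z; lia.
(* The one index at which the pair (n, n) occurs: in the first family of terms when n < 0, in the
   second otherwise. *)
pose i0 := if n < 0 then absz (- 1 - n)%R else absz n.
have i0M : (i0 < M)%N by rewrite /i0 /M; case: ifP; lia.
have D : Tm k (wact s0 (Y (voa_Y a (-1) a) (2%:Z * n + 1) ws) - pair n).
  have -> : pair n = \sum_(i < M) (i == i0 :> nat)%:R *: pair n.
    rewrite (bigD1 (Ordinal i0M)) //= eqxx scale1r big1 ?addr0 // => i.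
    by rewrite -val_eqE /= => /negbTE ->; rewrite scale0r.
  rewrite tot -sumrB; apply: (sub_sumP (Tm_sub k)) => i _.
  have := sub_addP (Tm_sub k) (Hj (-1 - i%:Z)) (Hj (2%:Z * n - i%:Z)).
  have E (x y z : W) (b c : K) : x - b *: z + (y - c *: z) = x + y - (b + c) *: z.
    by rewrite addrACA -opprD -scalerDl.
  rewrite E -natrD.
  have -> // : (((-1 - i%:Z)%R == n) + ((2%:Z * n - i%:Z)%R == n))%N = (i == i0 :> nat).
  rewrite /i0; case: ifP => n0'; do 3 (case: eqP => ?) => //=; lia.
have C : Tm k (wact s0 (Y (voa_Y a (-1) a) (2%:Z * n + 1) ws)).
  rewrite -[X in Tm k X]/(wact s0 (wd ((voa_Y a (-1) a, (h + h)%N, 2%:Z * n + 1) :: s1'))) -wd_cat.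
  apply: IHr.
  - apply/valid_cat; split=> //; apply/valid_cons; split=> //=.
    by apply: (mode_Vg va va); lia.
  - by rewrite -sz !size_cat /=; lia.
  - by rewrite -d !deg_cat /=; lia.
  - by rewrite -e !exc_cat /=; lia.
by rewrite -pn; have := sub_subP (Tm_sub k) C D; rewrite opprB addrC subrK.
Qed.

Lemma good_all s : valid s -> good s.
Proof.
have [p] := ubnP (deg s); elim: p s => [//|p IHp] s dp v k e bk.
have IHp' s' : valid s' -> (deg s' < deg s)%N -> good s'.
  by move=> v' d'; apply: IHp => //; lia.
have H r s' : valid s' -> (size s' < r)%N -> deg s' = deg s -> exc s' = k%:Z -> Tm k (wd s').
  elim: r s' => [//|r IHr] s' v' sr d' e'.
  apply: (good_step bk IHp' (r := size s')) => // s2 v2 sz2; apply: IHr => //.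
  by move: sr; rewrite ltnS; apply: leq_trans.
exact: (H (size s).+1).
Qed.

Lemma words_span w : lspan [set wd s | s in valid] w.
Proof.
apply: (w0_gen (S := lspan [set wd s | s in valid])); last first.
  by apply: sub_lspan; exists [::].
split=> [|u n x]; first exact: lspan_subspace.
have sS : subspace (lspan [set wd s | s in valid]) by exact: lspan_subspace.
apply: (@lspan_min _ _ _ [set x | lspan [set wd s | s in valid] (Y u n x)]).
  exact: (subspace_preim (Yl u n)).
move=> _ [s vs <-]; rewrite /=.
apply: (graded_ind (Vg_sum posV) (P := [set u | lspan [set wd s | s in valid] (Y u n (wd s))])).
  exact: (subspace_preim (Yr n (wd s))).
move=> h a va; apply: sub_lspan; exists ((a, h, n) :: s) => //.
by apply/valid_cons.
Qed.

Lemma Cgen_span k v : (bnd < k)%N -> Wg k v -> Tm k v.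
Proof.
move=> bk vk; rewrite -(pr_id dW vk).
apply: (lspan_min (A := [set w | Tm k (pr dW k w)]) _ _ (words_span v)).
  exact: (subspace_preim (pr_linear dW k) (Tm_sub k)).
move=> _ [s vs <-] /=; have [g1 g2] := wd_gr vs.
case: (ltrP (exc s) 0) => es.
  by rewrite g2 // (lin0 (pr_linear dW k)); case: (Tm_sub k).
have [j jE] : exists j : nat, exc s = j%:Z by exists (absz (exc s)); lia.
rewrite (pr_case dW k (g1 j jE)); case: eqP => [kj|_]; last by case: (Tm_sub k).
by apply: good_all => //; rewrite kj.
Qed.

End Target.

(** Larger [m] than 2 matter: m = 2 serves the C_1-cofiniteness of modules, m = 2 N + 2 the algebra
    A_N(V), whose relations have leading term u_(-2N-2) x. *)
Lemma mode_cofinite m N0 : (2 <= m)%N -> C2hom N0 ->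
  exists B : nat, forall k v, (B < k)%N -> Wg k v -> lspan (Cgen m k) v.
Proof.
move=> m2 hC2.
have bas h : {b : seq V | (forall x, x \in b -> Vg h x) & Vg h `<=` lspan [set` b]}.
  apply: cid2; have sV : subspace (Vg h) by exact: (voa_gr_sum V).1.
  have [b [bV _ bs]] := basis_exists sV (@voa_gr_fin R V h%:Z).
  exists b => // v /bs [g ->]; apply: (sub_sumP (lspan_subspace _)) => i _.
  by apply: (sub_scaleP (lspan_subspace _)); apply: sub_lspan; apply: mem_nth.
pose xs := [seq (x, h) | h <- iota 0 N0.+1, x <- s2val (bas h)].
exists (bnd m N0 xs) => k v; apply: Cgen_span => //.
  move=> x /allpairsPdep [h [y [+ yb ->]]] /=; rewrite mem_iota => hN.
  by split; [lia | apply: (s2valP (bas h))].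
move=> h hN u uh; apply: lspan_mono (s2valP' (bas h) u uh) => x /= xb.
by apply/allpairsPdep; exists h, x; rewrite mem_iota; split=> //; lia.
Qed.

End Words.

(** * Finiteness of quotients *)

Section Quotients.
Context {F : fieldType} {V : lmodType F}.
Variable X : set V.

Lemma quot_class_linear : linear (quot_class X).
Proof. by move=> a u v; rewrite quot_classD -quot_scale_class. Qed.

Lemma quot_finite (s : seq V) : (forall v, exists2 u, lspan [set` s] u & lspan X (v - u)) ->
  finite_dim (quot_space X).
Proof.
move=> h; exists [seq quot_class X x | x <- s] => q _.
have [u us /quot_classP] := h (quot_repr q); rewrite quot_reprK => ->.
apply: (@lspan_min _ _ _ [set u | lspan [set` [seq quot_class X x | x <- s]] (quot_class X u)] _ _ u us).
  exact: (subspace_preim quot_class_linear (lspan_subspace _)).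
by move=> x /= xs; apply: sub_lspan; apply: map_f.
Qed.

Lemma quot_finiteP : finite_dim (quot_space X) ->
  exists s : seq V, forall v, exists2 u, lspan [set` s] u & lspan X (v - u).
Proof.
move=> [s hs]; exists [seq quot_repr x | x <- s] => v.
have [t [ts qE]] := hs (quot_class X v) I.
exists (\sum_(p <- t) p.1 *: quot_repr p.2).
  apply: (sub_sum_seqP (lspan_subspace _)) => p pt; apply: (sub_scaleP (lspan_subspace _)).
  by apply: sub_lspan; apply: map_f; apply: ts.
apply/quot_classP; rewrite qE (lin_sum quot_class_linear); apply: eq_bigr => p _.
by rewrite (linZ quot_class_linear) quot_reprK.
Qed.

(** Induction on the degree pushes every vector into degrees at most [B]. Lower terms are allowed
    because the relations of A_n(V) are not homogeneous. *)
Lemma quot_finite_graded (A : nat -> set V) (B : nat) : direct_sum A ->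
  (forall k, finite_dim_in (A k)) ->
  (forall k v, (B < k)%N -> A k v -> lspan (X `|` [set y | exists2 j, (j < k)%N & A j y]) v) ->
  finite_dim (quot_space X).
Proof.
move=> dA fA h.
have bas k : {b : seq V | A k `<=` lspan [set` b]}.
  apply: cid; have [b [bA _ bs]] := basis_exists (dA.1 k) (fA k).
  exists b => // v /bs [g ->]; apply: (sub_sumP (lspan_subspace _)) => i _.
  by apply: (sub_scaleP (lspan_subspace _)); apply: sub_lspan; apply: mem_nth.
pose s := flatten [seq sval (bas k) | k <- iota 0 B.+1].
pose G := [set v | exists2 u, lspan [set` s] u & lspan X (v - u)].
have [X0 XD] := lspan_subspace X; have [s0 sD] := lspan_subspace [set` s].
have sG : subspace G.
  split; first by exists 0; rewrite ?subr0.
  move=> a v w [u1 h1 k1] [u2 h2 k2]; exists (a *: u1 + u2); first exact: sD.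
  rewrite (_ : _ - _ = a *: (v - u1) + (w - u2)); first exact: XD.
  by rewrite scalerBr opprD addrACA.
apply: (@quot_finite s); apply: (graded_ind dA (P := G)) => //.
elim/ltn_ind => k IH v vk; case: (ltnP B k) => kB; last first.
  exists v; last by rewrite subrr.
  apply: lspan_mono (svalP (bas k) v vk) => x /= xb; apply/flattenP.
  by exists (sval (bas k)) => //; apply: map_f; rewrite mem_iota; lia.
apply: (lspan_min sG _ (h k v kB vk)) => x [Xx|[j jk xj]]; last exact: IH jk _ xj.
by exists 0 => //; rewrite subr0; apply: sub_lspan.
Qed.

End Quotients.

Lemma YVl (R : realType) (V : voa R) (u : V) n : linear (voa_Y u n).
Proof. exact: (voa_Y_bilinear V).1. Qed.
Lemma YVr (R : realType) (V : voa R) n (w : V) : linear (fun u : V => voa_Y u n w).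
Proof. exact: (voa_Y_bilinear V).2. Qed.

(** * Cofiniteness of V, its Zhu algebras and its irreducible modules *)

Section Cofinite.
Context {R : realType} {V : voa R}.
Hypothesis posV : positive_energy V.
Local Notation K := R[i].
Local Notation Vg := (@Vg R V).
Local Notation dV := (Vg_sum posV).

Lemma Vplus_hom h (u : V) : (0 < h)%N -> Vg h u -> Vplus V u.
Proof. by move=> h0 uh; apply: sub_lspan; exists h%:Z; split=> //; lia. Qed.

Lemma Vplus_ind (P : set V) : subspace P -> (forall h u, (0 < h)%N -> Vg h u -> P u) ->
  Vplus V `<=` P.
Proof.
move=> sP h; apply: lspan_min => // u [n [n0 un]].
by case: n n0 un => // n n0 un; apply: (h n).
Qed.

Lemma pr_supp_nat v : exists N : nat, forall k, (N <= k)%N -> pr dV k v = 0.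
Proof.
have [s us sP] := pr_supp dV v; exists (\max_(i <- s) i).+1 => k hk.
apply: sP; apply/negP => ks; move: hk; rewrite ltnNge => /negP; apply.
exact: (@leq_bigmax_seq _ s xpredT id k ks isT).
Qed.

Lemma pr_supp_nat_seq (s : seq V) : exists N : nat, forall v k, v \in s -> (N <= k)%N -> pr dV k v = 0.
Proof.
elim: s => [|v s [N hN]]; first by exists 0%N.
have [M hM] := pr_supp_nat v; exists (N + M)%N => w k; rewrite inE => /orP[/eqP ->|ws] h.
  by apply: hM; lia.
by apply: hN => //; lia.
Qed.

(** Projection to degree k: generators of C_2(V) split into homogeneous ones, and finitely many
    representatives have no component in high degree. *)
Lemma C2hom_cofinite : C_cofinite V 2 -> exists N0, @C2hom R V N0.
Proof.
move=> /quot_finiteP [s hs]; have [N hN] := pr_supp_nat_seq s.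
exists N => k kN v vk; rewrite -(pr_id dV vk).
have [u us vu] := hs v.
have pu : pr dV k u = 0.
  apply: (@lspan_min _ _ _ [set u | pr dV k u = 0] _ _ u us).
    split; first exact: (lin0 (pr_linear dV k)).
    by move=> a x y /= x0 y0; rewrite (pr_linear dV k) x0 y0 scaler0 addr0.
  by move=> x /= xs; apply: hN => //; lia.
rewrite -[v](subrK u) (linD (pr_linear dV k)) pu addr0.
set T := lspan _; have sT : subspace T by exact: lspan_subspace.
have lT (f : V -> V) : linear f -> subspace [set x | T (pr dV k (f x))].
  by move=> lf; apply: (subspace_preim (f := fun x => pr dV k (f x))) => //; apply: linear_comp (pr_linear dV k) lf.
apply: (@lspan_min _ _ _ [set x | T (pr dV k x)] (lT id (@linear_id _ _)) _ _ vu).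
move=> _ [a [x [ap ->]]] /=.
apply: (@Vplus_ind [set a | T (pr dV k (voa_Y a (-2) x))] _ _ a ap).
  exact: lT (fun a => voa_Y a (-2) x) (YVr (-2) x).
move=> h b h0 bh /=.
apply: (graded_ind dV (P := [set x | T (pr dV k (voa_Y b (-2) x))])).
  exact: lT (voa_Y b (-2)) (YVl b (-2)).
move=> j y yj /=.
have by_ : Vg (j + h).+1 (voa_Y b (-2) y) by apply: (mode_Vg bh yj); lia.
rewrite (pr_case dV k by_); case: eqP => [kE|_]; last by case: sT.
by apply: sub_lspan; exists h, j, b, y; split=> //; rewrite -kE.
Qed.

Lemma Lm1_m2 (W : voa_module V) (u : V) (w : W) : mod_Y u (-2) w = mod_Y (voa_L (-1) u) (-1) w.
Proof. by rewrite mod_Lm1 mulrNz mulr1z opprK scale1r. Qed.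

(** u_(-2) v = (L(-1) u)_(-1) v is a generator of the first kind when v has positive degree; for v =
    c 1 it is L(-1) (c u), a generator of the second kind. *)
Lemma C1a_of_C2 : C_cofinite V 2 -> C1a_cofinite V.
Proof.
move=> /quot_finiteP [s hs]; apply: (@quot_finite _ _ _ s) => v.
have [u us vu] := hs v; exists u => //.
apply: (lspan_min (lspan_subspace _) _ vu) => _ [a [x [ap ->]]] /=.
have -> : voa_Y a (- 2%:Z) x = voa_Y (voa_L (-1) a) (-1) x by exact: (Lm1_m2 (W := adjoint_module V) a x).
have Da : Vplus V (voa_L (-1) a).
  apply: (@Vplus_ind [set a | Vplus V (voa_L (-1) a)] _ _ a ap).
    exact: (subspace_preim (YVl (voa_omega V) (-1 + 1)) (lspan_subspace _)).
  by move=> h b h0 bh; apply: (@Vplus_hom h.+1) => //; apply: Lm1_Vg.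
pose S := lspan (C1a_gen V); have sS : subspace S by exact: lspan_subspace.
apply: (graded_ind dV (P := [set x | S (voa_Y (voa_L (-1) a) (-1) x)])).
  exact: (subspace_preim (YVl (voa_L (-1) a) (-1))).
move=> [|h] y yh /=; apply: sub_lspan; last first.
  by left; exists (voa_L (-1) a), y; split=> //; apply: Vplus_hom yh.
right; have [c ->] := Vg0_vac posV yh; exists (c *: a).
rewrite /voa_L !(linZ (YVl _ _)).
by rewrite -/(voa_L (-1) a) (voa_creation (voa_L (-1) a)).1.
Qed.

Lemma L0_falling_hom n k h (u : V) : Vg h u -> exists c : K, L0_falling n k u = c *: u.
Proof.
move=> uh; elim: k => [|k [c /= ->]]; first by exists 1; rewrite scale1r.
exists (c * h%:R + (n%:R - k%:R) * c).
rewrite /voa_L (linZ (YVl _ _)) -[0 + 1]/(1 : int) (voa_L0 uh).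
by rewrite !scalerA scalerDl.
Qed.

Lemma vac_gen (S : set (adjoint_module V)) : is_submodule S -> S (voa_one V) -> forall v, S v.
Proof. by move=> [_ h] S1 v; rewrite -(voa_creation v).1; apply: (h v (-1)). Qed.

(** The relation Res x^(-2N-2) Y((1 + x)^(L(0)+N) u, x) v starts with u_(-2N-2) v and continues with
    terms of lower degree. *)
Lemma zhu_finite N0 N : @C2hom R V N0 -> finite_dim (zhu_algebra V N).
Proof.
move=> hC; pose m := (2 * N + 2)%N.
have one0 : @mod_gr R V (adjoint_module V) (0 + 0%:R) (voa_one V).
  by rewrite adjoint_Vg; exact: voa_one_gr.
have [|B hB] := mode_cofinite posV (adjoint_sum posV) one0 vac_gen (m := m) _ hC; first by rewrite /m; lia.
apply: (@quot_finite_graded _ _ _ Vg B dV) => [k|k v kB vk]; first exact: voa_gr_fin.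
rewrite -adjoint_Vg in vk; have := hB k v kB vk.
set T := lspan (_ `|` _); have sT : subspace T by exact: lspan_subspace.
apply: (lspan_min sT) => _ [h [j [u [x [h0 uh xj jE ->]]]]].
rewrite adjoint_Vg in xj; rewrite /=.
have [M hM] := trunc_nat (W := adjoint_module V) u x (- m%:Z).
have resE : zhu_res N (- m%:Z) u x = voa_Y u (- m%:Z) x +
    \sum_(i < M) voa_Y (L0_binom N i.+1 u) (- m%:Z + i.+1%:Z) x.
  rewrite /zhu_res (@fsum_nat _ M.+1); last first.
    move=> i iM; rewrite /L0_binom; have [c ->] := L0_falling_hom N i uh.
    rewrite !(linZ (YVr _ x)) -[voa_Y u]/(@mod_Y R V (adjoint_module V) u).
    by rewrite hM ?scaler0 //; lia.
  by rewrite big_ord_recl /L0_binom /= fact0 invr1 scale1r addr0.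
rewrite -[voa_Y u _ x](addrK (\sum_(i < M) voa_Y (L0_binom N i.+1 u) (- m%:Z + i.+1%:Z) x)) -resE.
apply: (sub_subP sT); first by apply: sub_lspan; left; left; exists u, x.
apply: (sub_sumP sT) => i _; rewrite /L0_binom; have [c ->] := L0_falling_hom N i.+1 uh.
rewrite !(linZ (YVr _ x)) /=; do 2 apply: (sub_scaleP sT).
case: (leqP i.+1 k) => ik; last first.
  have -> : voa_Y u (- m%:Z + i.+1%:Z) x = 0 by apply: (mode_Vg0 posV uh xj); lia.
  by case: sT.
apply: sub_lspan; right; exists (k - i.+1)%N; first by lia.
by apply: (mode_Vg uh xj); lia.
Qed.

Section Module.
Variables (W : voa_module V) (n0 : K).
Hypothesis dW : direct_sum (fun k : nat => @mod_gr R V W (n0 + k%:R)).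
Hypothesis irrW : irreducible W.

Lemma irr_C1 N0 (w0 : W) : @C2hom R V N0 -> @mod_gr R V W (n0 + 0%:R) w0 -> w0 <> 0 -> C_cofinite_mod 1 W.
Proof.
move=> hC w0g w00.
have gen (S : set W) : is_submodule S -> S w0 -> forall w, S w.
  by move=> sS Sw w; case: (irrW.2 S sS) => E; [case: w00; rewrite E in Sw | rewrite E].
have [B hB] := mode_cofinite posV dW w0g gen (m := 2) isT hC.
apply: (@quot_finite_graded _ _ _ _ B dW) => [k|k v kB vk]; first exact: mod_gr_fin.
apply: lspan_mono (@subsetUl _ _ _) _ _.
apply: (lspan_min (lspan_subspace _) _ (hB k v kB vk)) => _ [h [j [u [x [h0 uh xj jE ->]]]]].
apply: sub_lspan; exists (voa_L (-1) u), x; split; last by rewrite Lm1_m2.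
by apply: (@Vplus_hom h.+1) => //; apply: Lm1_Vg.
Qed.

End Module.

(** From one weight lam, descend by the largest k such that lam - k is a weight; it exists because
    real parts are bounded below. The weight spaces in n0 + N then span a nonzero submodule, hence
    W. *)
Lemma irr_lowest (W : voa_module V) : irreducible W -> exists n0 : K, is_lowest_weight W n0.
Proof.
move=> [[w wn] irr]; have dG := mod_gr_sum W.
have [lam wl] : exists lam, pr dG lam w <> 0.
  apply: contra_notP wn => h; rewrite (@pr_sum _ _ _ _ dG w [::]) ?big_nil // => lam _.
  by apply: contra_notP h => h; exists lam.
pose P (k : nat) := `[< exists x : W, mod_gr (lam - k%:R) x /\ x <> 0 >].
have P0 : exists k, P k.
  by exists 0%N; apply/asboolP; exists (pr dG lam w); rewrite subr0; split=> //; apply: pr_in.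
have [B hB] := mod_gr_bound W.
have [M hM] : exists M : nat, complex.Re lam - B < M%:R.
  exists (Num.bound `|complex.Re lam - B|); apply: le_lt_trans (ler_norm _) _.
  exact: archi_boundP.
have Pb k : P k -> (k <= M)%N.
  move=> /asboolP [x [xk xn]]; rewrite leqNgt; apply/negP => Mk; apply: xn; apply: (hB _ _ _ xk).
  have -> : complex.Re (lam - k%:R) = complex.Re lam - k%:R.
    case: (lam) => a b /=; rewrite (_ : k%:R = (k%:R)%:C%C) //=.
    by rewrite rmorph_nat.
  have : (M%:R : R) < k%:R by rewrite ltr_nat.
  by move: hM; lra.
case: (ex_maxnP P0 Pb) => k /asboolP [w0 [w0k w00]] kmax.
pose n0 : K := lam - k%:R; exists n0.
split; first by exists w0.
pose S := [set x : W | forall mu, (forall j : nat, mu != n0 + j%:R) -> pr dG mu x = 0].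
have sS : subspace S.
  split=> [mu _|a u v Su Sv mu h]; first exact: (lin0 (pr_linear dG mu)).
  by rewrite (pr_linear dG mu) Su // Sv // scaler0 addr0.
have Shom (j : nat) x : mod_gr (n0 + j%:R) x -> S x.
  by move=> xj mu h; rewrite (pr_case dG mu xj) (negbTE (h j)).
have ST x : S x.
  suff -> : S = setT by [].
  case: (irr S) => //; last first.
    move=> S0; have : S w0 by apply: (Shom 0%N); rewrite addr0.
    by rewrite S0.
  split=> // u n y Sy; have [s us sP] := pr_supp dG y.
  rewrite (pr_sum us sP) (lin_sum (Yl u n)); apply: (sub_sumP sS) => mu _.
  case: (pselect (exists j : nat, mu = n0 + j%:R)) => [[j muE]|nj]; last first.
    rewrite Sy ?(lin0 (Yl u n)); first by case: sS.
    by move=> j; apply/eqP => e; apply: nj; exists j.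
  apply: (graded_ind (voa_gr_sum V) (P := [set u | S (mod_Y u n (pr dG mu y))])).
    exact: (subspace_preim (Yr n _)).
  move=> h v vh /=; have := mode_gr n vh (pr_in dG mu y); rewrite {1}muE.
  have [z zE] : exists z : int, z = j%:Z + (h - n - 1) by eexists.
  have -> : n0 + j%:R + (h - n - 1)%:~R = n0 + z%:~R.
    by rewrite zE (intrD _ j%:Z) addrA.
  case: z zE => z zE; first exact: Shom.
  move=> yz; suff -> : mod_Y v n (pr dG mu y) = 0 by case: sS.
  apply: contra_notP w00 => yn; exfalso.
  have /kmax : P (k + z.+1)%N.
    apply/asboolP; exists (mod_Y v n (pr dG mu y)); split=> //.
    by move: yz; rewrite NegzE rmorphN /= /n0 -addrA -opprD -[z.+1%:~R]/(z.+1%:R) -natrD.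
  by lia.
apply: (@direct_sum_reindex _ _ _ _ (fun k : nat => n0 + k%:R) dG).
  by move=> i j /addrI /eqP; rewrite eqr_nat => /eqP.
by move=> mu v hmu vmu; rewrite -(pr_id dG vmu); apply: ST.
Qed.

End Cofinite.

(** * Formal coordinate changes *)

(** A product of series acts on a sequence that vanishes from [Q] on as the composite of its
    factors. The summation bounds only have to reach [Q], which frees the residue computations from
    exact supports. *)
Lemma ser_conv (A : fieldType) (V : lmodType A) Q (h g : ser A) (y : nat -> V) m n :
  (forall p, (Q <= p)%N -> y p = 0) -> (Q <= m)%N -> (Q <= n)%N ->
  \sum_(i < m) h i *: (\sum_(j < n) g j *: y (i + j)%N) = \sum_(p < Q) (h * g) p *: y p.
Proof.
elim: Q h y m n => [|Q IH] h y m n y0 Qm Qn.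
  rewrite big_ord0 big1 // => i _; rewrite big1 ?scaler0 // => j _.
  by rewrite y0 ?scaler0.
case: m Qm => // m Qm; rewrite big_ord_recl -[fintype.ord0 : nat]/0%N.
pose h' : ser A := Ser (fun i => h i.+1).
have hE : h = sercst (h 0%N) + serX * h'.
  by apply: ser_ext => -[|i]; rewrite serD serXM /= ?addr0 ?add0r.
rewrite [X in _ + X = _](_ : _ = \sum_(p < Q) (h' * g) p *: y p.+1); last first.
  rewrite -(IH h' (fun p => y p.+1) m n) ?(ltnW Qn) //; last by move=> p pQ; apply: y0.
rewrite [RHS]big_ord_recl serM0.
rewrite [X in _ = _ + X](_ : _ = h 0%N *: (\sum_(p < Q) g p.+1 *: y p.+1) +
    \sum_(p < Q) (h' * g) p *: y p.+1); last first.
  rewrite scaler_sumr -big_split; apply: eq_bigr => p _.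
  rewrite -[fintype.lift _ _ : nat]/(p.+1) {1}hE mulrDl serD sercstM -mulrA serXM.
  by rewrite scalerDl scalerA.
rewrite addrA -scalerA -scalerDr; congr (_ *: _ + _).
have -> : n = (Q.+1 + (n - Q.+1))%N by lia.
rewrite big_split_ord /= [X in _ + X]big1 ?addr0 => [|j _]; last by rewrite y0 ?scaler0 //; lia.
by rewrite big_ord_recl.
Qed.

Section LogKernels.
Context {K : numFieldType}.
Local Notation S := (ser K).

Lemma mulrnSI (a b : K) i : a *+ i.+1 = b *+ i.+1 -> a = b.
Proof. by move=> /eqP; rewrite -subr_eq0 -mulrnBl mulrn_eq0 subr_eq0 => /eqP. Qed.

Definition sder (f : S) : S := Ser (fun i => f i.+1 *+ i.+1).

Lemma serX_sder f : serX * sder f = stheta f.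
Proof. by apply: ser_ext => -[|i]; rewrite serXM stheta_coef ?mulr0n. Qed.

Lemma sderM f g : sder (f * g) = sder f * g + f * sder g.
Proof.
apply: serX_inj; rewrite serX_sder sthetaM mulrDr mulrA serX_sder (mulrCA serX f) serX_sder //.
Qed.

(** Read off from (1 + w) f_n' = m f_n + f_(n-1), the equation satisfied by f_n = (1 + w)^m (log(1 +
    w))^n / n!. *)
Fixpoint Ec (m : K) (i n : nat) : K :=
  if i is j.+1 then ((m - j%:R) * Ec m j n + (if n is n'.+1 then Ec m j n' else 0)) / j.+1%:R
  else (n == 0%N)%:R.

(* The series (1 + w)^m (log (1 + w))^n / n!. *)
Definition E (m : K) (n : nat) : S := Ser (fun i => Ec m i n).

Lemma E_0 m n : E m n 0%N = (n == 0%N)%:R. Proof. by []. Qed.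

Lemma E_S m n i : E m n i.+1 *+ i.+1 =
  (m - i%:R) * E m n i + (if n is n'.+1 then E m n' i else 0).
Proof.
have n1 : (i.+1%:R : K) != 0 by rewrite pnatr_eq0.
transitivity (((m - i%:R) * Ec m i n + (if n is n'.+1 then Ec m i n' else 0)) / i.+1%:R * i.+1%:R).
  by rewrite mulr_natr.
by rewrite divfK.
Qed.

Lemma E_small m n i : (i < n)%N -> E m n i = 0.
Proof.
elim: i n => [|i IH] [|n] // h.
apply/eqP; have := mulrn_eq0 (E m n.+1 i.+1) i.+1; rewrite orFb => <-; rewrite E_S IH ?(ltnW h) // IH //.
by rewrite mulr0 addr0.
Qed.

Lemma E_gbinom m i : E m 0 i = gbinom m i.
Proof.
elim: i => [|i IH]; first by rewrite gbinom0.
have n1 : (i.+1%:R : K) != 0 by rewrite pnatr_eq0.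
by apply: (mulfI n1); rewrite gbinomS -IH mulr_natl E_S addr0.
Qed.

(** (1 + w) d/dw, which is d/dz under w = e^z - 1; identities between the series [E] are proved by
    uniqueness for this derivation. *)
Definition dl (f : S) : S := sder f + stheta f.

Lemma dlM f g : dl (f * g) = dl f * g + f * dl g.
Proof. by rewrite /dl sderM sthetaM; ring. Qed.

Lemma dl_E m n : dl (E m n) = sercst m * E m n + (if n is n'.+1 then E m n' else 0).
Proof.
apply: ser_ext => i; rewrite /dl !serD sercstM stheta_coef -[sder _ i]/(E m n i.+1 *+ i.+1) E_S.
rewrite -[E m n i *+ i]mulr_natl mulrBl addrAC subrK.
by case: n.
Qed.

Lemma dl_uniq (c : K) (g f1 f2 : S) : dl f1 = sercst c * f1 + g -> dl f2 = sercst c * f2 + g ->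
  f1 0%N = f2 0%N -> f1 = f2.
Proof.
move=> h1 h2 h0; apply: ser_ext => i; elim: i => [//|i IH].
have := congr1 (fun f : S => f i) h1; have := congr1 (fun f : S => f i) h2.
rewrite /dl !serD !sercstM !stheta_coef -[sder f1 i]/(f1 i.+1 *+ i.+1) -[sder f2 i]/(f2 i.+1 *+ i.+1).
rewrite IH => <- /addIr /eqP; rewrite -subr_eq0 -mulrnBl mulrn_eq0 /= subr_eq0.
by move=> /eqP.
Qed.

Lemma E_mul0 m m' n : E m 0 * E m' n = E (m + m') n.
Proof.
elim: n => [|n IH].
  apply: (dl_uniq (c := m + m') (g := 0)); rewrite ?dlM ?dl_E ?serM0 ?E_0 ?mul1r //.
  by rewrite !addr0 rmorphD; ring.
apply: (dl_uniq (c := m + m') (g := E (m + m') n)); rewrite ?dlM ?dl_E ?serM0 ?E_0 ?mulr0 //.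
by rewrite -IH !addr0 rmorphD; ring.
Qed.

Lemma E_mul1 m m' n : E m 1 * E m' n = E (m + m') n.+1 *+ n.+1.
Proof.
elim: n => [|n IH].
  apply: (dl_uniq (c := m + m') (g := E (m + m') 0)); rewrite ?dlM ?dl_E ?serM0 ?E_0 ?mul0r //.
  by rewrite -E_mul0 rmorphD; ring.
have dMn f k : dl (f *+ k) = dl f *+ k.
  have dD f' g : dl (f' + g) = dl f' + dl g.
    have sD : sder (f' + g) = sder f' + sder g by apply: ser_ext => i; rewrite serD -mulrnDl.
    by rewrite /dl sD raddfD addrACA.
  elim: k => [|k IHk]; last by rewrite !mulrSr dD IHk.
  by apply: (addrI (dl f)); rewrite -dD mulr0n !addr0.
apply: (dl_uniq (c := m + m') (g := E (m + m') n.+1 *+ n.+2)).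
- rewrite dlM !dl_E -(E_mul0 m) mulrDl mulrDr.
  transitivity (sercst m * E m 1 * E m' n.+1 + E m 1 * (sercst m' * E m' n.+1) + (E m 0 * E m' n.+1 + E m 1 * E m' n)).
    by ring.
  rewrite IH E_mul0 rmorphD [in RHS]mulrS; ring.
- by rewrite dMn dl_E mulrnDl mulrnAr.
- by rewrite serM0 serMn !E_0 mul0r mul0rn.
Qed.

Lemma E10 : E 1 0 = 1 + serX.
Proof.
apply: ser_ext => -[|[|i]]; rewrite E_gbinom serD ser1 /=.
- by rewrite gbinom0 addr0.
- by rewrite gbinom1 add0r.
- by rewrite gbinom1SS addr0.
Qed.

Lemma E00 : E 0 0 = 1.
Proof. by apply: ser_ext => -[|i]; rewrite E_gbinom ser1 ?gbinom0 ?gbinom0S. Qed.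

Lemma sder_E m n : sder (E m n) = sercst m * E (m - 1) n + (if n is n'.+1 then E (m - 1) n' else 0).
Proof.
have e1 : E (-1) 0 * E 1 0 = 1 by rewrite E_mul0 addNr E00.
have H f : dl f = E 1 0 * sder f by rewrite E10 mulrDl mul1r serX_sder.
rewrite -[sder _]mul1r -e1 -mulrA -H dl_E mulrDr mulrCA E_mul0 addrC [-1 + m]addrC.
by rewrite addrC; case: n => [|n]; rewrite ?mulr0 // E_mul0 [-1 + m]addrC.
Qed.

(** The expansion of (1 + w)^t as exp(t log(1 + w)). *)
Lemma E_shift m (t : K) i M : (i < M)%N -> \sum_(k < M) t ^+ k * E m k i = E (m + t) 0 i.
Proof.
elim: i M => [|i IH] [//|M] iM.
  by rewrite big_ord_recl expr0 mul1r big1 ?addr0 // => k _; rewrite E_0 mulr0.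
have n1 : (i.+1%:R : K) != 0 by rewrite pnatr_eq0.
apply: (mulIf n1); rewrite mulr_suml [RHS]mulr_natr E_S addr0.
rewrite (eq_bigr (fun k : 'I_M.+1 => (m - i%:R) * (t ^+ k * E m k i) +
    (if (k : nat) is n'.+1 then t * (t ^+ n' * E m n' i) else 0))); last first.
  move=> [[|k] kM] _ /=; rewrite -mulrA mulr_natr E_S ?addr0 mulrCA //.
  by rewrite mulrDr exprS mulrCA -!mulrA; congr (_ + _); rewrite mulrCA.
rewrite big_split /= -mulr_sumr IH ?(ltnW iM) // big_ord_recl add0r /=.
by rewrite -mulr_sumr (IH M) // -mulrDl addrAC.
Qed.

(** The divided derivative f^(l) / l!. *)
Definition hasse l (f : S) : S := Ser (fun i => f (i + l)%N *+ 'C(i + l, l)).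

Lemma hasse_step i l (x : K) : x *+ 'C(i.+1 + l, l) *+ i.+1 = x *+ (i + l).+1 *+ 'C(i + l, l).
Proof.
rewrite -!mulrnA; congr (_ *+ _).
have := mul_bin_diag (i + l).+1 i; rewrite -!(addnC l) => H.
have e1 : 'C(l + i, i) = 'C(l + i, l) by rewrite -bin_sub ?leq_addl // addnK.
have e2 : 'C((l + i).+1, i.+1) = 'C(l + i.+1, l) by rewrite -addnS -bin_sub ?leq_addl // addnK.
by rewrite -e1 -e2 mulnC -H.
Qed.

Lemma hasse_E0 l m : hasse l (E m 0) = sercst (E m 0 l) * E (m - l%:R) 0.
Proof.
apply: ser_ext => i; rewrite sercstM; elim: i => [|i IH].
  by rewrite E_0 mulr1 /= binn mulr1n.
apply: (@mulrnSI _ _ i); rewrite -[hasse _ _ _]/(E m 0 (i.+1 + l)%N *+ 'C(i.+1 + l, l)).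
rewrite hasse_step E_S addr0 -mulrnAr -[_ *+ 'C(_, _)]/(hasse l (E m 0) i) IH -mulrnAr E_S addr0 natrD.
by rewrite opprD [- i%:R - l%:R]addrC addrA mulrCA.
Qed.

Lemma hasse_E1 l m : hasse l (E m 1) = sercst (E m 0 l) * E (m - l%:R) 1 + sercst (E m 1 l) * E (m - l%:R) 0.
Proof.
apply: ser_ext => i; rewrite serD !sercstM; elim: i => [|i IH].
  by rewrite !E_0 mulr1 mulr0 add0r /= binn mulr1n.
apply: (@mulrnSI _ _ i); rewrite -[hasse _ _ _]/(E m 1 (i.+1 + l)%N *+ 'C(i.+1 + l, l)).
have F0 : E m 0 (i + l)%N *+ 'C(i + l, l) = E m 0 l * E (m - l%:R) 0 i.
  by have := congr1 (fun f : S => f i) (hasse_E0 l m); rewrite sercstM.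
have F1 : E m 1 (i + l)%N *+ 'C(i + l, l) = E m 0 l * E (m - l%:R) 1 i + E m 1 l * E (m - l%:R) 0 i := IH.
rewrite hasse_step E_S mulrnDl -mulrnAr F0 F1 [RHS]mulrnDl -[X in _ = X + _]mulrnAr -[X in _ = _ + X]mulrnAr !E_S addr0 natrD.
by ring.
Qed.

(** Substitution of log(1 + w); the sum stops at i because the k-th power of the logarithm starts in
    degree k. *)
Definition logsub (f : S) : S := Ser (fun i => \sum_(k < i.+1) f k * (E 0 1 ^+ k) i).

Lemma E01X k : E 0 1 ^+ k = E 0 k *+ k`!.
Proof.
elim: k => [|k IH]; first by rewrite E00.
by rewrite exprS IH mulrnAr E_mul1 addr0 -mulrnA factS.
Qed.

Lemma logsubE f i M : (i < M)%N -> logsub f i = \sum_(k < M) f k * (E 0 1 ^+ k) i.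
Proof.
move=> iM; have -> : M = (i.+1 + (M - i.+1))%N by lia.
rewrite big_split_ord /= [X in _ + X]big1 ?addr0 // => k _.
by rewrite E01X serMn E_small ?mul0rn ?mulr0 //; lia.
Qed.

Lemma logsubM f g : logsub (f * g) = logsub f * logsub g.
Proof.
apply: ser_ext => i; rewrite serM.
pose F (u : S) : S := \sum_(k < i.+1) sercst (u k) * E 0 1 ^+ k.
have FE u j : (j <= i)%N -> logsub u j = F u j.
  move=> ji; rewrite (@logsubE _ _ i.+1) // /F ser_sum; apply: eq_bigr => k _.
  by rewrite sercstM.
transitivity ((F f * F g) i); last first.
  by rewrite serM; apply: eq_bigr => j _; rewrite !FE // ?leq_subr // -ltnS.
have C := @ser_conv K K^o i.+1 f g (fun p => (E 0 1 ^+ p) i) i.+1 i.+1.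
etransitivity; first by symmetry; apply: C => // p ip; rewrite E01X serMn E_small ?mul0rn.
rewrite /F mulr_suml ser_sum; apply: eq_bigr => k _.
have e : (E 0 1 ^+ k * \sum_(l < i.+1) sercst (g l) * E 0 1 ^+ l) i =
    \sum_(l < i.+1) g l * (E 0 1 ^+ (k + l)) i.
  by rewrite mulr_sumr ser_sum; apply: eq_bigr => l _; rewrite mulrCA sercstM exprD.
by rewrite -mulrA sercstM e.
Qed.

Lemma logsubD f g : logsub (f + g) = logsub f + logsub g.
Proof.
by apply: ser_ext => i; rewrite serD /= -big_split; apply: eq_bigr => k _; rewrite mulrDl.
Qed.

Lemma logsub1 : logsub 1 = 1.
Proof.
apply: ser_ext => i; rewrite (@logsubE _ _ i.+1) // big_ord_recl big1 ?addr0 => [|k _].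
  by rewrite ser1 mul1r.
by rewrite ser1 mul0r.
Qed.

Lemma logsubX : logsub serX = E 0 1.
Proof.
apply: ser_ext => i; rewrite (@logsubE _ _ i.+2) // 2!big_ord_recl big1 ?addr0 => [|k _].
  by rewrite mul0r add0r mul1r.
by rewrite mul0r.
Qed.

Lemma logsub_exp : logsub (ez 1) = 1 + serX.
Proof.
rewrite -E10; apply: ser_ext => i; rewrite -[in RHS](add0r 1) -(E_shift 0 1 (ltnSn i)).
apply: eq_bigr => k _; rewrite E01X serMn -[E 0 k i *+ _]mulr_natr -[ez 1 k]/(1 ^+ k / k`!%:R).
rewrite expr1n !mul1r mulrC -mulrA divff ?mulr1 // pnatr_eq0 -lt0n fact_gt0 //.
Qed.

Definition zeta : S := Ser (fun i => E 0 1 i.+1).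
Lemma zetaE : E 0 1 = serX * zeta. Proof. exact: ser_eqXM. Qed.

Lemma zeta0 : zeta 0%N = 1.
Proof.
have := E_S 0 1 0; rewrite mulr1n => /= ->.
by rewrite mulr0 add0r.
Qed.

Definition xi : S := sval (ser_inv zeta0).
Lemma xiE : zeta * xi = 1. Proof. by rewrite /xi; case: (ser_inv zeta0). Qed.
Lemma xi0 : xi 0%N = 1. Proof. by rewrite /xi; case: (ser_inv zeta0). Qed.

Lemma xi_E01 n : E 0 1 * xi * E 0 n = serX * E 0 n.
Proof. by rewrite zetaE -[serX * _ * xi]mulrA xiE mulr1. Qed.

(** At z = log(1 + w), [kap] = (z/2) (e^z + 1) / (e^z - 1) becomes (z/2) (2 + w) / w, and [xi] is w
    / z. *)
Lemma half_kernel : 2%:R * (xi * logsub kap) = 2%:R + serX.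
Proof.
have := congr1 logsub (kapE (F := K)).
have c2 f : logsub (2%:R * f) = 2%:R * logsub f by rewrite !mulr_natl !mulr2n logsubD.
have cN f : logsub (- f) = - logsub f.
  by apply: (addrI (logsub f)); rewrite -logsubD !subrr; apply: ser_ext => i /=; rewrite big1 // => k _; rewrite mul0r.
rewrite (logsubM (2%:R * kap)) (logsubM serX) c2 !logsubD cN logsub1 logsubX logsub_exp zetaE => H.
apply: serX_inj.
transitivity (2%:R * logsub kap * (1 + serX - 1) * xi); first by ring.
rewrite H -[serX * zeta * _]mulrA [zeta * _]mulrC mulrA -mulrA xiE mulr1; ring.
Qed.

End LogKernels.

(** * Square-bracket operators *)

Lemma gbinom_nat (K : numFieldType) n l : gbinom (n%:R : K) l = 'C(n, l)%:R.
Proof.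
elim: l => [|l IH]; first by rewrite gbinom0 bin0.
have n1 : (l.+1%:R : K) != 0 by rewrite pnatr_eq0.
apply: (mulfI n1); rewrite gbinomS IH -natrM mul_bin_left natrM.
case: (leqP l n) => ln; first by rewrite natrB.
by rewrite bin_small // !mulr0.
Qed.

Section SquareBracket.
Context {R : realType} {V : voa R}.
Hypothesis posV : positive_energy V.
Local Notation K := R[i].
Local Notation Vg := (@Vg R V).
Local Notation Y := (@voa_Y R V).
Local Notation om := (voa_omega V).
Local Notation dV := (Vg_sum posV).

Lemma Ytrunc a b (s : int) : exists N : nat, forall j : nat, (N <= j)%N -> Y a (s + j%:Z) b = 0.
Proof. exact: (trunc_nat (W := adjoint_module V)). Qed.

Lemma Ycomm u v (m n : int) w N : (forall i : nat, (N <= i)%N -> Y u i%:Z v = 0) ->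
  Y u m (Y v n w) - Y v n (Y u m w) =
  \sum_(i < N) gbinom (m%:~R : K) i *: Y (Y u i%:Z v) (m + n - i%:Z) w.
Proof. exact: (mode_comm (W := adjoint_module V)). Qed.

(* The residue of w^s g(w) Y(a, w) b. *)
Definition sqact (s : int) (a : V) (g : ser K) (b : V) : V :=
  \sum_(j \in [set: nat]) g j *: Y a (s + j%:Z) b.

Lemma sqactE s a g b N : (forall j : nat, (N <= j)%N -> Y a (s + j%:Z) b = 0) ->
  sqact s a g b = \sum_(j < N) g j *: Y a (s + j%:Z) b.
Proof. by move=> h; apply: fsum_nat => j /h ->; rewrite scaler0. Qed.

Lemma act_lin_b s a g : linear (sqact s a g).
Proof.
move=> c u v; have [N hN] := Ytrunc a u s; have [M hM] := Ytrunc a v s.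
rewrite !(@sqactE _ _ _ _ (N + M)%N); first last.
- by move=> j h; rewrite (YVl _ _) hN ?hM ?scaler0 ?addr0 //; lia.
- by move=> j h; apply: hN; lia.
- by move=> j h; apply: hM; lia.
rewrite scaler_sumr -big_split; apply: eq_bigr => j _.
by rewrite (YVl _ _) scalerDr !scalerA [c * _]mulrC.
Qed.

Lemma act_lin_a s g b : linear (fun a => sqact s a g b).
Proof.
move=> c u v; have [N hN] := Ytrunc u b s; have [M hM] := Ytrunc v b s.
rewrite !(@sqactE _ _ _ _ (N + M)%N); first last.
- by move=> j h; rewrite (YVr _ _) hN ?hM ?scaler0 ?addr0 //; lia.
- by move=> j h; apply: hN; lia.
- by move=> j h; apply: hM; lia.
rewrite scaler_sumr -big_split; apply: eq_bigr => j _.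
by rewrite (YVr _ _) scalerDr !scalerA [c * _]mulrC.
Qed.

Lemma sqactD s a g h b : sqact s a (g + h) b = sqact s a g b + sqact s a h b.
Proof.
have [N hN] := Ytrunc a b s; rewrite !(@sqactE _ _ _ _ N) // -big_split.
by apply: eq_bigr => j _; rewrite serD scalerDl.
Qed.

Lemma actZ s a c g b : sqact s a (sercst c * g) b = c *: sqact s a g b.
Proof.
have [N hN] := Ytrunc a b s; rewrite !(@sqactE _ _ _ _ N) // scaler_sumr.
by apply: eq_bigr => j _; rewrite sercstM scalerA.
Qed.

Lemma sqact0 s a b : sqact s a 0 b = 0.
Proof. by have := actZ s a 0 0 b; rewrite mulr0 scale0r. Qed.

Lemma actMn s a g b n : sqact s a (g *+ n) b = sqact s a g b *+ n.
Proof. by elim: n => [|n IH]; rewrite ?mulr0n ?sqact0 // !mulrS sqactD IH. Qed.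

Lemma act_X a g b : sqact (-1) a (serX * g) b = sqact 0 a g b.
Proof.
have [N hN] := Ytrunc a b 0; rewrite (@sqactE 0 a g b N) // (@sqactE (-1) a (serX * g) b N.+1); last first.
  by move=> [//|j] h; have := hN j; rewrite add0r (_ : -1 + j.+1%:Z = j%:Z); [apply | lia].
rewrite big_ord_recl serXM scale0r add0r; apply: eq_bigr => j _.
rewrite -[fintype.lift _ _ : nat]/(j.+1) serXM; congr (_ *: Y _ _ _).
by rewrite add0r; lia.
Qed.

(* Borcherds' commutator formula. *)
Lemma act_comm u f s a g b M : (forall l : nat, (M <= l)%N -> Y u l%:Z a = 0) ->
  sqact 0 u f (sqact s a g b) - sqact s a g (sqact 0 u f b) =
  \sum_(l < M) sqact s (Y u l%:Z a) (hasse l f * g) b.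
Proof.
move=> hM; have [N1 h1] := Ytrunc a b s; have [N2 h2] := Ytrunc u b 0.
have [Q hQ] : exists Q : nat, forall l p : nat, (l < M)%N -> (Q <= p)%N ->
    Y (Y u l%:Z a) (s + p%:Z) b = 0.
  elim: (M) => [|m [Q hQ]]; first by exists 0%N.
  have [Q' hQ'] := Ytrunc (Y u m%:Z a) b s; exists (Q + Q')%N => l p; rewrite ltnS leq_eqVlt => /orP[/eqP ->|lm] h.
    by apply: hQ'; lia.
  by apply: hQ => //; lia.
have [N3 h3] : exists N3 : nat, forall i j : nat, (j < N1)%N -> (N3 <= i)%N ->
    Y u (0 + i%:Z) (Y a (s + j%:Z) b) = 0.
  elim: (N1) => [|m [P hP]]; first by exists 0%N.
  have [P' hP'] := Ytrunc u (Y a (s + m%:Z) b) 0; exists (P + P')%N => i j; rewrite ltnS leq_eqVlt => /orP[/eqP ->|lm] h.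
    by apply: hP'; lia.
  by apply: hP => //; lia.
have [N4 h4] : exists N4 : nat, forall i j : nat, (i < N2)%N -> (N4 <= j)%N ->
    Y a (s + j%:Z) (Y u (0 + i%:Z) b) = 0.
  elim: (N2) => [|m [P hP]]; first by exists 0%N.
  have [P' hP'] := Ytrunc a (Y u (0 + m%:Z) b) s; exists (P + P')%N => i j; rewrite ltnS leq_eqVlt => /orP[/eqP ->|lm] h.
    by apply: hP'; lia.
  by apply: hP => //; lia.
pose A := (N2 + N3 + Q + M)%N; pose B := (N1 + N4 + Q)%N.
have e1 : sqact 0 u f (sqact s a g b) = \sum_(i < A) \sum_(j < B) (f i * g j) *: Y u i%:Z (Y a (s + j%:Z) b).
  rewrite (@sqactE s a g b N1) // (lin_sum (act_lin_b 0 u f)) exchange_big /=.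
  rewrite (_ : B = N1 + (N4 + Q))%N; last by rewrite /B; lia.
  rewrite big_split_ord /= [X in _ + X]big1 ?addr0; last first.
    move=> j _; rewrite big1 // => i _; rewrite h1 ?(lin0 (YVl _ _)) ?scaler0 //; lia.
  apply: eq_bigr => j _; rewrite (linZ (act_lin_b 0 u f)) (@sqactE _ _ _ _ A).
    by rewrite scaler_sumr; apply: eq_bigr => i _; rewrite scalerA mulrC add0r.
  by move=> i hi; apply: h3 => //; rewrite /A in hi; lia.
have e2 : sqact s a g (sqact 0 u f b) = \sum_(i < A) \sum_(j < B) (f i * g j) *: Y a (s + j%:Z) (Y u i%:Z b).
  rewrite (@sqactE 0 u f b N2) // (lin_sum (act_lin_b s a g)).
  rewrite (_ : A = N2 + (N3 + Q + M))%N; last by rewrite /A; lia.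
  rewrite big_split_ord /= [X in _ + X]big1 ?addr0; last first.
    move=> i _; rewrite big1 // => j _; have := h2 (N2 + i)%N (leq_addr _ _); rewrite add0r => ->.
    by rewrite (lin0 (YVl _ _)) scaler0.
  apply: eq_bigr => i _; rewrite (linZ (act_lin_b s a g)) (@sqactE _ _ _ _ B).
    by rewrite scaler_sumr; apply: eq_bigr => j _; rewrite scalerA add0r.
  by move=> j hj; apply: h4 => //; rewrite /B in hj; lia.
rewrite e1 e2 -sumrB.
transitivity (\sum_(i < A) \sum_(j < B) \sum_(l < M)
   (f i * g j * 'C(i, l)%:R) *: Y (Y u l%:Z a) (s + (i + j)%N%:Z - l%:Z) b).
  apply: eq_bigr => i _; rewrite -sumrB; apply: eq_bigr => j _.
  rewrite -scalerBr (@Ycomm _ _ _ _ _ M) // scaler_sumr; apply: eq_bigr => l _.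
  rewrite scalerA; congr ((_ * _) *: Y _ _ _); last by lia.
  exact: gbinom_nat.
rewrite (eq_bigr (fun i : 'I_A => \sum_(l < M) \sum_(j < B) (f i * g j * 'C(i, l)%:R) *:
   Y (Y u l%:Z a) (s + (i + j)%N%:Z - l%:Z) b)); last by move=> i _; rewrite exchange_big.
rewrite exchange_big /=; apply: eq_bigr => l _.
pose y p := Y (Y u l%:Z a) (s + p%:Z) b.
have yQ p : (Q <= p)%N -> y p = 0 by apply: hQ.
rewrite (@sqactE s _ _ b Q) // -(@ser_conv K V Q (hasse l f) g y (A - l)%N B) //; first last.
- by rewrite /B; lia.
- by have := ltn_ord l; rewrite /A; lia.
have lA : A = (l + (A - l))%N by have := ltn_ord l; rewrite /A; lia.
rewrite [in LHS]lA big_split_ord /= [X in X + _]big1 ?add0r; last first.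
  by move=> i _; rewrite big1 // => j _; rewrite bin_small ?mulr0 ?scale0r.
apply: eq_bigr => i _; rewrite scaler_sumr; apply: eq_bigr => j _.
rewrite scalerA /y (addnC i l) -[f (l + i)%N *+ _]mulr_natr mulrAC.
by congr (_ *: Y _ _ _); lia.
Qed.

(** Zhu's a[n] b divided by n!: the residue of (1 + w)^(wt a - 1) (log(1 + w))^n / n! Y(a, w) b. In
    [brm], which is a[-1] b, [xi] replaces 1 / w by 1 / log(1 + w). *)
Definition br (n : nat) (a b : V) : V := glin dV (fun h a => sqact 0 a (E (h%:R - 1) n) b) a.
Definition brm (a b : V) : V := glin dV (fun h a => sqact (-1) a (E (h%:R - 1) 0 * xi) b) a.

Lemma br_lin_a n b : linear (br n ^~ b).
Proof. by apply: glin_linear => h; apply: act_lin_a. Qed.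
Lemma brm_lin_a b : linear (brm ^~ b).
Proof. by apply: glin_linear => h; apply: act_lin_a. Qed.
Lemma br_hom n h a b : Vg h a -> br n a b = sqact 0 a (E (h%:R - 1) n) b.
Proof. by move=> ah; rewrite /br (glin_hom dV _ ah) // => i; apply: act_lin_a. Qed.
Lemma brm_hom h a b : Vg h a -> brm a b = sqact (-1) a (E (h%:R - 1) 0 * xi) b.
Proof. by move=> ah; rewrite /brm (glin_hom dV _ ah) // => i; apply: act_lin_a. Qed.

Lemma lin_b (f : V -> V -> V) : (forall b, linear (f^~ b)) ->
  (forall h a, Vg h a -> linear (f a)) -> forall a, linear (f a).
Proof.
move=> la lh a c u v; move: a.
apply: (graded_lin_ext dV (f := f^~ (c *: u + v)) (g := fun a => c *: f a u + f a v)) => //.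
  by apply: linear_add; [apply: linear_scale; apply: la | apply: la].
by move=> h a ah; apply: (lh h a ah).
Qed.
Lemma br_lin_b n a : linear (br n a).
Proof.
apply: (lin_b (f := br n)) => [b|h x xh]; first exact: br_lin_a.
by move=> c u v; rewrite !(br_hom _ _ xh) (act_lin_b _ _ _).
Qed.
Lemma brm_lin_b a : linear (brm a).
Proof.
apply: (lin_b (f := brm)) => [b|h x xh]; first exact: brm_lin_a.
by move=> c u v; rewrite !(brm_hom _ xh) (act_lin_b _ _ _).
Qed.

(** L[0] and, next, L[-1] for Zhu's conformal vector om - c/24; its vacuum part acts by 0 here and
    appears only in L[-2], defined as [L2b]. *)
Definition L0b (b : V) : V := br 1 om b.
Definition L1b (b : V) : V := br 0 om b.
Lemma L0b_lin : linear L0b. Proof. exact: br_lin_b. Qed.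
Lemma L1b_lin : linear L1b. Proof. exact: br_lin_b. Qed.
Lemma om_gr : Vg 2 om. Proof. exact: voa_omega_gr. Qed.
Lemma L0b_E b : L0b b = sqact 0 om (E 1 1) b.
Proof. by rewrite /L0b (br_hom _ _ om_gr) (_ : 2%:R - 1 = 1) //; ring. Qed.
Lemma L1b_E b : L1b b = Y om 0 b + Y om 1 b.
Proof.
rewrite /L1b (br_hom _ _ om_gr) (_ : 2%:R - 1 = 1); last by ring.
have [N hN] := Ytrunc om b 0; rewrite (@sqactE _ _ _ _ N.+2); last by move=> j h; apply: hN; lia.
rewrite !big_ord_recl big1 ?addr0; last by move=> j _; rewrite E_gbinom gbinom1SS scale0r.
by rewrite !E_gbinom gbinom0 gbinom1 !scale1r.
Qed.

(* [Y(L(-1) a, w)] is the derivative of [Y(a, w)]. *)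
Lemma act_Lm1 a g b : sqact 0 (Y om 0 a) g b = - sqact 0 a (sder g) b.
Proof.
have [N hN] := Ytrunc a b 0; have [M hM] := Ytrunc (Y om 0 a) b 0.
rewrite (@sqactE _ (Y om 0 a) _ _ (N + M).+1); last by move=> j h; apply: hM; lia.
rewrite (@sqactE _ a _ _ (N + M)%N); last by move=> j h; apply: hN; lia.
rewrite big_ord_recl voa_Lm1 mulr0z oppr0 scale0r scaler0 add0r -sumrN; apply: eq_bigr => j _.
rewrite voa_Lm1 scalerA -scaleNr -[fintype.lift _ _ : nat]/(j.+1) add0r.
rewrite (_ : j.+1%:Z - 1 = 0 + j%:Z) ?add0r; last by lia.
congr (_ *: _); rewrite -[sder g j]/(g j.+1 *+ j.+1) mulrN -mulr_natr //.
Qed.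

Lemma act_Lm1m a g b : sqact (-1) (Y om 0 a) (serX * g) b = - sqact (-1) a (stheta g) b.
Proof.
by rewrite act_X act_Lm1 -act_X serX_sder.
Qed.

(** Common source of the brackets of L[0] with a[n] and a[-1]. The divided derivatives of (1 + w)
    log(1 + w), the kernel of L[0], have one part that rebuilds L[0] a and another, carried by l = 0
    and l = 1 only, that differentiates the kernel [g]. *)
Lemma act_comm_L0 h a s g b : Vg h a ->
  L0b (sqact s a g b) - sqact s a g (L0b b) =
  glin dV (fun l x => sqact s x (E (l%:R - 1) 0 * (E (1 - h%:R) 0 * g)) b) (L0b a)
  + (sqact s (Y om 0 a) (E 1 1 * g) b + h%:R *: sqact s a (E 0 1 * g) b).
Proof.
move=> ah; have [M hM] := Ytrunc om a 0.
have hM' l : (M.+2 <= l)%N -> Y om l%:Z a = 0 by move=> Ml; have := hM l; rewrite add0r; apply; lia.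
rewrite !L0b_E (act_comm _ _ _ _ hM').
rewrite (@sqactE 0 om _ a M.+2) => [|j hj]; last by rewrite add0r hM'.
rewrite (lin_sum (glin_linear dV (fun l => act_lin_a s _ b))).
have D l : hasse l (E 1 1) * g = sercst (E 1 1 l) * (E (1 - l%:R) 0 * g) + sercst (E 1 0 l) * (E (1 - l%:R) 1 * g).
  by rewrite hasse_E1; ring.
rewrite (eq_bigr (fun l : 'I_M.+2 =>
   glin dV (fun l x => sqact s x (E (l%:R - 1) 0 * (E (1 - h%:R) 0 * g)) b) (E 1 1 l *: Y om (0 + l%:Z) a)
   + E 1 0 l *: sqact s (Y om l%:Z a) (E (1 - l%:R) 1 * g) b)).
  rewrite big_split; congr (_ + _); rewrite !big_ord_recl big1 ?addr0; last first.
    by move=> l _; rewrite E_gbinom gbinom1SS scale0r.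
  rewrite !E_gbinom gbinom0 gbinom1 !scale1r (_ : 1 - 0%:R = 1); last by rewrite subr0.
  rewrite (_ : 1 - (fintype.lift ord0 ord0 : 'I_M.+2)%:R = 0); last by rewrite subrr.
  rewrite -[(fintype.lift ord0 ord0 : 'I_M.+2)%:Z]/(1 : int) (voa_L0 ah) (linZ (act_lin_a s _ b)) /=.
  by rewrite addr0.
move=> l _; rewrite add0r D sqactD !actZ (linZ (glin_linear dV (fun l => act_lin_a s _ b))).
congr (_ *: _ + _); case: (leqP l h.+1) => lh; last first.
  have -> : Y om l%:Z a = 0 by apply: (mode_Vg0 posV om_gr ah); lia.
  by rewrite (lin0 (act_lin_a _ _ _)) (lin0 (glin_linear dV (fun l => act_lin_a s _ b))).
have lg : Vg (h.+1 - l)%N (Y om l%:Z a) by apply: (mode_Vg om_gr ah); lia.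
rewrite (glin_hom dV (fun l => act_lin_a s _ b) lg) mulrA E_mul0 natrB // -natr1.
by congr (sqact s _ (E _ 0 * g) b); ring.
Qed.

Lemma L0b_br n a b : L0b (br n a b) = br n (L0b a) b + br n a (L0b b) - n.+1%:R *: br n a b.
Proof.
move: a; apply: (graded_lin_ext dV (f := fun a => L0b (br n a b))
  (g := fun a => br n (L0b a) b + br n a (L0b b) - n.+1%:R *: br n a b)).
- by apply: (linear_comp (br_lin_b 1 om)); apply: br_lin_a.
- apply: linear_add; last by move=> c u v; rewrite (br_lin_a n b) scalerDr opprD scalerA mulrC -scalerA scalerN.
  by apply: linear_add; [apply: (linear_comp (br_lin_a n b) (br_lin_b 1 om)) | apply: br_lin_a].
move=> h a ah; rewrite !(br_hom n _ ah).
rewrite -[L0b (sqact _ _ _ _)](subrK (sqact 0 a (E (h%:R - 1) n) (L0b b))) (act_comm_L0 0 (E (h%:R - 1) n) b ah).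
rewrite E_mul0 (_ : 1 - h%:R + (h%:R - 1) = 0); last by ring.
have -> : glin dV (fun l x => sqact 0 x (E (l%:R - 1) 0 * E 0 n) b) (L0b a) = br n (L0b a) b.
  by rewrite /br; congr (glin dV _ _); apply/funext => l; apply/funext => x; rewrite E_mul0 addr0.
rewrite addrAC; congr (_ + _); rewrite !E_mul1 !actMn act_Lm1 (_ : 1 + (h%:R - 1) = h%:R); last by ring.
have G (x y : V) (c : K) k : - (c *: x + y) *+ k + c *: (x *+ k) = - (k%:R *: y).
  by rewrite -[_ *+ k]scaler_nat -[x *+ k]scaler_nat scalerN scalerDr !scalerA [c * _]mulrC opprD addrAC addNr add0r.
by rewrite add0r sder_E sqactD actZ G.
Qed.

Lemma L0b_brm a b : L0b (brm a b) = brm (L0b a) b + brm a (L0b b).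
Proof.
move: a; apply: (graded_lin_ext dV (f := fun a => L0b (brm a b))
  (g := fun a => brm (L0b a) b + brm a (L0b b))).
- by apply: (linear_comp (br_lin_b 1 om)); apply: brm_lin_a.
- by apply: linear_add; [apply: (linear_comp (brm_lin_a b) (br_lin_b 1 om)) | apply: brm_lin_a].
move=> h a ah; rewrite !(brm_hom _ ah); apply/eqP; rewrite -subr_eq; apply/eqP.
rewrite (act_comm_L0 (-1) (E (h%:R - 1) 0 * xi) b ah) mulrA E_mul0 (_ : 1 - h%:R + (h%:R - 1) = 0); last by ring.
rewrite E00 mul1r -[RHS]addr0; congr (_ + _).
have xX (m : K) : E m 1 * xi = serX * E m 0.
  have -> : E m 1 = E 0 1 * E m 0 by rewrite E_mul1 add0r.
  by rewrite mulrAC zetaE -[serX * _ * xi]mulrA xiE mulr1.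
rewrite !mulrA !E_mul1 !mulr1n (_ : 1 + (h%:R - 1) = h%:R); last by ring.
by rewrite add0r !xX act_Lm1m -serX_sder !act_X sder_E addr0 actZ addNr.
Qed.

Lemma br_Lm1 n a b : br n (L1b a) b = (if n is n'.+1 then - br n' a b else 0).
Proof.
move: a; apply: (graded_lin_ext dV (f := fun a => br n (L1b a) b)
  (g := fun a => if n is n'.+1 then - br n' a b else 0)).
- exact: (linear_comp (br_lin_a n b) (br_lin_b 0 om)).
- case: n => [|n] c u v; first by rewrite scaler0 addr0.
  by rewrite (br_lin_a n b) opprD scalerN.
move=> h a ah; rewrite L1b_E (linD (br_lin_a n b)) (voa_L0 ah) (linZ (br_lin_a n b)).
have Da : Vg h.+1 (Y om 0 a) by apply: (mode_Vg om_gr ah); lia.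
rewrite (br_hom n b Da) (br_hom n b ah) act_Lm1 -[h.+1%:R]natr1 addrK sder_E.
rewrite sqactD actZ opprD addrAC addNr add0r.
by case: n => [|n]; rewrite ?sqact0 ?oppr0 // (br_hom n b ah).
Qed.

Lemma one_gr : Vg 0 (voa_one V). Proof. exact: voa_one_gr. Qed.

Lemma br_one n b : br n (voa_one V) b = 0.
Proof.
rewrite (br_hom n b one_gr) (@sqactE _ _ _ _ 0) ?big_ord0 // => j _.
by rewrite voa_vacuum add0r.
Qed.

Lemma brm_one b : brm (voa_one V) b = b.
Proof.
rewrite (brm_hom b one_gr) (@sqactE _ _ _ _ 1) => [|j j0]; last first.
  by rewrite voa_vacuum ifN //; lia.
by rewrite big_ord1 voa_vacuum addr0 eqxx serM0 E_0 xi0 mulr1 scale1r.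
Qed.

Lemma L0b_one : L0b (voa_one V) = 0.
Proof.
rewrite L0b_E (@sqactE _ _ _ _ 0) ?big_ord0 // => j _.
by rewrite (voa_creation om).2.
Qed.

Lemma Lp_om (k : nat) : (1 <= k)%N -> Y om k.+1%:Z om = (if k == 2%N then 2%:R^-1 * voa_c V else 0) *: voa_one V.
Proof.
move=> k1; have := @voa_virasoro R V k%:Z (-2) (voa_one V).
rewrite (_ : -2 + 1 = -1 :> int) // (voa_creation om).1 (voa_creation om).2 ?(lin0 (YVl _ _)) ?subr0; last by lia.
rewrite (_ : k%:Z + 1 = k.+1%:Z); last by lia.
move=> ->; case: (eqVneq k 2) => [->|k2].
  rewrite (voa_creation om).2 // scaler0 add0r /=; congr (_ *: _).
  by rewrite (_ : (2 : int) ^+ 3 - 2 = 6) // -[6%:~R]/(6%:R : K); field.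
rewrite (_ : (k%:Z - 2 == 0) = false); last by apply/negP => /eqP; lia.
rewrite !scale0r addr0; case: (ltnP k 2) => k2'; last by rewrite (voa_creation om).2 ?scaler0 //; lia.
have -> : k = 1%N by lia.
have -> : Y om (1%:Z - 2 + 1) (voa_one V) = 0 by rewrite (voa_creation om).2.
by rewrite scaler0.
Qed.

Lemma E11_vals : [/\ E 1 1 0%N = 0 :> K, E 1 1 1%N = 1 :> K & E 1 1 3%N = - 6%:R^-1 :> K].
Proof.
have e0 : E 1 1 0%N = 0 :> K by rewrite E_0.
have e1 : E 1 1 1%N = 1 :> K by have := E_S (1 : K) 1 0; rewrite mulr1n e0 mulr0 add0r E_0.
have e2 : E 1 1 2%N = 2%:R^-1 :> K.
  have n2 : (2%:R : K) != 0 by rewrite pnatr_eq0.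
  apply: (mulIf n2); rewrite mulr_natr E_S E_gbinom gbinom1 subrr mul0r add0r mulVf //.
have n3 : (3%:R : K) != 0 by rewrite pnatr_eq0.
split=> //; apply: (mulIf n3); rewrite mulr_natr E_S E_gbinom gbinom1SS e2; by field.
Qed.

(** The anomaly is L(2) om = (c/2) 1 times - 1/6, the coefficient of w^3 in (1 + w) log(1 + w). Thus
    om - c/24 has L[0]-weight 2. *)
Lemma L0b_om : L0b om = 2%:R *: om - (voa_c V / 12%:R) *: voa_one V.
Proof.
have [e0 e1 e3] := E11_vals.
rewrite L0b_E (@sqactE _ _ _ _ 4) => [|j j4]; last first.
  by rewrite add0r (_ : j%:Z = j.-1.+1%:Z) ?Lp_om ?ifN ?scale0r //; lia.
have -> : \sum_(j < 4) E 1 1 j *: Y om (0 + j%:Z) om = E 1 1 0%N *: Y om 0 om +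
    (E 1 1 1%N *: Y om 1 om + (E 1 1 2%N *: Y om 2%N%:Z om + (E 1 1 3%N *: Y om 3%N%:Z om + 0))).
  by rewrite !big_ord_recl big_ord0.
rewrite addr0 e0 scale0r add0r Lp_om // Lp_om // !scale0r scaler0 add0r (voa_L0 om_gr).
rewrite e1 scale1r; congr (_ + _).
rewrite e3 scalerA -scaleNr; congr (_ *: _).
by field.
Qed.

Lemma L0b_L1b b : L0b (L1b b) = L1b (L0b b) + L1b b.
Proof.
rewrite /L1b L0b_br L0b_om (linB (br_lin_a 0 b)) !(linZ (br_lin_a 0 b)) br_one scaler0 subr0.
rewrite addrAC addrC -scalerBl; congr (_ + _).
by rewrite (_ : 2%:R - 1%:R = 1) ?scale1r //; ring.
Qed.

Definition L2b b := brm om b - (voa_c V / 24%:R) *: b.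

Lemma L0b_L2b b : L0b (L2b b) = L2b (L0b b) + 2%:R *: L2b b.
Proof.
rewrite /L2b (linB L0b_lin) L0b_brm L0b_om (linB (brm_lin_a b)) !(linZ (brm_lin_a b)) brm_one.
rewrite (linZ L0b_lin) scalerBr scalerA.
rewrite (_ : 2%:R * (voa_c V / 24%:R) = voa_c V / 12%:R :> K); last by field.
move: (brm _ (L0b b)) (2%:R *: _) (_ *: L0b b) (_ *: b) => x y z t.
by rewrite -[LHS]addrA addrC.
Qed.

Lemma br_small a b : exists M : nat, forall k, (M <= k)%N -> br k a b = 0.
Proof.
apply: (graded_ind dV (P := [set a | exists M : nat, forall k, (M <= k)%N -> br k a b = 0])).
  split; first by exists 0%N => k _; rewrite (lin0 (br_lin_a k b)).
  move=> c u v [M hM] [M' hM']; exists (M + M')%N => k hk.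
  by rewrite (br_lin_a k b) hM ?hM' ?scaler0 ?addr0 //; lia.
move=> h x xh /=; have [N hN] := Ytrunc x b 0; exists N => k Nk.
rewrite (br_hom k b xh) (@sqactE _ _ _ _ N) // big1 // => j _.
by rewrite E_small ?scale0r //; have := ltn_ord j; lia.
Qed.

(** By [half_kernel], (2 + w) / w equals 2 kap(log(1 + w)) / log(1 + w); expanding [kap] in powers
    of the logarithm gives a[-1] from its constant term and the a[k] from the rest. *)
Lemma act_half h a b M : Vg h a -> (forall j : nat, (M <= j)%N -> Y a (0 + j%:Z) b = 0) ->
  sqact (-1) a (E (h%:R - 1) 0 * (2%:R + serX)) b =
  2%:R *: (brm a b + \sum_(k < M) (kap k.+1 * k`!%:R) *: br k a b).
Proof.
move=> ah hM; have hM' j : (M.+1 <= j)%N -> Y a (-1 + j%:Z) b = 0.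
  by case: j => // j jM; have := hM j; rewrite add0r (_ : -1 + j.+1%:Z = j%:Z); [apply | lia].
pose T : ser K := xi + serX * \sum_(k < M) sercst (kap k.+1 * k`!%:R) * E 0 k.
have TE j : (j <= M)%N -> (xi * logsub kap) j = T j.
  move=> jM; transitivity ((xi * \sum_(k < M.+1) sercst (@kap K k) * E 0 1 ^+ k) j).
    rewrite !serM; apply: eq_bigr => i _; congr (_ * _).
    rewrite (@logsubE _ _ _ M.+1) ?ser_sum; last by rewrite ltnS; apply: leq_trans (leq_subr _ _) jM.
    by apply: eq_bigr => k _; rewrite sercstM.
  congr (scoef _ j); rewrite big_ord_recl kap0 rmorph1 mul1r expr0 mulrDr mulr1; congr (_ + _).
  rewrite !mulr_sumr; apply: eq_bigr => k _.
  have cE : sercst (kap k.+1 * k`!%:R) = sercst (@kap K k.+1) * k`!%:R by rewrite rmorphM rmorph_nat.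
  rewrite -[fintype.lift _ _ : nat]/(k.+1) exprS E01X cE -[E 0 k *+ _]mulr_natr.
  transitivity (sercst (@kap K k.+1) * k`!%:R * (E 0 1 * xi * E 0 k)); first by ring.
  by rewrite xi_E01; ring.
rewrite -half_kernel mulrCA -(rmorph_nat (@sercst K)) actZ; congr (_ *: _).
transitivity (sqact (-1) a (E (h%:R - 1) 0 * T) b).
  rewrite !(@sqactE _ _ _ _ M.+1) //; apply: eq_bigr => j _; congr (_ *: _); rewrite !serM.
  by apply: eq_bigr => i _; rewrite TE //; have := ltn_ord j; lia.
rewrite /T mulrDr sqactD (brm_hom b ah) mulrCA act_X; congr (_ + _).
have aS (r : seq nat) (F : nat -> ser K) : sqact 0 a (\sum_(i <- r) F i) b = \sum_(i <- r) sqact 0 a (F i) b.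
  by elim: r => [|i r IHr]; rewrite ?big_nil ?sqact0 // !big_cons sqactD IHr.
rewrite mulr_sumr -(big_mkord xpredT (fun k => E (h%:R - 1) 0 * (sercst (kap k.+1 * k`!%:R) * E 0 k))).
rewrite aS big_mkord; apply: eq_bigr => k _.
by rewrite mulrCA actZ E_mul0 addr0 (br_hom k b ah).
Qed.

(** The filtration by L(0)-degree. L[0] is triangular for it, with eigenvalue n on the n-th graded
    part, which allows the two gradings to be compared. *)
Definition Ulow n : set V := [set v | forall k, (n <= k)%N -> pr dV k v = 0].

Lemma Ulow_sub n : subspace (Ulow n).
Proof.
split=> [k _|a u v hu hv k nk]; first exact: (lin0 (pr_linear dV k)).
by rewrite (pr_linear dV k) hu // hv // scaler0 addr0.
Qed.

Lemma Ulow_mono n m : (n <= m)%N -> Ulow n `<=` Ulow m.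
Proof. by move=> nm v h k mk; apply: h; apply: leq_trans mk. Qed.

Lemma Vg_Ulow k n v : (k < n)%N -> Vg k v -> Ulow n v.
Proof. by move=> kn vk j nj; rewrite (pr_case dV j vk) ifN //; lia. Qed.

Lemma Ulow_ind (P : set V) n : subspace P -> (forall k v, (k < n)%N -> Vg k v -> P v) -> Ulow n `<=` P.
Proof.
move=> sP h v hv; have [s us sv] := pr_supp dV v; rewrite (pr_sum us sv).
apply: (sub_sumP sP) => i _; case: (ltnP i n) => ik; first by apply: (h i) => //; apply: pr_in.
by rewrite hv //; case: sP.
Qed.

Lemma Ulow0 v : Ulow 0 v -> v = 0.
Proof.
by apply: (@Ulow_ind [set v | v = 0] 0) => //; split=> // a u w /= -> ->; rewrite scaler0 addr0.
Qed.

Lemma Ulow_ex v : exists M, Ulow M v.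
Proof. by have [M hM] := pr_supp_nat posV v; exists M. Qed.

Lemma mode_Ulow p q a b (i : int) n : Vg p a -> Vg q b -> q%:Z + p%:Z - i - 1 < n%:Z -> Ulow n (Y a i b).
Proof.
move=> ap bq h; case: (ltrP (q%:Z + p%:Z - i - 1) 0) => neg.
  by rewrite (mode_Vg0 posV ap bq neg); case: (Ulow_sub n).
have [j jE] : exists j : nat, q%:Z + p%:Z - i - 1 = j%:Z by exists (absz (q%:Z + p%:Z - i - 1)%R); lia.
by apply: (@Vg_Ulow j); [lia | apply: (mode_Vg ap bq); rewrite -jE].
Qed.

Lemma L0b_top n v : Vg n v -> Ulow n (L0b v - n%:R *: v).
Proof.
move=> vn; have [N hN] := Ytrunc om v 0; have [e0 e1 _] := E11_vals.
rewrite L0b_E (@sqactE _ _ _ _ N.+2); last by move=> j h; apply: hN; lia.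
rewrite 2!big_ord_recl e0 scale0r add0r -[scoef (E 1 1) (fintype.lift _ _)]/(E 1 1 1%N) e1 scale1r.
rewrite -[0 + (fintype.lift _ _)%:Z]/(1 : int) (voa_L0 vn) addrAC subrr add0r.
apply: (sub_sumP (Ulow_sub n)) => j _; apply: (sub_scaleP (Ulow_sub n)).
by apply: (mode_Ulow om_gr vn); rewrite /= /bump /=; lia.
Qed.

Lemma L1b_top n v : Vg n v -> Ulow n.+1 (L1b v - Y om 0 v).
Proof.
move=> vn; rewrite L1b_E addrAC subrr add0r (voa_L0 vn); apply: (sub_scaleP (Ulow_sub _)).
exact: (@Vg_Ulow n).
Qed.

Lemma brm_top p q a b : Vg p a -> Vg q b -> Ulow (p + q) (brm a b - Y a (-1) b).
Proof.
move=> ap bq; have [N hN] := Ytrunc a b (-1).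
rewrite (brm_hom b ap) (@sqactE _ _ _ _ N.+1); last by move=> j h; apply: hN; lia.
rewrite big_ord_recl serM0 E_0 xi0 mulr1 scale1r addr0 addrAC subrr add0r.
apply: (sub_sumP (Ulow_sub _)) => j _; apply: (sub_scaleP (Ulow_sub _)).
by apply: (mode_Ulow ap bq); rewrite /= /bump /=; lia.
Qed.

Lemma brm_Ulow p q a b : Ulow p.+1 a -> Ulow q.+1 b -> Ulow (p + q).+1 (brm a b).
Proof.
move=> ha hb; move: a ha; apply: Ulow_ind; first exact: (subspace_preim (brm_lin_a b) (Ulow_sub _)).
move=> i a ip ai; move: b hb; apply: Ulow_ind; first exact: (subspace_preim (brm_lin_b a) (Ulow_sub _)).
move=> j b jq bj; rewrite -[brm a b](subrK (Y a (-1) b)); apply: (sub_addP (Ulow_sub _)).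
  by apply: (Ulow_mono _ (brm_top ai bj)); lia.
by apply: (mode_Ulow ai bj); lia.
Qed.

Lemma L1b_Ulow p a : Ulow p a -> Ulow p.+1 (L1b a).
Proof.
move: a; apply: Ulow_ind; first exact: (subspace_preim L1b_lin (Ulow_sub _)).
move=> i a ip ai; rewrite -[L1b a](subrK (Y om 0 a)); apply: (sub_addP (Ulow_sub _)).
  by apply: (Ulow_mono _ (L1b_top ai)); lia.
by apply: (mode_Ulow om_gr ai); lia.
Qed.

Definition sqw (mu : K) v := L0b v = mu *: v.

Lemma sqwE mu v : sqw mu v = (L0b v = mu *: v). Proof. by []. Qed.

Lemma sqw_sub mu : subspace (sqw mu).
Proof.
split; first by rewrite /sqw (lin0 L0b_lin) scaler0.
by move=> a u v hu hv; rewrite /sqw L0b_lin hu hv scalerDr !scalerA mulrC.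
Qed.

Lemma L0b_pr n v : Ulow n.+1 v -> pr dV n (L0b v) = n%:R *: pr dV n v.
Proof.
move: v; apply: Ulow_ind.
  split; first by rewrite /= (lin0 L0b_lin) (lin0 (pr_linear dV n)) scaler0.
  by move=> a u v /= hu hv; rewrite L0b_lin !(pr_linear dV n) hu hv scalerDr !scalerA mulrC.
move=> k v kn vk /=; rewrite -[L0b v](subrK (k%:R *: v)) (linD (pr_linear dV n)).
rewrite (L0b_top vk); last by lia.
rewrite add0r (linZ (pr_linear dV n)) (pr_case dV n vk); case: eqP => [->|] //.
by rewrite !scaler0.
Qed.

Lemma sqw_desc mu n v : sqw mu v -> Ulow n.+1 v -> mu != n%:R -> Ulow n v.
Proof.
move=> hv vn mn k; rewrite leq_eqVlt => /orP[/eqP <-|]; last exact: vn.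
have := L0b_pr vn; rewrite hv (linZ (pr_linear dV n)) => /eqP.
by rewrite -subr_eq0 -scalerBl scaler_eq0 subr_eq0 (negbTE mn) => /eqP.
Qed.

Lemma sqw_down mu m v : sqw mu v -> (forall n, (m <= n)%N -> mu != n%:R) -> Ulow m v.
Proof.
move=> hv hm; have [M] := Ulow_ex v; elim: M => [|M IH] vM; first by apply: Ulow_mono vM.
case: (leqP m M) => mM; last by apply: Ulow_mono vM.
by apply: IH; exact: (sqw_desc hv vM (hm M mM)).
Qed.

Lemma sqw_zero mu v : sqw mu v -> (forall n : nat, mu != n%:R) -> v = 0.
Proof. by move=> hv h; apply: Ulow0; apply: (sqw_down hv) => n _; apply: h. Qed.

Lemma sqw_Ulow k v : sqw k%:R v -> Ulow k.+1 v.
Proof. by move=> hv; apply: (sqw_down hv) => n kn; rewrite eqr_nat; lia. Qed.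

Lemma sqw_sep k v : sqw k%:R v -> Ulow k v -> v = 0.
Proof.
move=> hv; elim: k {-2}k (leqnn k) hv => [|n IH] k kn hv vk; first by apply: Ulow0; apply: Ulow_mono vk.
suff h m : (m <= k)%N -> Ulow (k - m) v by have := h k (leqnn k); rewrite subnn; apply: Ulow0.
elim: m => [|m IHm] mk; first by rewrite subn0.
apply: (sqw_desc hv); last by rewrite eqr_nat; lia.
by rewrite -subSn // subSS; apply: IHm; apply: ltnW.
Qed.

Definition Sspan n := lspan [set v | exists k, [/\ (k < n)%N, sqw k%:R v & Ulow n v]].

(** With v' = v + y, the equation (n - L[0]) y = L[0] v - n v has to be solved in lower degree,
    where L[0] is diagonalized with eigenvalues k < n. *)
Lemma top_lift_of n : Ulow n `<=` Sspan n -> forall v, Vg n v ->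
  exists v', [/\ sqw n%:R v', Ulow n (v' - v) & Sspan n (v' - v)].
Proof.
move=> US v vn; set S := Sspan n in US *; have sS : subspace S by exact: lspan_subspace.
have [y Sy yE] : exists2 y, S y & n%:R *: y - L0b y = L0b v - n%:R *: v.
  apply: (@lspan_min _ _ _ [set x | exists2 y, S y & n%:R *: y - L0b y = x] _ _ _ (US _ (L0b_top vn))).
    split; first by exists 0; rewrite ?(lin0 L0b_lin) ?scaler0 ?subr0 //; case: sS.
    move=> a _ _ [y1 S1 <-] [y2 S2 <-]; exists (a *: y1 + y2); first exact: sS.2.
    rewrite L0b_lin scalerBr !scalerDr !scalerA [n%:R * a]mulrC opprD addrACA //.
  move=> x [k [kn xk xn]]; exists ((n%:R - k%:R)^-1 *: x).
    by apply: (sub_scaleP sS); apply: sub_lspan; exists k.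
  have nk : (n%:R - k%:R : K) != 0 by rewrite subr_eq0 eqr_nat; lia.
  by rewrite (linZ L0b_lin) xk !scalerA mulrC -scalerBl -mulrBr mulVf // scale1r.
exists (v + y); rewrite addrAC subrr add0r; split=> //.
  rewrite /sqw (linD L0b_lin) scalerDr; apply/eqP; rewrite -subr_eq0 opprD addrACA -yE.
  by rewrite -[L0b y - _]opprB subrr.
apply: (lspan_min (Ulow_sub n) _ Sy) => x [k []] //.
Qed.

Lemma Ulow_span n : Ulow n `<=` Sspan n.
Proof.
elim: n => [|n IH].
  by move=> v /Ulow0 ->; case: (lspan_subspace [set v | exists k, [/\ (k < 0)%N, sqw k%:R v & Ulow 0 v]]).
have sS : subspace (Sspan n.+1) by exact: lspan_subspace.
have mono : Sspan n `<=` Sspan n.+1.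
  by apply: lspan_mono => x [k [kn xk xn]]; exists k; split; [lia | | apply: Ulow_mono xn].
apply: (Ulow_ind sS) => k v; rewrite ltnS leq_eqVlt => /orP[/eqP ->|kn] vk; last first.
  by apply/mono/IH; apply: (Vg_Ulow kn vk).
have [v' [h1 h2 h3]] := top_lift_of IH vk.
rewrite -[v](subKr v'); apply: (sub_subP sS); last exact: mono.
by apply: sub_lspan; exists n; split=> //; apply: sqw_Ulow.
Qed.

Lemma top_lift n v : Vg n v -> exists2 v', sqw n%:R v' & Ulow n (v' - v).
Proof. by move=> /(top_lift_of (@Ulow_span n)) [v' [h1 h2 _]]; exists v'. Qed.

Lemma sqw_br n i j a b : sqw i a -> sqw j b -> sqw (i + j - n.+1%:R) (br n a b).
Proof.
move=> ai bj; rewrite /sqw L0b_br ai bj (linZ (br_lin_a n b)) (linZ (br_lin_b n a)).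
by rewrite scalerBl scalerDl.
Qed.

Lemma sqw_brm i j a b : sqw i a -> sqw j b -> sqw (i + j) (brm a b).
Proof.
by move=> ai bj; rewrite /sqw L0b_brm ai bj (linZ (brm_lin_a b)) (linZ (brm_lin_b a)) scalerDl.
Qed.

Lemma sqw_L1b i a : sqw i a -> sqw (i + 1) (L1b a).
Proof. by move=> ai; rewrite /sqw L0b_L1b ai (linZ L1b_lin) scalerDl scale1r. Qed.

Lemma L2b_lin : linear L2b.
Proof.
apply: linear_add; first exact: brm_lin_b.
by move=> a u v; rewrite -!scaleNr scalerDr !scalerA [a * _]mulrC.
Qed.

Lemma sqw_L2b i a : sqw i a -> sqw (i + 2%:R) (L2b a).
Proof.
move=> ai; have e : L2b (L0b a) = i *: L2b a by rewrite ai (linZ L2b_lin).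
by rewrite /sqw scalerDl -e; exact: L0b_L2b.
Qed.

Definition brk k := [set y | exists (i j : nat) a b,
  [/\ (i + j).+1 = k, sqw i%:R a, sqw j%:R b & y = brm (L1b a) b]].

(** [C2hom] for the L[0]-grading, as (L[-1] a)[-1] b = a[-2] b. The top component of [v] is
    rewritten by [C2hom] and the factors are lifted to eigenvectors; the result differs from [v]
    only below degree k, where no nonzero vector has eigenvalue k. *)
Lemma sqw_gen N0 k v : @C2hom R V N0 -> (N0 < k)%N -> sqw k%:R v -> lspan (brk k) v.
Proof.
move=> hC kN vk; have sS : subspace (lspan (brk k)) by exact: lspan_subspace.
have gk : lspan (brk k) `<=` sqw k%:R.
  apply: (lspan_min (sqw_sub _)) => _ [i [j [a [b [<- ai bj ->]]]]].
  by have := sqw_brm (sqw_L1b ai) bj; rewrite -natr1 natrD addrAC.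
have [y Sy yE] : exists2 y, lspan (brk k) y & Ulow k (y - pr dV k v).
  apply: (@lspan_min _ _ _ [set x | exists2 y, lspan (brk k) y & Ulow k (y - x)] _ _ _ (hC k kN _ (pr_in dV k v))).
    split; first by exists 0; rewrite ?subr0; [case: sS | case: (Ulow_sub k)].
    move=> c x1 x2 [y1 S1 e1] [y2 S2 e2]; exists (c *: y1 + y2); first exact: sS.2.
    by have := (Ulow_sub k).2 c _ _ e1 e2; rewrite scalerBr opprD addrACA.
  move=> _ [h [j [u [x [h0 uh xj hE ->]]]]].
  have [u' u1 u2] := top_lift uh; have [x' x1 x2] := top_lift xj.
  exists (brm (L1b u') x'); first by apply: sub_lspan; exists h, j, u', x'; rewrite addnC.
  have Uu' : Ulow h.+1 u' by apply: sqw_Ulow.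
  have -> : Y u (-2) x = Y (Y om 0 u) (-1) x by rewrite voa_Lm1 mulrNz mulr1z opprK scale1r.
  have Du : Vg h.+1 (Y om 0 u) by apply: (mode_Vg om_gr uh); lia.
  have -> : brm (L1b u') x' - Y (Y om 0 u) (-1) x =
      brm (L1b u') (x' - x) + brm (L1b (u' - u)) x + brm (L1b u - Y om 0 u) x
      + (brm (Y om 0 u) x - Y (Y om 0 u) (-1) x).
    rewrite (linB (brm_lin_b _)) (linB L1b_lin) !(linB (brm_lin_a x)).
    by rewrite !addrA !subrK.
  apply: (sub_addP (Ulow_sub k)); first (apply: (sub_addP (Ulow_sub k)); first apply: (sub_addP (Ulow_sub k))).
  - case: j {xj} hE x1 x2 => [|j] hE x1 x2.
      by rewrite (Ulow0 x2) (lin0 (brm_lin_b _)); case: (Ulow_sub k).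
    by rewrite (_ : k = (h.+1 + j).+1); [apply: brm_Ulow => //; apply: L1b_Ulow | lia].
  - case: h {uh h0 u1 Uu' Du} hE u2 => [|h] hE u2.
      by rewrite (Ulow0 u2) (lin0 L1b_lin) (lin0 (brm_lin_a _)); case: (Ulow_sub k).
    rewrite (_ : k = (h.+1 + j).+1); last by lia.
    by apply: brm_Ulow; [apply: L1b_Ulow | apply: (Vg_Ulow _ xj)].
  - rewrite (_ : k = (h + j).+1); last by lia.
    by apply: brm_Ulow; [apply: L1b_top | apply: (Vg_Ulow _ xj)].
  - by rewrite (_ : k = (h.+1 + j)%N); [apply: brm_top | lia].
have -> : v = y; last by [].
apply/eqP; rewrite -subr_eq0; apply/eqP; apply: (@sqw_sep k).
  by apply: (sub_subP (sqw_sub _)) => //; apply: gk.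
rewrite -opprB -scaleN1r; apply: (sub_scaleP (Ulow_sub k)).
rewrite -[y - v](subrKA (pr dV k v)); apply: (sub_addP (Ulow_sub k)) => //.
move=> i ki; rewrite (linB (pr_linear dV i)) (pr_case dV i (pr_in dV k v)).
case: eqP => [->|/eqP ik]; first by rewrite subrr.
by rewrite sub0r (sqw_Ulow vk) ?oppr0 //; lia.
Qed.

End SquareBracket.

(** * Graded traces *)

Lemma divpairs_sum (A : zmodType) n (g : nat -> nat -> A) :
  \sum_(N < n.+1) \sum_(v <- divpairs N) g v.1 v.2 =
  \sum_(j <- iota 1 n) \sum_(i <- iota 1 n | (i * j <= n)%N) g j i.
Proof.
pose L := [seq (j, i) | j <- iota 1 n, i <- iota 1 n].
transitivity (\sum_(N < n.+1) \sum_(v <- L | (v.1 * v.2)%N == N) g v.1 v.2).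
  apply: eq_bigr => N _; rewrite -[RHS]big_filter; apply: perm_big; apply: uniq_perm.
  - exact: uniq_divpairs.
  - by rewrite filter_uniq // allpairs_uniq ?iota_uniq // => -[? ?] [? ?] _ _ [-> ->].
  move=> [a b]; rewrite mem_divpairs mem_filter /=; apply/idP/idP.
    move=> /and3P[a0 b0 /eqP abN]; rewrite abN eqxx /=; apply: allpairs_f; rewrite mem_iota.
      by have := ltn_ord N; nia.
    by have := ltn_ord N; nia.
  by move=> /andP[-> /allpairsP [[c d] [/= + + [-> ->]]]]; rewrite !mem_iota andbT; lia.
rewrite (exchange_big_dep (fun v => (v.1 * v.2 <= n)%N)) /=; last first.
  by move=> N v _ /eqP ->; rewrite -ltnS.
rewrite big_mkcond big_allpairs_dep /=; apply: eq_bigr => j _; rewrite [RHS]big_mkcond.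
apply: eq_bigr => i _; rewrite mulnC; case: ifP => // ij.
have ijn : (i * j < n.+1)%N by rewrite ltnS.
by rewrite (big_pred1 (Ordinal ijn)) // => N; rewrite /= eq_sym -(inj_eq val_inj).
Qed.

(** In generating functions, F = D q^j / (1 - q^j): the geometric series from which divisor sums
    arise. *)
Lemma step_sum (A : zmodType) (j : nat) (F D : nat -> A) : (0 < j)%N ->
  (forall n, (n < j)%N -> F n = 0) -> (forall n, F (n + j)%N = D n + F n) ->
  forall n m, (n <= m)%N -> F n = \sum_(i <- iota 1 m | (i * j <= n)%N) D (n - i * j)%N.
Proof.
move=> j0 F0 FS; elim/ltn_ind => n IH m nm; case: (ltnP n j) => nj.
  rewrite F0 // big_seq_cond big1 // => i; rewrite mem_iota; nia.
case: m nm => [|m] nm; first by move: nj j0; lia.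
rewrite -(subnK nj) FS /= big_cons mul1n subnK // nj; congr (_ + _).
rewrite (IH (n - j)%N _ m); [|lia|lia].
rewrite -(addn1 1) (iotaDl 1 1 m) big_map; apply: eq_big => i; first by rewrite mulnDl mul1n; lia.
by move=> _; rewrite mulnDl mul1n subnDA.
Qed.

Lemma iota1_sum (A : zmodType) n (F : nat -> A) : \sum_(j <- iota 1 n) F j = \sum_(i < n) F i.+1.
Proof.
rewrite -(addn1 0) addnC iotaDl big_map -(big_mkord xpredT (fun i => F i.+1)) /index_iota subn0.
by apply: eq_bigr => i _; rewrite addnC addn1.
Qed.

Section Traces.
Context {R : realType} {V : voa R}.
Hypothesis posV : positive_energy V.
Local Notation K := R[i].
Local Notation Vg := (@Vg R V).
Local Notation om := (voa_omega V).
Local Notation dV := (Vg_sum posV).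
Variables (W : voa_module V) (n0 : K).
Hypothesis dW : direct_sum (fun k : nat => @mod_gr R V W (n0 + k%:R)).
Local Notation Wg k := (@mod_gr R V W (n0 + k%:R)).
Local Notation Y := (@mod_Y R V W).

Lemma Wbasis k : {bc : seq W * (nat -> W -> K) |
  [/\ forall x, x \in bc.1 -> Wg k x, forall j a u v, bc.2 j (a *: u + v) = a * bc.2 j u + bc.2 j v,
    forall v, Wg k v -> v = \sum_(j < size bc.1) bc.2 j v *: bc.1`_j &
    forall i j, (i < size bc.1)%N -> (j < size bc.1)%N -> bc.2 i bc.1`_j = (i == j)%:R]}.
Proof.
apply: cid; have [b [c h]] := basis_coord dW (fun k => @mod_gr_fin R V W (n0 + k%:R)) k.
by exists (b, c).
Qed.

Definition wb k := (sval (Wbasis k)).1.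
Definition wc k := (sval (Wbasis k)).2.
Lemma wb_in k j : (j < size (wb k))%N -> Wg k (wb k)`_j.
Proof. by rewrite /wb; case: (Wbasis k) => /= bc [h _ _ _] jb; apply/h/mem_nth. Qed.
Lemma wc_lin k j : linear (wc k j : W -> K^o).
Proof. by rewrite /wc; case: (Wbasis k) => /= bc [_ h _ _] a u v; apply: h. Qed.
Lemma wbE k v : Wg k v -> v = \sum_(j < size (wb k)) wc k j v *: (wb k)`_j.
Proof. by rewrite /wb /wc; case: (Wbasis k) => /= bc [_ _ h _]; apply: h. Qed.
Lemma wcb k i j : (i < size (wb k))%N -> (j < size (wb k))%N -> wc k i (wb k)`_j = (i == j)%:R.
Proof. by rewrite /wb /wc; case: (Wbasis k) => /= bc [_ _ _ h]; apply: h. Qed.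

Definition tr k (f : W -> W) : K := \sum_(i < size (wb k)) wc k i (f (wb k)`_i).

Lemma tr_ext k (f g : W -> W) : (forall w, Wg k w -> f w = g w) -> tr k f = tr k g.
Proof. by move=> fg; apply: eq_bigr => i _; rewrite fg //; apply: wb_in. Qed.

Lemma tr_id k : tr k id = (size (wb k))%:R.
Proof.
rewrite /tr (eq_bigr (fun=> 1)) ?sumr_const ?card_ord // => i _.
by rewrite wcb ?eqxx.
Qed.

Lemma tr_lin k a (f g : W -> W) : tr k (fun w => a *: f w + g w) = a * tr k f + tr k g.
Proof.
by rewrite /tr mulr_sumr -big_split; apply: eq_bigr => i _; rewrite (wc_lin k i).
Qed.
Lemma tr0 k : tr k (fun=> 0) = 0.
Proof. by rewrite /tr big1 // => i _; rewrite (lin0 (wc_lin k i)). Qed.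
Lemma trD k (f g : W -> W) : tr k (fun w => f w + g w) = tr k f + tr k g.
Proof. by rewrite -[X in X + _]mul1r -tr_lin; apply: tr_ext => w _; rewrite scale1r. Qed.
Lemma trB k (f g : W -> W) : tr k (fun w => f w - g w) = tr k f - tr k g.
Proof.
by rewrite addrC -mulN1r -tr_lin; apply: tr_ext => w _; rewrite scaleN1r addrC.
Qed.
Lemma tr_sum k (I : Type) (r : seq I) (f : I -> W -> W) :
  tr k (fun w => \sum_(i <- r) f i w) = \sum_(i <- r) tr k (f i).
Proof.
elim: r => [|i r IH]; first by rewrite big_nil -[RHS](tr0 k); apply: tr_ext => w _; rewrite big_nil.
by rewrite big_cons -IH -trD; apply: tr_ext => w _; rewrite big_cons.
Qed.

(** Cyclicity across two different degrees; this produces the degree shifts in the recursions for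
    traces. *)
Lemma tr_cyc m n (f g : W -> W) : linear f -> linear g ->
  (forall w, Wg m w -> Wg n (f w)) -> (forall w, Wg n w -> Wg m (g w)) ->
  tr n (fun w => f (g w)) = tr m (fun w => g (f w)).
Proof.
move=> lf lg fmn gnm.
transitivity (\sum_(i < size (wb n)) \sum_(j < size (wb m)) wc m j (g (wb n)`_i) * wc n i (f (wb m)`_j)).
  apply: eq_bigr => i _; rewrite {1}(wbE (gnm _ (wb_in (ltn_ord i)))) (lin_sum lf) (lin_sum (wc_lin n i)).
  by apply: eq_bigr => j _; rewrite (linZ lf) (linZ (wc_lin n i)).
rewrite exchange_big; apply: eq_bigr => j _ /=.
rewrite [in RHS](wbE (fmn _ (wb_in (ltn_ord j)))) (lin_sum lg) (lin_sum (wc_lin m j)).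
by apply: eq_bigr => i _; rewrite (linZ lg) (linZ (wc_lin m j)) mulrC.
Qed.

(** The zero mode o(a) = a_(wt a - 1). *)
Definition oW (a : V) (w : W) : W := glin dV (fun h a => Y a (h%:Z - 1) w) a.
Lemma oW_lin_a w : linear (oW ^~ w).
Proof. by apply: glin_linear => h; apply: Yr. Qed.
Lemma oW_hom h a w : Vg h a -> oW a w = Y a (h%:Z - 1) w.
Proof. by move=> ah; rewrite /oW (glin_hom dV _ ah) // => i; apply: Yr. Qed.

Definition Sn n (a : V) : K := tr n (oW a).
Lemma Sn_lin n : linear (Sn n : V -> K^o).
Proof. by move=> c u v; rewrite /Sn -tr_lin; apply: tr_ext => w _; apply: oW_lin_a. Qed.
Definition St (a : V) : ser K := Ser (fun n => Sn n a).
Lemma St_lin c u v : St (c *: u + v) = sercst c * St u + St v.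
Proof. by apply: ser_ext => n; rewrite serD sercstM; apply: (Sn_lin n). Qed.
Definition Zn n (a b : V) : K := tr n (fun w => oW b (oW a w)).

Section Homogeneous.
Variables (h l : nat) (a b : V).
Hypotheses (ah : Vg h a) (bl : Vg l b).
Definition am (j : int) := Y a (h%:Z - 1 + j).
Definition bm (j : int) := Y b (l%:Z - 1 + j).
Definition Xm (m : K) : V := sqact 0 a (E m 0) b.

Lemma am_gr (j : int) (k n : nat) w : Wg k w -> n%:Z = k%:Z - j -> Wg n (am j w).
Proof. by move=> wk e; apply: (mode_ngr ah wk); lia. Qed.
Lemma bm_gr (j : int) (k n : nat) w : Wg k w -> n%:Z = k%:Z - j -> Wg n (bm j w).
Proof. by move=> wk e; apply: (mode_ngr bl wk); lia. Qed.
Lemma am0 (j : int) (k : nat) w : Wg k w -> k%:Z < j -> am j w = 0.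
Proof. by move=> wk e; apply: (mode_ngr0 dW ah wk); lia. Qed.
Lemma bm0 (j : int) (k : nat) w : Wg k w -> k%:Z < j -> bm j w = 0.
Proof. by move=> wk e; apply: (mode_ngr0 dW bl wk); lia. Qed.

Lemma Yab0 (i : nat) : (h + l <= i)%N -> voa_Y a (0 + i%:Z) b = 0.
Proof. by move=> hi; rewrite add0r; apply: (mode_Vg0 posV ah bl); lia. Qed.

(** The binomials of h - 1 + j in the commutator formula are the coefficients of (1 + w)^(h - 1 +
    j). *)
Lemma zero_mode_comm (j : int) w : am j (bm (- j) w) - bm (- j) (am j w) = oW (Xm (h%:R - 1 + j%:~R)) w.
Proof.
rewrite /am /bm (@mode_comm _ _ _ _ _ _ _ _ (h + l)%N); last first.
  by move=> i hi; have := Yab0 hi; rewrite add0r.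
rewrite /Xm (sqactE _ Yab0) (lin_sum (oW_lin_a w)); apply: eq_bigr => i _.
have il := ltn_ord i.
have gi : Vg (h + l - i).-1 (voa_Y a (0 + i%:Z) b) by apply: (mode_Vg ah bl); lia.
transitivity (gbinom (h%:R - 1 + j%:~R : K) i *: Y (voa_Y a (0 + i%:Z) b) ((h + l - i).-1%:Z - 1) w).
  congr (gbinom _ _ *: Y _ _ _); first by rewrite intrD intrB.
  by lia.
by rewrite (linZ (oW_lin_a w)) (oW_hom w gi) -(E_gbinom (h%:R - 1 + j%:~R) i).
Qed.

Lemma Sn_Xm n (j : int) : Sn n (Xm (h%:R - 1 + j%:~R)) =
  tr n (fun w => am j (bm (- j) w)) - tr n (fun w => bm (- j) (am j w)).
Proof. by rewrite -trB; apply: tr_ext => w _; rewrite zero_mode_comm. Qed.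

Definition tau (j n : nat) := tr n (fun w => bm (- j%:Z) (am j%:Z w)).
Definition sig' (j n : nat) := tr n (fun w => am (- j%:Z) (bm j%:Z w)).

(** Exchanging the two modes costs the trace of a zero mode; moving one of them around the trace
    shifts the degree by j. *)
Lemma tau_step j n : tau j (n + j) = Sn n (Xm (h%:R - 1 + j%:R)) + tau j n.
Proof.
rewrite -[j%:R]/((j%:Z)%:~R) Sn_Xm subrK; symmetry; apply: tr_cyc; rewrite /am /bm; try exact: Yl.
  by move=> w wk; apply: (am_gr wk); lia.
by move=> w wk; apply: (bm_gr wk); lia.
Qed.

Lemma sig_step j n : sig' j (n + j) = - Sn n (Xm (h%:R - 1 - j%:R)) + sig' j n.
Proof.
rewrite -[j%:R]/((j%:Z)%:~R) -mulrNz Sn_Xm opprK opprB subrK; apply: tr_cyc; rewrite /am /bm; try exact: Yl.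
  by move=> w wk; apply: (am_gr wk); lia.
by move=> w wk; apply: (bm_gr wk); lia.
Qed.

Lemma tau_small j n : (n < j)%N -> tau j n = 0.
Proof.
move=> nj; rewrite -[RHS](tr0 n); apply: tr_ext => w wn.
by rewrite (am0 wn) ?ltz_nat // /bm (lin0 (Yl _ _)).
Qed.
Lemma sig_small j n : (n < j)%N -> sig' j n = 0.
Proof.
move=> nj; rewrite -[RHS](tr0 n); apply: tr_ext => w wn.
by rewrite (bm0 wn) ?ltz_nat // /am (lin0 (Yl _ _)).
Qed.

Lemma Sn_br0 n : Sn n (br posV 0 a b) = 0.
Proof.
rewrite (br_hom posV 0 b ah); have := tau_step 0 n; rewrite addn0 addr0.
by move/eqP; rewrite -subr_eq subrr eq_sym => /eqP.
Qed.

Lemma Xm_shift (t : K) M : (h + l <= M)%N -> Xm (h%:R - 1 + t) = \sum_(k < M) t ^+ k *: br posV k a b.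
Proof.
move=> hM; have Y0 i : (M <= i)%N -> voa_Y a (0 + i%:Z) b = 0 by move=> Mi; apply: Yab0; lia.
rewrite /Xm (sqactE _ Y0) (eq_bigr (fun i : 'I_M => \sum_(k < M) (t ^+ k * E (h%:R - 1) k i) *: voa_Y a (0 + i%:Z) b)).
  rewrite exchange_big; apply: eq_bigr => k _.
  by rewrite (br_hom posV k b ah) (sqactE _ Y0) scaler_sumr; apply: eq_bigr => i _; rewrite scalerA.
by move=> i _; rewrite -scaler_suml E_shift.
Qed.

Hypothesis h1 : (0 < h)%N.

Lemma E_geom m : E (m%:R : K) 0 = 1 + serX * \sum_(j < m) E j%:R 0.
Proof.
elim: m => [|m IH]; first by rewrite big_ord0 mulr0 addr0 E00.
rewrite big_ord_recr /= mulrDr addrA -IH -natr1 [m%:R + 1]addrC -(E_mul0 1 m%:R 0) E10; ring.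
Qed.

(** The iterate formula expands o(a_(-1) b) in products of modes, of which h - 1 stand in the wrong
    order. The terms of (1 + w)^(h - 1) = 1 + w (1 + ... + (1 + w)^(h - 2)) after the first
    contribute exactly the commutators that reorder them. *)
Lemma Sn_prod n : Sn n (sqact (-1) a (E (h%:R - 1) 0) b) =
  Zn n a b + \sum_(j <- iota 1 n) (tau j n + sig' j n).
Proof.
have [g hE] : exists g, h = g.+1 by exists h.-1; lia.
have actE0 : sqact (-1) a (E (h%:R - 1) 0) b = voa_Y a (-1) b + \sum_(i < g) Xm i%:R.
  rewrite hE -natr1 addrK E_geom sqactD act_X; congr (_ + _).
    have [N hN] := Ytrunc a b (-1); rewrite (@sqactE _ _ _ _ _ _ N.+1); last by move=> j hj; apply: hN; lia.
    rewrite big_ord_recl ser1 scale1r addr0 big1 ?addr0 // => j _.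
    by rewrite ser1 scale0r.
  have aS (r : seq nat) (F : nat -> ser K) : sqact 0 a (\sum_(i <- r) F i) b = \sum_(i <- r) sqact 0 a (F i) b.
    by elim: r => [|i r IHr]; rewrite ?big_nil ?sqact0 // !big_cons sqactD IHr.
  by rewrite -(big_mkord xpredT (fun j => E j%:R 0)) aS big_mkord.
have XE (i : nat) : (i < g)%N -> Sn n (Xm i%:R) = sig' (g - i) n - tr n (fun w => bm (g - i)%N%:Z (am (- (g - i)%N%:Z) w)).
  move=> ig; have -> : (i%:R : K) = h%:R - 1 + (- (g - i)%N%:Z)%:~R.
    by rewrite hE -natr1 addrK mulrNz -[((g - i)%N%:Z)%:~R]/((g - i)%N%:R) natrB ?(ltnW ig) // opprB addrC subrK.
  by rewrite Sn_Xm opprK.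
have gab : Vg (h + l)%N (voa_Y a (-1) b) by apply: (mode_Vg ah bl); lia.
have iter : Sn n (voa_Y a (-1) b) =
    \sum_(i < n + h) (sig' (h + i) n + tr n (fun w => bm (g%:Z - i%:Z) (am (i%:Z - g%:Z) w))).
  rewrite /sig' -(big_mkord xpredT (fun i => tr n (fun w => am (- (h + i)%N%:Z) (bm (h + i)%N%:Z w)) + tr n (fun w => bm (g%:Z - i%:Z) (am (i%:Z - g%:Z) w)))).
  rewrite (eq_bigr (fun i => tr n (fun w => am (- (h + i)%N%:Z) (bm (h + i)%N%:Z w) + bm (g%:Z - i%:Z) (am (i%:Z - g%:Z) w)))); last by move=> i _; rewrite trD.
  rewrite -tr_sum; apply: tr_ext => w wn; rewrite (oW_hom _ gab).
  rewrite (@mode_iter _ _ _ _ _ _ _ (n + h)%N); first last.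
  - by move=> i hi; apply: (mode_ngr0 dW ah wn); lia.
  - by move=> i hi; apply: (mode_ngr0 dW bl wn); lia.
  rewrite big_mkord; apply: eq_bigr => i _; rewrite /am /bm.
  by congr (Y _ _ (Y _ _ _) + Y _ _ (Y _ _ _)); lia.
rewrite actE0 (linD (Sn_lin n)) (lin_sum (Sn_lin n)) iter big_split /=.
rewrite (eq_bigr (fun i : 'I_g => sig' (g - i) n - tr n (fun w => bm (g - i)%N%:Z (am (- (g - i)%N%:Z) w)))); last first.
  by move=> i _; apply: XE.
rewrite sumrB.
have -> : \sum_(i < n + h) tr n (fun w => bm (g%:Z - i%:Z) (am (i%:Z - g%:Z) w)) =
    \sum_(i < g) tr n (fun w => bm (g - i)%N%:Z (am (- (g - i)%N%:Z) w)) + (Zn n a b + \sum_(j <- iota 1 n) tau j n).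
  have -> : (n + h = g + (1 + n))%N by lia.
  rewrite big_split_ord /=; congr (_ + _).
    by apply: eq_bigr => i _; apply: tr_ext => w _; congr (bm _ (am _ w)); have := ltn_ord i; lia.
  rewrite big_split_ord big_ord1 /=; congr (_ + _).
    apply: tr_ext => w _; rewrite (oW_hom _ ah) (oW_hom _ bl) /bm /am.
    by congr (Y _ _ (Y _ _ w)); lia.
  rewrite iota1_sum; apply: eq_bigr => i _.
  by apply: tr_ext => w _; congr (bm _ (am _ w)); lia.
have sS : \sum_(i < n + h) sig' (h + i) n + \sum_(i < g) sig' (g - i) n = \sum_(j <- iota 1 n) sig' j n.
  rewrite iota1_sum addrC (reindex_inj rev_ord_inj) /=.
  transitivity (\sum_(i < n + (g + h)) sig' i.+1 n); last first.
    rewrite big_split_ord /= [X in _ + X]big1 ?addr0 // => i _.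
    by rewrite sig_small //; lia.
  rewrite (_ : (n + (g + h))%N = (g + (n + h))%N); last by lia.
  rewrite [RHS]big_split_ord /=; congr (_ + _); apply: eq_bigr => i _; congr (sig' _ n).
    by have := ltn_ord i; lia.
  by rewrite /= -addSn -hE.
have R1 (x y z t u : K) : x + (z + (t + u)) + (y - z) = t + (u + (x + y)) by ring.
rewrite big_split -sS /=; exact: R1.
Qed.

(** (2 + w) / w = 2 / w + 1, and the summand 1 contributes a[0] b, whose traces vanish. *)
Lemma Sn_half n M : (h + l <= M)%N -> Sn n (sqact (-1) a (E (h%:R - 1) 0) b) =
  Sn n (brm posV a b) + \sum_(k < M) (kap k.+1 * k`!%:R) * Sn n (br posV k a b).
Proof.
move=> hM; have Y0 i : (M <= i)%N -> voa_Y a (0 + i%:Z) b = 0 by move=> Mi; apply: Yab0; lia.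
have := congr1 (Sn n) (act_half posV ah Y0).
rewrite mulrDr -{1}(rmorph_nat (@sercst K)) [_ * sercst _]mulrC sqactD actZ [_ * serX]mulrC act_X.
rewrite -(br_hom posV 0 b ah) (linD (Sn_lin n)) !(linZ (Sn_lin n)) Sn_br0 addr0.
have n2 : (2%:R : K) != 0 by rewrite pnatr_eq0.
move=> /(mulfI n2) ->; rewrite (linD (Sn_lin n)); congr (_ + _).
by rewrite (lin_sum (Sn_lin n)); apply: eq_bigr => k _; rewrite (linZ (Sn_lin n)).
Qed.

Lemma gam_div k N : \sum_(v <- divpairs N) (v.1%:R ^+ k - (- v.1%:R) ^+ k) =
  - (k`!%:R * (gam k.+1 N - (N == 0%N)%:R * kap k.+1)) :> K.
Proof.
have k0 : (k`!%:R : K) != 0 by rewrite pnatr_eq0 -lt0n fact_gt0.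
case: N => [|N]; first by rewrite divpairs0 big_nil gam_0 mul1r subrr mulr0 oppr0.
by rewrite gam_S // mul0r subr0 mulrC divfK // opprK.
Qed.

(** Zhu's recursion for homogeneous arguments. Solving the degree shifts of [tau] and [sig'] gives
    divisor sums, recognized by [gam_div] as the q-coefficients of [gam] without the constant terms;
    those are supplied by [Sn_half]. *)
Lemma ZR_hom n M : (h + l <= M)%N -> Sn n (brm posV a b) =
  Zn n a b - \sum_(k < M) (sercst k`!%:R * gam k.+1 * St (br posV k a b)) n.
Proof.
move=> hM; have := Sn_prod n; rewrite (Sn_half n hM) => H.
pose D j m := Sn m (Xm (h%:R - 1 + j%:R)) - Sn m (Xm (h%:R - 1 - j%:R)).
have tsE j : (0 < j)%N -> (j <= n)%N -> tau j n + sig' j n = \sum_(i <- iota 1 n | (i * j <= n)%N) D j (n - i * j)%N.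
  move=> j0 jn; apply: (@step_sum _ j (fun n => tau j n + sig' j n) (D j)) => // m.
    by move=> mj; rewrite tau_small // sig_small // addr0.
  by rewrite tau_step sig_step /D addrACA.
have E1 : \sum_(j <- iota 1 n) (tau j n + sig' j n) =
    \sum_(k < M) \sum_(N < n.+1) (- (k`!%:R * (gam k.+1 N - (N == 0%N :> nat)%:R * kap k.+1))) * Sn (n - N)%N (br posV k a b).
  rewrite big_seq (eq_bigr (fun j => \sum_(i <- iota 1 n | (i * j <= n)%N) D j (n - i * j)%N)); last first.
    by move=> j; rewrite mem_iota => jn; apply: tsE; lia.
  rewrite -big_seq -(divpairs_sum n (fun j i => D j (n - i * j)%N)) exchange_big; apply: eq_bigr => N _.
  transitivity (\sum_(v <- divpairs N) \sum_(k < M) (v.1%:R ^+ k - (- v.1%:R) ^+ k) * Sn (n - N)%N (br posV k a b)).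
    rewrite big_seq [RHS]big_seq; apply: eq_bigr => v; rewrite mem_divpairs => /and3P[_ _ /eqP vN].
    rewrite [(v.2 * v.1)%N]mulnC vN /D !(@Xm_shift _ M) // !(lin_sum (Sn_lin _)) -sumrB.
    by apply: eq_bigr => k _; rewrite !(linZ (Sn_lin _)) -mulrBl.
  by rewrite exchange_big; apply: eq_bigr => k _; rewrite -mulr_suml gam_div.
have E2 : \sum_(j <- iota 1 n) (tau j n + sig' j n) =
    \sum_(k < M) ((kap k.+1 * k`!%:R) * Sn n (br posV k a b) - (sercst k`!%:R * gam k.+1 * St (br posV k a b)) n).
  rewrite E1; apply: eq_bigr => k _; rewrite -[sercst _ * _ * _]mulrA sercstM serM.
  rewrite (eq_bigr (fun N : 'I_n.+1 => (N == 0%N :> nat)%:R * (k`!%:R * kap k.+1 * Sn (n - N)%N (br posV k a b))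
     - k`!%:R * (gam k.+1 N * St (br posV k a b) (n - N)%N))); last first.
    by move=> N _; rewrite -[St _ _]/(Sn _ _); ring.
  rewrite sumrB -mulr_sumr; congr (_ - _); rewrite big_ord_recl big1 ?addr0 => [|i _]; last first.
    by rewrite -[X in X * _]/(0 : K) mul0r.
  have -> : ((ord0 : 'I_n.+1) == 0%N :> nat)%:R = 1 :> K by [].
  by rewrite mul1r subn0 [k`!%:R * _]mulrC.
rewrite E2 sumrB in H.
by apply: (addIr (\sum_(k < M) kap k.+1 * k`!%:R * Sn n (br posV k a b))); rewrite H addrAC addrA.
Qed.

End Homogeneous.

Lemma oW_lin_w a : linear (oW a).
Proof.
move=> c u v; move: a.
apply: (graded_lin_ext dV (f := fun a => oW a (c *: u + v)) (g := fun a => c *: oW a u + oW a v)).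
- exact: oW_lin_a.
- by apply: linear_add; [apply: linear_scale; apply: oW_lin_a | apply: oW_lin_a].
by move=> h x xh; rewrite !(oW_hom _ xh) (Yl _ _).
Qed.

(** The defect of Zhu's recursion truncated at [M]. It is linear in both arguments, so its vanishing
    passes from homogeneous vectors to others. *)
Definition Df M n a b : K := Sn n (brm posV a b) - Zn n a b +
  \sum_(k < M) (sercst k`!%:R * gam k.+1 * St (br posV k a b)) n.

Lemma Stf_lin (f : ser K) n : linear ((fun x => (f * St x) n) : V -> K^o).
Proof.
move=> c u v; rewrite St_lin mulrDr mulrCA serD sercstM //.
Qed.

Lemma Df_lin_b M n a : linear (Df M n a : V -> K^o).
Proof.
apply: linear_add; last by apply: linear_sumf => k; apply: (linear_comp (Stf_lin _ n) (br_lin_b posV k a)).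
apply: linear_add; first exact: (linear_comp (Sn_lin n) (brm_lin_b posV a)).
move=> c u v; rewrite scalerN -opprD; congr (- _); rewrite /Zn -tr_lin.
by apply: tr_ext => w _; apply: oW_lin_a.
Qed.

Lemma Df_lin_a M n b : linear ((fun a => Df M n a b) : V -> K^o).
Proof.
apply: linear_add; last by apply: linear_sumf => k; apply: (linear_comp (Stf_lin _ n) (br_lin_a posV k b)).
apply: linear_add; first exact: (linear_comp (Sn_lin n) (brm_lin_a posV b)).
move=> c u v; rewrite scalerN -opprD; congr (- _); rewrite /Zn -tr_lin.
by apply: tr_ext => w _; rewrite oW_lin_a oW_lin_w.
Qed.

Lemma Df_zero h a b : (0 < h)%N -> Vg h a -> exists M0, forall M n, (M0 <= M)%N -> Df M n a b = 0.
Proof.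
move=> h0 ah; apply: (graded_ind dV (P := [set b | exists M0, forall M n, (M0 <= M)%N -> Df M n a b = 0])).
  split; first by exists 0%N => M n _; apply: (lin0 (Df_lin_b M n a)).
  move=> c u v [M1 h1] [M2 h2]; exists (M1 + M2)%N => M n hM.
  by rewrite (Df_lin_b M n a) h1 ?h2 ?scaler0 ?addr0 //; lia.
move=> l x xl; exists (h + l)%N => M n hM.
by rewrite /Df (ZR_hom ah xl h0 n hM) addrAC subrK subrr.
Qed.

Lemma Df_tail M M' n a b : (M <= M')%N -> (forall k, (M <= k)%N -> br posV k a b = 0) ->
  Df M' n a b = Df M n a b.
Proof.
move=> MM hk; rewrite /Df -(subnKC MM) big_split_ord [X in _ + (_ + X)]big1 ?addr0 // => k _.
by rewrite (hk _ (leq_addr _ _)) (lin0 (Stf_lin _ n)).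
Qed.

(** Zhu's recursion for L[-1] a: the zero mode of L[-1] a = L(-1) a + L(0) a vanishes, and [br_Lm1]
    shifts the index of [br]. *)
Lemma St_brm_Lm1 a b M : (forall k, (M <= k)%N -> br posV k a b = 0) ->
  St (brm posV (L1b posV a) b) =
  \sum_(k < M) sercst k.+1`!%:R * gam k.+2 * St (br posV k a b).
Proof.
move=> hM; apply: ser_ext => n; rewrite ser_sum; move: hM.
suff [M0 hM0] : exists M0, forall M n, (M0 <= M)%N -> Df M n (L1b posV a) b = 0 /\ Zn n (L1b posV a) b = 0.
  move=> hM; have [h1 h2] := hM0 (M0 + M.+1)%N n (leq_addr _ _).
  have hM' k : (M.+1 <= k)%N -> br posV k (L1b posV a) b = 0.
    by case: k => // k kM; rewrite br_Lm1 hM ?oppr0.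
  have := Df_tail n (leq_addl M0 M.+1) hM'; rewrite h1 /Df h2 subr0 big_ord_recl br_Lm1.
  rewrite (lin0 (Stf_lin _ n)) add0r => /esym/eqP; rewrite addr_eq0 => /eqP.
  rewrite -[St _ n]/(Sn n _) => ->; rewrite -sumrN; apply: eq_bigr => k _.
  by rewrite -[fintype.lift _ _ : nat]/(k.+1) br_Lm1 (linN (Stf_lin _ n)) opprK.
clear M n.
apply: (graded_ind dV (P := [set a | exists M0, forall M n, (M0 <= M)%N -> Df M n (L1b posV a) b = 0 /\ Zn n (L1b posV a) b = 0])).
  split.
    exists 0%N => M n _; rewrite (lin0 (L1b_lin posV)) (lin0 (Df_lin_a M n b)); split=> //.
    rewrite -[RHS](tr0 n); apply: tr_ext => w _; by rewrite (lin0 (oW_lin_a w)) (lin0 (oW_lin_w b)).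
  move=> c u v [M1 h1] [M2 h2]; exists (M1 + M2)%N => M n hM.
  have [|d1 z1] := h1 M n; first by lia.
  have [|d2 z2] := h2 M n; first by lia.
  rewrite (L1b_lin posV) (Df_lin_a M n b) d1 d2 scaler0 addr0; split=> //.
  rewrite -[RHS](addr0 0) -{1}(mulr0 c) -{1}z1 -z2 /Zn -tr_lin; apply: tr_ext => w _.
  by rewrite oW_lin_a oW_lin_w.
move=> h x xh /=; have Dx : Vg h.+1 (voa_Y om 0 x) by apply: (mode_Vg (om_gr (V := V)) xh); lia.
have [M1 h1] := @Df_zero h.+1 _ b isT Dx.
(* [Df_zero] requires positive weight; a vector of weight 0 enters with the factor h = 0. *)
have [M2 h2] : exists M2, forall M n, (M2 <= M)%N -> Df M n (h%:R *: x) b = 0.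
  case: h xh {Dx h1} => [|h] xh; first by exists 0%N => M n _; rewrite scale0r (lin0 (Df_lin_a M n b)).
  have [M2 h2] := @Df_zero h.+1 _ b isT xh; exists M2 => M n hM.
  by rewrite (linZ (Df_lin_a M n b)) h2 // scaler0.
exists (M1 + M2)%N => M n hM; rewrite L1b_E (voa_L0 xh) (linD (Df_lin_a M n b)) h1 ?h2 ?addr0; [|lia|lia].
split=> //; rewrite -[RHS](tr0 n); apply: tr_ext => w _.
rewrite (linD (oW_lin_a w)) (linZ (oW_lin_a w)) (oW_hom _ Dx) (oW_hom _ xh).
have := @mod_Lm1 _ _ W x (h.+1%:Z - 1) w; rewrite /voa_L addNr => ->.
rewrite (_ : h.+1%:Z - 1 = h%:Z); last by lia.
by rewrite scaleNr addNr (lin0 (oW_lin_w b)).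
Qed.

(** Zhu's recursion for a = om: o(om) = L(0) acts by n0 + n in degree n, which gives the derivation
    plus n0, and c / 24 comes from L[-2]. *)
Lemma St_L2b b M : (forall k, (M <= k)%N -> br posV k om b = 0) ->
  St (L2b posV b) = stheta (St b) + sercst (n0 - voa_c V / 24%:R) * St b
    - \sum_(k < M) sercst k`!%:R * gam k.+1 * St (br posV k om b).
Proof.
move=> hM; apply: ser_ext => n; rewrite serB serD stheta_coef sercstM ser_sum.
have [M0 h0] := @Df_zero 2 om b isT (om_gr (V := V)).
have := Df_tail n (leq_addl M0 M) hM; rewrite h0 ?leq_addr // /Df => /esym/eqP.
rewrite addr_eq0 subr_eq => /eqP e.
rewrite -[St _ n]/(Sn n _) /L2b (linB (Sn_lin n)) (linZ (Sn_lin n)) e.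
have -> : Zn n om b = (n0 + n%:R) * Sn n b.
  rewrite /Zn /Sn -[RHS]addr0 -(tr0 n) -tr_lin; apply: tr_ext => w wn.
  by rewrite (oW_hom _ (om_gr (V := V))) (mod_L0 wn) (linZ (oW_lin_w b)) addr0.
rewrite -[St b n]/(Sn n b) -mulr_natr.
move: (Sn n b) (\sum_(k < M) _) => x y; rewrite -[_ *: x]/(_ * x); ring.
Qed.

Lemma St_one n : St (voa_one V) n = (size (wb n))%:R.
Proof.
rewrite -tr_id -[LHS]/(tr n _); apply: tr_ext => w _.
by rewrite (oW_hom _ (one_gr (V := V))) mod_vacuum.
Qed.

Lemma St_one0 w : Wg 0 w -> w <> 0 -> St (voa_one V) 0%N != 0.
Proof.
move=> w0 wn; rewrite St_one pnatr_eq0; apply: contra_notN wn => /eqP s0.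
by rewrite (wbE w0) s0 big_ord0.
Qed.

End Traces.

(** * Systems satisfied by the traces *)

Section TraceSystem.
Context {R : realType} {V : voa R}.
Hypothesis posV : positive_energy V.
Local Notation K := R[i].
Local Notation M := {poly {poly {poly K}}}.
Local Notation Vg := (@Vg R V).
Local Notation om := (voa_omega V).
Local Notation ev := (ev (eisP : ser K) eisQ eisR).
Local Notation br := (br posV).
Local Notation brm := (brm posV).
Local Notation L1b := (L1b posV).
Local Notation sqw := (sqw posV).

(** What the reduction of arguments uses of a trace, with no mention of a module: coefficients found
    for all such S at once are common to all W. *)
Definition trace_like (S : V -> ser K) :=
  (forall c u v, S (c *: u + v) = sercst c * S u + S v) /\
  (forall a b m, (forall k, (m <= k)%N -> br k a b = 0) ->
    S (brm (L1b a) b) = \sum_(k < m) sercst k.+1`!%:R * gam k.+2 * S (br k a b)).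

Lemma trace_like_sum S (I : Type) (r : seq I) (f : I -> V) : trace_like S ->
  S 0 = 0 /\ S (\sum_(i <- r) f i) = \sum_(i <- r) S (f i).
Proof.
move=> [lS _]; have S0 : S 0 = 0.
  have := lS (-1) 0 0; rewrite scaler0 addr0 rmorphN rmorph1 mulN1r => e.
  by rewrite e addNr.
split=> //; elim: r => [|i r IH]; first by rewrite !big_nil.
by rewrite !big_cons -IH -[f i]scale1r lS rmorph1 mul1r scale1r.
Qed.

Lemma sqw_finite N0 : exists ws : seq (V * nat),
  [/\ forall x, x \in ws -> sqw x.2%:R x.1,
     forall k, (k <= N0)%N -> sqw k%:R `<=` lspan [set y | (y, k) \in ws]
   & (voa_one V, 0%N) \in ws].
Proof.
have bas k : {b : seq V | Vg k `<=` lspan [set` b]} by apply: cid; exact: (@voa_gr_fin R V k%:Z).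
have fin k : finite_dim_in (sqw k%:R).
  exists (flatten [seq sval (bas i) | i <- iota 0 k.+1]) => v /sqw_Ulow.
  apply: Ulow_ind; first exact: lspan_subspace.
  move=> i x ik xi; apply: lspan_mono (svalP (bas i) x xi) => y /= yb.
  have : y \in flatten [seq sval (bas i) | i <- iota 0 k.+1].
    by apply/flattenP; exists (sval (bas i)) => //; apply: map_f; rewrite mem_iota; lia.
  by [].
have sb k : {b : seq V | (forall x, x \in b -> sqw k%:R x) & sqw k%:R `<=` lspan [set` b]}.
  apply: cid2; have [b [bV _ bs]] := basis_exists (sqw_sub posV k%:R) (fin k).
  exists b => // v /bs [g ->]; apply: (sub_sumP (lspan_subspace _)) => i _.
  by apply: (sub_scaleP (lspan_subspace _)); apply: sub_lspan; apply: mem_nth.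
exists ((voa_one V, 0%N) :: [seq (x, k) | k <- iota 0 N0.+1, x <- s2val (sb k)]); split.
- move=> x; rewrite inE => /orP[/eqP -> /=|/allpairsPdep [k [y [_ yb ->]]]].
    by rewrite sqwE L0b_one scale0r.
  exact: (s2valP (sb k)).
- move=> k kN v vk; apply: lspan_mono (s2valP' (sb k) v vk) => x xb.
  have : (x, k) \in [seq (x, k) | k <- iota 0 N0.+1, x <- s2val (sb k)].
    by apply/allpairsPdep; exists k, x; rewrite mem_iota.
  by rewrite /= inE => ->; rewrite orbT.
- exact: mem_head.
Qed.

Section System.
Variables (N0 : nat) (ws : seq (V * nat)).
Hypothesis hC : @C2hom R V N0.
Hypothesis ws_sqw : forall x, x \in ws -> sqw x.2%:R x.1.
Hypothesis ws_span : forall k, (k <= N0)%N -> sqw k%:R `<=` lspan [set y | (y, k) \in ws].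
Local Notation n := (size ws).
Definition wv (i : 'I_n) : V := (nth (0, 0%N) ws i).1.
Definition wt (i : 'I_n) : K := (nth (0, 0%N) ws i).2%:R.

Definition red (mu : K) (v : V) := exists G : 'I_n -> M,
  (forall j, isob (mu - wt j) (G j)) /\
  forall S, trace_like S -> S v = \sum_j ev (G j) * S (wv j).

Lemma red_sub mu : subspace (red mu).
Proof.
split.
  exists (fun=> 0); split=> [j|S tS]; first exact: isob0.
  have [-> _] := trace_like_sum (Nil nat) (fun=> 0) tS.
  by rewrite big1 // => j _; rewrite rmorph0 mul0r.
move=> a u v [G [G1 G2]] [H [H1 H2]]; exists (fun j => mc a * G j + H j); split=> [j|S tS].
  by apply: isobD => //; rewrite -[mu - wt j]add0r; apply: isobM => //; apply: isob_c.
rewrite tS.1 (G2 S tS) (H2 S tS) mulr_sumr -big_split; apply: eq_bigr => j _.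
by rewrite rmorphD rmorphM ev_c mulrDl mulrA.
Qed.

Lemma red_mul mu k g v S' : isob k%:R g -> red mu v ->
  (forall S, trace_like S -> S' S = ev g * S v) ->
  exists G : 'I_n -> M, (forall j, isob (k%:R + mu - wt j) (G j)) /\
  forall S, trace_like S -> S' S = \sum_j ev (G j) * S (wv j).
Proof.
move=> gk [G [G1 G2]] e; exists (fun j => g * G j); split=> [j|S tS].
  by rewrite -addrA; apply: isobM.
rewrite (e S tS) (G2 S tS) mulr_sumr; apply: eq_bigr => j _.
by rewrite rmorphM mulrA.
Qed.

(* A weighted combination of traces is again reducible: the weights of the
   Eisenstein coefficients compensate those of the arguments. *)
Lemma red_comb mu m (f : nat -> K) (sh : nat -> nat) (x : nat -> V) (S' : (V -> ser K) -> ser K) :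
  (forall k, red (mu - (sh k)%:R) (x k)) ->
  (forall S, trace_like S -> S' S = \sum_(k < m) sercst (f k) * gam (sh k) * S (x k)) ->
  exists G : 'I_n -> M, (forall j, isob (mu - wt j) (G j)) /\
  forall S, trace_like S -> S' S = \sum_j ev (G j) * S (wv j).
Proof.
move=> rx e.
have /choice [G HG] (k : nat) : exists G : 'I_n -> M, (forall j, isob (mu - wt j) (G j)) /\
    forall S, trace_like S -> sercst (f k) * gam (sh k) * S (x k) = \sum_j ev (G j) * S (wv j).
  have [g gi gE] := gam_isob (F := K) (sh k).
  have [G [G1 G2]] := @red_mul _ _ (mc (f k) * g) _ (fun S => sercst (f k) * gam (sh k) * S (x k))
    (eq_ind _ (fun z => isob z (mc (f k) * g)) (isobM (isob_c (f k)) gi) _ (add0r _)) (rx k)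
    (fun S _ => congr1 (fun z => z * S (x k)) (etrans (congr2 *%R (esym (ev_c _ _ _ (f k))) gE) (esym (rmorphM _ _ _)))).
  have E j : (sh k)%:R + (mu - (sh k)%:R) - wt j = mu - wt j by rewrite [_ + (mu - _)]addrC subrK.
  by exists G; split=> [j|]; [rewrite -E; exact: G1 | exact: G2].
exists (fun j => \sum_(k < m) G k j); split=> [j|S tS].
  by apply: isob_sum => k _; apply: (HG k).1.
rewrite (e S tS) (eq_bigr (fun k : 'I_m => \sum_j ev (G k j) * S (wv j))).
  by rewrite exchange_big; apply: eq_bigr => j _; rewrite rmorph_sum mulr_suml.
by move=> k _; apply: (HG k).2.
Qed.

(** Above [N0], a[-2] b is traded for the [br p a b], of weight k - p - 2, with coefficients
    [gam (p + 2)] of weight p + 2, so the total weight is kept and the induction applies. Vectors of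
    negative weight are 0. *)
Lemma sqw_red k v : sqw k%:R v -> red k%:R v.
Proof.
elim/ltn_ind: k v => k IH v vk; case: (leqP k N0) => kN.
  apply: (lspan_min (red_sub k%:R) _ (ws_span kN vk)) => x /= xw.
  have ix : (index (x, k) ws < n)%N by rewrite index_mem.
  have E : nth (0, 0%N) ws (Ordinal ix) = (x, k) by rewrite /= nth_index.
  exists (fun j => (j == Ordinal ix)%:R); split=> [j|S tS].
    case: eqP => [->|_]; last exact: isob0.
    by rewrite /wt E subrr; apply: isob1.
  rewrite (bigD1 (Ordinal ix)) //= eqxx rmorph1 mul1r big1 ?addr0 => [|j /negbTE ->].
    by rewrite /wv E.
  by rewrite rmorph0 mul0r.
apply: (lspan_min (red_sub k%:R) _ (sqw_gen hC kN vk)) => _ [i [j [a [b [ij ai bj ->]]]]].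
have [m hm] := br_small posV a b.
apply: (@red_comb _ m (fun p => p.+1`!%:R) (fun p => p.+2) (fun p => br p a b)
  (fun S => S (brm (L1b a) b))); last by move=> S [_ h]; apply: h.
move=> p; have xp := sqw_br p ai bj.
have E : i%:R + j%:R - p.+1%:R = k%:R - p.+2%:R :> K.
  by rewrite -ij -natrD -[(i + j).+1%:R]natr1 -[p.+2%:R]natr1 opprD addrACA subrr addr0.
rewrite E in xp; case: (leqP p.+2 k) => pk.
  by rewrite -natrB // in xp *; apply: IH xp; lia.
rewrite (sqw_zero xp); first by case: (red_sub (k%:R - p.+2%:R)).
move=> t; rewrite subr_eq -natrD eqr_nat; lia.
Qed.

Lemma sqw_red_int (mu : K) v : sqw mu v -> (exists z : int, mu = z%:~R) -> red mu v.
Proof.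
move=> xv [[z|z] e]; first by rewrite e in xv *; apply: sqw_red.
rewrite (sqw_zero xv); first by case: (red_sub mu).
by move=> t; rewrite e -[t%:R]/((t%:Z)%:~R) eqr_int; apply/eqP; lia.
Qed.

Lemma red_add mu S1 S2 :
  (exists G : 'I_n -> M, (forall j, isob (mu - wt j) (G j)) /\
    forall S, trace_like S -> S1 S = \sum_j ev (G j) * S (wv j)) ->
  (exists G : 'I_n -> M, (forall j, isob (mu - wt j) (G j)) /\
    forall S, trace_like S -> S2 S = \sum_j ev (G j) * S (wv j)) ->
  exists G : 'I_n -> M, (forall j, isob (mu - wt j) (G j)) /\
    forall S, trace_like S -> S1 S + S2 S = \sum_j ev (G j) * S (wv j).
Proof.
move=> [G [G1 G2]] [H [H1 H2]]; exists (fun j => G j + H j); split=> [j|S tS]; first exact: isobD.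
rewrite (G2 S tS) (H2 S tS) -big_split; apply: eq_bigr => j _.
by rewrite rmorphD mulrDl.
Qed.

(** L[-2] applied to [wv i] and the vectors [br k om (wv i)] reduce to the finite family; comparison
    with the derivative formula for L[-2] gives row i, multiplied by 12 to match [th]. *)
Lemma trace_system : exists A : 'M[M]_n, (forall i j, isob (wt i + 2%:R - wt j) (A i j)) /\
  forall S (c : K), trace_like S ->
   (forall b m, (forall k, (m <= k)%N -> br k om b = 0) ->
     S (L2b posV b) = stheta (S b) + sercst c * S b - \sum_(k < m) sercst k`!%:R * gam k.+1 * S (br k om b)) ->
   forall i, shiftT th (c *+ 12) (S (wv i)) = \sum_j ev (A i j) * S (wv j).
Proof.
have H (i : 'I_n) : exists G : 'I_n -> M, (forall j, isob (wt i + 2%:R - wt j) (G j)) /\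
  forall S (c : K), trace_like S ->
   (forall b m, (forall k, (m <= k)%N -> br k om b = 0) ->
     S (L2b posV b) = stheta (S b) + sercst c * S b - \sum_(k < m) sercst k`!%:R * gam k.+1 * S (br k om b)) ->
   stheta (S (wv i)) + sercst c * S (wv i) = \sum_j ev (G j) * S (wv j).
  have wi : sqw (wt i) (wv i) by apply: ws_sqw; apply: mem_nth.
  have [m hm] := br_small posV om (wv i).
  have r1 : exists G : 'I_n -> M, (forall j, isob (wt i + 2%:R - wt j) (G j)) /\
      forall S, trace_like S -> S (L2b posV (wv i)) = \sum_j ev (G j) * S (wv j).
    by apply: sqw_red_int; [apply: sqw_L2b | exists ((nth (0%R : V, 0%N) ws i).2 + 2)%N%:Z; rewrite /wt -natrD].
  have r2 : exists G : 'I_n -> M, (forall j, isob (wt i + 2%:R - wt j) (G j)) /\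
      forall S, trace_like S -> \sum_(k < m) sercst k`!%:R * gam k.+1 * S (br k om (wv i)) = \sum_j ev (G j) * S (wv j).
    apply: (@red_comb _ m (fun k => k`!%:R) succn (fun k => br k om (wv i))) => // k.
    have e2 : br k (L0b posV om) (wv i) = 2%:R *: br k om (wv i).
      by rewrite L0b_om (linB (br_lin_a posV k (wv i))) !(linZ (br_lin_a posV k (wv i))) br_one scaler0 subr0.
    apply: sqw_red_int.
      by rewrite sqwE L0b_br e2 wi (linZ (br_lin_b posV k om)) -scalerDl -scalerBl [2%:R + _]addrC.
    exists (((nth (0%R : V, 0%N) ws i).2 + 2)%N%:Z - k.+1%:Z); rewrite intrB /wt -natrD //.
  have [G [G1 G2]] := red_add r1 r2.
  exists G; split=> [|S c tS hS]; first exact: G1.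
  by rewrite -(G2 S tS) (hS _ m hm) subrK.
have [G HG] := choice H.
exists (\matrix_(i, j) (mc 12%:R * G i j)); split=> [i j|S c tS hS i].
  by rewrite mxE -[wt i + _ - _]add0r; apply: isobM; [apply: isob_c | apply: (HG i).1].
have e := (HG i).2 S c tS hS.
rewrite /shiftT /th rmorphMn mulrnAl -mulrnDl /= e -sumrMnl.
by apply: eq_bigr => j _; rewrite mxE rmorphM ev_c -mulrA (rmorph_nat (@sercst K)) mulr_natl.
Qed.

End System.

Lemma St_trace_like (W : voa_module V) n0 dW : trace_like (@St R V posV W n0 dW).
Proof. by split=> [c u v|a b m hm]; [apply: St_lin | apply: St_brm_Lm1]. Qed.

Lemma lowest_constraints : C_cofinite V 2 -> exists p : {poly K}, p != 0 /\
  forall (W : voa_module V) (n0 : K),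
  direct_sum (fun k : nat => @mod_gr R V W (n0 + k%:R)) ->
  (exists w : W, mod_gr (n0 + 0%:R) w /\ w <> 0) ->
  root p ((n0 - voa_c V / 24%:R) *+ 12) /\ n0 - voa_c V / 24%:R \is Num.real.
Proof.
move=> /(C2hom_cofinite posV) [N0 hC]; have [ws [ws1 ws2 ws0]] := sqw_finite N0.
have [A [Ai AS]] := trace_system hC ws1 ws2.
(* Transposed, because eigenvectors are rows here; at q = 0 the derivative term of the system
   vanishes. *)
pose A0 : 'M[K]_(size ws) := \matrix_(i, j) (ev (A j i)) 0%N.
exists (char_poly A0); split; first exact/monic_neq0/char_poly_monic.
move=> W n0 dW [w [w0 wn]].
pose c : K := n0 - voa_c V / 24%:R.
have tS := St_trace_like dW.
have sys : forall i : 'I_(size ws), shiftT th (c *+ 12) (St posV dW (wv i)) = \sum_j ev (A i j) * St posV dW (wv j).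
  by apply: (AS (@St R V posV W n0 dW) c tS) => b m hm; apply: St_L2b.
have ix : (index (voa_one V, 0%N) ws < size ws)%N by rewrite index_mem.
pose j0 := Ordinal ix.
have E : nth (0, 0%N) ws j0 = (voa_one V, 0%N) by rewrite /= nth_index.
have vE : wv j0 = voa_one V by rewrite /wv E.
have y0 : St posV dW (voa_one V) 0%N != 0 by apply: (St_one0 posV dW w0 wn).
split.
  rewrite -eigenvalue_root_char; apply/eigenvalueP.
  exists (\row_i (St posV dW (wv i) 0%N)).
    apply/rowP => i; rewrite !mxE.
    have := congr1 (fun f : ser K => f 0%N) (sys i); rewrite /shiftT serD /th serMn stheta0 mul0rn add0r sercstM => ->.
    by rewrite ser_sum; apply: eq_bigr => j _; rewrite !mxE serM0 mulrC.
  by apply/eqP => /rowP /(_ j0); rewrite !mxE vE => /eqP; rewrite (negbTE y0).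
have cc : c *+ 12 = (Num.conj_op (c *+ 12)).
  have [hP hQ hR] := sermap_eis (Num.conj_op : {rmorphism K -> K}).
  apply: (@shift_unique K eisP eisQ eisR (@eis_ramP K) (@eis_ramQ K) (@eis_ramR K) (@eisP0 K) (@eisQ0 K) (@eisR0 K)
     (@eis_disc K) (size ws) (@wt ws) j0 _ A (\matrix_(i, j) mconj Num.conj_op (A i j))
     (fun i => St posV dW (wv i)) (fun i => sermap Num.conj_op (St posV dW (wv i)))) => //.
  - by rewrite /wt E.
  - move=> i j; rewrite mxE; apply: isob_mconj => //.
    by apply: conj_Creal; apply: realB; [apply: realD; exact: realn | exact: realn].
  - move=> i; have := congr1 (sermap Num.conj_op) (sys i).
    rewrite /shiftT sermapD sermapM sermap_th sermap_cst sermap_sum => ->.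
    by apply: eq_bigr => j _; rewrite sermapM ev_mconj // mxE.
  - by rewrite vE; apply: ser_ext => k; rewrite -[RHS]/(Num.conj_op _) St_one rmorph_nat.
  - by rewrite vE => e; move: y0; rewrite e ser0 eqxx.
have -> : n0 - voa_c V / 24%:R = (c *+ 12) / 12%:R by rewrite -(mulr_natr c) mulfK ?pnatr_eq0.
by apply: realM; [apply/CrealP; exact: (esym cc) | rewrite realV; exact: realn].
Qed.

Lemma central_charge_real : C_cofinite V 2 -> voa_one V <> 0 -> voa_c V \is Num.real.
Proof.
move=> /lowest_constraints [p [_ H]] V1.
have low : exists w : adjoint_module V, mod_gr (0 + 0%:R) w /\ w <> 0.
  exists (voa_one V); split=> //.
  by rewrite (adjoint_Vg V 0); exact: one_gr.
have [_ h] := H (adjoint_module V) 0 (adjoint_sum posV) low.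
have -> : voa_c V = - (0 - voa_c V / 24%:R) * 24%:R by rewrite sub0r opprK divfK ?pnatr_eq0.
by apply: realM; [rewrite realN | exact: realn].
Qed.

End TraceSystem.

(** * From the constraints on weights to the three conditions *)

Lemma irr_one_neq0 (R : realType) (V : voa R) (W : voa_module V) : irreducible W -> voa_one V <> 0.
Proof.
move=> [[w wn] _] e; apply: wn; have := @mod_vacuum R V W (-1) w.
by rewrite e (lin0 (Yr _ _)).
Qed.

Lemma roots_bounded (R : realType) (p : {poly R[i]}) : p != 0 ->
  exists B : R, forall z, root p z -> `|complex.Re z| <= B.
Proof.
move=> p0; have [r pE] := closed_field_poly_normal p.
exists (\sum_(z <- r) `|complex.Re z|) => z; rewrite pE rootZ ?lead_coef_eq0 // root_prod_XsubC => zr.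
by rewrite (big_rem z) //= lerDl sumr_ge0.
Qed.

Theorem proposition4p1 (R : realType) (V : voa R) :
  C_cofinite V 2 -> positive_energy V ->
  [/\ C1a_cofinite V,
      exists N : nat,
        [/\ (0 < N)%N,
            forall (W1 W2 : voa_module V) (n1 n2 : R[i]),
              irreducible W1 -> irreducible W2 ->
              is_lowest_weight W1 n1 -> is_lowest_weight W2 n2 ->
              `|complex.Re n1 - complex.Re n2| <= N%:R
          & finite_dim (zhu_algebra V N)]
    & forall W : voa_module V, irreducible W ->
        real_graded W /\ C_cofinite_mod 1 W].
Proof.
move=> C2 posV; have [N0 hC] := C2hom_cofinite posV C2.
have [p [p0 H]] := lowest_constraints posV C2.
have [B hB] := roots_bounded p0.
have low (W : voa_module V) n0 : is_lowest_weight W n0 ->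
    exists w : W, mod_gr (n0 + 0%:R) w /\ w <> 0.
  by move=> [[w [w0 wn]] _]; exists w; rewrite addr0.
split; first exact: C1a_of_C2.
  (* The roots are 12 (n - c/24), so c cancels in a difference and 12 |Re n1 - Re n2| <= 2 B. Since
     A_N(V) is finite dimensional for every N, any integer above this bound will do. *)
  exists (Num.bound (`|B| *+ 2)).+1; split=> //; last exact: (zhu_finite posV _ hC).
  move=> W1 W2 n1 n2 _ _ l1 l2.
  have [r1 _] := H W1 n1 l1.2 (low _ _ l1); have [r2 _] := H W2 n2 l2.2 (low _ _ l2).
  have b1 := hB _ r1; have b2 := hB _ r2.
  have ReB (x y : R[i]) : complex.Re (x - y) = complex.Re x - complex.Re y by case: x y => ? ? [? ?].
  have ReM (x : R[i]) k : complex.Re (x *+ k) = complex.Re x *+ k.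
    by elim: k => [|k IH]; rewrite ?mulr0n // !mulrS -IH; case: (x) (x *+ k) => ? ? [? ?].
  have bb : (`|B| *+ 2 < (Num.bound (`|B| *+ 2))%:R :> R) by apply: archi_boundP; rewrite mulrn_wge0.
  rewrite -natr1; move: b1 b2 bb (ler_norm B); rewrite !ReM !ReB.
  move: (complex.Re n1) (complex.Re n2) (complex.Re _) `|B| (_%:R) => x y z t u.
  rewrite !ler_norml => /andP[? ?] /andP[? ?] ? ?; apply/andP; split; lra.
move=> W irr; have [n0 ln0] := irr_lowest irr.
have [w [w0 wn]] := low _ _ ln0.
split; last exact: (irr_C1 posV ln0.2 irr hC w0 wn).
have cr := central_charge_real posV C2 (irr_one_neq0 irr).
have [_ nr] := H W n0 ln0.2 (low _ _ ln0).
have n0r : n0 \is Num.real.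
  rewrite -[n0](subrK (voa_c V / 24%:R)); apply: realD => //.
  by apply: realM => //; rewrite realV; exact: realn.
move=> mu [x [xmu xn]].
have [k ->] : exists k : nat, mu = n0 + k%:R.
  apply: contra_notP xn => h; apply: (gr_out ln0.2 _ xmu) => k.
  by apply/eqP => e; apply: h; exists k.
by apply: realD => //; exact: realn.
Qed.
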